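(* Let $Q,B$ be $n\times n$ real matrices satisfying the standing assumptions, with local homogeneous dimension $D$ and volume function $V$. Assume that there exists $\gamma>0$ such that $$V(t)\ge \gamma\, t^{D}e^{t\operatorname{tr}B}\qquad\text{for every } t>0 .$$ Let $r>2$, with $r<\infty$ if $D=2$ and $r<\frac{2D}{D-2}$ if $D>2$, and let $q$ be defined by $\frac 2q=D\left(\frac12-\frac1r\right)$. Then there exists a constant $C>0$, depending on $n$, $r$ and the fixed matrices $Q,B$, such that if $u$ solves the Cauchy problem $$\partial_t u-i\operatorname{tr}(Q\nabla^2u)-\langle Bx,\nabla u\rangle=F(x,t),\qquad u(x,0)=\varphi(x),$$ with $\varphi\in L^2(\mathbb R^n)$ and $F$ such that $\big\|e^{\frac{\operatorname{tr}B}{2}t}\,\|F(\cdot,t)\|_{L^{r'}(\mathbb R^n)}\big\|_{L^{q'}_t(\mathbb R)}<\infty$, then $$\left(\int_{\mathbb R}e^{\frac{q\operatorname{tr}B}{2}t}\Big(\int_{\mathbb R^n}|u(x,t)|^r\,dx\Big)^{\frac qr}dt\right)^{\frac1q}\le C\left\{\|\varphi\|_{L^2(\mathbb R^n)}+\left(\int_{\mathbb R}e^{\frac{q'\operatorname{tr}B}{2}t}\Big(\int_{\mathbb R^n}|F(x,t)|^{r'}dx\Big)^{\frac{q'}{r'}}dt\right)^{\frac1{q'}}\right\}.$$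
   Context: Standing assumptions. $n\ge2$; $Q,B$ are constant real $n\times n$ matrices, $Q=Q^\star\ge0$ ($^\star$ is transpose). $\operatorname{Ker}Q$ contains no nontrivial invariant subspace of $B^\star$; equivalently the Gramian $Q(t)=\int_0^te^{sB}Qe^{sB^\star}ds$ is positive definite for every $t>0$. Moreover $Q,B$ are in canonical form: $Q=\begin{pmatrix}Q_0&0\\0&0\end{pmatrix}$ with $Q_0=Q_0^\star>0$ of size $p_0\times p_0$, and with respect to the block partition $n=p_0+p_1+\dots+p_\nu$, $p_0\ge p_1\ge\dots\ge p_\nu\ge1$, the matrix $B$ has subdiagonal blocks $B_1,\dots,B_\nu$, where $B_j$ is $p_j\times p_{j-1}$ of rank $p_j$ (in block position row $j$, column $j-1$, blocks numbered from $0$), all blocks strictly below the subdiagonal are zero, and all blocks on or above the diagonal are arbitrary. If $Q$ is invertible then $p_0=n$ and there are no other blocks. Local homogeneous dimension: $D=p_0+3p_1+5p_2+\dots+(2\nu+1)p_\nu$ (so $D=n$ when $Q$ is invertible). Volume function: $V(t)=\det Q(t)$, $t>0$. Primes denote Hölder conjugate exponents; $\nabla,\nabla^2$ are the gradient and Hessian in $x\in\mathbb R^n$. Solution. The solution is given, for $t\in\mathbb R$, by Duhamel's formula $u(\cdot,t)=U(t)\varphi+\int_0^tU(t-s)F(\cdot,s)\,ds$, where $\{U(t)\}_{t\in\mathbb R}$ is the group defined on Schwartz functions by $U(0)\phi=\phi$, and $$U(t)\phi(x)=\frac{(4\pi)^{-n/2}e^{-i\pi n/4}}{\sqrt{V(t)}}\int_{\mathbb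 R^n}e^{\frac i4\langle Q(t)^{-1}(y-e^{tB}x),\,y-e^{tB}x\rangle}\phi(y)\,dy\quad(t>0),$$ $$U(t)\phi(x)=\frac{(4\pi)^{-n/2}e^{i\pi n/4}e^{|t|\operatorname{tr}B}}{\sqrt{V(|t|)}}\int_{\mathbb R^n}e^{-\frac i4\langle Q(|t|)^{-1}(x-e^{|t|B}y),\,x-e^{|t|B}y\rangle}\phi(y)\,dy\quad(t<0),$$ and $U(t)$ is extended by density to $L^2(\mathbb R^n)$ and, for $t\ne0$ and $r\ge2$, to a bounded operator $L^{r'}(\mathbb R^n)\to L^r(\mathbb R^n)$. *)

(* Defs.v *)
From HB Require Import structures.
From mathcomp Require Import all_boot all_order all_algebra.
From mathcomp Require Import all_classical all_reals all_analysis.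
From mathcomp Require Import measurable_realfun.
From mathcomp Require Import complex.

Set Implicit Arguments.
Unset Strict Implicit.
Unset Printing Implicit Defensive.
Import Order.TTheory GRing.Theory Num.Theory.
Import numFieldTopology.Exports numFieldNormedType.Exports.

Local Open Scope classical_set_scope.
Local Open Scope ring_scope.
Local Open Scope complex_scope.

(* Column vectors carry the Borel sigma-algebra, generated by the coordinates,
   as n.-tuple R does in the library. *)
Section measurable_cV.
Context {R : realType} (n : nat).

Let coor (i : 'I_n) (x : 'cV[R]_n) : R := x i ord0.

Let cV_set0 : g_sigma_preimage coor set0.
Proof. exact: sigma_algebra0. Qed.

Let cV_setC A : g_sigma_preimage coor A -> g_sigma_preimage coor (~` A).
Proof. exact: sigma_algebraC. Qed.

Let cV_bigcup (F : _^nat) : (forall i, g_sigma_preimage coor (F i)) ->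
  g_sigma_preimage coor (\bigcup_i (F i)).
Proof. exact: sigma_algebra_bigcup. Qed.

HB.instance Definition _ := @isMeasurable.Build default_measure_display
  'cV[R]_n (g_sigma_preimage coor) cV_set0 cV_setC cV_bigcup.

Lemma measurable_coor (i : 'I_n) :
  measurable_fun [set: 'cV[R]_n] (fun x : 'cV[R]_n => x i ord0).
Proof.
move=> _ Y mY; rewrite setTI; apply: sub_sigma_algebra => /=.
rewrite -bigcup_seq/=; exists i => /=; first by rewrite mem_index_enum.
by exists Y => //; rewrite setTI.
Qed.

Lemma measurable_fun_coorP d (T : measurableType d) (f : T -> 'cV[R]_n) :
  (forall i, measurable_fun [set: T] (fun t => f t i ord0)) ->
  measurable_fun [set: T] f.
Proof.
move=> mf; suff H : g_sigma_preimage coor `<=`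
    [set A | measurable ([set: T] `&` f @^-1` A)].
  by move=> _ A mA; exact: H.
apply: smallest_sub.
  split => /=.
  - by rewrite preimage_set0 setI0.
  - by move=> A; rewrite !setTI setTD preimage_setC => /measurableC.
  - move=> F mF; rewrite setTI preimage_bigcup; apply: bigcupT_measurable => i.
    by have := mF i; rewrite setTI.
rewrite -bigcup_seq; apply: bigcup_sub => i _ _ [B mB <-] /=.
by rewrite !setTI; have := mf i measurableT B mB; rewrite setTI.
Qed.

End measurable_cV.

Section lebesgue_cV_step.
Context {R : realType} (n : nat).
Variable mu : {sigma_finite_measure set 'cV[R]_n -> \bar R}.

Definition cons_cV (z : R * 'cV[R]_n) : 'cV[R]_(n.+1) := col_mx (z.1)%:M z.2.

Let uncons_cV (x : 'cV[R]_(n.+1)) : R * 'cV[R]_n :=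
  (x ord0 ord0, dsubmx (x : 'cV[R]_(1 + n))).

Let cons_cVK : cancel cons_cV uncons_cV.
Proof.
case=> a v; rewrite /uncons_cV /cons_cV /=; congr pair; last exact: col_mxKd.
have -> : (ord0 : 'I_(1 + n)) = lshift n (ord0 : 'I_1) by exact/val_inj.
by rewrite (col_mxEu (a%:M : 'M[R]_1)) mxE eqxx.
Qed.

Let measurable_cons_cV : measurable_fun [set: R * 'cV[R]_n] cons_cV.
Proof.
apply: measurable_fun_coorP => i; rewrite /cons_cV.
case: (@splitP 1 n i) => [j|k] ij.
  have -> : i = lshift n j :> 'I_(1 + n) by exact/val_inj.
  under eq_fun do rewrite (col_mxEu (_ : 'M[R]_1)) mxE ord1 eqxx.
  exact: measurable_fst.
have -> : i = rshift 1 k :> 'I_(1 + n) by exact/val_inj.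
under eq_fun do rewrite (col_mxEd (_ : 'M[R]_1)).
exact: (measurableT_comp (measurable_coor k) measurable_snd).
Qed.

Let measurable_uncons_cV : measurable_fun [set: 'cV[R]_(n.+1)] uncons_cV.
Proof.
apply/measurable_fun_pairP; split; first exact: measurable_coor.
apply: measurable_fun_coorP => i.
under eq_fun do rewrite /= mxE.
exact: measurable_coor.
Qed.

Definition lebesgue_cV_cons : set 'cV[R]_(n.+1) -> \bar R :=
  pushforward (lebesgue_measure \x mu)%E cons_cV.

Let leb := pushforward (@lebesgue_measure R \x mu)%E cons_cV.

Let leb0 : leb set0 = 0%E.
Proof. by rewrite /leb /pushforward preimage_set0 measure0. Qed.

Let leb_ge0 A : (0 <= leb A)%E.
Proof. exact: measure_ge0. Qed.

Let leb_sigma_additive : semi_sigma_additive leb.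
Proof.
move=> F mF tF mUF; rewrite /leb /pushforward preimage_bigcup.
apply: measure_semi_sigma_additive.
- by move=> k; rewrite -[X in measurable X]setTI; exact: measurable_cons_cV.
- apply/trivIsetP => /= i j _ _ ij; rewrite -preimage_setI.
  by move/trivIsetP : tF => /(_ _ _ _ _ ij) ->//; rewrite preimage_set0.
- by rewrite -preimage_bigcup -[X in measurable X]setTI; exact: measurable_cons_cV.
Qed.

HB.instance Definition _ := isMeasure.Build _ _ _ lebesgue_cV_cons
  leb0 leb_ge0 leb_sigma_additive.

Let leb_sigma_finite : sigma_finite [set: 'cV[R]_(n.+1)] lebesgue_cV_cons.
Proof.
have /sigma_finiteP[F [TF ndF mF]] := sigma_finiteT (@lebesgue_measure R).
have /sigma_finiteP[G [TG ndG mG]] := sigma_finiteT mu.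
exists (fun k => uncons_cV @^-1` (F k `*` G k)).
  rewrite -preimage_bigcup; apply/esym/seteqP; split => // x _ /=.
  have [a _ Fa] : (\bigcup_i F i) (uncons_cV x).1 by rewrite -TF.
  have [b _ Gb] : (\bigcup_i G i) (uncons_cV x).2 by rewrite -TG.
  exists (maxn a b) => //; split.
    by move: Fa; exact/subsetPset/ndF/leq_maxl.
  by move: Gb; exact/subsetPset/ndG/leq_maxr.
move=> k; have [mFk Fk] := mF k; have [mGk Gk] := mG k; split.
  by rewrite -[X in measurable X]setTI; apply: measurable_uncons_cV => //;
    exact: measurableX.
rewrite /lebesgue_cV_cons /pushforward -comp_preimage.
rewrite (_ : uncons_cV \o cons_cV = id); last exact/funext/cons_cVK.
rewrite preimage_id [ltLHS]product_measure1E//.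
by rewrite lte_mul_pinfty// ge0_fin_numE.
Qed.

HB.instance Definition _ := Measure_isSigmaFinite.Build _ _ _ lebesgue_cV_cons
  leb_sigma_finite.

End lebesgue_cV_step.

(* n-fold product of the one-dimensional Lebesgue measure, built by splitting off
   the first coordinate. *)
Fixpoint lebesgue_cV (R : realType) (n : nat) :
    {sigma_finite_measure set 'cV[R]_n -> \bar R} :=
  match n with
  | 0 => \d_(0 : 'cV[R]_0)
  | m.+1 => lebesgue_cV_cons (lebesgue_cV R m)
  end.

Definition cvdot (R : realType) (n : nat) (x y : 'cV[R]_n) : R :=
  \sum_i x i ord0 * y i ord0.

Definition expmx (R : realType) (n : nat) (A : 'M[R]_n) : 'M[R]_n :=
  limn (series (fun k => (k`!%:R)^-1 *: A ^+ k)).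

Definition gramian (R : realType) (n : nat) (Q B : 'M[R]_n) (t : R) : 'M[R]_n :=
  \matrix_(i, j) (\int[lebesgue_measure]_(s in `[0, t])
                    (expmx (s *: B) *m Q *m expmx (s *: B^T)) i j)%R.

Definition volume (R : realType) (n : nat) (Q B : 'M[R]_n) (t : R) : R :=
  \det (gramian Q B t).

Definition kalman (R : realType) (n : nat) (Q B : 'M[R]_n) : Prop :=
  forall W : {vspace 'cV[R]_n},
    (forall v, v \in W -> Q *m v = 0) ->
    (forall v, v \in W -> B^T *m v \in W) -> W = 0%VS.

(* The blocks have sizes p_0, ..., p_nu; submxblock M i j is the block of M in
   block row i and block column j, both numbered from 0. *)
Definition canonical_form (R : realType) (nu : nat) (p : 'I_nu.+1 -> nat)
    (Q B : 'M[R]_(\sum_i p i)%N) : Prop :=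
  [/\ (forall i j : 'I_nu.+1, (i <= j)%N -> (p j <= p i)%N),
      (forall i, (1 <= p i)%N),
      [/\ (submxblock Q ord0 ord0)^T = submxblock Q ord0 ord0,
          (forall v : 'cV[R]_(p ord0), v != 0 ->
             0 < cvdot (submxblock Q ord0 ord0 *m v) v) &
          (forall i j : 'I_nu.+1, (i != ord0) || (j != ord0) ->
             submxblock Q i j = 0)],
      (forall i j : 'I_nu.+1, i = j.+1 :> nat ->
         \rank (submxblock B i j) = p i) &
      (forall i j : 'I_nu.+1, (j.+1 < i)%N -> submxblock B i j = 0)].

Definition standing_assumptions (R : realType) (nu : nat) (p : 'I_nu.+1 -> nat)
    (Q B : 'M[R]_(\sum_i p i)%N) : Prop :=
  [/\ (2 <= \sum_i p i)%N,
      Q^T = Q,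
      (forall v, 0 <= cvdot (Q *m v) v),
      kalman Q B &
      canonical_form Q B].

Definition homogeneous_dim (nu : nat) (p : 'I_nu.+1 -> nat) : nat :=
  (\sum_(i < nu.+1) (2 * i + 1) * p i)%N.

Section complex_functions.
Context {R : realType} {d : measure_display} {T : measurableType d}.

Definition cmod (z : R[i]) : R := ComplexField.Normc.normc z.

Definition cmeasurable (f : T -> R[i]) : Prop :=
  measurable_fun [set: T] (fun x => complex.Re (f x)) /\
  measurable_fun [set: T] (fun x => complex.Im (f x)).

Definition cintegral (mu : {measure set T -> \bar R}) (f : T -> R[i]) : R[i] :=
  (\int[mu]_x complex.Re (f x))%R +i* (\int[mu]_x complex.Im (f x))%R.

Definition cLnorm (mu : {measure set T -> \bar R}) (r : R) (f : T -> R[i])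
    : \bar R :=
  'N[mu]_(r%:E)[(fun x => (cmod (f x))%:E)]%E.

Definition cLp (mu : {measure set T -> \bar R}) (r : R) (f : T -> R[i]) : Prop :=
  cmeasurable f /\ (cLnorm mu r f < +oo)%E.

End complex_functions.

Section schwartz.
Context {R : realType} (n : nat).

Fixpoint iter_partial (s : seq 'I_n) (f : 'cV[R]_n -> R) : 'cV[R]_n -> R :=
  match s with
  | [::] => f
  | i :: s' => 'D_(delta_mx i ord0) (iter_partial s' f)
  end.

(* All iterated partial derivatives exist everywhere and decay rapidly; as they
   are all bounded, they are all Lipschitz, so f is smooth. *)
Definition schwartz (f : 'cV[R]_n -> R) : Prop :=
  forall s : seq 'I_n,
    (forall (x : 'cV[R]_n) (i : 'I_n),
       derivable (iter_partial s f) x (delta_mx i ord0)) /\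
    (forall N : nat, exists M : R, forall x : 'cV[R]_n,
       (1 + `|x|) ^+ N * `|iter_partial s f x| <= M).

Definition cschwartz (f : 'cV[R]_n -> R[i]) : Prop :=
  schwartz (fun x => complex.Re (f x)) /\ schwartz (fun x => complex.Im (f x)).

End schwartz.

Definition expi (R : realType) (a : R) : R[i] := cos a +i* sin a.

Section propagator.
Context {R : realType} (n : nat) (Q B : 'M[R]_n).
Implicit Types (phi psi : 'cV[R]_n -> R[i]) (t : R).

Definition propagator0 t phi (x : 'cV[R]_n) : R[i] :=
  if t == 0 then phi x else
  if 0 < t then
    (((4 * pi) `^ (- (n%:R / 2)))%:C * expi (- (pi * n%:R / 4))
      / (Num.sqrt (volume Q B t))%:C)
    * cintegral (lebesgue_cV R n) (fun y =>
        let z := y - expmx (t *: B) *m x in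
        expi (4^-1 * cvdot (invmx (gramian Q B t) *m z) z) * phi y)
  else
    (((4 * pi) `^ (- (n%:R / 2)))%:C * expi (pi * n%:R / 4)
      * (expR (`|t| * \tr B))%:C / (Num.sqrt (volume Q B `|t|))%:C)
    * cintegral (lebesgue_cV R n) (fun y =>
        let z := x - expmx (`|t| *: B) *m y in
        expi (- (4^-1 * cvdot (invmx (gramian Q B `|t|) *m z) z)) * phi y).

(* psi is the image of phi under the extension by density of U(t) to an operator
   from L^a to L^b: (phi, psi) lies in the closure in L^a x L^b of the graph of
   U(t) on Schwartz functions. *)
Definition propagator (a b t : R) phi psi : Prop :=
  [/\ cLp (lebesgue_cV R n) a phi,
      cLp (lebesgue_cV R n) b psi &
      exists f : nat -> 'cV[R]_n -> R[i],
        [/\ (forall k, cschwartz (f k)),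
            (fun k => cLnorm (lebesgue_cV R n) a (fun x => f k x - phi x))
              @ \oo --> 0%E &
            (fun k => cLnorm (lebesgue_cV R n) b
               (fun x => propagator0 t (f k) x - psi x)) @ \oo --> 0%E]].

(* g is the Bochner integral over the bounded interval D of the L^b-valued
   function w: the limit in L^b of the integrals of simple functions
   S_k = \sum_(i < m k) 1_(A k i) * c k i with \int_D |w - S_k|_b ds --> 0. *)
Definition bochner_integral (b : R) (D : set R) (w : R -> 'cV[R]_n -> R[i])
    (g : 'cV[R]_n -> R[i]) : Prop :=
  exists (m : nat -> nat) (A : nat -> nat -> set R)
         (c : nat -> nat -> 'cV[R]_n -> R[i]),
    let dist k s := cLnorm (lebesgue_cV R n) b
      (fun x => w s x - \sum_(i < m k) (\1_(A k i) s)%:C * c k i x) in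
    [/\ (forall k i, measurable (A k i) /\ cLp (lebesgue_cV R n) b (c k i)),
        (forall k, measurable_fun D (dist k)),
        (fun k => \int[lebesgue_measure]_(s in D) dist k s)%E @ \oo --> 0%E,
        cLp (lebesgue_cV R n) b g &
        (fun k => cLnorm (lebesgue_cV R n) b (fun x =>
           \sum_(i < m k) (fine (lebesgue_measure (A k i `&` D)))%:C * c k i x
           - g x)) @ \oo --> 0%E].

(* u(., t) = U(t) phi + \int_0^t U(t - s) F(., s) ds for almost every t, with
   U(t) phi in L^2 and the integral taken in L^r. For t < 0 the integral is minus
   the one over [t, 0], whence the sign. *)
Definition cauchy_solution (r r' : R) phi (F u : R -> 'cV[R]_n -> R[i]) : Prop :=
  [/\ cmeasurable (fun z : R * 'cV[R]_n => u z.1 z.2),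
      {ae lebesgue_cV R n, forall x, u 0 x = phi x} &
      {ae lebesgue_measure, forall t : R,
        exists (v : 'cV[R]_n -> R[i]) (w : R -> 'cV[R]_n -> R[i])
               (g : 'cV[R]_n -> R[i]),
          [/\ propagator 2 2 t phi v,
              {ae lebesgue_measure, forall s : R,
                s \in `[Num.min 0 t, Num.max 0 t] ->
                propagator r' r (t - s) (F s) (w s)},
              bochner_integral r `[Num.min 0 t, Num.max 0 t] w g &
              {ae lebesgue_cV R n, forall x,
                u t x = v x + (Num.sg t)%:C * g x}]}].

End propagator.

(* Main.v *)
Require Import Defs.
From HB Require Import structures.
From mathcomp Require Import all_boot all_order all_algebra fingroup perm.
From mathcomp Require Import all_classical all_reals all_analysis.
From mathcomp Require Import measurable_realfun.
From mathcomp Require Import complex.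
From mathcomp Require Import ring lra.

Set Implicit Arguments.
Unset Strict Implicit.
Unset Printing Implicit Defensive.
Import Order.TTheory GRing.Theory Num.Theory.
Import numFieldTopology.Exports numFieldNormedType.Exports.

Local Open Scope classical_set_scope.
Local Open Scope ring_scope.

(* With A_t = Q(t) for t > 0, continued to negative times so that
   A_(t+s) = A_t + e^(tB) A_s e^(tB^T), the operator e^(t tr B / 2) U(t) has a
   kernel of modulus (4 pi)^(-n/2) |det A_t|^(-1/2) e^(t tr B / 2) and Gaussian
   phase; it contracts L^2, and composing the kernels at times t and s gives a
   Gaussian oscillatory integral bounded by a |t - s|^(-D/2), where the lower
   bound on the volume enters. Interpolation gives the L^r' -> L^r bound
   C |t - s|^(-2/q), and the one-dimensional Hardy-Littlewood-Sobolev inequality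
   for the Riesz potential |t|^(-2/q) then yields the homogeneous estimate by
   the TT* argument and the Duhamel estimate by integrating norms in time. All
   bounds are proved for functions in both L^1 and L^2 and carried to the
   extensions by density through Fatou's lemma, along one sequence of Schwartz
   functions that converges fast enough to give almost everywhere convergence
   of its images at every time. *)

(** * Complex-valued integration *)

(** The weight e^(t tr B / 2) compensates the change of the L^2 norm under U(t), which is why it
    appears in the estimate. The group law of U is never invoked: the TT* argument only needs the
    kernel at time t times the conjugate kernel at time s, integrated over their common variable y.
    This product has constant modulus in y, so its integral does not converge absolutely, and that
    shapes the proof: Gaussian weights exp(-e |y|^2) are inserted, every bound is proved with a
    constant free of e, and Fatou's lemma removes the weight. The same device gives Plancherel's
    theorem as an inequality, which suffices. The operators act on [cL12], functions both in L^1 and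
    in L^2. This class contains the Schwartz functions and is stable under truncation in height, so
    that interpolation can be done as in Marcinkiewicz's theorem, by cutting at a height that
    depends on the level. The restriction on r yields q > 2, that is, local integrability of
    |t|^(-2/q). Norms of the extended operators are given one time at a time, so they are always
    compared with majorants that are measurable in time by construction. *)

Section complex_modulus.
Context {R : realType}.
Implicit Types (z w : R[i]) (a b : R).
Local Open Scope complex_scope.

Lemma cmodE z : cmod z = Num.sqrt (complex.Re z ^+ 2 + complex.Im z ^+ 2).
Proof. by case: z. Qed.

Lemma cmod_ge0 z : 0 <= cmod z. Proof. by rewrite cmodE sqrtr_ge0. Qed.

Lemma cmod_sqr z : cmod z ^+ 2 = complex.Re z ^+ 2 + complex.Im z ^+ 2.
Proof. by rewrite cmodE sqr_sqrtr// addr_ge0// sqr_ge0. Qed.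

Lemma cmodM z w : cmod (z * w) = cmod z * cmod w.
Proof. exact: ComplexField.Normc.normcM. Qed.

Lemma cmodD z w : cmod (z + w) <= cmod z + cmod w.
Proof. exact: le_normcD. Qed.

Lemma cmodN z : cmod (- z) = cmod z.
Proof. exact: normcN. Qed.

Lemma cmodB z w : cmod (z - w) = cmod (w - z).
Proof. by rewrite -cmodN opprB. Qed.

Lemma cmod0 : cmod (0 : R[i]) = 0. Proof. exact: ComplexField.Normc.normc0. Qed.

Lemma cmod_eq0 z : cmod z = 0 -> z = 0.
Proof. exact: ComplexField.Normc.eq0_normc. Qed.

Lemma cmodR a : cmod a%:C = `|a|.
Proof. by rewrite cmodE/= expr0n addr0 sqrtr_sqr. Qed.

Lemma cmod_conj z : cmod z^* = cmod z.
Proof. by case: z => a b; rewrite !cmodE/= sqrrN. Qed.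

Lemma cmod_Re z : `|complex.Re z| <= cmod z.
Proof. by rewrite cmodE -sqrtr_sqr ler_wsqrtr// lerDl sqr_ge0. Qed.

Lemma cmod_Im z : `|complex.Im z| <= cmod z.
Proof. by rewrite cmodE -sqrtr_sqr ler_wsqrtr// lerDr sqr_ge0. Qed.

Lemma ReM z w : complex.Re (z * w) =
  complex.Re z * complex.Re w - complex.Im z * complex.Im w.
Proof. by case: z; case: w. Qed.

Lemma ImM z w : complex.Im (z * w) =
  complex.Re z * complex.Im w + complex.Im z * complex.Re w.
Proof. by case: z; case: w. Qed.

Lemma ReD z w : complex.Re (z + w) = complex.Re z + complex.Re w.
Proof. by case: z; case: w. Qed.

Lemma ImD z w : complex.Im (z + w) = complex.Im z + complex.Im w.
Proof. by case: z; case: w. Qed.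

Lemma ReN z : complex.Re (- z) = - complex.Re z.
Proof. by case: z. Qed.

Lemma ImN z : complex.Im (- z) = - complex.Im z.
Proof. by case: z. Qed.

Lemma Re_conj z : complex.Re z^* = complex.Re z.
Proof. by case: z. Qed.

Lemma Im_conj z : complex.Im z^* = - complex.Im z.
Proof. by case: z. Qed.

Definition cReImE := (ReM, ImM, ReD, ImD, ReN, ImN, Re_conj, Im_conj).

Lemma eq_ReIm z w : complex.Re z = complex.Re w -> complex.Im z = complex.Im w ->
  z = w.
Proof. by case: z; case: w => a b c d /= -> ->. Qed.

Lemma mulc_conj z : z * z^*%C = (cmod z ^+ 2)%:C.
Proof. by rewrite cmod_sqr; case: z => a b; apply: eq_ReIm => /=; ring. Qed.

Lemma cmod_expi a : cmod (expi a) = 1.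
Proof. by rewrite cmodE/= cos2Dsin2 sqrtr1. Qed.

Lemma expiD a b : expi (a + b) = expi a * expi b.
Proof.
by apply: eq_ReIm; rewrite !cReImE/= ?cosD ?sinD//; ring.
Qed.

Lemma expiN a : expi (- a) = (expi a)^*.
Proof. by rewrite /expi cosN sinN. Qed.

(** Multiplication by [expi a] with a = -arg z turns z into its modulus, so a bound on all rotated
    real parts is a bound on the modulus. This reduces the triangle inequality for complex integrals
    to real ones. *)
Lemma cmod_ind z (M : R) :
  (forall a, complex.Re (expi a * z) <= M) -> cmod z <= M.
Proof.
move=> H; have [z0|z0] := eqVneq z 0.
  by have := H 0; rewrite z0 cmod0 mulr0.
have cz : 0 < cmod z.
  rewrite lt_def cmod_ge0 andbT; by apply: contra z0 => /eqP/cmod_eq0 ->.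
pose u := complex.Re z / cmod z; pose v := complex.Im z / cmod z.
have uv : u ^+ 2 + v ^+ 2 = 1.
  by rewrite !expr_div_n -mulrDl -cmod_sqr divff// sqrf_eq0 gt_eqF.
have u1 : -1 <= u <= 1.
  rewrite -ler_norml -(@ler_pXn2r _ 2%N)// ?nnegrE//.
  by rewrite real_normK ?num_real// expr1n -uv lerDl sqr_ge0.
(* [acos] only reaches angles with nonnegative sine; the sign of v decides between [acos u] and its
   opposite. *)
have [a [ca sa]] : exists a, cos a = u /\ sin a = v.
  have sv : Num.sqrt (1 - u ^+ 2) = `|v|.
    by rewrite -uv addrAC subrr add0r sqrtr_sqr.
  have [v0|v0] := leP 0 v.
    exists (acos u); rewrite acosK ?in_itv//= sin_acos// sv.
    by rewrite ger0_norm.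
  exists (- acos u); rewrite cosN acosK ?in_itv//= sinN sin_acos// sv.
  by rewrite ltr0_norm// opprK.
have := H (- a); rewrite ReM/= cosN sinN ca sa.
suff -> : u * complex.Re z - - v * complex.Im z = cmod z by [].
rewrite mulNr opprK /u /v.
rewrite mulrAC -expr2 [X in _ + X]mulrAC -expr2 -mulrDl -cmod_sqr expr2.
by rewrite mulfK// gt_eqF.
Qed.

End complex_modulus.

Section cmeasurable_theory.
Context {R : realType} {d : measure_display} {T : measurableType d}.
Implicit Types f g : T -> R[i].
Local Open Scope complex_scope.

Lemma cmeasurable_cst (z : R[i]) : cmeasurable (fun _ : T => z).
Proof. by split; exact: measurable_cst. Qed.

Lemma cmeasurableD f g : cmeasurable f -> cmeasurable g ->
  cmeasurable (fun x => f x + g x).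
Proof.
move=> [f1 f2] [g1 g2]; split.
  by under eq_fun do rewrite ReD; exact: measurable_funD.
by under eq_fun do rewrite ImD; exact: measurable_funD.
Qed.

Lemma cmeasurableN f : cmeasurable f -> cmeasurable (fun x => - f x).
Proof.
move=> [f1 f2]; split.
  by under eq_fun do rewrite ReN; exact: measurableT_comp.
by under eq_fun do rewrite ImN; exact: measurableT_comp.
Qed.

Lemma cmeasurableB f g : cmeasurable f -> cmeasurable g ->
  cmeasurable (fun x => f x - g x).
Proof. by move=> mf mg; apply: cmeasurableD => //; exact: cmeasurableN. Qed.

Lemma cmeasurableM f g : cmeasurable f -> cmeasurable g ->
  cmeasurable (fun x => f x * g x).
Proof.
move=> [f1 f2] [g1 g2]; split.
  by under eq_fun do rewrite ReM; apply: measurable_funB; exact: measurable_funM.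
by under eq_fun do rewrite ImM; apply: measurable_funD; exact: measurable_funM.
Qed.

Lemma cmeasurable_conj f : cmeasurable f -> cmeasurable (fun x => (f x)^*).
Proof.
move=> [f1 f2]; split.
  by under eq_fun do rewrite Re_conj.
by under eq_fun do rewrite Im_conj; exact: measurableT_comp.
Qed.

Lemma cmeasurableR (a : T -> R) : measurable_fun setT a ->
  cmeasurable (fun x => (a x)%:C).
Proof. by move=> ma; split => //; exact: measurable_cst. Qed.

Lemma cmeasurable_expi (a : T -> R) : measurable_fun setT a ->
  cmeasurable (fun x => expi (a x)).
Proof.
move=> ma; split => /=; apply: measurableT_comp => //;
  apply: continuous_measurable_fun; [exact: continuous_cos|exact: continuous_sin].
Qed.

Lemma measurable_cmod f : cmeasurable f -> measurable_fun setT (fun x => cmod (f x)).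
Proof.
move=> [f1 f2]; under eq_fun do rewrite cmodE.
apply: measurableT_comp => //.
  by apply: continuous_measurable_fun; exact: sqrt_continuous.
by apply: measurable_funD; apply: measurable_funX.
Qed.

Lemma cmeasurable_sum (I : Type) (s : seq I) (f : I -> T -> R[i]) :
  (forall i, cmeasurable (f i)) -> cmeasurable (fun x => \sum_(i <- s) f i x).
Proof.
move=> mf; elim: s => [|i s ih].
  by under eq_fun do rewrite big_nil; exact: cmeasurable_cst.
by under eq_fun do rewrite big_cons; apply: cmeasurableD.
Qed.

End cmeasurable_theory.

Lemma cmeasurable_comp (R : realType) d (T : measurableType d) d'
    (T' : measurableType d') (f : T' -> R[i]) (h : T -> T') :
  cmeasurable f -> measurable_fun setT h -> cmeasurable (fun x => f (h x)).
Proof. by move=> [f1 f2] mh; split; [exact: (measurableT_comp f1 mh)|exact: (measurableT_comp f2 mh)]. Qed.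

Section cintegral_theory.
Context {R : realType} {d : measure_display} {T : measurableType d}.
Variable mu : {measure set T -> \bar R}.
Implicit Types f g : T -> R[i].
Local Open Scope complex_scope.

Definition cintegrable f :=
  mu.-integrable setT (fun x => (complex.Re (f x))%:E) /\
  mu.-integrable setT (fun x => (complex.Im (f x))%:E).

Lemma cintegrable_le f (g : T -> R) : cmeasurable f ->
  mu.-integrable setT (EFin \o g) -> (forall x, cmod (f x) <= g x) ->
  cintegrable f.
Proof.
move=> [f1 f2] ig fg; split; apply: le_integrable ig => //=.
- exact/measurable_EFinP.
- move=> x _; rewrite lee_fin (le_trans (cmod_Re _))// (le_trans (fg x))//.
  exact: ler_norm.
- exact/measurable_EFinP.
- move=> x _; rewrite lee_fin (le_trans (cmod_Im _))// (le_trans (fg x))//.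
  exact: ler_norm.
Qed.

Lemma cintegrable_measurable f : cintegrable f -> cmeasurable f.
Proof.
by move=> [/integrableP[/measurable_EFinP + _] /integrableP[/measurable_EFinP + _]].
Qed.

Lemma cintegrable_cmod f : cintegrable f ->
  mu.-integrable setT (fun x => (cmod (f x))%:E).
Proof.
move=> cf; have [m1 m2] := cintegrable_measurable cf.
case: cf => i1 i2.
have ig : mu.-integrable setT
    (fun x => (`|complex.Re (f x)| + `|complex.Im (f x)|)%:E).
  under eq_fun do rewrite EFinD.
  by apply: integrableD => //; [exact: (integrable_abse i1)|exact: (integrable_abse i2)].
apply: le_integrable ig => //=.
  by apply/measurable_EFinP/measurable_cmod.
move=> x _; rewrite lee_fin ger0_norm ?cmod_ge0// ger0_norm ?addr_ge0//.
rewrite -(@ler_pXn2r _ 2%N)// ?nnegrE ?cmod_ge0 ?addr_ge0//.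
rewrite cmod_sqr sqrrD !real_normK ?num_real//.
by rewrite lerD2r lerDl mulrn_wge0// mulr_ge0.
Qed.

Lemma cintegrableP f : cmeasurable f ->
  mu.-integrable setT (fun x => (cmod (f x))%:E) -> cintegrable f.
Proof. by move=> mf fi; apply: (cintegrable_le mf fi). Qed.

Lemma eq_cintegral f g : f =1 g -> cintegral mu f = cintegral mu g.
Proof. by move=> /funext ->. Qed.

Lemma cintegralD f g : cintegrable f -> cintegrable g ->
  cintegral mu (fun x => f x + g x) = cintegral mu f + cintegral mu g.
Proof.
move=> [f1 f2] [g1 g2]; apply: eq_ReIm; rewrite ?cReImE/=.
  by under eq_Rintegral do rewrite ReD; rewrite RintegralD.
by under eq_Rintegral do rewrite ImD; rewrite RintegralD.
Qed.

Lemma cintegrableZ (z : R[i]) f : cintegrable f -> cintegrable (fun x => z * f x).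
Proof.
move=> cf; apply: (@cintegrable_le _ (fun x => cmod z * cmod (f x))).
- by apply: cmeasurableM; [exact: cmeasurable_cst|exact: cintegrable_measurable].
- by rewrite /comp; under eq_fun do rewrite EFinM; apply: integrableZl => //;
    exact: cintegrable_cmod.
- by move=> x; rewrite cmodM.
Qed.

Lemma cintegrableN f : cintegrable f -> cintegrable (fun x => - f x).
Proof.
by move=> cf; under eq_fun do rewrite -mulN1r; exact: cintegrableZ.
Qed.

Lemma cintegralZ (z : R[i]) f : cintegrable f ->
  cintegral mu (fun x => z * f x) = z * cintegral mu f.
Proof.
move=> cf; have [f1 f2] := cf; apply: eq_ReIm; rewrite !cReImE/=.
  under eq_Rintegral do rewrite ReM.
  rewrite RintegralB ?RintegralZl//.
    by under [X in _.-integrable _ X]eq_fun do rewrite EFinM; exact: integrableZl.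
  by under [X in _.-integrable _ X]eq_fun do rewrite EFinM; exact: integrableZl.
under eq_Rintegral do rewrite ImM.
rewrite RintegralD ?RintegralZl//.
  by under [X in _.-integrable _ X]eq_fun do rewrite EFinM; exact: integrableZl.
by under [X in _.-integrable _ X]eq_fun do rewrite EFinM; exact: integrableZl.
Qed.

Lemma cintegral_conj f : cintegrable f ->
  cintegral mu (fun x => (f x)^*) = (cintegral mu f)^*.
Proof.
move=> [f1 f2]; apply: eq_ReIm; rewrite !cReImE/=.
  by under eq_Rintegral do rewrite Re_conj.
under eq_Rintegral do rewrite Im_conj -mulN1r.
by rewrite RintegralZl// mulN1r.
Qed.

Lemma cmod_cintegral f : cintegrable f ->
  cmod (cintegral mu f) <= (\int[mu]_x cmod (f x))%R.
Proof.
move=> cf; apply: cmod_ind => a.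
rewrite -cintegralZ//=.
have [i1 i2] := cintegrableZ (expi a) cf.
apply: le_Rintegral => //; first exact: cintegrable_cmod.
move=> x _; rewrite (le_trans (ler_norm _))// (le_trans (cmod_Re _))//.
by rewrite cmodM cmod_expi mul1r.
Qed.

Lemma cmod_cintegral_le f : cintegrable f ->
  ((cmod (cintegral mu f))%:E <= \int[mu]_x (cmod (f x))%:E)%E.
Proof.
move=> cf; have /integrableP[_ fi] := cintegrable_cmod cf.
rewrite -[leRHS]fineK ?lee_fin; first exact: cmod_cintegral.
rewrite ge0_fin_numE; last by apply: integral_ge0 => x _; rewrite lee_fin cmod_ge0.
by under eq_integral do rewrite -[X in X%:E]ger0_norm ?cmod_ge0//.
Qed.

Lemma cmod_cintegral_bound f (g : T -> R) : cmeasurable f ->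
  mu.-integrable setT (EFin \o g) -> (forall x, cmod (f x) <= g x) ->
  cmod (cintegral mu f) <= (\int[mu]_x g x)%R.
Proof.
move=> mf ig fg; have cf := cintegrable_le mf ig fg.
rewrite (le_trans (cmod_cintegral cf))// le_Rintegral//.
exact: cintegrable_cmod.
Qed.

End cintegral_theory.

(** * Parameter integrals and Fubini's theorem *)

Section parameter_integrals.
Context {R : realType} {d1 d2 : measure_display}.
Context {T1 : measurableType d1} {T2 : measurableType d2}.
Variables (m1 : {sigma_finite_measure set T1 -> \bar R})
          (m2 : {sigma_finite_measure set T2 -> \bar R}).
Local Open Scope complex_scope.

Lemma measurable_integral_param (F : T1 -> T2 -> \bar R) :
  measurable_fun setT (fun z : T1 * T2 => F z.1 z.2) ->
  measurable_fun setT (fun x => \int[m2]_y F x y)%E.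
Proof.
move=> mF; under eq_fun do rewrite integralE.
apply: emeasurable_funB.
  have mp : measurable_fun setT (fun z : T1 * T2 => ((F z.1)^\+ z.2)%E).
    by have := measurable_funepos mF; rewrite funepos.unlock.
  by have := @measurable_fun_fubini_tonelli_F _ _ _ _ _ m2 _ mp; exact.
have mn : measurable_fun setT (fun z : T1 * T2 => ((F z.1)^\- z.2)%E).
  by have := measurable_funeneg mF; rewrite funeneg.unlock.
by have := @measurable_fun_fubini_tonelli_F _ _ _ _ _ m2 _ mn; exact.
Qed.

Lemma measurable_Rintegral_param (F : T1 -> T2 -> R) :
  measurable_fun setT (fun z : T1 * T2 => F z.1 z.2) ->
  measurable_fun setT (fun x => \int[m2]_y F x y)%R.
Proof.
move=> mF; apply: measurableT_comp; first exact: fine_measurable.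
apply: (@measurable_integral_param (fun x y => (F x y)%:E)).
exact/measurable_EFinP.
Qed.

Lemma cmeasurable_cintegral (F : T1 -> T2 -> R[i]) :
  cmeasurable (fun z : T1 * T2 => F z.1 z.2) ->
  cmeasurable (fun x => cintegral m2 (F x)).
Proof.
move=> [F1 F2]; split => /=.
  exact: (@measurable_Rintegral_param (fun x y => complex.Re (F x y))).
exact: (@measurable_Rintegral_param (fun x y => complex.Im (F x y))).
Qed.

Lemma measurable_curryr (d3 : measure_display) (T3 : measurableType d3)
    (F : T1 * T2 -> T3) (x : T1) :
  measurable_fun setT F -> measurable_fun setT (fun y => F (x, y)).
Proof. by move=> mF; exact: (measurableT_comp mF (measurable_pair1 x)). Qed.

Lemma measurable_curryl (d3 : measure_display) (T3 : measurableType d3)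
    (F : T1 * T2 -> T3) (y : T2) :
  measurable_fun setT F -> measurable_fun setT (fun x => F (x, y)).
Proof. by move=> mF; exact: (measurableT_comp mF (measurable_pair2 y)). Qed.

Variables (a : T1 -> R) (b : T2 -> R).
Hypotheses (ia : m1.-integrable setT (EFin \o a))
           (ib : m2.-integrable setT (EFin \o b))
           (a0 : forall x, 0 <= a x) (b0 : forall y, 0 <= b y).

(** Domination by a product of integrable functions makes F integrable on the product space and on
    every section, not just on almost every one; hence [fine] loses nothing in the inner integrals.
    The exchanges of complex integrals below all go through this form. *)
Lemma Fubini_dom (F : T1 -> T2 -> R) :
  measurable_fun setT (fun z : T1 * T2 => F z.1 z.2) ->
  (forall x y, `|F x y| <= a x * b y) ->
  \int[m1]_x \int[m2]_y F x y = \int[m2]_y \int[m1]_x F x y.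
Proof.
move=> mF Fab.
have ma : measurable_fun setT a by case/integrableP: ia => /measurable_EFinP.
have mb : measurable_fun setT b by case/integrableP: ib => /measurable_EFinP.
have I1 x : m2.-integrable setT (EFin \o (F x)).
  apply: (@le_integrable _ _ _ m2 _ measurableT _ (EFin \o (fun y => a x * b y))).
  - exact/measurable_EFinP/(measurable_curryr x mF).
  - move=> y _ /=; rewrite lee_fin (le_trans (Fab x y))//.
    exact: ler_norm.
  - by rewrite /comp; under eq_fun do rewrite EFinM; exact: integrableZl.
have I2 y : m1.-integrable setT (EFin \o (F ^~ y)).
  apply: (@le_integrable _ _ _ m1 _ measurableT _ (EFin \o (fun x => b y * a x))).
  - exact/measurable_EFinP/(measurable_curryl y mF).
  - move=> x _ /=; rewrite lee_fin (le_trans (Fab x y))//.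
    by rewrite mulrC; exact: ler_norm.
  - by rewrite /comp; under eq_fun do rewrite EFinM; exact: integrableZl.
rewrite /Rintegral; congr fine.
have E1 x : ((fine (\int[m2]_y (F x y)%:E))%:E = \int[m2]_y (F x y)%:E)%E.
  by rewrite fineK//; exact: (integrable_fin_num measurableT (I1 x)).
have E2 y : ((fine (\int[m1]_x (F x y)%:E))%:E = \int[m1]_x (F x y)%:E)%E.
  by rewrite fineK//; exact: (integrable_fin_num measurableT (I2 y)).
under eq_integral do rewrite E1.
under [RHS]eq_integral do rewrite E2.
apply: (@Fubini _ _ _ _ _ m1 m2 (fun z => (F z.1 z.2)%:E)).
apply/integrable12ltyP; first exact/measurable_EFinP.
apply: (@le_lt_trans _ _ (\int[m1]_x ((a x)%:E * \int[m2]_y (b y)%:E))%E).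
  apply: ge0_le_integral => //.
  - by move=> x _; apply: integral_ge0.
  - apply: (@measurable_integral_param (fun x y => `|(F x y)%:E|)%E).
    by apply/measurable_EFinP; exact: measurableT_comp.
  - by apply: emeasurable_funM => //; exact/measurable_EFinP.
  move=> x _; rewrite -ge0_integralZl_EFin//.
  - apply: ge0_le_integral => //.
    + by apply: measurableT_comp => //; exact/measurable_EFinP/(measurable_curryr x mF).
    + by apply: emeasurable_funM => //; exact/measurable_EFinP.
    + by move=> y _; rewrite -EFinM lee_fin.
  - by move=> y _; rewrite lee_fin.
  - exact/measurable_EFinP.
have fb : (\int[m2]_y (b y)%:E)%E \is a fin_num by exact: integrable_fin_num.
have fa : (\int[m1]_y (a y)%:E)%E \is a fin_num by exact: integrable_fin_num.
rewrite ge0_integralZr//.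
- by rewrite -(fineK fa) -(fineK fb) -EFinM ltry.
- exact/measurable_EFinP.
- by move=> x _; rewrite lee_fin.
- by apply: integral_ge0 => y _; rewrite lee_fin.
Qed.

Lemma cfubini (F : T1 -> T2 -> R[i]) :
  cmeasurable (fun z : T1 * T2 => F z.1 z.2) ->
  (forall x y, cmod (F x y) <= a x * b y) ->
  cintegral m1 (fun x => cintegral m2 (F x)) =
  cintegral m2 (fun y => cintegral m1 (F ^~ y)).
Proof.
move=> [F1 F2] Fab; apply: eq_ReIm => /=.
  apply: (@Fubini_dom (fun x y => complex.Re (F x y))) => // x y.
  exact: le_trans (cmod_Re _) _.
apply: (@Fubini_dom (fun x y => complex.Im (F x y))) => // x y.
exact: le_trans (cmod_Im _) _.
Qed.

End parameter_integrals.

(** * Lebesgue measure on column vectors *)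

Section lebesgue_affine.
Context {R : realType}.
Notation mu := (@lebesgue_measure R).
Local Open Scope ereal_scope.

Let affine (a b : R) (x : R) : measurableTypeR R := (a * x + b)%R.

Let measurable_affine a b : measurable_fun setT (affine a b).
Proof.
rewrite /affine; apply: continuous_measurable_fun => x.
by apply: cvgD; [apply: cvgM; [exact: cvg_cst|exact: cvg_id]|exact: cvg_cst].
Qed.

Let image_affine a b : {measure set (measurableTypeR R) -> \bar R} :=
  measure_function_pushforward__canonical__measure_function_Measure
    (@lebesgue_measure R) (@measurable_affine a b).

(** By uniqueness of Lebesgue measure it suffices to compare both sides on intervals ]u, v]. For a <
    0 the preimage is closed on the left and open on the right, which does not change its length. *)
Let lebesgue_affine (a b : R) : a != 0%R -> forall A, measurable A ->
  mu A = (`|a|)%:E * pushforward mu (affine a b) A.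
Proof.
move=> a0 A mA.
pose nu := mscale (NngNum (normr_ge0 a)) (image_affine a b).
rewrite -[RHS]/(nu A); apply: lebesgue_measure_unique => // _ [[u v]] _ <- /=.
rewrite /nu /mscale/= /image_affine/= /pushforward lebesgue_measure_itv/=.
have [u_v|vu] := ltP u v; last first.
  rewrite lte_fin ltNge vu/=.
  rewrite [X in mu X](_ : _ = set0) ?measure0 ?mule0//.
  apply/seteqP; split => // x /=; rewrite in_itv/= => /andP[ux xv].
  by have := lt_le_trans ux xv; rewrite ltNge vu.
rewrite lte_fin u_v.
have [a_gt0|a_lt0|a_eq0] := ltgtP 0%R a; last by rewrite a_eq0 eqxx in a0.
- rewrite [X in mu X](_ : _ = `]((u - b) / a)%R, ((v - b) / a)%R]%classic); last first.
    apply/seteqP; split => x /=; rewrite /affine !in_itv/=.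
      by rewrite ltr_pdivrMr// ler_pdivlMr// => /andP[? ?]; apply/andP; split; lra.
    by rewrite ltr_pdivrMr// ler_pdivlMr// => /andP[? ?]; apply/andP; split; lra.
  rewrite lebesgue_measure_itv/= lte_fin ltr_pM2r ?invr_gt0// ltrD2r u_v.
  rewrite gtr0_norm// -!EFinD -EFinM; congr EFin.
  by field; rewrite gt_eqF.
- rewrite [X in mu X](_ : _ = `[((v - b) / a)%R, ((u - b) / a)%R[%classic); last first.
    apply/seteqP; split => x /=; rewrite /affine !in_itv/=.
      by rewrite ltr_ndivlMr// ler_ndivrMr// => /andP[? ?]; apply/andP; split; lra.
    by rewrite ltr_ndivlMr// ler_ndivrMr// => /andP[? ?]; apply/andP; split; lra.
  rewrite lebesgue_measure_itv/= lte_fin ltr_nM2r ?invr_lt0// ltrD2r u_v.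
  rewrite ltr0_norm// -!EFinD -EFinM; congr EFin.
  by field; rewrite lt_eqF.
Qed.

Lemma ge0_integral_affine (a b : R) (f : R -> \bar R) : a != 0%R ->
  measurable_fun setT f -> (forall x, 0 <= f x) ->
  \int[mu]_x f (a * x + b)%R = (`|a|^-1)%:E * \int[mu]_x f x.
Proof.
move=> a0 mf f0.
pose nu := mscale (NngNum (normr_ge0 a)) (image_affine a b).
have -> : \int[mu]_x f x = \int[nu]_x f x.
  by apply: eq_measure_integral => A mA _; exact: lebesgue_affine.
rewrite ge0_integral_mscale//= /image_affine/= ge0_integral_pushforward//=.
  by rewrite muleA -EFinM mulVf ?normr_eq0// mul1e.
exact: measurable_affine.
Qed.

End lebesgue_affine.

Section lebesgue_cV_theory.
Context {R : realType}.
Local Open Scope ereal_scope.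

Lemma cons_cV0 n (z : R * 'cV[R]_n) : cons_cV z ord0 ord0 = z.1.
Proof.
rewrite /cons_cV; have -> : (ord0 : 'I_(1 + n)) = lshift n (ord0 : 'I_1) by exact/val_inj.
by rewrite (col_mxEu (_ : 'M[R]_1)) mxE eqxx.
Qed.

Lemma cons_cVS n (z : R * 'cV[R]_n) (i : 'I_n) : cons_cV z (lift ord0 i) ord0 = z.2 i ord0.
Proof.
rewrite /cons_cV; have -> : lift ord0 i = rshift 1 i :> 'I_(1 + n) by exact/val_inj.
by rewrite (col_mxEd (_ : 'M[R]_1)).
Qed.

Lemma measurable_cons_cV n : measurable_fun [set: R * 'cV[R]_n] (@cons_cV R n).
Proof.
apply: measurable_fun_coorP => i.
case: (unliftP ord0 i) => [j ->|->].
  by under eq_fun do rewrite cons_cVS; exact: (measurableT_comp (measurable_coor _) measurable_snd).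
by under eq_fun do rewrite cons_cV0; exact: measurable_fst.
Qed.

Lemma ge0_integral_cons_cV n (f : 'cV[R]_n.+1 -> \bar R) :
  measurable_fun setT f -> (forall x, 0 <= f x) ->
  \int[lebesgue_cV R n.+1]_x f x =
  \int[lebesgue_measure]_a \int[lebesgue_cV R n]_v f (cons_cV (a, v)).
Proof.
move=> mf f0.
have mc := @measurable_cons_cV n.
rewrite -[LHS]/(\int[pushforward (@lebesgue_measure R \x lebesgue_cV R n) (@cons_cV R n)]_x f x).
rewrite ge0_integral_pushforward//= fubini_tonelli1//=.
exact: (measurableT_comp mf mc).
Qed.

Lemma measurable_mulmx n m (M : 'M[R]_(m, n)) :
  measurable_fun [set: 'cV[R]_n] (fun x : 'cV[R]_n => M *m x)%R.
Proof.
apply: measurable_fun_coorP => i; under eq_fun do rewrite mxE.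
apply: measurable_sum => j; apply: measurable_funM => //.
exact: measurable_coor.
Qed.

Lemma measurable_cVD d (T : measurableType d) n (f g : T -> 'cV[R]_n) :
  measurable_fun setT f -> measurable_fun setT g ->
  measurable_fun setT (fun x => f x + g x)%R.
Proof.
move=> mf mg; apply: measurable_fun_coorP => i; under eq_fun do rewrite mxE.
by apply: measurable_funD;
  [exact: (measurableT_comp (measurable_coor i) mf)|exact: (measurableT_comp (measurable_coor i) mg)].
Qed.

Lemma ge0_integral_translate n (c : 'cV[R]_n) (f : 'cV[R]_n -> \bar R) :
  measurable_fun setT f -> (forall x, 0 <= f x) ->
  \int[lebesgue_cV R n]_x f (x + c)%R = \int[lebesgue_cV R n]_x f x.
Proof.
elim: n c f => [|n ih] c f mf f0.
  by apply: eq_integral => x _; congr f; apply/matrixP => -[].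
have mfc : measurable_fun setT (fun x : 'cV[R]_n.+1 => f (x + c)%R).
  by apply: (measurableT_comp mf); apply: measurable_cVD.
rewrite (ge0_integral_cons_cV mfc (fun x => f0 _)) (ge0_integral_cons_cV mf f0).
pose c1 := c ord0 ord0; pose c' : 'cV[R]_n := \col_i c (lift ord0 i) ord0.
have cE a v : (cons_cV (a, v) + c = cons_cV (a + c1, v + c'))%R.
  apply/matrixP => i j; rewrite (ord1 j) mxE.
  by case: (unliftP ord0 i) => [k ->|->]; rewrite ?cons_cV0 ?cons_cVS//= !mxE.
under eq_integral do under eq_integral do rewrite cE.
pose g a := \int[lebesgue_cV R n]_v f (cons_cV (a, v)).
transitivity (\int[lebesgue_measure]_a g (1 * a + c1)%R).
  apply: eq_integral => a _; rewrite mul1r; apply: (ih c' (fun v => f (cons_cV (_, v)))) => //.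
  exact: (measurable_curryr (a + c1)%R (measurableT_comp mf (@measurable_cons_cV n))).
rewrite (@ge0_integral_affine _ 1%R c1 g) ?oner_eq0//.
- by rewrite normr1 invr1 mul1e.
- apply: (@measurable_integral_param _ _ _ _ _ _ (fun a v => f (cons_cV (a, v)))).
  have := measurableT_comp mf (@measurable_cons_cV n); apply: eq_measurable_fun => -[a b] _ //.
- by move=> a; apply: integral_ge0.
Qed.

(** The change of variables formula as a property of the matrix, to be propagated along a
    factorisation into triangular blocks. *)
Let good n (M : 'M[R]_n) := forall f : 'cV[R]_n -> \bar R,
  measurable_fun setT f -> (forall x, 0 <= f x) ->
  \int[lebesgue_cV R n]_x f (M *m x)%R = (`|\det M|^-1)%:E * \int[lebesgue_cV R n]_x f x.

Let good_mul n (M N : 'M[R]_n) : good M -> good N -> good (M *m N)%R.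
Proof.
move=> gM gN f mf f0.
under eq_integral do rewrite -mulmxA.
rewrite (gN (fun x => f (M *m x)%R))//; last first.
  exact: (measurableT_comp mf (measurable_mulmx M)).
by rewrite (gM f mf f0) muleA -EFinM -invfM -normrM det_mulmx mulrC.
Qed.

Let cons_mulmx n (a : R) (v : 'rV[R]_n) (w : 'cV[R]_n) (M : 'M[R]_n) (z : R * 'cV[R]_n) :
  (@block_mx R 1 n 1 n a%:M v w M *m cons_cV z =
    cons_cV (a * z.1 + (v *m z.2) ord0 ord0, z.1 *: w + M *m z.2))%R.
Proof.
rewrite /cons_cV (mul_block_col (a%:M : 'M[R]_1)) -scalar_mxM mul_mx_scalar/=; congr col_mx.
by apply/matrixP => i j; rewrite !ord1 !mxE eqxx.
Qed.

(** By Tonelli the first coordinate is integrated first: for a fixed tail the map is affine of slope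
    a in it. What remains is the action of M on the tail. *)
Let good_upper n (a : R) (v : 'rV[R]_n) (M : 'M[R]_n) : a != 0%R ->
  good M -> good (@block_mx R 1 n 1 n a%:M v 0 M)%R.
Proof.
move=> a0 gM f mf f0.
have mfc : measurable_fun setT (fun z : R * 'cV[R]_n => f (cons_cV z)).
  exact: (measurableT_comp mf (@measurable_cons_cV n)).
have mfM : measurable_fun setT (fun z : R * 'cV[R]_n =>
    f (cons_cV (a * z.1 + (v *m z.2) ord0 ord0, M *m z.2)%R)).
  apply: (measurableT_comp mfc); apply/measurable_fun_pairP; split => /=.
    apply: measurable_funD; first exact: measurable_funM.
    under eq_fun do rewrite mxE; apply: measurable_sum => j.
    by apply: measurable_funM => //; exact: (measurableT_comp (measurable_coor _) measurable_snd).
  exact: (measurableT_comp (measurable_mulmx M) measurable_snd).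
rewrite (ge0_integral_cons_cV (measurableT_comp mf (@measurable_mulmx n.+1 n.+1 _)) (fun _ => f0 _)).
under eq_integral do under eq_integral do rewrite /= cons_mulmx scaler0 add0r.
rewrite (@fubini_tonelli _ _ _ _ _ lebesgue_measure (lebesgue_cV R n)
  (fun z => f (cons_cV (a * z.1 + (v *m z.2) ord0 ord0, M *m z.2)%R)))//.
under eq_integral => x _.
  rewrite (@ge0_integral_affine _ a ((v *m x) ord0 ord0) (fun b => f (cons_cV (b, M *m x)%R)))//; last first.
    exact: (measurable_curryl (M *m x)%R mfc).
  over.
rewrite ge0_integralZl_EFin ?invr_ge0//; last 2 first.
- by move=> x _; apply: integral_ge0.
- apply (@measurable_integral_param _ _ _ _ _ lebesgue_measure (fun (x : 'cV[R]_n) (b : R) => f (cons_cV (b, M *m x)%R))).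
  apply: (measurableT_comp mfc); apply/measurable_fun_pairP; split => /=.
    exact: measurable_snd.
  exact: (measurableT_comp (measurable_mulmx M) measurable_fst).
rewrite (gM (fun x => \int[lebesgue_measure]_b f (cons_cV (b, x)))); last 2 first.
- apply (@measurable_integral_param _ _ _ _ _ lebesgue_measure
    (fun (x : 'cV[R]_n) (b : R) => f (cons_cV (b, x)))).
  apply: (measurableT_comp mfc); apply/measurable_fun_pairP; split => /=.
    exact: measurable_snd.
  exact: measurable_fst.
- by move=> x; apply: integral_ge0.
rewrite muleA -EFinM -invfM -normrM.
rewrite (det_ublock (a%:M : 'M[R]_1)) det_scalar1; congr *%E.
rewrite (ge0_integral_cons_cV mf f0).
by rewrite (@fubini_tonelli _ _ _ _ _ lebesgue_measure (lebesgue_cV R n) _ mfc).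
Qed.

(** A shear: for a fixed first coordinate the tail is merely translated. *)
Let good_lower n (w : 'cV[R]_n) : good (@block_mx R 1 n 1 n 1%:M 0 w 1%:M)%R.
Proof.
move=> f mf f0.
have mfc : measurable_fun setT (fun z : R * 'cV[R]_n => f (cons_cV z)).
  exact: (measurableT_comp mf (@measurable_cons_cV n)).
rewrite (det_lblock (1%:M : 'M[R]_1)) !det1 mulr1 normr1 invr1 mul1e.
rewrite (ge0_integral_cons_cV (measurableT_comp mf (@measurable_mulmx n.+1 n.+1 _)) (fun _ => f0 _)).
under eq_integral do under eq_integral do
  rewrite /= cons_mulmx/= mul0mx mxE addr0 mul1r mul1mx addrC.
rewrite (ge0_integral_cons_cV mf f0).
apply: eq_integral => x _.
rewrite (@ge0_integral_translate n (x *: w)%R (fun v => f (cons_cV (x, v))))//.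
exact: (measurable_curryr x mfc).
Qed.

(** Gaussian elimination, by induction on the dimension. A nonzero corner entry allows a block LU
    factorisation whose smaller block is the Schur complement; a zero corner is first repaired by
    adding a row that does not vanish in the first column. *)
Theorem ge0_integral_mulmx n (M : 'M[R]_n) (f : 'cV[R]_n -> \bar R) :
  M \in unitmx -> measurable_fun setT f -> (forall x, 0 <= f x) ->
  \int[lebesgue_cV R n]_x f (M *m x)%R = (`|\det M|^-1)%:E * \int[lebesgue_cV R n]_x f x.
Proof.
suff H : forall m (N : 'M[R]_m), N \in unitmx -> good N by move=> uM mf f0; exact: (H).
elim=> {n M f} [|n ih] M uM.
  move=> f mf f0; rewrite det_mx00 normr1 invr1 mul1e.
  by apply: eq_integral => x _; congr f; apply/matrixP => -[].
have piv (N : 'M[R]_n.+1) : N \in unitmx -> N ord0 ord0 != 0%R -> good N.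
  move=> uN; rewrite -(@submxK R 1 n 1 n N).
  set N1 := @ulsubmx R 1 n 1 n N; set v := @ursubmx R 1 n 1 n N.
  set w := @dlsubmx R 1 n 1 n N; set N' := @drsubmx R 1 n 1 n N.
  pose a := N1 ord0 ord0.
  have N1E : N1 = (a%:M)%R by rewrite [LHS]mx11_scalar.
  have -> : (@block_mx R 1 n 1 n N1 v w N') ord0 ord0 = a.
    have -> : (ord0 : 'I_n.+1) = lshift n (ord0 : 'I_1) by exact/val_inj.
    by rewrite (@block_mxEul R 1 n 1 n).
  (* The Schur complement of the pivot a. It is invertible because the determinant of N is a times
     its own. *)
  move=> a0; pose M' := (N' - (a^-1 *: w) *m v)%R.
  have E : (@block_mx R 1 n 1 n N1 v w N' =
      block_mx 1%:M 0 (a^-1 *: w) 1%:M *m block_mx a%:M v 0 M')%R.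
    rewrite mulmx_block !mul1mx !mul0mx !addr0 !mul_mx_scalar scalerA mulfV//.
    by rewrite scale1r addrC subrK N1E.
  rewrite E; apply: good_mul; first exact: good_lower.
  apply: good_upper => //; apply: ih.
  have := uN; rewrite -(@submxK R 1 n 1 n N) -/N1 -/v -/w -/N' E.
  rewrite !unitmxE det_mulmx (det_lblock (1%:M : 'M[R]_1)) !det1 !mul1r.
  by rewrite (det_ublock (a%:M : 'M[R]_1)) det_scalar1 unitrM => /andP[].
have [M0|M0] := eqVneq (M ord0 ord0) 0%R; last exact: piv.
have [i Mi] : exists i : 'I_n, M (lift ord0 i) ord0 != 0%R.
  apply/existsP; apply: contraLR uM => /existsPn H.
  rewrite unitmxE (expand_det_col M ord0) big1 ?unitr0// => j _.
  case: (unliftP ord0 j) => [k ->|->]; last by rewrite M0 mul0r.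
  by have := H k; rewrite negbK => /eqP ->; rewrite mul0r.
(* [S c] adds c times the row [lift ord0 i] to the first row; [S (-1)] undoes [S 1]. *)
pose S (c : R) := (@block_mx R 1 n 1 n 1%:M (c *: delta_mx ord0 i) 0 1%:M)%R.
have SK : (S (-1) *m S 1 = 1%:M)%R.
  rewrite /S mulmx_block !mul1mx !mul0mx !mulmx0 !mulmx1 !addr0 add0r.
  rewrite (_ : (1 *: _ + -1 *: _ = 0)%R) -?scalar_mx_block//.
  by rewrite -scalerDl subrr scale0r.
have -> : M = (S (-1) *m (S 1 *m M))%R by rewrite mulmxA SK mul1mx.
have uS c : S c \in unitmx.
  by rewrite unitmxE (det_ublock (1%:M : 'M[R]_1)) !det1 mulr1 unitr1.
apply: good_mul.
  apply: good_upper; first exact: oner_neq0.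
  move=> f mf f0; rewrite det1 normr1 invr1 mul1e.
  by under eq_integral do rewrite mul1mx.
apply: piv; first by rewrite unitmx_mul uS.
rewrite mxE big_ord_recl/= M0 mulr0 add0r.
rewrite (bigD1 i)//= big1 => [|k ki].
  rewrite addr0.
  have -> : (ord0 : 'I_n.+1) = lshift n (ord0 : 'I_1) by exact/val_inj.
  have -> : lift (lshift n (ord0 : 'I_1)) i = rshift 1 i :> 'I_(1 + n) by exact/val_inj.
  rewrite (@block_mxEur R 1 n 1 n) !mxE !eqxx mulr1 mul1r.
  have -> : rshift 1 i = lift ord0 i :> 'I_n.+1 by exact/val_inj.
  by have -> : lshift n (ord0 : 'I_1) = ord0 :> 'I_n.+1 by exact/val_inj.
have -> : (ord0 : 'I_n.+1) = lshift n (ord0 : 'I_1) by exact/val_inj.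
have -> : lift (lshift n (ord0 : 'I_1)) k = rshift 1 k :> 'I_(1 + n) by exact/val_inj.
by rewrite (@block_mxEur R 1 n 1 n) !mxE (negbTE ki) mulr0 mul0r.
Qed.

End lebesgue_cV_theory.

(** * Changes of variables for signed and complex integrands *)

Section transport.
Context {R : realType} {d : measure_display} {T : measurableType d}.
Variables (mu : {measure set T -> \bar R}) (phi : T -> T) (c : R).
Hypotheses (mphi : measurable_fun setT phi)
  (phiE : forall f : T -> \bar R, measurable_fun setT f -> (forall x, (0 <= f x)%E) ->
     (\int[mu]_x f (phi x) = c%:E * \int[mu]_x f x)%E).

Lemma integrable_transport (f : T -> R) :
  mu.-integrable setT (EFin \o f) -> mu.-integrable setT (fun x => (f (phi x))%:E).
Proof.
move=> /integrableP[mf fi]; apply/integrableP; split.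
  exact: (measurableT_comp mf mphi).
rewrite (phiE (f := fun x => `|(f x)%:E|)%E)//; last exact: measurableT_comp.
by move: fi; rewrite -ge0_fin_numE ?integral_ge0//= => /fineK <-; rewrite -EFinM ltry.
Qed.

Lemma Rintegral_transport (f : T -> R) : mu.-integrable setT (EFin \o f) ->
  (\int[mu]_x f (phi x) = c * \int[mu]_x f x)%R.
Proof.
move=> fi; have fphi := integrable_transport fi.
have /integrableP[mf _] := fi.
rewrite /Rintegral [in LHS]integralE [in RHS]integralE.
have [fp fn] : (\int[mu]_x ((EFin \o f)^\+ x) \is a fin_num)%E /\
               (\int[mu]_x ((EFin \o f)^\- x) \is a fin_num)%E.
  split; first exact: integrable_pos_fin_num.
  exact: integrable_neg_fin_num.
have -> : (\int[mu]_x ((fun x => (f (phi x))%:E)^\+ x) = c%:E * \int[mu]_x ((EFin \o f)^\+ x))%E.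
  rewrite -phiE//; first by apply: eq_integral => x _; rewrite !funeposE.
  exact: measurable_funepos.
have -> : (\int[mu]_x ((fun x => (f (phi x))%:E)^\- x) = c%:E * \int[mu]_x ((EFin \o f)^\- x))%E.
  rewrite -phiE//; first by apply: eq_integral => x _; rewrite !funenegE.
  exact: measurable_funeneg.
by rewrite -(fineK fp) -(fineK fn) -!EFinM -!EFinB/= mulrBr.
Qed.

Lemma cintegrable_transport (f : T -> R[i]) : cintegrable mu f ->
  cintegrable mu (fun x => f (phi x)).
Proof.
move=> [f1 f2]; split.
  exact: (@integrable_transport (fun x => complex.Re (f x))).
exact: (@integrable_transport (fun x => complex.Im (f x))).
Qed.

Lemma cintegral_transport (f : T -> R[i]) : cintegrable mu f ->
  cintegral mu (fun x => f (phi x)) = c%:C%C * cintegral mu f.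
Proof.
move=> [f1 f2]; apply: eq_ReIm; rewrite !cReImE/= !mul0r ?subr0 ?addr0.
  exact: (@Rintegral_transport (fun x => complex.Re (f x))).
exact: (@Rintegral_transport (fun x => complex.Im (f x))).
Qed.

End transport.

(** * Gaussian integrals *)

Section gauss1.
Context {R : realType}.
Notation mu := (@lebesgue_measure R).

Lemma measurable_affine (a b : R) : measurable_fun setT (fun x : R => a * x + b).
Proof. by apply: measurable_funD => //; apply: measurable_funM. Qed.

(** Integration by parts without boundary terms: on [-(n+1), n+1] the fundamental theorem gives
    F(n+1) - F(-(n+1)), which tends to l - l, and dominated convergence identifies the limit with
    the integral over the line. *)
Lemma Rintegral_derive_T (f F : R -> R) (l : R) :
  (forall x, is_derive x (1:R) F (f x)) -> continuous f ->
  mu.-integrable setT (EFin \o f) ->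
  F n%:R @[n --> \oo] --> l -> F (- n%:R) @[n --> \oo] --> l ->
  (\int[mu]_x f x = 0)%R.
Proof.
move=> dF cf fi Fl Fl'.
have cF : continuous F.
  by move=> x; apply: differentiable_continuous; apply/derivable1_diffP; case: (dF x).
have mf : measurable_fun setT (EFin \o f) by case/integrableP : fi.
pose D n : set R := `[(- (n.+1)%:R)%R, (n.+1)%:R]%classic.
pose f_ n := (EFin \o f) \_ (D n).
have FTC n : (\int[mu]_x f_ n x = (F n.+1%:R - F (- n.+1%:R))%:E)%E.
  rewrite -integral_mkcond EFinB; apply: continuous_FTC2.
  - by rewrite (@lt_trans _ _ 0)// ?oppr_lt0.
  - exact: continuous_subspaceT.
  - split => /=.
    + by move=> x _; case: (dF x).
    + by apply: cvg_at_right_filter; exact: cF.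
    + by apply: cvg_at_left_filter; exact: cF.
  - by move=> x _; rewrite derive1E; apply: derive_val.
have f_f x : f_ ^~ x @ \oo --> (f x)%:E.
  apply: cvg_near_cst; exists (Num.truncn `|x|) => // n /= xn.
  rewrite /f_ patchE ifT// inE /D/= in_itv/= -ler_norml.
  by rewrite (le_trans (ltW (truncnS_gt `|x|)))// ler_nat ltnS.
have [|||] := @dominated_convergence _ _ _ mu setT measurableT f_ (EFin \o f)
  (abse \o (EFin \o f)) _ mf _ (integrable_abse fi) _.
- move=> n; apply/(measurable_restrictT _ _).1; first exact: measurable_itv.
  exact: measurable_funS mf.
- by apply: aeW => x _; exact: f_f.
- apply: aeW => x n _; rewrite /f_ patchE; case: ifPn => //= _.
  by rewrite normr0 lee_fin.
move=> _ _ H.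
have H0 : [sequence (\int[mu]_x f_ n x)%E]_n @ \oo --> (0 : \bar R)%E.
  under eq_fun do rewrite FTC.
  apply: cvg_EFin; first exact: nearW.
  rewrite -(subrr l); apply: cvgB.
    by rewrite (cvg_shiftS (fun n => F n%:R)).
  by rewrite (cvg_shiftS (fun n => F (- n%:R))).
rewrite /Rintegral; rewrite [X in fine X](_ : _ = 0%E)//.
by apply: (cvg_unique _ H H0); exact: ereal_hausdorff.
Qed.

Definition gaussian (e x : R) : R := expR (- (e * x ^+ 2)).

Lemma gaussian_ge0 e x : 0 <= gaussian e x. Proof. exact: expR_ge0. Qed.

Lemma continuous_gaussian e : continuous (gaussian e).
Proof.
move=> x; apply: (@continuous_comp _ _ _ (fun x : R => - (e * x ^+ 2)) expR).
  apply: cvgN; apply: cvgM; first exact: cvg_cst.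
  exact: exprn_continuous.
exact: continuous_expR.
Qed.

Lemma measurable_gaussian e : measurable_fun setT (gaussian e).
Proof. by apply: continuous_measurable_fun; exact: continuous_gaussian. Qed.

Lemma gaussian_scale (e x : R) : 0 < e -> gaussian e x = gauss_fun (Num.sqrt e * x + 0).
Proof. by move=> e0; rewrite /gaussian /gauss_fun addr0 exprMn sqr_sqrtr// ltW. Qed.

Lemma integral_gaussian (e : R) : 0 < e ->
  (\int[mu]_x (gaussian e x)%:E = (Num.sqrt (pi / e))%:E)%E.
Proof.
move=> e0; under eq_integral do rewrite gaussian_scale//.
rewrite (@ge0_integral_affine R _ _ (EFin \o gauss_fun)).
- rewrite /= integralT_gauss -EFinM; congr EFin.
  by rewrite ger0_norm// mulrC sqrtrM ?pi_ge0// sqrtrV// ltW.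
- by rewrite sqrtr_eq0 -ltNge.
- by apply/measurable_EFinP; exact: measurable_gauss_fun.
- by move=> x; rewrite lee_fin gauss_fun_ge0.
Qed.

Lemma integrable_gaussian (e : R) : 0 < e -> mu.-integrable setT (EFin \o gaussian e).
Proof.
move=> e0; apply/integrableP; split.
  by apply/measurable_EFinP; exact: measurable_gaussian.
under eq_integral do rewrite /= ger0_norm ?gaussian_ge0//.
by rewrite integral_gaussian// ltry.
Qed.

Lemma integrable_gaussian_le (e C : R) (f : R -> R) : 0 < e ->
  measurable_fun setT f -> (forall x, `|f x| <= C * gaussian e x) ->
  mu.-integrable setT (EFin \o f).
Proof.
move=> e0 mf fC.
apply: (@le_integrable _ _ _ mu _ measurableT _ (EFin \o (fun x => C * gaussian e x))).
- exact/measurable_EFinP.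
- by move=> x _ /=; rewrite lee_fin (le_trans (fC x))// ler_norm.
- rewrite /comp; under eq_fun do rewrite EFinM.
  by apply: integrableZl => //; exact: integrable_gaussian.
Qed.

(** Since |x| <= 1 + x^2/2 <= exp(x^2/2), half of the Gaussian absorbs the factor. This is the
    majorant, uniform in the frequency, for differentiating the cosine transform under the
    integral. *)
Lemma norm_mul_gaussian_le (x : R) : `|x| * gaussian 1 x <= gaussian 2^-1 x.
Proof.
rewrite /gaussian mul1r.
have -> : - x ^+ 2 = - (2^-1 * x ^+ 2) + - (2^-1 * x ^+ 2) by field.
rewrite expRD mulrA ler_piMl ?expR_ge0// expRN ler_pdivrMr ?expR_gt0// mul1r.
rewrite (le_trans _ (expR_ge1Dx _))//.
rewrite -[x ^+ 2]real_normK ?num_real//.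
have : 0 <= (`|x| - 1) ^+ 2 by exact: sqr_ge0.
rewrite sqrrB1 => h; lra.
Qed.

Let ft (b : R) : R := (\int[mu]_x (gaussian 1 x * cos (b * x)))%R.

Let measurable_gcos b : measurable_fun setT (fun x : R => gaussian 1 x * cos (b * x)).
Proof.
apply: measurable_funM; first exact: measurable_gaussian.
apply: (@measurableT_comp _ _ _ _ _ _ cos); last exact: measurable_funM.
by apply: continuous_measurable_fun; exact: continuous_cos.
Qed.

Let measurable_xgsin b : measurable_fun setT (fun x : R => - x * gaussian 1 x * sin (b * x)).
Proof.
apply: measurable_funM; first by apply: measurable_funM => //; exact: measurable_gaussian.
apply: (@measurableT_comp _ _ _ _ _ _ sin); last exact: measurable_funM.
by apply: continuous_measurable_fun; exact: continuous_sin.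
Qed.

Let integrable_gcos b : mu.-integrable setT (fun x : R => (gaussian 1 x * cos (b * x))%:E).
Proof.
apply: (@integrable_gaussian_le 1 1) => // x.
rewrite normrM ger0_norm ?gaussian_ge0// mul1r ler_piMr ?gaussian_ge0//.
by rewrite ler_norml cos_geN1 cos_le1.
Qed.

Let xgsin_bound b x : `|- x * gaussian 1 x * sin (b * x)| <= gaussian 2^-1 x.
Proof.
rewrite 2!normrM normrN (ger0_norm (gaussian_ge0 _ _)).
apply: le_trans (norm_mul_gaussian_le x).
by rewrite ler_piMr ?mulr_ge0 ?gaussian_ge0// ler_norml sin_geN1 sin_le1.
Qed.

Let integrable_xgsin b :
  mu.-integrable setT (fun x : R => (- x * gaussian 1 x * sin (b * x))%:E).
Proof.
by apply: (@integrable_gaussian_le 2^-1 1) => // x; rewrite mul1r xgsin_bound.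
Qed.

Let dcosM (x b : R) : is_derive b (1:R) (fun b => gaussian 1 x * cos (b * x))
  (- x * gaussian 1 x * sin (b * x)).
Proof.
apply: is_derive_eq.
rewrite -[LHS]/(_ * _) /GRing.scale/=; ring.
Qed.

Let dft b : is_derive b (1:R) ft (\int[mu]_x (- x * gaussian 1 x * sin (b * x)))%R.
Proof.
pose f (b x : R) := gaussian 1 x * cos (b * x).
have dE y z : partial1of2 f y z = - z * gaussian 1 z * sin (y * z).
  by rewrite partial1of2E; apply: derive_val; exact: dcosM.
have Ib : (`]b - 1, b + 1[%classic : set R) b by rewrite /= in_itv/= ltrBlDr ltrDl ltr01.
have I1 y : (`]b - 1, b + 1[%classic : set R) y -> mu.-integrable setT (EFin \o f y).
  by move=> _; exact: integrable_gcos.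
have I2 y z : (`]b - 1, b + 1[%classic : set R) y -> setT z -> derivable (f ^~ z) y 1.
  by move=> _ _; case: (dcosM z y).
have I3 y z : (`]b - 1, b + 1[%classic : set R) y -> setT z ->
    `|partial1of2 f y z| <= gaussian 2^-1 z.
  by move=> _ _; rewrite dE xgsin_bound.
have ig : mu.-integrable setT (EFin \o gaussian 2^-1) by exact: integrable_gaussian.
have H1 := @derivable_under_integral R _ _ mu f setT measurableT b _ _ Ib I1 I2 _
  (gaussian_ge0 _) ig I3.
have H2 := @differentiation_under_integral R _ _ mu f setT measurableT b _ _ Ib I1 I2 _
  (gaussian_ge0 _) ig I3.
apply: DeriveDef; first exact: H1.
rewrite -derive1E [LHS]H2; apply: eq_Rintegral => x _; exact: dE.
Qed.

Lemma gaussian_nat_cvg0 : gaussian 1 n%:R @[n --> \oo] --> (0 : R).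
Proof.
have := @cvg_gauss_fun R; move/cvg_pinftyP => /(_ (fun n => n%:R)) H.
have := H (@cvgr_idn R); apply: cvg_trans; apply: near_eq_cvg.
by apply: nearW => n; rewrite /gaussian /gauss_fun mul1r.
Qed.

(** Integrating the derivative of [gaussian 1 x * sin (b * x)] over the line gives b ft(b) + 2 J =
    0, where J is the derivative of [ft] at b: the differential equation ft' = -(b/2) ft. *)
Let ode b : (\int[mu]_x (- x * gaussian 1 x * sin (b * x)))%R = - (b / 2) * ft b.
Proof.
pose F (x : R) := gaussian 1 x * sin (b * x).
pose f (x : R) := b * (gaussian 1 x * cos (b * x)) + 2 * (- x * gaussian 1 x * sin (b * x)).
have dF x : is_derive x (1:R) F (f x).
  apply: is_derive_eq; rewrite /f /gaussian /GRing.scale/=; ring.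
have cF x (G : R -> R) : continuous G -> {for x, continuous (fun x => G (b * x))}.
  move=> cG; apply: (@continuous_comp _ _ _ (fun x => b * x) G); last exact: cG.
  by apply: cvgM; [exact: cvg_cst|exact: cvg_id].
have cf : continuous f.
  move=> x; apply: cvgD.
    apply: cvgM; first exact: cvg_cst.
    by apply: cvgM; [exact: continuous_gaussian|exact: (cF _ _ (@continuous_cos R))].
  apply: cvgM; first exact: cvg_cst.
  apply: cvgM; last exact: (cF _ _ (@continuous_sin R)).
  by apply: cvgM; [apply: cvgN; exact: cvg_id|exact: continuous_gaussian].
have i1 := integrable_gcos b; have i2 := integrable_xgsin b.
have j1 : mu.-integrable setT (fun x : R => (b * (gaussian 1 x * cos (b * x)))%:E).
  by under eq_fun do rewrite EFinM; exact: integrableZl.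
have j2 : mu.-integrable setT (fun x : R => (2 * (- x * gaussian 1 x * sin (b * x)))%:E).
  by under eq_fun do rewrite EFinM; exact: integrableZl.
have fi : mu.-integrable setT (EFin \o f).
  by rewrite /comp /f; under eq_fun do rewrite EFinD; exact: integrableD.
have l0 (s : nat -> R) : (forall n, `|s n| <= 1) -> 
    gaussian 1 n%:R * s n @[n --> \oo] --> (0 : R).
  move=> s1; apply: norm_cvg0.
  apply: (@squeeze_cvgr _ _ _ _ (cst 0) (fun n => gaussian 1 n%:R)).
  - apply: nearW => n /=; rewrite normr_ge0/= normrM (ger0_norm (gaussian_ge0 _ _)).
    by rewrite ler_piMr ?gaussian_ge0.
  - exact: cvg_cst.
  - exact: gaussian_nat_cvg0.
have := @Rintegral_derive_T f F 0 dF cf fi.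
rewrite /f RintegralD//= !RintegralZl// -/(ft b) => H.
have {}H := H (l0 (fun n => sin (b * n%:R)) _) _.
set J := (\int[mu]_x (- x * _ * _))%R in H *.
have : b * ft b + 2 * J = 0.
  apply: H => [n|]; first by rewrite ler_norml sin_geN1 sin_le1.
  have := l0 (fun n => sin (b * - n%:R)); rewrite /F/gaussian => {}l0.
  under eq_fun do rewrite sqrrN; apply: l0 => n.
  by rewrite ler_norml sin_geN1 sin_le1.
lra.
Qed.

(** The differential equation makes ft(b) exp(b^2/4) constant, and its value at b = 0 is the
    Gaussian integral. *)
Lemma gaussian_cos (b : R) :
  (\int[mu]_x (gaussian 1 x * cos (b * x)))%R = Num.sqrt pi * expR (- (b ^+ 2 / 4)).
Proof.
pose g (b : R) := ft b * expR (b ^+ 2 / 4).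
have dg x : is_derive x (1:R) g 0.
  have dx := dft x.
  apply: is_derive_eq; by rewrite ode /GRing.scale/=; field.
have : g b = g 0 by exact: is_derive_0_is_cst.
rewrite /g expr0n/= mul0r expR0 mulr1.
have -> : ft 0 = Num.sqrt pi.
  rewrite /ft; under eq_Rintegral do rewrite mul0r cos0 mulr1.
  by rewrite /Rintegral integral_gaussian// divr1.
by move=> <-; rewrite -mulrA -expRD subrr expR0 mulr1.
Qed.

Lemma gaussian_sin (b : R) : (\int[mu]_x (gaussian 1 x * sin (b * x)))%R = 0.
Proof.
have mi : mu.-integrable setT (EFin \o (fun x : R => gaussian 1 x * sin (b * x))).
  apply: (@integrable_gaussian_le 1 1) => //.
    apply: measurable_funM; first exact: measurable_gaussian.
    apply: (@measurableT_comp _ _ _ _ _ _ sin); last exact: measurable_funM.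
    by apply: continuous_measurable_fun; exact: continuous_sin.
  move=> x; rewrite normrM ger0_norm ?gaussian_ge0// mul1r ler_piMr ?gaussian_ge0//.
  by rewrite ler_norml sin_geN1 sin_le1.
have := @Rintegral_transport _ _ _ mu _ _ (measurable_affine (-1) 0)
  (fun f mf f0 => @ge0_integral_affine R (-1) 0 f (ltr0_neq0 (ltrN10 R)) mf f0) _ mi.
set J := (\int[mu]_x (gaussian 1 x * sin (b * x)))%R.
rewrite normrN1 invr1 mul1r.
under eq_Rintegral do rewrite addr0 mulN1r /gaussian sqrrN mulrN sinN mulrN -mulN1r.
by rewrite RintegralZl// -/J; lra.
Qed.

Lemma gaussian_phase (e b c : R) : 0 < e ->
  (\int[mu]_x (gaussian e x * cos (b * x + c)))%R =
  Num.sqrt (pi / e) * expR (- (b ^+ 2 / (4 * e))) * cos c.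
Proof.
move=> e0; have se : 0 < Num.sqrt e by rewrite sqrtr_gt0.
have se0 : Num.sqrt e != 0 by rewrite gt_eqF.
pose b' := b / Num.sqrt e.
pose f (x : R) := gaussian 1 x * cos (b' * x + c).
have mtr (s : R -> R) (a : R) : continuous s -> measurable_fun setT (fun x : R => gaussian 1 x * s (b' * x + a)).
  move=> cs; apply: measurable_funM; first exact: measurable_gaussian.
  apply: (@measurableT_comp _ _ _ _ _ _ s); last exact: measurable_affine.
  exact: continuous_measurable_fun.
have itr (s : R -> R) a : continuous s -> (forall x, `|s x| <= 1) ->
    mu.-integrable setT (fun x : R => (gaussian 1 x * s (b' * x + a))%:E).
  move=> cs s1; apply: (@integrable_gaussian_le 1 1) => //; first exact: mtr.
  by move=> x; rewrite normrM ger0_norm ?gaussian_ge0// mul1r ler_piMr ?gaussian_ge0.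
have fi : mu.-integrable setT (EFin \o f).
  apply: itr; first exact: continuous_cos.
  by move=> x; rewrite ler_norml cos_geN1 cos_le1.
have := @Rintegral_transport _ _ _ mu _ _ (measurable_affine (Num.sqrt e) 0)
  (fun f mf f0 => @ge0_integral_affine R (Num.sqrt e) 0 f se0 mf f0) _ fi.
rewrite (ger0_norm (ltW se)).
under eq_Rintegral => x _.
  rewrite /f addr0 /gaussian mul1r exprMn sqr_sqrtr ?ltW// mulrA /b' divfK//.
  over.
move=> ->; rewrite /f.
under eq_Rintegral => x _.
  rewrite cosD mulrBr mulrA [X in _ - X]mulrA [X in X - _]mulrC [X in _ - X]mulrC.
  over.
have jc := itr cos 0 (@continuous_cos R) (fun x => _).
have js := itr sin 0 (@continuous_sin R) (fun x => _).
have {}jc : mu.-integrable setT (fun x : R => (gaussian 1 x * cos (b' * x))%:E).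
  by under eq_fun do rewrite -[b' * _]addr0; apply: jc => x; rewrite ler_norml cos_geN1 cos_le1.
have {}js : mu.-integrable setT (fun x : R => (gaussian 1 x * sin (b' * x))%:E).
  by under eq_fun do rewrite -[b' * _]addr0; apply: js => x; rewrite ler_norml sin_geN1 sin_le1.
rewrite RintegralB//=; last 2 first.
- by rewrite /comp; under eq_fun do rewrite EFinM; exact: integrableZl.
- by rewrite /comp; under eq_fun do rewrite EFinM; exact: integrableZl.
rewrite !RintegralZl// gaussian_cos gaussian_sin mulr0 subr0.
rewrite sqrtrM ?pi_ge0// sqrtrV ?ltW// /b' expr_div_n sqr_sqrtr ?ltW//.
rewrite (_ : b ^+ 2 / e / 4 = b ^+ 2 / (4 * e)); first ring.
by field; rewrite gt_eqF.
Qed.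

End gauss1.

Section cvdot_theory.
Context {R : realType} (n : nat).
Implicit Types x y z : 'cV[R]_n.

Lemma cvdotC x y : cvdot x y = cvdot y x.
Proof. by apply: eq_bigr => i _; rewrite mulrC. Qed.

Lemma cvdotDl x y z : cvdot (x + y) z = cvdot x z + cvdot y z.
Proof. by rewrite -big_split; apply: eq_bigr => i _; rewrite mxE mulrDl. Qed.

Lemma cvdotDr x y z : cvdot z (x + y) = cvdot z x + cvdot z y.
Proof. by rewrite cvdotC cvdotDl !(cvdotC z). Qed.

Lemma cvdotZl a x y : cvdot (a *: x) y = a * cvdot x y.
Proof. by rewrite mulr_sumr; apply: eq_bigr => i _; rewrite mxE mulrA. Qed.

Lemma cvdotZr a x y : cvdot x (a *: y) = a * cvdot x y.
Proof. by rewrite cvdotC cvdotZl cvdotC. Qed.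

Lemma cvdotNl x y : cvdot (- x) y = - cvdot x y.
Proof. by rewrite -scaleN1r cvdotZl mulN1r. Qed.

Lemma cvdotNr x y : cvdot x (- y) = - cvdot x y.
Proof. by rewrite cvdotC cvdotNl cvdotC. Qed.

Lemma cvdotBl x y z : cvdot (x - y) z = cvdot x z - cvdot y z.
Proof. by rewrite cvdotDl cvdotNl. Qed.

Lemma cvdotBr x y z : cvdot z (x - y) = cvdot z x - cvdot z y.
Proof. by rewrite cvdotDr cvdotNr. Qed.

Lemma cvdot_ge0 x : 0 <= cvdot x x.
Proof. by apply: sumr_ge0 => i _; rewrite -expr2 sqr_ge0. Qed.

Lemma cvdot_mx x y : cvdot x y = (x^T *m y) ord0 ord0.
Proof. by rewrite mxE; apply: eq_bigr => i _; rewrite mxE. Qed.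

Lemma cvdot_mulmxl (M : 'M[R]_n) x y : cvdot (M *m x) y = cvdot x (M^T *m y).
Proof. by rewrite !cvdot_mx trmx_mul mulmxA. Qed.

Lemma measurable_cvdot d (T : measurableType d) (f g : T -> 'cV[R]_n) :
  measurable_fun setT f -> measurable_fun setT g ->
  measurable_fun setT (fun t => cvdot (f t) (g t)).
Proof.
move=> mf mg; rewrite /cvdot; apply: measurable_sum => i.
by apply: measurable_funM; [exact: (measurableT_comp (measurable_coor i) mf)|
  exact: (measurableT_comp (measurable_coor i) mg)].
Qed.

End cvdot_theory.

(** * Gaussian integrals in several variables *)

Section gaussn.
Context {R : realType}.

Definition gaussn n (e : R) (z : 'cV[R]_n) : R := expR (- (e * cvdot z z)).

Lemma gaussn_ge0 n e (z : 'cV[R]_n) : 0 <= gaussn e z.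
Proof. exact: expR_ge0. Qed.

Lemma gaussn_le1 n e (z : 'cV[R]_n) : 0 <= e -> gaussn e z <= 1.
Proof. by move=> e0; rewrite -expR0 ler_expR oppr_le0 mulr_ge0// cvdot_ge0. Qed.

Lemma measurable_gaussn n e : measurable_fun setT (gaussn e : 'cV[R]_n -> R).
Proof.
apply: measurableT_comp => //; apply: measurableT_comp => //.
apply: measurable_funM => //.
by apply: measurable_cvdot; exact: measurable_id.
Qed.

Definition tail_cV n (b : 'cV[R]_n.+1) : 'cV[R]_n := \col_i b (lift ord0 i) ord0.

Lemma cvdot_cons n (b : 'cV[R]_n.+1) (z : R * 'cV[R]_n) :
  cvdot b (cons_cV z) = b ord0 ord0 * z.1 + cvdot (tail_cV b) z.2.
Proof.
rewrite /cvdot big_ord_recl cons_cV0; congr (_ + _).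
by apply: eq_bigr => i _; rewrite cons_cVS mxE.
Qed.

Lemma tail_cons n (z : R * 'cV[R]_n) : tail_cV (cons_cV z) = z.2.
Proof. by apply/matrixP => i j; rewrite mxE cons_cVS (ord1 j). Qed.

Lemma gaussn_cons n e (z : R * 'cV[R]_n) :
  gaussn e (cons_cV z) = gaussian e z.1 * gaussn e z.2.
Proof.
rewrite /gaussn /gaussian cvdot_cons tail_cons cons_cV0 -expRD; congr expR; ring.
Qed.

Let amp e : R := Num.sqrt (pi / e).

Let measurable_phase n e (b : 'cV[R]_n) (c : R) :
  measurable_fun setT (fun z : 'cV[R]_n => gaussn e z * (1 + cos (cvdot b z + c))).
Proof.
apply: measurable_funM; first exact: measurable_gaussn.
apply: measurable_funD => //; apply: (@measurableT_comp _ _ _ _ _ _ cos).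
  by apply: continuous_measurable_fun; exact: continuous_cos.
by apply: measurable_funD => //; apply: measurable_cvdot.
Qed.

Let phase_ge0 n e (b : 'cV[R]_n) (c : R) z :
  0 <= gaussn e z * (1 + cos (cvdot b z + c)).
Proof. by rewrite mulr_ge0 ?gaussn_ge0// -lerBlDl sub0r cos_geN1. Qed.

(** Adding 1 to the cosine makes the integrand nonnegative, so coordinates can be split off with
    Tonelli's theorem alone. The free phase c absorbs the contribution of the coordinate held fixed
    in the induction step. *)
Let gaussn_phase1 n e (b : 'cV[R]_n) (c : R) : 0 < e ->
  (\int[lebesgue_cV R n]_z (gaussn e z * (1 + cos (cvdot b z + c)))%:E =
   (amp e ^+ n * (1 + expR (- (cvdot b b / (4 * e))) * cos c))%:E)%E.
Proof.
move=> e0; elim: n b c => [|n ih] b c.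
  rewrite [LHS]integral_dirac//=; last by apply/measurable_EFinP; exact: measurable_phase.
  rewrite diracT mul1e /gaussn /cvdot !big_ord0 mulr0 oppr0 expR0 mul1r.
  by rewrite mul0r oppr0 expR0 add0r expr0 !mul1r.
rewrite (@ge0_integral_cons_cV _ _ (fun z => (gaussn e z * (1 + cos (cvdot b z + c)))%:E)); last 2 first.
- by apply/measurable_EFinP; exact: measurable_phase.
- by move=> z; rewrite lee_fin.
set b0 := b ord0 ord0; set b' := tail_cV b.
set E := expR (- (cvdot b' b' / (4 * e))).
transitivity (\int[lebesgue_measure]_a
    ((amp e ^+ n * gaussian e a + (amp e ^+ n * E) * (gaussian e a * cos (b0 * a + c)))%:E))%E.
  apply: eq_integral => a _.
  under eq_integral => v _.
    rewrite gaussn_cons cvdot_cons/= -/b0 -/b' -mulrA EFinM.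
    rewrite -[_ + _ + c]addrA [_ + (_ + c)]addrCA.
    over.
  rewrite ge0_integralZl_EFin//; last 3 first.
  - by move=> v _; rewrite lee_fin.
  - by apply/measurable_EFinP; exact: measurable_phase.
  - exact: gaussian_ge0.
  by rewrite ih -EFinM -/E; congr EFin; ring.
have i1 : lebesgue_measure.-integrable setT (EFin \o (fun a => amp e ^+ n * gaussian e a)).
  by rewrite /comp; under eq_fun do rewrite EFinM; apply: integrableZl => //; exact: integrable_gaussian.
have ic : lebesgue_measure.-integrable setT (EFin \o (fun a => gaussian e a * cos (b0 * a + c))).
  apply: (@integrable_gaussian_le _ e 1) => //.
    apply: measurable_funM; first exact: measurable_gaussian.
    apply: (@measurableT_comp _ _ _ _ _ _ cos); last exact: measurable_affine.
    by apply: continuous_measurable_fun; exact: continuous_cos.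
  move=> x; rewrite normrM ger0_norm ?gaussian_ge0// mul1r ler_piMr ?gaussian_ge0//.
  by rewrite ler_norml cos_geN1 cos_le1.
have i2 : lebesgue_measure.-integrable setT (EFin \o (fun a => amp e ^+ n * E * (gaussian e a * cos (b0 * a + c)))).
  by rewrite /comp; under eq_fun do rewrite EFinM; apply: integrableZl.
rewrite -[LHS]fineK; last first.
  apply: integrable_fin_num => //.
  by under eq_fun do rewrite EFinD; exact: integrableD.
congr EFin; rewrite -[LHS]/(\int[lebesgue_measure]_a (_ + _))%R.
rewrite RintegralD// !RintegralZl//; last exact: integrable_gaussian.
rewrite gaussian_phase// [X in _ * X + _](_ : _ = amp e); last first.
  by rewrite /Rintegral integral_gaussian.
rewrite -/(amp e) [RHS]mulrDr mulr1; congr (_ + _); first by rewrite exprSr.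
rewrite [amp e ^+ n.+1]exprSr.
have -> : expR (- (cvdot b b / (4 * e))) = expR (- (b0 ^+ 2 / (4 * e))) * E.
  rewrite /E -expRD; congr expR; rewrite -opprD -mulrDl; congr (- (_ / _)).
  rewrite {1}/cvdot big_ord_recl -expr2; congr (_ + _).
  by apply: eq_bigr => i _; rewrite !mxE.
ring.
Qed.

Lemma integral_gaussn n (e : R) : 0 < e ->
  (\int[lebesgue_cV R n]_z (gaussn e z)%:E = (Num.sqrt (pi / e) ^+ n)%:E)%E.
Proof.
(* With b = 0 and c = pi/2 the cosine vanishes and only the Gaussian is left. *)
move=> e0; have := gaussn_phase1 (0 : 'cV[R]_n) (pi / 2) e0.
rewrite cos_pihalf mulr0 addr0 mulr1 => <-; apply: eq_integral => z _.
rewrite (_ : cvdot 0 z = 0) ?add0r ?cos_pihalf ?addr0 ?mulr1//.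
by rewrite /cvdot big1// => i _; rewrite mxE mul0r.
Qed.

Lemma integrable_gaussn n (e : R) : 0 < e ->
  (lebesgue_cV R n).-integrable setT (EFin \o gaussn e).
Proof.
move=> e0; apply/integrableP; split.
  by apply/measurable_EFinP; exact: measurable_gaussn.
under eq_integral do rewrite /= ger0_norm ?gaussn_ge0//.
by rewrite integral_gaussn// ltry.
Qed.

Lemma gaussn_phase n e (b : 'cV[R]_n) (c : R) : 0 < e ->
  (\int[lebesgue_cV R n]_z (gaussn e z * cos (cvdot b z + c)))%R =
   Num.sqrt (pi / e) ^+ n * expR (- (cvdot b b / (4 * e))) * cos c.
Proof.
move=> e0.
have i1 : (lebesgue_cV R n).-integrable setT (EFin \o (fun z => gaussn e z * (1 + cos (cvdot b z + c)))).
  apply/integrableP; split; first by apply/measurable_EFinP; exact: measurable_phase.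
  under eq_integral do rewrite /= ger0_norm//.
  by rewrite gaussn_phase1// ltry.
have i2 := @integrable_gaussn n e e0.
transitivity (\int[lebesgue_cV R n]_z (gaussn e z * (1 + cos (cvdot b z + c)) - gaussn e z))%R.
  by apply: eq_Rintegral => z _; ring.
rewrite RintegralB// /Rintegral gaussn_phase1// integral_gaussn//= -/(amp e).
ring.
Qed.

Lemma cintegrable_gaussn n e (a : 'cV[R]_n -> R) : 0 < e -> measurable_fun setT a ->
  cintegrable (lebesgue_cV R n) (fun z => (gaussn e z)%:C%C * expi (a z)).
Proof.
move=> e0 ma; apply: (@cintegrable_le _ _ _ _ _ (gaussn e)).
- by apply: cmeasurableM; [apply: cmeasurableR; exact: measurable_gaussn|exact: cmeasurable_expi].
- exact: integrable_gaussn.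
- by move=> x; rewrite cmodM cmod_expi mulr1 cmodR ger0_norm ?gaussn_ge0.
Qed.

Lemma gaussn_fourier n e (b : 'cV[R]_n) : 0 < e ->
  cintegral (lebesgue_cV R n) (fun z => (gaussn e z)%:C%C * expi (cvdot b z)) =
  (Num.sqrt (pi / e) ^+ n * expR (- (cvdot b b / (4 * e))))%:C%C.
Proof.
move=> e0; apply: eq_ReIm => /=.
  under eq_Rintegral => z _ do rewrite mul0r subr0 -[cvdot b z]addr0.
  by rewrite gaussn_phase// cos0 mulr1.
under eq_Rintegral => z _.
  rewrite mul0r addr0 (_ : sin _ = cos (cvdot b z + - (pi / 2))); last first.
    by rewrite cosD cosN sinN cos_pihalf sin_pihalf; ring.
  over.
by rewrite gaussn_phase// cosN cos_pihalf mulr0.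
Qed.

End gaussn.

Section cV_signed.
Context {R : realType} (n : nat).

Lemma cintegral_translate (c : 'cV[R]_n) (f : 'cV[R]_n -> R[i]) :
  cintegrable (lebesgue_cV R n) f ->
  cintegral (lebesgue_cV R n) (fun x => f (x + c)) = cintegral (lebesgue_cV R n) f.
Proof.
move=> cf; rewrite (@cintegral_transport _ _ _ _ (fun x : 'cV[R]_n => x + c) 1).
- by rewrite mul1r.
- by apply: measurable_cVD.
- by move=> g mg g0; rewrite mul1e; exact: ge0_integral_translate.
- exact: cf.
Qed.

Lemma cintegrable_translate (c : 'cV[R]_n) (f : 'cV[R]_n -> R[i]) :
  cintegrable (lebesgue_cV R n) f ->
  cintegrable (lebesgue_cV R n) (fun x => f (x + c)).
Proof.
apply: (@cintegrable_transport _ _ _ _ (fun x : 'cV[R]_n => x + c) 1).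
- by apply: measurable_cVD.
- by move=> g mg g0; rewrite mul1e; exact: ge0_integral_translate.
Qed.

End cV_signed.

(** * Plancherel's inequality and oscillatory Gaussians *)

Section fatou_bound.
Context {R : realType} {d : measure_display} {T : measurableType d}.
Variable mu : {measure set T -> \bar R}.
Local Open Scope ereal_scope.

Lemma limn_einf_le_bound (u : (\bar R)^nat) (M : \bar R) :
  (forall k, u k <= M) -> limn_einf u <= M.
Proof.
move=> uM; rewrite limn_einf_lim; apply: lime_le; first exact: is_cvg_einfs.
apply: nearW => n; apply: le_trans (uM n).
by apply: ereal_inf_lbound; exists n => /=.
Qed.

Lemma fatou_bound (g : (T -> \bar R)^nat) (l : T -> \bar R) (M : \bar R) :
  (forall k, measurable_fun setT (g k)) -> (forall k x, 0 <= g k x) ->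
  (forall x, g ^~ x @ \oo --> l x) -> (forall k, \int[mu]_x g k x <= M) ->
  \int[mu]_x l x <= M.
Proof.
move=> mg g0 gl gM.
have -> : \int[mu]_x l x = \int[mu]_x limn_einf (g ^~ x).
  apply: eq_integral => x _; rewrite is_cvg_limn_einfE; first exact/esym/cvg_lim.
  by apply/cvg_ex; exists (l x); exact: gl.
apply: le_trans (fatou mu measurableT mg (fun n x _ => g0 n x)) _.
exact: limn_einf_le_bound.
Qed.

End fatou_bound.

Section cL12.
Context {R : realType} {d : measure_display} {T : measurableType d}.
Variable mu : {measure set T -> \bar R}.

(** Membership in L^1 makes the integral against a bounded kernel converge absolutely at every
    point; L^2 is where the operators contract. The class is closed under passing to smaller
    functions ([cL12_le]), in particular under truncation in height. *)
Definition cL12 (f : T -> R[i]) :=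
  [/\ cmeasurable f, mu.-integrable setT (fun x => (cmod (f x))%:E) &
      mu.-integrable setT (fun x => (cmod (f x) ^+ 2)%:E)].

Lemma measurable_cmod_sqr (f : T -> R[i]) : cmeasurable f ->
  measurable_fun setT (fun x => (cmod (f x) ^+ 2)%:E).
Proof.
by move=> mf; apply/measurable_EFinP; apply: measurable_funX; exact: measurable_cmod.
Qed.

Lemma cL12_le (f g : T -> R[i]) : cL12 f -> cmeasurable g ->
  (forall x, cmod (g x) <= cmod (f x)) -> cL12 g.
Proof.
move=> [mf f1 f2] mg gf; split => //.
- apply: le_integrable f1 => //; first exact/measurable_EFinP/measurable_cmod.
  by move=> x _; rewrite lee_fin !ger0_norm ?cmod_ge0.
- apply: le_integrable f2 => //; first exact: measurable_cmod_sqr.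
  move=> x _; rewrite lee_fin !ger0_norm ?sqr_ge0//.
  by rewrite lerXn2r ?nnegrE ?cmod_ge0.
Qed.

Lemma cL12_conj (f : T -> R[i]) : cL12 f -> cL12 (fun x => (f x)^*%C).
Proof.
move=> fL; apply: (cL12_le fL) => [|x]; last by rewrite cmod_conj.
by apply: cmeasurable_conj; case: fL.
Qed.

Lemma cL12_cintegrable (f : T -> R[i]) : cL12 f -> cintegrable mu f.
Proof. by case=> mf f1 _; exact: cintegrableP. Qed.

Lemma cL12_phase (f : T -> R[i]) (a : T -> R) : cL12 f -> measurable_fun setT a ->
  cL12 (fun x => expi (a x) * f x).
Proof.
move=> fL ma; apply: (cL12_le fL) => [|x]; last by rewrite cmodM cmod_expi mul1r.
by apply: cmeasurableM; [exact: cmeasurable_expi|case: fL].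
Qed.

End cL12.

Section plancherel.
Context {R : realType} (n : nat).
Notation leb := (lebesgue_cV R n).
Implicit Types f : 'cV[R]_n -> R[i].

Lemma gaussnN e (z : 'cV[R]_n) : gaussn e (- z) = gaussn e z.
Proof. by rewrite /gaussn cvdotNl cvdotNr opprK. Qed.

Lemma measurable_cVB d (T : measurableType d) (f g : T -> 'cV[R]_n) :
  measurable_fun setT f -> measurable_fun setT g ->
  measurable_fun setT (fun x => f x - g x).
Proof.
move=> mf mg; apply: measurable_fun_coorP => i; under eq_fun do rewrite !mxE.
by apply: measurable_funB;
  [exact: (measurableT_comp (measurable_coor i) mf)|exact: (measurableT_comp (measurable_coor i) mg)].
Qed.

Lemma cvdot0 (z : 'cV[R]_n) : cvdot 0 z = 0.
Proof. by rewrite /cvdot big1// => i _; rewrite mxE mul0r. Qed.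

Lemma gaussn0 e : gaussn e (0 : 'cV[R]_n) = 1.
Proof. by rewrite /gaussn cvdot0 mulr0 oppr0 expR0. Qed.

(** The Fourier transform of [gaussn e], see [gaussn_fourier]. Its mass (2 pi)^n does not depend on
    e and becomes the constant of Plancherel's inequality. *)
Let G e (v : 'cV[R]_n) : R := Num.sqrt (pi / e) ^+ n * gaussn (4 * e)^-1 v.

Let G_ge0 e v : 0 <= G e v.
Proof. by rewrite mulr_ge0 ?exprn_ge0 ?sqrtr_ge0 ?gaussn_ge0. Qed.

Let measurable_G e : measurable_fun setT (G e).
Proof. by apply: measurable_funM => //; exact: measurable_gaussn. Qed.

Let integral_G e : 0 < e -> (\int[leb]_v (G e v)%:E = ((2 * pi) ^+ n)%:E)%E.
Proof.
move=> e0; under eq_integral do rewrite EFinM.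
rewrite ge0_integralZl_EFin//.
- rewrite integral_gaussn ?invr_gt0 ?mulr_gt0// -EFinM -exprMn -sqrtrM.
    congr ((_ ^+ _)%:E); rewrite invrK.
    rewrite (_ : pi / e * (pi * (4 * e)) = (2 * pi) ^+ 2).
      by rewrite sqrtr_sqr ger0_norm// mulr_ge0// pi_ge0.
    by field; rewrite gt_eqF.
  by rewrite divr_ge0 ?pi_ge0// ltW.
- by move=> v _; rewrite lee_fin gaussn_ge0.
- by apply/measurable_EFinP; exact: measurable_gaussn.
Qed.

Let G_sym e u v : G e (u - v) = G e (v - u).
Proof. by rewrite /G -gaussnN opprB. Qed.

Let integral_GB e v : 0 < e -> (\int[leb]_u (G e (u - v))%:E = ((2 * pi) ^+ n)%:E)%E.
Proof.
move=> e0; rewrite -(integral_G e0).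
rewrite (ge0_integral_translate (- v) (f := fun u => (G e u)%:E))//.
  exact/measurable_EFinP.
by move=> x; rewrite lee_fin.
Qed.

Let measurable_GB e : measurable_fun setT (fun z : 'cV[R]_n * 'cV[R]_n => G e (z.2 - z.1)).
Proof. by apply: (measurableT_comp (measurable_G e)); apply: measurable_cVB. Qed.

(** Schur's test: |f(z)| |f(y)| <= (|f(z)|^2 + |f(y)|^2)/2, and by the symmetry of [G] each half
    contributes half the mass of [G] times the squared norm of f. *)
Let schur e f : 0 < e -> cL12 leb f ->
  (\int[leb]_z \int[leb]_y (cmod (f z) * (cmod (f y) * G e (y - z)))%:E <=
    ((2 * pi) ^+ n)%:E * \int[leb]_y (cmod (f y) ^+ 2)%:E)%E.
Proof.
move=> e0 [mf f1 f2].
have m1 : measurable_fun setT (fun z : 'cV[R]_n * 'cV[R]_n => cmod (f z.1)).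
  exact: (measurable_cmod (cmeasurable_comp mf measurable_fst)).
have m2 : measurable_fun setT (fun z : 'cV[R]_n * 'cV[R]_n => cmod (f z.2)).
  exact: (measurable_cmod (cmeasurable_comp mf measurable_snd)).
pose K1 (z y : 'cV[R]_n) := 2^-1 * (cmod (f z) ^+ 2 * G e (y - z)).
pose K2 (z y : 'cV[R]_n) := 2^-1 * (cmod (f y) ^+ 2 * G e (y - z)).
have mK1 : measurable_fun setT (fun z : 'cV[R]_n * 'cV[R]_n => (K1 z.1 z.2)%:E).
  apply/measurable_EFinP; apply: measurable_funM => //.
  by apply: measurable_funM => //; exact: measurable_funX.
have mK2 : measurable_fun setT (fun z : 'cV[R]_n * 'cV[R]_n => (K2 z.1 z.2)%:E).
  apply/measurable_EFinP; apply: measurable_funM => //.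
  by apply: measurable_funM => //; exact: measurable_funX.
have K10 z y : (0 <= (K1 z y)%:E)%E.
  by rewrite lee_fin mulr_ge0// mulr_ge0// sqr_ge0.
have K20 z y : (0 <= (K2 z y)%:E)%E.
  by rewrite lee_fin mulr_ge0// mulr_ge0// sqr_ge0.
have mK : measurable_fun setT (fun z : 'cV[R]_n * 'cV[R]_n =>
    (cmod (f z.1) * (cmod (f z.2) * G e (z.2 - z.1)))%:E).
  by apply/measurable_EFinP; apply: measurable_funM => //; exact: measurable_funM.
have IK (a : R) z : (0 <= a)%R ->
    (\int[leb]_y (2^-1 * (a * G e (y - z)))%:E = (2^-1 * a * (2 * pi) ^+ n)%:E)%E.
  move=> a0; under eq_integral do rewrite mulrA EFinM.
  rewrite ge0_integralZl_EFin//.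
  - by rewrite integral_GB.
  - by move=> y _; rewrite lee_fin.
  - by apply/measurable_EFinP; exact: (measurable_curryr z (@measurable_GB e)).
  - by rewrite mulr_ge0.
have J1 : (\int[leb]_z \int[leb]_y (K1 z y)%:E =
    (2^-1 * (2 * pi) ^+ n)%:E * \int[leb]_y (cmod (f y) ^+ 2)%:E)%E.
  under eq_integral do rewrite IK ?sqr_ge0// mulrAC EFinM.
  rewrite ge0_integralZl_EFin//.
  - by move=> y _; rewrite lee_fin sqr_ge0.
  - exact: measurable_cmod_sqr.
  - by rewrite mulr_ge0// exprn_ge0// mulr_ge0// pi_ge0.
have J2 : (\int[leb]_z \int[leb]_y (K2 z y)%:E =
    (2^-1 * (2 * pi) ^+ n)%:E * \int[leb]_y (cmod (f y) ^+ 2)%:E)%E.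
  rewrite (@fubini_tonelli _ _ _ _ _ leb leb _ mK2) => [|z]; last exact: K20.
  rewrite -J1; apply: eq_integral => y _; apply: eq_integral => z _.
  by rewrite /K1 /K2 /= G_sym.
have K0 z y : 0 <= cmod (f z) * (cmod (f y) * G e (y - z)).
  by apply: mulr_ge0; [exact: cmod_ge0|apply: mulr_ge0; [exact: cmod_ge0|exact: G_ge0]].
apply: (@le_trans _ _ (\int[leb]_z \int[leb]_y ((K1 z y)%:E + (K2 z y)%:E))%E).
  apply: ge0_le_integral => //.
  - move=> z _; apply: integral_ge0 => y _.
    by rewrite lee_fin K0.
  - exact: (measurable_integral_param leb mK).
  - by apply: (measurable_integral_param leb); exact: emeasurable_funD.
  move=> z _; apply: ge0_le_integral => //.
  - by move=> y _; rewrite lee_fin K0.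
  - exact: (measurable_curryr z mK).
  - by apply: emeasurable_funD; [exact: (measurable_curryr z mK1)|exact: (measurable_curryr z mK2)].
  move=> y _; rewrite -EFinD lee_fin /K1 /K2.
  move: (G e (y - z)) (G_ge0 e (y - z)) => g g0.
  rewrite -mulrDr -mulrDl !mulrA ler_wpM2r//.
  rewrite -subr_ge0.
  have -> : 2^-1 * (cmod (f z) ^+ 2 + cmod (f y) ^+ 2) - cmod (f z) * cmod (f y) =
    2^-1 * (cmod (f z) - cmod (f y)) ^+ 2 by field.
  by rewrite mulr_ge0// sqr_ge0.
under eq_integral => z _.
  rewrite ge0_integralD//; last 2 first.
  - exact: (measurable_curryr z mK1).
  - exact: (measurable_curryr z mK2).
  over.
rewrite ge0_integralD//; last 4 first.
- by move=> z _; apply: integral_ge0.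
- exact: (measurable_integral_param leb mK1).
- by move=> z _; apply: integral_ge0.
- exact: (measurable_integral_param leb mK2).
rewrite J1 J2 -ge0_muleDl ?lee_fin; last 2 first.
- by rewrite mulr_ge0// exprn_ge0// mulr_ge0// pi_ge0.
- by rewrite mulr_ge0// exprn_ge0// mulr_ge0// pi_ge0.
by rewrite -EFinD -mulrDl (_ : 2^-1 + 2^-1 = 1) ?mul1r//; lra.
Qed.

Definition fourier f (xi : 'cV[R]_n) : R[i] := cintegral leb (fun y => expi (cvdot xi y) * f y).

Let m_phase f : cmeasurable f -> cmeasurable (fun z : 'cV[R]_n * 'cV[R]_n => expi (cvdot z.1 z.2) * f z.2).
Proof.
move=> mf; apply: cmeasurableM; last exact: (cmeasurable_comp mf measurable_snd).
by apply: cmeasurable_expi; exact: measurable_cvdot.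
Qed.

Lemma cmeasurable_fourier f : cmeasurable f -> cmeasurable (fourier f).
Proof.
move=> mf.
exact: (@cmeasurable_cintegral _ _ _ _ _ leb (fun xi y => expi (cvdot xi y) * f y) (m_phase mf)).
Qed.

Let i_phase f xi : cL12 leb f -> cintegrable leb (fun y => expi (cvdot xi y) * f y).
Proof. by move=> fL; apply: cL12_cintegrable; apply: cL12_phase => //; exact: measurable_cvdot. Qed.

Let fourier_bound f xi : cL12 leb f -> cmod (fourier f xi) <= (\int[leb]_y cmod (f y))%R.
Proof.
move=> fL; apply: (le_trans (cmod_cintegral (i_phase xi fL))).
rewrite le_eqVlt; apply/orP; left; apply/eqP; apply: eq_Rintegral => y _.
by rewrite cmodM cmod_expi mul1r.
Qed.

(** Expanding the squared modulus of the transform gives a triple integral in xi, y and z. The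
    Gaussian weight in xi makes it absolutely convergent, so the xi-integral can be done first; it
    yields [G e (y - z)], and Schur's test finishes. *)
Let gauss_fourier_le e f : 0 < e -> cL12 leb f ->
  (\int[leb]_xi (gaussn e xi * cmod (fourier f xi) ^+ 2)%:E <=
    ((2 * pi) ^+ n)%:E * \int[leb]_y (cmod (f y) ^+ 2)%:E)%E.
Proof.
move=> e0 fL; have [mf f1 f2] := fL.
set h := fourier f; have mh : cmeasurable h by exact: cmeasurable_fourier.
set N1 := (\int[leb]_y cmod (f y))%R.
have N10 : 0 <= N1 by apply: Rintegral_ge0 => y _; exact: cmod_ge0.
have ig := @integrable_gaussn R n e e0.
pose w (xi : 'cV[R]_n) : R[i] := ((gaussn e xi)%:C)%C.
have mw : cmeasurable w by apply: cmeasurableR; exact: measurable_gaussn.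
have cw xi : cmod (w xi) = gaussn e xi by rewrite cmodR ger0_norm ?gaussn_ge0.
have if1 : leb.-integrable setT (EFin \o (fun y => cmod (f y))) by [].
have E1 xi : (gaussn e xi * cmod (h xi) ^+ 2)%:C%C =
    cintegral leb (fun z => w xi * h xi * (expi (cvdot xi z) * f z)^*%C).
  rewrite cintegralZ; last first.
    by apply: cL12_cintegrable; apply: cL12_conj; apply: cL12_phase => //; exact: measurable_cvdot.
  by rewrite cintegral_conj; [rewrite -mulrA mulc_conj rmorphM|exact: i_phase].
have I1 : leb.-integrable setT (fun xi => (gaussn e xi * cmod (h xi) ^+ 2)%:E).
  apply: (@le_integrable _ _ _ leb _ measurableT _ (EFin \o (fun x => N1 ^+ 2 * gaussn e x))).
  - apply/measurable_EFinP; apply: measurable_funM; first exact: measurable_gaussn.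
    by apply: measurable_funX; exact: measurable_cmod.
  - move=> x _ /=; rewrite lee_fin !ger0_norm ?mulr_ge0 ?gaussn_ge0 ?sqr_ge0//.
    rewrite mulrC ler_wpM2r ?gaussn_ge0// lerXn2r ?nnegrE ?cmod_ge0//.
    exact: fourier_bound.
  - by rewrite /comp; under eq_fun do rewrite EFinM; exact: integrableZl.
have E2 : (\int[leb]_xi (gaussn e xi * cmod (h xi) ^+ 2))%R%:C%C =
    cintegral leb (fun z => cintegral leb (fun xi => w xi * h xi * (expi (cvdot xi z) * f z)^*%C)).
  rewrite -(@cfubini _ _ _ _ _ leb leb (fun xi => N1 * gaussn e xi) (fun z => cmod (f z))).
  - under [RHS]eq_cintegral do rewrite -E1.
    by apply: eq_ReIm => //=; rewrite /Rintegral integral0.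
  - by rewrite /comp; under eq_fun do rewrite EFinM; exact: integrableZl.
  - exact: if1.
  - by move=> x; rewrite mulr_ge0 ?gaussn_ge0.
  - by move=> x; exact: cmod_ge0.
  - apply: cmeasurableM.
      by apply: cmeasurableM; [exact: (cmeasurable_comp mw measurable_fst)|exact: (cmeasurable_comp mh measurable_fst)].
    by apply: cmeasurable_conj; exact: m_phase.
  - move=> x y; rewrite !cmodM cmod_conj cmodM cmod_expi mul1r cw.
    rewrite ler_wpM2r ?cmod_ge0// mulrC ler_wpM2r ?gaussn_ge0//.
    exact: fourier_bound.
have iG z : cintegrable leb (fun y => (G e (y - z))%:C%C * f y).
  apply: (@cintegrable_le _ _ _ _ _ (fun y => G e 0 * cmod (f y))).
  - apply: cmeasurableM => //; apply: cmeasurableR.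
    exact: (measurable_curryr z (@measurable_GB e)).
  - by rewrite /comp; under eq_fun do rewrite EFinM; exact: integrableZl.
  - move=> y; rewrite cmodM cmodR ger0_norm// ler_wpM2r ?cmod_ge0//.
    rewrite /G ler_wpM2l ?exprn_ge0 ?sqrtr_ge0//.
    by rewrite gaussn0 gaussn_le1 ?invr_ge0 ?mulr_ge0 ?ltW.
have E3 z : cintegral leb (fun xi => w xi * h xi * (expi (cvdot xi z) * f z)^*%C) =
    (f z)^*%C * cintegral leb (fun y => (G e (y - z))%:C%C * f y).
  transitivity (cintegral leb (fun xi => cintegral leb (fun y =>
      (f z)^*%C * (w xi * expi (cvdot xi (y - z)) * f y)))).
    apply: eq_cintegral => xi.
    transitivity (cintegral leb (fun y => (w xi * (expi (cvdot xi z) * f z)^*%C) *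
       (expi (cvdot xi y) * f y))).
      by rewrite cintegralZ; [rewrite mulrAC|exact: i_phase].
    apply: eq_cintegral => y; rewrite cvdotBr expiD expiN rmorphM/=.
    by ring.
  rewrite (@cfubini _ _ _ _ _ leb leb (fun xi => cmod (f z) * gaussn e xi) (fun y => cmod (f y))).
  - rewrite -cintegralZ; last exact: iG.
    apply: eq_cintegral => y.
    transitivity (cintegral leb (fun xi => (f z)^*%C * f y * (w xi * expi (cvdot (y - z) xi)))).
      by apply: eq_cintegral => xi; rewrite (cvdotC xi); ring.
    rewrite cintegralZ; last by apply: cintegrable_gaussn => //; exact: measurable_cvdot.
    rewrite gaussn_fourier// -mulrA; congr (_ * _); rewrite mulrC; congr ((_ * _)%:C%C * _).
    by rewrite /gaussn mulrC.
  - by rewrite /comp; under eq_fun do rewrite EFinM; exact: integrableZl.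
  - exact: if1.
  - by move=> x; rewrite mulr_ge0 ?cmod_ge0 ?gaussn_ge0.
  - by move=> x; exact: cmod_ge0.
  - apply: cmeasurableM; first exact: cmeasurable_cst.
    apply: cmeasurableM; last exact: (cmeasurable_comp mf measurable_snd).
    apply: cmeasurableM; first exact: (cmeasurable_comp mw measurable_fst).
    apply: cmeasurable_expi; apply: measurable_cvdot => //.
    exact: measurable_cVB.
  - by move=> x y; rewrite !cmodM cmod_conj cmod_expi mulr1 cw mulrA.
have -> : (\int[leb]_xi (gaussn e xi * cmod (h xi) ^+ 2)%:E =
    (cmod (\int[leb]_xi (gaussn e xi * cmod (h xi) ^+ 2))%R%:C%C)%:E)%E.
  rewrite cmodR ger0_norm; last first.
    by apply: Rintegral_ge0 => x _; rewrite mulr_ge0 ?gaussn_ge0 ?sqr_ge0.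
  by rewrite /Rintegral fineK//; apply: integrable_fin_num.
rewrite E2; under eq_cintegral do rewrite E3.
apply: le_trans _ (schur e0 fL).
have mGf : cmeasurable (fun z : 'cV[R]_n * 'cV[R]_n => (G e (z.2 - z.1))%:C%C * f z.2).
  apply: cmeasurableM; last exact: (cmeasurable_comp mf measurable_snd).
  by apply: cmeasurableR; exact: measurable_GB.
have mI := @cmeasurable_cintegral _ _ _ _ _ leb (fun z y : 'cV[R]_n => (G e (y - z))%:C%C * f y) mGf.
have mI2 : cmeasurable (fun z => (f z)^*%C * cintegral leb (fun y => (G e (y - z))%:C%C * f y)).
  by apply: cmeasurableM => //; exact: cmeasurable_conj.
have G0 z y : (G e (y - z)) <= G e 0.
  rewrite /G ler_wpM2l ?exprn_ge0 ?sqrtr_ge0//.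
  by rewrite gaussn0 gaussn_le1 ?invr_ge0 ?mulr_ge0 ?ltW.
have cI z : ((cmod (cintegral leb (fun y => (G e (y - z))%:C%C * f y)))%:E <=
    \int[leb]_y (cmod (f y) * G e (y - z))%:E)%E.
  apply: (le_trans (cmod_cintegral_le (iG z))).
  rewrite le_eqVlt; apply/orP; left; apply/eqP; apply: eq_integral => y _.
  by rewrite cmodM cmodR ger0_norm// mulrC.
apply: (@le_trans _ _ (\int[leb]_z (cmod ((f z)^*%C * cintegral leb (fun y => (G e (y - z))%:C%C * f y)))%:E)%E).
  apply: cmod_cintegral_le.
  apply: (@cintegrable_le _ _ _ _ _ (fun z => (G e 0 * N1) * cmod (f z))) => //.
    by rewrite /comp; under eq_fun do rewrite EFinM; exact: integrableZl.
  move=> z; rewrite cmodM cmod_conj mulrC ler_wpM2r ?cmod_ge0//.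
  apply: (le_trans (cmod_cintegral (iG z))).
  rewrite /N1 -RintegralZl//; apply: le_Rintegral => //.
  - exact: (cintegrable_cmod (iG z)).
  - by rewrite /comp; under eq_fun do rewrite EFinM; exact: integrableZl.
  - by move=> y _; rewrite cmodM cmodR ger0_norm// ler_wpM2r ?cmod_ge0.
have mK : measurable_fun setT (fun z : 'cV[R]_n * 'cV[R]_n =>
    (cmod (f z.1) * (cmod (f z.2) * G e (z.2 - z.1)))%:E).
  apply/measurable_EFinP; apply: measurable_funM.
    exact: (measurable_cmod (cmeasurable_comp mf measurable_fst)).
  apply: measurable_funM; last exact: measurable_GB.
  exact: (measurable_cmod (cmeasurable_comp mf measurable_snd)).
apply: ge0_le_integral => //.
- by move=> z _; rewrite lee_fin cmod_ge0.
- by apply/measurable_EFinP; exact: measurable_cmod.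
- exact: (measurable_integral_param leb mK).
move=> z _; rewrite cmodM cmod_conj EFinM.
under eq_integral do rewrite EFinM.
rewrite ge0_integralZl_EFin ?cmod_ge0//.
- by rewrite lee_wpmul2l ?lee_fin ?cmod_ge0.
- by move=> y _; rewrite lee_fin; apply: mulr_ge0; [exact: cmod_ge0|exact: G_ge0].
- apply/measurable_EFinP; apply: measurable_funM; first exact: measurable_cmod.
  exact: (measurable_curryr z (@measurable_GB e)).
Qed.

Lemma gaussn_cvg (z : 'cV[R]_n) : gaussn (k.+1%:R)^-1 z @[k --> \oo] --> (1 : R).
Proof.
have H : - ((k.+1%:R)^-1 * cvdot z z) @[k --> \oo] --> (0 : R).
  rewrite -oppr0; apply: cvgN; rewrite -(mul0r (cvdot z z)).
  by apply: cvgMl; exact: cvg_harmonic.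
by have := cvg_comp _ _ H (@continuous_expR R 0); rewrite expR0.
Qed.

Theorem plancherel_le f : cL12 leb f ->
  (\int[leb]_xi (cmod (fourier f xi) ^+ 2)%:E <=
    ((2 * pi) ^+ n)%:E * \int[leb]_y (cmod (f y) ^+ 2)%:E)%E.
Proof.
move=> fL; have [mf _ _] := fL; have mh := cmeasurable_fourier mf.
apply: (@fatou_bound _ _ _ _ (fun k xi => (gaussn (k.+1%:R)^-1 xi * cmod (fourier f xi) ^+ 2)%:E)).
- move=> k; apply/measurable_EFinP; apply: measurable_funM; first exact: measurable_gaussn.
  by apply: measurable_funX; exact: measurable_cmod.
- by move=> k xi; rewrite lee_fin mulr_ge0 ?gaussn_ge0 ?sqr_ge0.
- move=> xi; apply: cvg_EFin; first exact: nearW.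
  rewrite -[X in _ --> X]mul1r; apply: cvgMl; exact: gaussn_cvg.
- by move=> k; apply: gauss_fourier_le.
Qed.

End plancherel.

Lemma conjcM (R : realType) (z w : R[i]) : (z * w)^*%C = z^*%C * w^*%C.
Proof. exact: rmorphM. Qed.

(** * Gaussian-damped oscillatory integrals *)

Section oscillatory.
Context {R : realType} (n : nat).
Notation leb := (lebesgue_cV R n).
Implicit Types (P : 'M[R]_n) (b z w h : 'cV[R]_n).

(** The squared modulus is a double integral over the difference h and the midpoint m of two points.
    In these variables the phase is linear in m and the Gaussians decouple, so the m-integral is an
    explicit Gaussian in P h. Integrating over h produces 1/|det P|, and the powers of e cancel. No
    diagonalisation of P is involved. *)
Theorem oscillatory_gaussn_le (e : R) P b : 0 < e -> P^T = P -> P \in unitmx ->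
  cmod (cintegral leb (fun z =>
    (gaussn e z)%:C%C * expi (cvdot (P *m z) z + cvdot b z))) ^+ 2 <=
  pi ^+ n / `|\det P|.
Proof.
move=> e0 sP uP.
pose ph z := cvdot (P *m z) z + cvdot b z.
have mph : measurable_fun setT ph.
  apply: measurable_funD; apply: measurable_cvdot => //.
  exact: measurable_mulmx.
pose F z : R[i] := (gaussn e z)%:C%C * expi (ph z).
have cF z : cmod (F z) = gaussn e z by rewrite cmodM cmod_expi mulr1 cmodR ger0_norm ?gaussn_ge0.
have iF : cintegrable leb F by exact: cintegrable_gaussn.
have mF : cmeasurable F by exact: cintegrable_measurable iF.
rewrite -/F; set J := cintegral leb F.
have phB m h : ph (m + 2^-1 *: h) - ph (m - 2^-1 *: h) = cvdot (2 *: (P *m h)) m + cvdot b h.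
  have PC x y : cvdot (P *m x) y = cvdot (P *m y) x by rewrite cvdot_mulmxl sP cvdotC.
  rewrite /ph !mulmxDr !mulmxN -!scalemxAr.
  rewrite !(cvdotDl, cvdotDr, cvdotNl, cvdotNr, cvdotZl, cvdotZr) (PC m h).
  by field.
have gB m h : gaussn e (m + 2^-1 *: h) * gaussn e (m - 2^-1 *: h) =
    gaussn (2 * e) m * gaussn (e / 2) h.
  rewrite /gaussn -!expRD; congr expR.
  rewrite !(cvdotDl, cvdotDr, cvdotNl, cvdotNr, cvdotZl, cvdotZr) (cvdotC h m).
  by field.
have e40 : 0 < e / 4 by rewrite divr_gt0.
have e20 : 0 < 2 * e by rewrite mulr_gt0.
have ig4 := @integrable_gaussn R n _ e40.
(* Fubini needs a bound by a product in h and w. The exponents differ by e (3/4 |h|^2 + 2 h.w + 7/4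
   |w|^2), and the bracket is at least |3h + 4w|^2 / 12. *)
have dom h w : gaussn e (h + w) * gaussn e w <= gaussn (e / 4) h * gaussn (e / 4) w.
  rewrite /gaussn -!expRD ler_expR.
  rewrite -subr_ge0 !(cvdotDl, cvdotDr) (cvdotC w h).
  have := cvdot_ge0 (3 *: h + 4 *: w); have := cvdot_ge0 w; have := cvdot_ge0 h.
  rewrite !(cvdotDl, cvdotDr, cvdotZl, cvdotZr) (cvdotC w h).
  move: (cvdot h h) (cvdot w w) (cvdot h w) => a c d a0 c0 H.
  have -> : - (e / 4 * a) + - (e / 4 * c) - (- (e * (a + d + (d + c))) + - (e * c)) =
    e * (3 / 4 * a + 2 * d + 7 / 4 * c) by field.
  by rewrite mulr_ge0 ?(ltW e0)//; lra.
have mFF : cmeasurable (fun x : 'cV[R]_n * 'cV[R]_n => (F x.2)^*%C * F (x.1 + x.2)).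
  apply: cmeasurableM; first by apply: cmeasurable_conj; exact: (cmeasurable_comp mF measurable_snd).
  by apply: (cmeasurable_comp mF); exact: measurable_cVD.
have E1 : ((cmod J ^+ 2)%:C)%C = cintegral leb (fun h => cintegral leb (fun w => (F w)^*%C * F (h + w))).
  rewrite (@cfubini _ _ _ _ _ leb leb (gaussn (e / 4)) (gaussn (e / 4))) => //.
  - rewrite -mulc_conj -cintegral_conj// -cintegralZ; last first.
      apply: (@cintegrable_le _ _ _ _ _ (gaussn e)).
      + exact: cmeasurable_conj.
      + exact: integrable_gaussn.
      + by move=> x; rewrite cmod_conj cF.
    apply: eq_cintegral => w; rewrite mulrC cintegralZ; last exact: cintegrable_translate.
    by rewrite cintegral_translate.
  - by move=> h; exact: gaussn_ge0.
  - by move=> h; exact: gaussn_ge0.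
  - by move=> h w; rewrite cmodM cmod_conj !cF mulrC.
have iFF h : cintegrable leb (fun w => (F w)^*%C * F (h + w)).
  apply: (@cintegrable_le _ _ _ _ _ (fun w => gaussn (e / 4) h * gaussn (e / 4) w)).
  - exact: (cmeasurable_comp mFF (measurable_pair1 h)).
  - by rewrite /comp; under eq_fun do rewrite EFinM; exact: integrableZl.
  - by move=> w; rewrite cmodM cmod_conj !cF mulrC.
have E2 h : cmod (cintegral leb (fun w => (F w)^*%C * F (h + w))) <=
    Num.sqrt (pi / (2 * e)) ^+ n * gaussn (2 * e)^-1 (P *m h).
  (* Substituting w = m - h/2 turns the two points into m - h/2 and m + h/2, as [phB] and [gB]
     expect. *)
  rewrite -(cintegral_translate (- (2^-1 *: h)) (iFF h)).
  have FE m : (F (m - 2^-1 *: h))^*%C * F (h + (m - 2^-1 *: h)) =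
      ((gaussn (e / 2) h)%:C%C * expi (cvdot b h)) *
      ((gaussn (2 * e) m)%:C%C * expi (cvdot (2 *: (P *m h)) m)).
    have -> : h + (m - 2^-1 *: h) = m + 2^-1 *: h.
      rewrite addrCA; congr (_ + _); rewrite -{1}[h]scale1r -scalerBl; congr (_ *: _); lra.
    transitivity ((gaussn e (m + 2^-1 *: h) * gaussn e (m - 2^-1 *: h))%:C%C *
       expi (ph (m + 2^-1 *: h) - ph (m - 2^-1 *: h))).
      by rewrite /F conjcM conjc_real expiD expiN rmorphM/=; ring.
    by rewrite gB phB expiD rmorphM/=; ring.
  under eq_cintegral do rewrite FE.
  rewrite cintegralZ; last by apply: cintegrable_gaussn => //; exact: measurable_cvdot.
  rewrite gaussn_fourier// cmodM cmodM cmod_expi mulr1 !cmodR.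
  rewrite !ger0_norm ?gaussn_ge0 ?mulr_ge0 ?exprn_ge0 ?sqrtr_ge0 ?expR_ge0//.
  rewrite mulrCA ler_wpM2l ?exprn_ge0 ?sqrtr_ge0//.
  (* The factor [gaussn (e / 2) h] is at most 1 and is dropped; the decay in h comes from the
     invertibility of P. *)
  apply: (@le_trans _ _ (expR (- (cvdot (2 *: (P *m h)) (2 *: (P *m h)) / (4 * (2 * e)))))).
    by rewrite ler_piMl ?expR_ge0// gaussn_le1// divr_ge0// ltW.
  rewrite cvdotZl cvdotZr /gaussn ler_expR lerN2 le_eqVlt; apply/orP; left; apply/eqP.
  by field; rewrite gt_eqF.
have mg : measurable_fun setT (fun h => gaussn (2 * e)^-1 (P *m h)).
  exact: (measurableT_comp (@measurable_gaussn _ n _) (measurable_mulmx P)).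
have G0 : 0 <= Num.sqrt (pi / (2 * e)) ^+ n by rewrite exprn_ge0 ?sqrtr_ge0.
have I : (\int[leb]_h (Num.sqrt (pi / (2 * e)) ^+ n * gaussn (2 * e)^-1 (P *m h))%:E =
    (pi ^+ n / `|\det P|)%:E)%E.
  under eq_integral do rewrite EFinM.
  rewrite ge0_integralZl_EFin//; last 2 first.
  - by move=> h _; rewrite lee_fin gaussn_ge0.
  - exact/measurable_EFinP.
  rewrite (ge0_integral_mulmx (f := fun h => (gaussn (2 * e)^-1 h)%:E))//; last 2 first.
  - by apply/measurable_EFinP; exact: measurable_gaussn.
  - by move=> h; rewrite lee_fin gaussn_ge0.
  rewrite integral_gaussn ?invr_gt0// -!EFinM; congr EFin.
  rewrite mulrCA mulrC -exprMn -sqrtrM; last by rewrite divr_ge0 ?pi_ge0// ltW.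
  congr (_ ^+ _ * _); rewrite invrK (_ : pi / (2 * e) * (pi * (2 * e)) = pi ^+ 2).
    by rewrite sqrtr_sqr ger0_norm// pi_ge0.
  by field; rewrite gt_eqF.
have ib : leb.-integrable setT (EFin \o (fun h => Num.sqrt (pi / (2 * e)) ^+ n * gaussn (2 * e)^-1 (P *m h))).
  apply/integrableP; split.
    by apply/measurable_EFinP; exact: measurable_funM.
  under eq_integral do rewrite /= ger0_norm ?mulr_ge0 ?gaussn_ge0//.
  by rewrite I ltry.
have -> : cmod J ^+ 2 = cmod ((cmod J ^+ 2)%:C)%C by rewrite cmodR ger0_norm// sqr_ge0.
rewrite E1.
have := @cmod_cintegral_bound _ _ _ leb _ _
  (@cmeasurable_cintegral _ _ _ _ _ leb (fun h w : 'cV[R]_n => (F w)^*%C * F (h + w)) mFF) ib E2.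
by rewrite [in X in _ <= X -> _]/Rintegral I.
Qed.

End oscillatory.

(** * Interpolation and the Hardy-Littlewood-Sobolev inequality *)

Section power_integrals.
Context {R : realType}.
Notation mu := (@lebesgue_measure R).

(** The derivative of l^b, extended by 0 to l <= 0, so that layer-cake integrals run over the whole
    line. *)
Definition pw (b l : R) : R := if 0 < l then b * l `^ (b - 1) else 0.

Lemma pw_ge0 b l : 0 <= b -> 0 <= pw b l.
Proof. by move=> b0; rewrite /pw; case: ifP => // _; rewrite mulr_ge0// powR_ge0. Qed.

Lemma measurable_pw b : measurable_fun setT (pw b).
Proof.
apply: measurable_fun_ifT.
- exact: measurable_fun_ltr.
- by apply: measurable_funM => //; exact: measurable_powR.
- exact: measurable_cst.
Qed.

Lemma measurable_lt_nat d (T : measurableType d) (f g : T -> R) :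
  measurable_fun setT f -> measurable_fun setT g ->
  measurable_fun setT (fun x => (f x < g x)%R%:R : R).
Proof.
move=> mf mg; rewrite (_ : (fun x => _) = (fun x => if f x < g x then 1 else 0)).
  by apply: measurable_fun_ifT => //; exact: measurable_fun_ltr.
by apply/funext => x; case: ifP.
Qed.

Lemma measurable_le_nat d (T : measurableType d) (f g : T -> R) :
  measurable_fun setT f -> measurable_fun setT g ->
  measurable_fun setT (fun x => (f x <= g x)%R%:R : R).
Proof.
move=> mf mg; rewrite (_ : (fun x => _) = (fun x => if f x <= g x then 1 else 0)).
  by apply: measurable_fun_ifT => //; exact: measurable_fun_ler.
by apply/funext => x; case: ifP.
Qed.

Lemma measurable_funV d (T : measurableType d) (f : T -> R) :
  measurable_fun setT f -> measurable_fun setT (fun x => (f x)^-1).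
Proof.
move=> mf; rewrite (_ : (fun x => _) = (fun x => f x * `|f x| `^ (- 2%:R))).
  apply: measurable_funM => //; apply: (measurableT_comp (@measurable_powR R (- 2%:R))).
  exact: measurableT_comp.
apply/funext => x; rewrite powRN powR_mulrn// real_normK ?num_real//.
have [->|x0] := eqVneq (f x) 0; first by rewrite invr0 mul0r.
by rewrite expr2 invfM mulrA mulfV// mul1r.
Qed.

(** For b < 1 the density is unbounded at 0; the fundamental theorem is therefore applied on
    [c/(n+1), c], and monotone convergence reaches ]0, c]. *)
Lemma integral_pw (b c : R) : 0 < b -> 0 <= c ->
  (\int[mu]_l (pw b l * (l < c)%R%:R)%:E = (c `^ b)%:E)%E.
Proof.
move=> b0; rewrite le_eqVlt => /predU1P[<-|c0].
  rewrite powR0 ?gt_eqF// integral0_eq// => l _.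
  by rewrite /pw; case: ifP => [l0|]; rewrite ?mul0r// ltNge ltW//= mulr0.
have mD : measurable_fun setT (fun x : R => (b * x `^ (b - 1))%:E).
  by apply/measurable_EFinP; apply: measurable_funM => //; exact: measurable_powR.
transitivity (\int[mu]_(x in `]0%R, c[) (b * x `^ (b - 1))%:E)%E.
  rewrite [RHS]integral_mkcond; apply: eq_integral => x _; rewrite patchE mem_setE in_itv/= /pw.
  by case: (0 < x) => /=; [case: (x < c) => /=; rewrite ?mulr1 ?mulr0|rewrite mul0r].
rewrite integral_itv_bndo_bndc; last exact: measurable_funS mD.
pose F n : set R := `[c / n.+1%:R, c]%classic.
have FE : \bigcup_n F n = `]0, c]%classic.
  apply/seteqP; split => [x [n _]|x]; rewrite /F /= !in_itv/=.
    by move=> /andP[cx ->]; rewrite (lt_le_trans _ cx)// divr_gt0.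
  move=> /andP[x0 xc]; exists (Num.truncn (c / x)) => //=; rewrite in_itv/= xc andbT.
  by rewrite ler_pdivrMr// mulrC -ler_pdivrMr// ltW// truncnS_gt.
have ndF : nondecreasing_seq F.
  apply/nondecreasing_seqP => n; apply/subsetPset => x; rewrite /F/= !in_itv/= => /andP[cx ->].
  rewrite andbT (le_trans _ cx)// ler_wpM2l ?(ltW c0)// lef_pV2 ?posrE//.
  by rewrite ler_nat.
have := @ge0_nondecreasing_set_cvg_integral _ (measurableTypeR R) R F (fun x => (b * x `^ (b - 1))%:E) (@lebesgue_measure R) ndF
  (fun i => measurable_itv _) _ _.
rewrite FE => /(_ _ _) H.
have {}H : (\int[mu]_(x in F i) (b * x `^ (b - 1))%:E @[i --> \oo] -->
    \int[mu]_(x in `]0%R, c]) (b * x `^ (b - 1))%:E)%E.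
  apply: H.
  - by move=> i; exact: measurable_funS mD.
  - by move=> i x _; rewrite lee_fin mulr_ge0 ?(ltW b0) ?powR_ge0.
have H2 : (\int[mu]_(x in F i) (b * x `^ (b - 1))%:E @[i --> \oo] --> (c `^ b)%:E)%E.
  (* The interval of index 0 is [c, c], which is degenerate; hence the shift of the index. *)
  rewrite -cvg_shiftS /=.
  have FTC n : (\int[mu]_(x in F n.+1) (b * x `^ (b - 1))%:E =
      (c `^ b - (c / n.+2%:R) `^ b)%:E)%E.
    have cn0 : 0 < c / n.+2%:R by rewrite divr_gt0.
    have cnc : c / n.+2%:R < c by rewrite ltr_pdivrMr// ltr_pMr// ltr1n.
    rewrite EFinB; have FTC2 := @continuous_FTC2 R (fun x => b * x `^ (b - 1)) (fun x : R => x `^ b) _ _ cnc.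
    apply FTC2.
    - apply: derivable_within_continuous => x; rewrite in_itv/= => /andP[cx _].
      apply: derivableM => //; apply: derivable_powR.
      by rewrite in_itv/= andbT (lt_le_trans cn0).
    - apply: (@derivable_oy_continuousWoo _ _ 0).
      + by rewrite ltr_pdivrMr// ltr_pMr// ltr1n.
      + exact: ltW.
      + split => [x|].
          by rewrite in_itv/= andbT => x0; apply: derivable_powR; rewrite in_itv/= x0.
        rewrite powR0 ?gt_eqF//; exact: powR_cvg0.
    - move=> x; rewrite in_itv/= => /andP[cx _]; apply: powR_derive1.
      by rewrite in_itv/= andbT (lt_trans cn0).
  under eq_fun do rewrite FTC.
  apply: cvg_EFin; first exact: nearW.
  rewrite -[X in _ --> X]subr0; apply: cvgB; first exact: cvg_cst.
  have -> : (fun n : nat => (c / n.+2%:R) `^ b) = (fun n => c `^ b * (n.+2%:R^-1) `^ b).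
    by apply/funext => n; rewrite powRM// ?invr_ge0// ltW.
  rewrite -[X in _ --> X](mulr0 (c `^ b)); apply: cvgMr.
  have h := @powR_cvg0 R b b0.
  move/cvg_at_rightP : h => /(_ (fun n => n.+2%:R^-1)); apply; split.
    by move=> n; rewrite invr_gt0.
  rewrite (cvg_shiftS (fun n : nat => n.+1%:R^-1 : R)); exact: cvg_harmonic.
by apply: (cvg_unique _ H H2); exact: ereal_hausdorff.
Qed.

Lemma ge0_integral_sym (phi psi : R -> R) (J : \bar R) : measurable_fun setT phi ->
  (forall u, 0 <= phi u) -> (forall u, psi u = phi u + phi (- u)) ->
  (\int[mu]_u (phi u)%:E = J -> \int[mu]_u (psi u)%:E = J + J)%E.
Proof.
move=> mphi phi0 psiE IJ; under eq_integral do rewrite psiE EFinD.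
have mN : measurable_fun setT (fun u : R => phi (- u)) by exact: measurableT_comp.
rewrite ge0_integralD//; last 4 first.
- by move=> x _; rewrite lee_fin.
- exact/measurable_EFinP.
- by move=> x _; rewrite lee_fin.
- exact/measurable_EFinP.
rewrite IJ; congr (_ + _)%E.
transitivity (\int[mu]_u (EFin \o phi) (-1 * u + 0)%R)%E.
  by apply: eq_integral => u _; rewrite /= mulN1r addr0.
rewrite ge0_integral_affine.
- by rewrite normrN1 invr1 mul1e.
- by rewrite oppr_eq0 oner_eq0.
- exact/measurable_EFinP.
- by move=> x; rewrite lee_fin.
Qed.

Lemma integral_norm_small (al rho : R) : 0 < al -> al < 1 -> 0 < rho ->
  (\int[mu]_u (`|u| `^ (- al) * (`|u| < rho)%R%:R)%:E =
    (2 * (rho `^ (1 - al) / (1 - al)))%:E)%E.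
Proof.
move=> al0 al1 r0; have al1' : 0 < 1 - al by rewrite subr_gt0.
pose phi (u : R) := (1 - al)^-1 * (pw (1 - al) u * (u < rho)%R%:R).
rewrite (@ge0_integral_sym phi _ (rho `^ (1 - al) / (1 - al))%:E).
- by rewrite -EFinD; congr EFin; ring.
- apply: measurable_funM => //; apply: measurable_funM; first exact: measurable_pw.
  exact: measurable_lt_nat.
- by move=> u; rewrite mulr_ge0 ?invr_ge0 ?(ltW al1')// mulr_ge0 ?pw_ge0 ?(ltW al1').
- move=> u; rewrite /phi /pw oppr_gt0.
  have -> : 1 - al - 1 = - al by ring.
  have [u0|u0|<-] := ltgtP 0 u.
  + rewrite mul0r mulr0 addr0 ger0_norm ?ltW// !mulrA mulVf ?mul1r// gt_eqF//.
  + rewrite mul0r mulr0 add0r ltr0_norm// !mulrA mulVf ?mul1r// gt_eqF//.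
  + by rewrite !mul0r !mulr0 addr0 normr0 powR0 ?mul0r// oppr_eq0 gt_eqF.
- under eq_integral do rewrite EFinM.
  rewrite ge0_integralZl_EFin//.
  + by rewrite integral_pw ?ltW// -EFinM mulrC.
  + by move=> u _; rewrite lee_fin mulr_ge0// pw_ge0// ltW.
  + apply/measurable_EFinP; apply: measurable_funM; first exact: measurable_pw.
    exact: measurable_lt_nat.
  + by rewrite invr_ge0 ltW.
Qed.

Lemma integral_norm_large (rho : R) : 0 < rho ->
  (\int[mu]_u (`|u| ^- 2 * (rho <= `|u|)%R%:R)%:E = (2 / rho)%:E)%E.
Proof.
move=> r0.
pose phi (u : R) := u ^- 2 * (rho <= u)%R%:R.
have mV : measurable_fun setT (fun u : R => u ^- 2).
  rewrite (_ : (fun u => _) = (fun u : R => (`|u| `^ (-2%:R)))); last first.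
    apply/funext => u; rewrite powRN powR_mulrn// real_normK ?num_real//.
  by apply: (measurableT_comp (@measurable_powR R (-2%:R))).
rewrite (@ge0_integral_sym phi _ (rho^-1)%:E).
- by rewrite -EFinD; congr EFin; rewrite mulr_natl mulr2n.
- by apply: measurable_funM => //; exact: measurable_le_nat.
- by move=> u; rewrite mulr_ge0// invr_ge0 sqr_ge0.
- move=> u; rewrite /phi sqrrN real_normK ?num_real// -mulrDr; congr (_ * _).
  have [u0|u0] := leP 0 u.
    rewrite ger0_norm// [rho <= - u]leNgt (le_lt_trans _ r0) ?oppr_le0//= addr0//.
  by rewrite ltr0_norm// [rho <= u]leNgt (lt_trans u0)//= add0r.
- transitivity (\int[mu]_(u in `[rho, +oo[) (u ^- 2)%:E)%E.
    rewrite [RHS]integral_mkcond; apply: eq_integral => x _.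
    rewrite patchE mem_setE in_itv/= andbT /phi.
    by case: (rho <= x); rewrite ?mulr1 ?mulr0.
  rewrite (@ge0_continuous_FTC2y _ _ (fun x => - x^-1) rho 0).
  + by rewrite -EFinB sub0r opprK.
  + by move=> x _; rewrite invr_ge0 sqr_ge0.
  + apply: continuous_in_subspaceT => x; rewrite inE/= in_itv/= andbT => rx.
    have x0 : x != 0 by rewrite gt_eqF// (lt_le_trans r0).
    apply: cvgV; first by rewrite sqrf_eq0.
    exact: exprn_continuous.
  + rewrite -oppr0; apply: cvgN; apply/gtr0_cvgV0; last exact: cvg_id.
    exact: nbhs_pinfty_gt.
  + move=> x rx; apply: derivableN; apply: derivableV => //.
    by rewrite gt_eqF// (lt_trans r0).
  + apply: cvg_at_right_filter; apply: cvgN; apply: cvgV; last exact: cvg_id.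
    by rewrite gt_eqF.
  + move=> x; rewrite in_itv/= andbT => rx; rewrite derive1E.
    have x0 : x != 0 by rewrite gt_eqF// (lt_trans r0).
    rewrite deriveN; last exact: derivableV.
    by rewrite deriveV// derive_id /GRing.scale/= mulr1 opprK.
Unshelve. all: by end_near. Qed.

End power_integrals.

Section layer_cake.
Context {R : realType} {d : measure_display} {T : measurableType d}.
Variable mu : {sigma_finite_measure set T -> \bar R}.
Notation leb := (@lebesgue_measure R).
Local Open Scope ereal_scope.

Lemma poweR_pw (b : R) (y : \bar R) : (0 < b)%R -> 0 <= y ->
  y `^ b = \int[leb]_l ((pw b l)%:E * (l%:E < y)%E%:R%:E).
Proof.
move=> b0; case: y => [c|_|//].
  rewrite lee_fin => c0; rewrite poweR_EFin -integral_pw//; apply: eq_integral => l _.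
rewrite poweRyr ?gt_eqF//; apply/esym/eqyP => M M0.
pose c := (M `^ b^-1)%R.
apply: (@le_trans _ _ (\int[leb]_l (pw b l * (l < c)%R%:R)%:E)).
  rewrite integral_pw ?powR_ge0// /c -powRrM mulVf ?gt_eqF// powRr1// ltW//.
have mp := @measurable_pw R b.
apply: ge0_le_integral => //.
- by move=> l _; rewrite lee_fin mulr_ge0// pw_ge0// ltW.
- by apply/measurable_EFinP; apply: measurable_funM => //; exact: measurable_lt_nat.
- by apply: emeasurable_funM; [exact/measurable_EFinP|under eq_fun do rewrite ltry; exact: measurable_cst].
- move=> l _; rewrite ltry -EFinM lee_fin; case: (l < c)%R => //=.
  by rewrite mulr0 mulr1 pw_ge0// ltW.
Qed.

Lemma layer_cake (b : R) (h : T -> \bar R) : (0 < b)%R ->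
  measurable_fun setT h -> (forall x, 0 <= h x) ->
  \int[mu]_x (h x) `^ b = \int[leb]_l ((pw b l)%:E * mu [set x | l%:E < h x]).
Proof.
move=> b0 mh h0.
under eq_integral do rewrite poweR_pw//.
have mlt : measurable_fun setT (fun z : T * R => (z.2%:E < h z.1)%E%:R%:E : \bar R).
  rewrite (_ : (fun z => _) = (fun z : T * R => if (z.2%:E < h z.1)%E then 1 else 0)).
    apply: measurable_fun_ifT => //; apply: measurable_fun_lte.
      by apply/measurable_EFinP; exact: measurable_snd.
    exact: (measurableT_comp mh measurable_fst).
  by apply/funext => z; case: ifP.
have mF : measurable_fun setT (fun z : T * R => (pw b z.2)%:E * (z.2%:E < h z.1)%E%:R%:E : \bar R).
  apply: emeasurable_funM => //; apply/measurable_EFinP.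
  exact: (measurableT_comp (@measurable_pw R b) measurable_snd).
rewrite (@fubini_tonelli _ _ _ _ _ mu leb _ mF) => [|z]; last first.
  by rewrite mule_ge0// lee_fin pw_ge0// ltW.
apply: eq_integral => l _ /=.
have ml : measurable_fun setT (fun x : T => (l%:E < h x)%E%:R%:E : \bar R).
  exact: (measurable_curryl l mlt).
rewrite ge0_integralZl_EFin//; last by rewrite pw_ge0// ltW.
congr *%E.
have mA : measurable [set x | l%:E < h x].
  have := mh measurableT `]l%:E, +oo[%classic (emeasurable_itv _).
  by rewrite setTI (_ : _ @^-1` _ = [set x | l%:E < h x])//; apply/seteqP; split => x /=;
    rewrite in_itv/= andbT.
rewrite -(setIT [set x | l%:E < h x]) -integral_indic//.
apply: eq_integral => x _; rewrite indicE; congr (_%:R%:E).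
by case: (boolP (l%:E < h x)) => H; [rewrite mem_set|rewrite memNset//; exact/negP].
Qed.

Lemma chebyshev_sqr (g : T -> R) (l : R) : (0 < l)%R -> measurable_fun setT g ->
  mu [set x | (l < `|g x|)%R] <= (l ^- 2)%:E * \int[mu]_x (`|g x| ^+ 2)%:E.
Proof.
move=> l0 mg.
have mA : measurable [set x | (l < `|g x|)%R].
  have mg' : measurable_fun setT (fun x => `|g x|)%R by exact: measurableT_comp.
  have := mg' measurableT `]l, +oo[%classic (measurable_itv _).
  by rewrite setTI (_ : _ @^-1` _ = [set x | (l < `|g x|)%R])//; apply/seteqP; split => x /=;
    rewrite in_itv/= andbT.
have m2 : measurable_fun setT (fun x => (`|g x| ^+ 2)%:E).
  by apply/measurable_EFinP; apply: measurable_funX; exact: measurableT_comp.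
rewrite -(setIT [set x | _]) -integral_indic// -ge0_integralZl_EFin//; last by rewrite invr_ge0 sqr_ge0.
apply: ge0_le_integral => //.
- exact/measurable_EFinP.
- exact: measurable_funeM.
- move=> x _; rewrite indicE -EFinM lee_fin.
  case: (boolP (x \in _)) => [/[!inE]/= lg|_]; last by rewrite mulr_ge0 ?invr_ge0 ?sqr_ge0.
  by rewrite mulrC ler_pdivlMr ?exprn_gt0// mul1r lerXn2r ?nnegrE ?(ltW l0)// ltW.
Qed.

Lemma markov_le (g : T -> \bar R) (l : R) : (0 < l)%R -> measurable_fun setT g ->
  (forall x, 0 <= g x) ->
  mu [set x | l%:E < g x] <= (l^-1)%:E * \int[mu]_x g x.
Proof.
move=> l0 mg g0.
have mA : measurable [set x | l%:E < g x].
  have := mg measurableT `]l%:E, +oo[%classic (emeasurable_itv _).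
  by rewrite setTI (_ : _ @^-1` _ = [set x | l%:E < g x])//; apply/seteqP; split => x /=;
    rewrite in_itv/= andbT.
rewrite -(setIT [set x | _]) -integral_indic// -ge0_integralZl_EFin//; last by rewrite invr_ge0 ltW.
apply: ge0_le_integral => //.
- exact/measurable_EFinP.
- exact: measurable_funeM.
- move=> x _; rewrite indicE.
  case: (boolP (x \in _)) => [/[!inE]/= lg|_]; last by rewrite mule_ge0// lee_fin invr_ge0 ltW.
  by rewrite muleC lee_pdivlMr// mul1e ltW.
Qed.

End layer_cake.

Lemma measurable_flip d1 d2 d3 (T1 : measurableType d1) (T2 : measurableType d2)
    (T3 : measurableType d3) (F : T1 -> T2 -> T3) :
  measurable_fun setT (fun z : T1 * T2 => F z.1 z.2) ->
  measurable_fun setT (fun z : T2 * T1 => F z.2 z.1).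
Proof.
move=> mF; have ms : measurable_fun setT (fun z : T2 * T1 => (z.2, z.1)).
  by apply/measurable_fun_pairP; split => /=; [exact: measurable_snd|exact: measurable_fst].
exact (measurableT_comp mF ms).
Qed.

(** * Interpolation between L^1 to L^oo and L^2 to L^2 *)

Section interpolation.
Context {R : realType} {d d' : measure_display}.
Context {T : measurableType d} {T' : measurableType d'}.
Variables (mu : {sigma_finite_measure set T -> \bar R})
          (nu : {sigma_finite_measure set T' -> \bar R}).
Variables (Op : (T -> R[i]) -> (T' -> R[i])) (a r : R).
Hypotheses (a0 : 0 < a) (r2 : 2 < r).
Hypothesis OpD : forall f g y, cL12 mu f -> cL12 mu g ->
  Op (fun x => f x + g x) y = Op f y + Op g y.
Hypothesis mOp : forall f, cL12 mu f -> cmeasurable (Op f).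
Hypothesis Op1 : forall f y, cL12 mu f ->
  ((cmod (Op f y))%:E <= a%:E * \int[mu]_x (cmod (f x))%:E)%E.
Hypothesis Op2 : forall f, cL12 mu f ->
  (\int[nu]_y (cmod (Op f y) ^+ 2)%:E <= \int[mu]_x (cmod (f x) ^+ 2)%:E)%E.

(** The factor 4 comes from Chebyshev's inequality at level l/2, r from the density [pw r], 1/(r -
    2) from rewriting that density with [pw (r - 2)], and 2^(r-2) from the factor 2 in the
    truncation height. *)
Definition interp_cst (r : R) := 4 * r / (r - 2) * 2 `^ (r - 2).

Lemma interp_cst_gt0 : 0 < interp_cst r.
Proof.
by rewrite mulr_gt0 ?powR_gt0// divr_gt0 ?subr_gt0// mulr_gt0// (lt_trans _ r2).
Qed.

Let r_gt0 : 0 < r. Proof. exact: lt_trans r2. Qed.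
Let r1_gt0 : 0 < r - 1. Proof. by rewrite subr_gt0 (lt_trans _ r2)// ltr1n. Qed.
Let r2_gt0 : 0 < r - 2. Proof. by rewrite subr_gt0. Qed.

(* Truncating f at the height s = (2aN/l)^(r-1) makes the contribution of the
   upper part to Op f at most l/2. *)
Theorem interpolation (f : T -> R[i]) (N : R) : 0 < N -> cL12 mu f ->
  (\int[mu]_x (cmod (f x) `^ (r / (r - 1)))%:E <= N%:E)%E ->
  (\int[nu]_y (cmod (Op f y) `^ r)%:E <=
    (interp_cst r * a `^ (r - 2) * N `^ (r - 1))%:E)%E.
Proof.
move=> N0 fL fN; have [mf f1 f2] := fL.
pose r' := r / (r - 1).
have mcf := measurable_cmod mf.
have mOf := mOp fL.
pose s l := (2 * a * N / l) `^ (r - 1).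
have aN0 : 0 < 2 * a * N by rewrite !mulr_gt0.
pose lo l x : R[i] := ((cmod (f x) <= s l)%R%:R)%:C%C * f x.
pose hi l x : R[i] := ((s l < cmod (f x))%R%:R)%:C%C * f x.
have mlo l : cmeasurable (lo l).
  by apply: cmeasurableM => //; apply: cmeasurableR; exact: measurable_le_nat.
have mhi l : cmeasurable (hi l).
  by apply: cmeasurableM => //; apply: cmeasurableR; exact: measurable_lt_nat.
have cb (b : bool) (z : R[i]) : cmod ((b%:R)%:C%C * z) = b%:R * cmod z.
  by rewrite cmodM cmodR ger0_norm.
have loL l : cL12 mu (lo l).
  by apply: (cL12_le fL) => // x; rewrite cb; case: (cmod (f x) <= s l); rewrite ?mul1r ?mul0r ?cmod_ge0.
have hiL l : cL12 mu (hi l).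
  by apply: (cL12_le fL) => // x; rewrite cb; case: (s l < cmod (f x)); rewrite ?mul1r ?mul0r ?cmod_ge0.
have flohi l : f = (fun x => lo l x + hi l x).
  apply/funext => x; rewrite /lo /hi -mulrDl -rmorphD/=.
  by case: leP => _; rewrite ?addr0 ?add0r mul1r.
have mfr : measurable_fun setT (fun x => (cmod (f x) `^ r')%:E).
  by apply/measurable_EFinP; exact: (measurableT_comp (@measurable_powR R r') mcf).
have s_gt0 l : 0 < l -> 0 < s l by move=> l0; rewrite powR_gt0// divr_gt0.
(* Above the height s one has |f| <= s^(1-r') |f|^r' because 1 - r' < 0, and the height is such that
   s^(1-r') N = l/(2a). *)
have hi1 l : 0 < l -> (\int[mu]_x (cmod (hi l x))%:E <= (l / (2 * a))%:E)%E.
  move=> l0.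
  have sE : s l `^ (1 - r') = l / (2 * a * N).
    rewrite /s -powRrM (_ : (r - 1) * (1 - r') = -1); last first.
      by rewrite /r'; field; rewrite gt_eqF.
    by rewrite powR_inv1 ?divr_ge0 ?(ltW aN0) ?(ltW l0)// invf_div.
  apply: (@le_trans _ _ (\int[mu]_x ((s l `^ (1 - r'))%:E * (cmod (f x) `^ r')%:E))%E).
    apply: ge0_le_integral => //.
    - by move=> x _; rewrite lee_fin cmod_ge0.
    - by apply/measurable_EFinP; exact: measurable_cmod.
    - exact: measurable_funeM.
    - move=> x _; rewrite -EFinM lee_fin cb.
      case: ltP => [sf|_]; last by rewrite mul0r mulr_ge0 ?powR_ge0.
      have f0 : 0 < cmod (f x) by rewrite (lt_trans (s_gt0 _ l0)).
      rewrite mul1r -[leLHS](@powRr1 _ (cmod (f x))) ?cmod_ge0//.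
      rewrite -{1}(subrK r' 1) powRD; last by rewrite (gt_eqF f0) implybT.
      rewrite ler_wpM2r ?powR_ge0//.
      have -> : 1 - r' = - (r' - 1) by ring.
      rewrite !powRN lef_pV2 ?posrE ?(powR_gt0 _ f0) ?(powR_gt0 _ (s_gt0 _ l0))//.
      rewrite ge0_ler_powR// ?nnegrE ?(ltW (s_gt0 _ l0)) ?(ltW f0) ?(ltW sf)//.
      rewrite /r' (_ : r / (r - 1) - 1 = (r - 1)^-1) ?invr_ge0 ?ltW//.
      by field; rewrite gt_eqF.
  rewrite ge0_integralZl_EFin ?powR_ge0//; last by move=> x _; rewrite lee_fin powR_ge0.
  rewrite sE; apply: (@le_trans _ _ ((l / (2 * a * N))%:E * N%:E)%E).
    by rewrite lee_wpmul2l// lee_fin divr_ge0// ltW.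
  rewrite -EFinM lee_fin le_eqVlt; apply/orP; left; apply/eqP.
  by field; rewrite !gt_eqF.
have Ohi l y : 0 < l -> cmod (Op (hi l) y) <= l / 2.
  move=> l0; rewrite -lee_fin; apply: (le_trans (Op1 y (hiL l))).
  apply: (@le_trans _ _ (a%:E * (l / (2 * a))%:E)%E).
    by rewrite lee_wpmul2l ?lee_fin ?(ltW a0)// hi1.
  rewrite -EFinM lee_fin le_eqVlt; apply/orP; left; apply/eqP.
  by field; rewrite !gt_eqF.
(* The image of the upper part is at most l/2, so where |Op f| > l the image of the lower part
   exceeds l/2; the L^2 bound applies to the latter. *)
have lvl l : 0 < l -> (nu [set y | l%:E < (cmod (Op f y))%:E] <=
    (4 / l ^+ 2)%:E * \int[mu]_x ((cmod (f x) <= s l)%R%:R * cmod (f x) ^+ 2)%:E)%E.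
  move=> l0.
  have l20 : 0 < l / 2 by rewrite divr_gt0.
  have mO := measurable_cmod (mOp (loL l)).
  apply: (@le_trans _ _ (nu [set y | l / 2 < `|cmod (Op (lo l) y)|])).
    apply: le_measure; rewrite ?inE.
    - have mh : measurable_fun setT (fun y => cmod (Op f y)) by exact: measurable_cmod.
      have := mh measurableT `]l, +oo[%classic (measurable_itv _).
      by rewrite setTI (_ : _ @^-1` _ = [set y | l%:E < (cmod (Op f y))%:E]%E)//; apply/seteqP; split => x /=;
        rewrite in_itv/= andbT.
    - have mh : measurable_fun setT (fun y => `|cmod (Op (lo l) y)|) by exact: measurableT_comp.
      have := mh measurableT `]l / 2, +oo[%classic (measurable_itv _).
      by rewrite setTI (_ : _ @^-1` _ = [set y | l / 2 < `|cmod (Op (lo l) y)|])//; apply/seteqP; split => x /=;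
        rewrite in_itv/= andbT.
    - move=> y /=; rewrite lte_fin ger0_norm ?cmod_ge0// => lf.
      have := Ohi l y l0; have := cmodD (Op (lo l) y) (Op (hi l) y).
      rewrite -OpD// -flohi; move: lf; lra.
  apply: (le_trans (chebyshev_sqr nu l20 mO)).
  have -> : (l / 2) ^- 2 = 4 / l ^+ 2 by field; rewrite gt_eqF.
  rewrite lee_wpmul2l ?lee_fin ?divr_ge0 ?sqr_ge0//.
  under eq_integral do rewrite ger0_norm ?cmod_ge0//.
  apply: (le_trans (Op2 (loL l))).
  rewrite le_eqVlt; apply/orP; left; apply/eqP; apply: eq_integral => x _.
  by rewrite cb; case: (_ <= _); rewrite ?mul1r// !mul0r expr0n.
have -> : (\int[nu]_y (cmod (Op f y) `^ r)%:E = \int[nu]_y ((cmod (Op f y))%:E `^ r))%E.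
  by apply: eq_integral => y _; rewrite poweR_EFin.
rewrite layer_cake//; last 2 first.
- by apply/measurable_EFinP; exact: measurable_cmod.
- by move=> y; rewrite lee_fin cmod_ge0.
pose C := 4 * r / (r - 2).
have C0 : 0 <= C by rewrite divr_ge0 ?(ltW r2_gt0)// mulr_ge0// ltW.
pose F l x : R := C * pw (r - 2) l * ((cmod (f x) <= s l)%R%:R * cmod (f x) ^+ 2).
have ms : measurable_fun setT s.
  apply: (measurableT_comp (@measurable_powR R (r - 1))).
  by apply: measurable_funM => //; exact: measurable_funV.
have mF : measurable_fun setT (fun z : R * T => (F z.1 z.2)%:E).
  apply/measurable_EFinP; apply: measurable_funM.
    apply: measurable_funM => //.
    exact: (measurableT_comp (@measurable_pw R (r - 2)) measurable_fst).
  apply: measurable_funM.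
    apply: measurable_le_nat; first exact: (measurableT_comp mcf measurable_snd).
    exact: (measurableT_comp ms measurable_fst).
  by apply: measurable_funX; exact: (measurableT_comp mcf measurable_snd).
have F0 l x : 0 <= F l x.
  rewrite /F; apply: mulr_ge0; first by rewrite mulr_ge0// pw_ge0// ltW.
  by rewrite mulr_ge0 ?sqr_ge0.
have mlev : measurable_fun setT (fun l : R => nu [set y | l%:E < (cmod (Op f y))%:E]%E).
  have -> : (fun l : R => nu [set y | l%:E < (cmod (Op f y))%:E]%E) =
      (fun l : R => \int[nu]_y ((l < cmod (Op f y))%R%:R)%:E)%E.
    apply/funext => l.
    have mA : measurable [set y | l%:E < (cmod (Op f y))%:E]%E.
      have mh : measurable_fun setT (fun y => cmod (Op f y)) by exact: measurable_cmod.
      have := mh measurableT `]l, +oo[%classic (measurable_itv _).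
      by rewrite setTI (_ : _ @^-1` _ = [set y | l%:E < (cmod (Op f y))%:E]%E)//; apply/seteqP; split => x /=;
        rewrite in_itv/= andbT.
    rewrite -(setIT [set y | _]) -integral_indic//.
    apply: eq_integral => y _; rewrite indicE; congr (_%:R%:E); rewrite -lte_fin.
    by case: (boolP (l%:E < (cmod (Op f y))%:E)%E) => H; [rewrite mem_set|rewrite memNset//; exact/negP].
  apply (@measurable_integral_param _ _ _ _ _ nu (fun (l : R) y => ((l < cmod (Op f y))%R%:R)%:E)).
  apply/measurable_EFinP; apply: measurable_lt_nat; first exact: measurable_fst.
  exact: (measurableT_comp (measurable_cmod mOf) measurable_snd).
apply: (@le_trans _ _ (\int[lebesgue_measure]_l \int[mu]_x (F l x)%:E)%E).
  apply: ge0_le_integral => //.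
  - by move=> l _; rewrite mule_ge0// lee_fin pw_ge0// ltW.
  - apply: emeasurable_funM => //; apply/measurable_EFinP; exact: measurable_pw.
  - exact: (measurable_integral_param mu mF).
  move=> l _; rewrite /F /pw; case: ifPn => [l0|_]; last first.
    by rewrite mul0e; apply: integral_ge0 => x _; rewrite mulr0 mul0r.
  apply: (@le_trans _ _ ((r * l `^ (r - 1))%:E * ((4 / l ^+ 2)%:E * \int[mu]_x ((cmod (f x) <= s l)%R%:R * cmod (f x) ^+ 2)%:E)))%E.
    by rewrite lee_wpmul2l ?lvl// lee_fin mulr_ge0 ?powR_ge0// ltW.
  rewrite muleA -EFinM -ge0_integralZl_EFin//; last 3 first.
  - by move=> x _; rewrite lee_fin mulr_ge0// sqr_ge0.
  - apply/measurable_EFinP; apply: measurable_funM; last exact: measurable_funX.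
    exact: measurable_le_nat.
  - by rewrite !mulr_ge0 ?invr_ge0 ?sqr_ge0 ?powR_ge0 ?(ltW r_gt0).
  rewrite le_eqVlt; apply/orP; left; apply/eqP; apply: eq_integral => x _.
  rewrite -EFinM; congr (_ * _)%:E.
  have -> : r - 1 = (r - 2 - 1) + 2 by ring.
  rewrite powRD; last by rewrite (gt_eqF l0) implybT.
  rewrite powR_mulrn ?(ltW l0)// /C; field.
  by rewrite !gt_eqF.
rewrite (@fubini_tonelli _ _ _ _ _ (@lebesgue_measure R) mu _ mF) => [|z]; last by rewrite lee_fin.
(* Read as a condition on l, |f(x)| <= s l means l <= c with c = 2 a N |f(x)|^(-1/(r-1)). The
   l-integral is then c^(r-2), and 2 - (r-2)/(r-1) = r' is the resulting power of |f(x)|. *)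
have inner x : (\int[lebesgue_measure]_l (F l x)%:E <=
    (C * (2 * a * N) `^ (r - 2))%:E * (cmod (f x) `^ r')%:E)%E.
  have [f0|f0] := eqVneq (cmod (f x)) 0.
    rewrite f0 powR0; last by rewrite /r' mulf_neq0 ?invr_eq0 ?gt_eqF.
    rewrite mule0 integral0_eq// => l _.
    by rewrite /F f0 expr0n/= !mulr0.
  have fx0 : 0 < cmod (f x) by rewrite lt_def f0 cmod_ge0.
  pose c := 2 * a * N * cmod (f x) `^ (- (r - 1)^-1).
  have c0 : 0 <= c by rewrite mulr_ge0 ?powR_ge0// ltW.
  have sc l : 0 < l -> (cmod (f x) <= s l)%R -> (l <= c)%R.
    move=> l0 fs.
    have : cmod (f x) `^ (r - 1)^-1 <= s l `^ (r - 1)^-1.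
      by rewrite ge0_ler_powR// ?nnegrE ?invr_ge0 ?cmod_ge0 ?(ltW r1_gt0) ?(ltW (s_gt0 _ l0)).
    rewrite /s -powRrM mulfV ?gt_eqF// powRr1 ?divr_ge0 ?(ltW aN0) ?(ltW l0)//.
    by rewrite ler_pdivlMr// mulrC -ler_pdivlMr ?powR_gt0// -powRN.
  apply: (@le_trans _ _ (\int[lebesgue_measure]_l ((C * cmod (f x) ^+ 2)%:E * (pw (r - 2) l * (l <= c)%R%:R)%:E))%E).
    apply: ge0_le_integral => //.
    - by move=> l _; rewrite lee_fin.
    - exact: (measurable_curryl x mF).
    - apply: measurable_funeM; apply/measurable_EFinP; apply: measurable_funM; first exact: measurable_pw.
      exact: measurable_le_nat.
    - move=> l _; rewrite -EFinM lee_fin /F.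
      have [l0|l0] := ltP 0 l; last by rewrite /pw ltNge l0/= !(mulr0, mul0r).
      rewrite -[leRHS]mulrA -[leLHS]mulrA ler_wpM2l// [leRHS]mulrCA ler_wpM2l ?pw_ge0 ?(ltW r2_gt0)//.
      rewrite [leRHS]mulrC ler_wpM2r ?sqr_ge0//.
      by case: (boolP (cmod (f x) <= s l)) => [/(sc l l0) ->|_].
  (* [integral_pw] has l < c in place of l <= c; the two differ at one point only. *)
  have Ic : (\int[lebesgue_measure]_l (pw (r - 2) l * (l <= c)%R%:R)%:E = (c `^ (r - 2))%:E)%E.
    rewrite -(integral_pw r2_gt0 c0); apply: ae_eq_integral => //.
    - by apply/measurable_EFinP; apply: measurable_funM; [exact: measurable_pw|exact: measurable_le_nat].
    - by apply/measurable_EFinP; apply: measurable_funM; [exact: measurable_pw|exact: measurable_lt_nat].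
    - exists [set c]; split => //; first exact: lebesgue_measure_set1.
      move=> l /= H; apply: contrapT => lc; apply: H => _.
      by rewrite [in RHS]lt_neqAle (_ : l != c)//; apply/eqP.
  rewrite ge0_integralZl_EFin//; last 3 first.
  - by move=> l _; rewrite lee_fin mulr_ge0// pw_ge0// ltW.
  - by apply/measurable_EFinP; apply: measurable_funM; [exact: measurable_pw|exact: measurable_le_nat].
  - by rewrite mulr_ge0// sqr_ge0.
  rewrite Ic -!EFinM lee_fin /c powRM ?powR_ge0 ?(ltW aN0)//.
  rewrite -powRrM -(@powR_mulrn _ (cmod (f x)) 2) ?cmod_ge0//.
  have -> : cmod (f x) `^ r' = cmod (f x) `^ 2%:R * cmod (f x) `^ (- (r - 1)^-1 * (r - 2)).
    rewrite -powRD; last by rewrite f0 implybT.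
    by congr (_ `^ _); rewrite /r'; field; rewrite gt_eqF.
  by rewrite le_eqVlt; apply/orP; left; apply/eqP; ring.
apply: (@le_trans _ _ (\int[mu]_x ((C * (2 * a * N) `^ (r - 2))%:E * (cmod (f x) `^ r')%:E))%E).
  apply: ge0_le_integral => //.
  - by move=> x _; apply: integral_ge0 => l _; rewrite lee_fin.
  - apply (@measurable_integral_param _ _ _ _ _ (@lebesgue_measure R) (fun x (l : R) => (F l x)%:E)).
    exact (@measurable_flip _ _ _ _ _ _ (fun (l : R) x => (F l x)%:E) mF).
  - exact: measurable_funeM.
  - by move=> x _; exact: inner.
rewrite ge0_integralZl_EFin//; last 2 first.
- by move=> x _; rewrite lee_fin powR_ge0.
- by rewrite mulr_ge0 ?powR_ge0.
apply: (@le_trans _ _ ((C * (2 * a * N) `^ (r - 2))%:E * N%:E)%E).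
  by rewrite lee_wpmul2l// lee_fin mulr_ge0 ?powR_ge0.
rewrite -EFinM lee_fin /interp_cst -/C.
rewrite powRM ?mulr_ge0 ?(ltW a0) ?(ltW N0)// powRM ?(ltW a0)//.
have -> : N `^ (r - 1) = N `^ (r - 2) * N.
  rewrite -[X in _ = _ * X](@powRr1 _ N) ?(ltW N0)// -powRD.
    by congr (_ `^ _); ring.
  by rewrite (gt_eqF N0) implybT.
rewrite le_eqVlt; apply/orP; left; apply/eqP; ring.
Qed.

End interpolation.

Lemma in_set_bool T (b : T -> bool) x : (x \in [set t | b t]) = b x.
Proof. by apply/idP/idP => [/set_mem//|bx]; exact: mem_set. Qed.

(** * The one-dimensional Hardy-Littlewood-Sobolev inequality *)

Section hardy_littlewood_sobolev.
Context {R : realType}.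
Notation mu := (@lebesgue_measure R).
Variable q : R.
Hypothesis q2 : 2 < q.

Let al := 2 / q.
Let p := q / (q - 1).
Let q_gt0 : 0 < q. Proof. exact: lt_trans q2. Qed.
Let q1_gt0 : 0 < q - 1. Proof. by rewrite subr_gt0 (lt_trans _ q2)// ltr1n. Qed.
Let al_gt0 : 0 < al. Proof. by rewrite divr_gt0. Qed.
Let al_lt1 : al < 1. Proof. by rewrite ltr_pdivrMr// mul1r. Qed.
Let al1_gt0 : 0 < 1 - al. Proof. by rewrite subr_gt0. Qed.
Let q0 : q != 0. Proof. by rewrite gt_eqF. Qed.
Let q10 : q - 1 != 0. Proof. by rewrite gt_eqF. Qed.
Let al10 : 1 - al != 0. Proof. by rewrite gt_eqF. Qed.
Let p_gt0 : 0 < p. Proof. by rewrite divr_gt0. Qed.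

(** With al = 2/q and p conjugate to q one has 1/p - 1/q = 1 - al, the scaling under which this
    potential maps L^p to L^q. *)
Definition riesz (g : R -> R) (t : R) : \bar R :=
  (\int[mu]_u (`|t - u| `^ (- al) * g u)%:E)%E.

(** Twice the constant of the controlled part in [bound_lo]: at the height s with s^(p-1) = l/K this
    part equals l/2. *)
Let K : R := 2 * (3 + 2 / (1 - al)).
(** The factor q comes from the layer cake, 4/(1 - al) and K^(q-2) from [level], and the last K from
    the range l < K g^(p-1) of levels that a value g can influence. *)
Definition hls_cst : R := q * (4 / (1 - al)) * K `^ (q - 2) * K.

Let K_gt0 : 0 < K.
Proof. by rewrite mulr_gt0// addr_gt0// divr_gt0. Qed.

Lemma hls_cst_gt0 : 0 < hls_cst.
Proof. by rewrite /hls_cst mulr_gt0// mulr_gt0 ?powR_gt0// mulr_gt0// divr_gt0. Qed.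

Lemma measurable_riesz_kernel : measurable_fun setT (fun z : R * R => `|z.1 - z.2| `^ (- al)).
Proof.
apply: (measurableT_comp (@measurable_powR R (- al))).
by apply: measurableT_comp => //; exact: measurable_funB.
Qed.

Lemma measurable_riesz (g : R -> R) : measurable_fun setT g -> measurable_fun setT (riesz g).
Proof.
move=> mg; apply (@measurable_integral_param _ _ _ _ _ mu (fun t u : R => (`|t - u| `^ (- al) * g u)%:E)).
apply/measurable_EFinP; apply: measurable_funM; first exact: measurable_riesz_kernel.
exact: (measurableT_comp mg measurable_snd).
Qed.

Let integral_refl (phi : R -> R) (t : R) : measurable_fun setT phi -> (forall u, 0 <= phi u) ->
  (\int[mu]_u (phi (t - u))%:E = \int[mu]_u (phi u)%:E)%E.
Proof.
move=> mphi phi0.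
transitivity (\int[mu]_u (EFin \o phi) (-1 * u + t)%R)%E.
  by apply: eq_integral => u _; rewrite /= mulN1r addrC.
rewrite ge0_integral_affine.
- by rewrite normrN1 invr1 mul1e.
- by rewrite oppr_eq0 oner_eq0.
- exact/measurable_EFinP.
- by move=> x; rewrite lee_fin.
Qed.

Let small (rho v : R) : R := `|v| `^ (- al) * (`|v| < rho)%R%:R.
Let large (rho v : R) : R := `|v| ^- 2 * (rho <= `|v|)%R%:R.

Let measurable_small rho : measurable_fun setT (small rho).
Proof.
apply: measurable_funM; first by apply: (measurableT_comp (@measurable_powR R (- al))).
by apply: measurable_lt_nat => //; exact: measurableT_comp.
Qed.

Let measurable_large rho : measurable_fun setT (large rho).
Proof.
apply: measurable_funM; last by apply: measurable_le_nat => //; exact: measurableT_comp.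
by apply: measurable_funV; apply: measurable_funX.
Qed.

Let small_ge0 rho v : 0 <= small rho v. Proof. by rewrite mulr_ge0 ?powR_ge0. Qed.
Let large_ge0 rho v : 0 <= large rho v. Proof. by rewrite mulr_ge0// invr_ge0 sqr_ge0. Qed.

(* The radius s^-p matches the height s of g: only the last term, with g > s near
   the singularity, can exceed the level attached to s. *)
Let kernel_split s (v y : R) : 0 < s -> 0 <= y ->
  `|v| `^ (- al) * y <= s `^ (p - 1) * (s `^ (- p) * large (s `^ (- p)) v + y `^ p) +
    s * small (s `^ (- p)) v + small (s `^ (- p)) v * (y * (s < y)%R%:R).
Proof.
move=> s0 y0; set rho := s `^ (- p).
rewrite /small /large; have [vr|vr] := ltP `|v| rho.
  rewrite mulr0 mulr0 add0r mulr1.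
  have h : 0 <= s `^ (p - 1) * y `^ p by rewrite mulr_ge0 ?powR_ge0.
  have [sy|ys] := ltP s y.
    by rewrite mulr1 lerDr addr_ge0// mulr_ge0 ?powR_ge0 ?ltW.
  rewrite mulr0 mulr0 addr0 (le_trans (_ : _ <= s * `|v| `^ (- al)))//.
    by rewrite mulrC ler_wpM2r ?powR_ge0.
  by rewrite lerDr.
rewrite mulr1 !mulr0 mul0r !addr0.
have v0 : 0 < `|v| by rewrite (lt_le_trans _ vr)// powR_gt0.
have sp : 0 < s `^ (p - 1) by rewrite powR_gt0.
(* Young's inequality is applied to a and y; the scaling of a gives a^q = rho |v|^-2, the integrable
   tail. *)
set a := `|v| `^ (- al) / s `^ (p - 1).
have a0 : 0 <= a by rewrite divr_ge0 ?powR_ge0.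
have aq : a `^ q = rho * `|v| ^- 2.
  rewrite /a powRM ?invr_ge0 ?powR_ge0// -powRrM -powRN -powRrM.
  rewrite [- al * q](_ : _ = - 2%:R); last by rewrite /al mulNr divfK.
  rewrite mulrC powRN powR_mulrn//; congr (_ `^ _ * _).
  by rewrite /p; field.
have -> : `|v| `^ (- al) * y = s `^ (p - 1) * (a * y).
  by rewrite /a mulrA [s `^ _ * _]mulrC divfK// gt_eqF.
rewrite ler_wpM2l ?(ltW sp)//.
have qp : q^-1 + p^-1 = 1 by rewrite /p; field; rewrite ?q0 ?q10.
apply: le_trans (conjugate_powR a0 y0 q_gt0 p_gt0 qp) _.
rewrite aq lerD//.
  rewrite ler_piMr ?mulr_ge0 ?powR_ge0 ?invr_ge0 ?sqr_ge0// invf_le1//.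
  by rewrite ltW// (lt_trans _ q2)// ltr1n.
rewrite ler_piMr ?powR_ge0// invf_le1// ler_pdivlMr//.
by rewrite mul1r gerBl ler01.
Qed.

(** Integration of [kernel_split]. The far term gives rho times the tail mass 2/rho, that is 2; the
    power of g gives at most 1; the near term at height s gives 2/(1 - al). The choice rho = s^(-p)
    makes all three carry the factor s^(p-1). *)
Let bound_lo s (g : R -> R) t : 0 < s -> measurable_fun setT g -> (forall u, 0 <= g u) ->
  (\int[mu]_u (g u `^ p)%:E <= 1)%E ->
  (riesz g t <= (K / 2 * s `^ (p - 1))%:E +
    \int[mu]_u (small (s `^ (- p)) (t - u) * (g u * (s < g u)%R%:R))%:E)%E.
Proof.
move=> s0 mg g0 gp; set rho := s `^ (- p).
have rho0 : 0 < rho by rewrite powR_gt0.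
have mtu : measurable_fun setT (fun u : R => t - u) by exact: measurable_funB.
have mS : measurable_fun setT (fun u : R => small rho (t - u)) by exact: (measurableT_comp (measurable_small rho)).
have mL : measurable_fun setT (fun u : R => large rho (t - u)) by exact: (measurableT_comp (measurable_large rho)).
have mgp : measurable_fun setT (fun u => g u `^ p) by exact: (measurableT_comp (@measurable_powR R p)).
have mC : measurable_fun setT (fun u : R => small rho (t - u) * (g u * (s < g u)%R%:R)).
  by apply: measurable_funM => //; apply: measurable_funM => //; exact: measurable_lt_nat.
have mA1 : measurable_fun setT (fun u : R => s `^ (p - 1) * (rho * large rho (t - u) + g u `^ p)).
  by apply: measurable_funM => //; apply: measurable_funD => //; exact: measurable_funM.
have mB1 : measurable_fun setT (fun u : R => s * small rho (t - u)) by exact: measurable_funM.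
have A0 u : 0 <= s `^ (p - 1) * (rho * large rho (t - u) + g u `^ p).
  by rewrite mulr_ge0 ?powR_ge0// addr_ge0 ?powR_ge0// mulr_ge0// ltW.
have B0 u : 0 <= s * small rho (t - u) by rewrite mulr_ge0// ltW.
have C0 u : 0 <= small rho (t - u) * (g u * (s < g u)%R%:R) by rewrite mulr_ge0// mulr_ge0.
apply: (@le_trans _ _ (\int[mu]_u ((s `^ (p - 1) * (rho * large rho (t - u) + g u `^ p))%:E +
    (s * small rho (t - u))%:E + (small rho (t - u) * (g u * (s < g u)%R%:R))%:E))%E).
  apply: ge0_le_integral => //.
  - by move=> u _; rewrite lee_fin mulr_ge0 ?powR_ge0.
  - apply/measurable_EFinP; apply: measurable_funM => //.
    by apply: (measurableT_comp (@measurable_powR R (- al))); exact: measurableT_comp.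
  - by apply: emeasurable_funD; [apply: emeasurable_funD|]; exact/measurable_EFinP.
  - by move=> u _; rewrite -!EFinD lee_fin; exact: kernel_split.
rewrite ge0_integralD//; last 4 first.
- by move=> u _; rewrite -EFinD lee_fin addr_ge0.
- by apply: emeasurable_funD; exact/measurable_EFinP.
- by move=> u _; rewrite lee_fin.
- exact/measurable_EFinP.
rewrite leeD2r// ge0_integralD//; last 4 first.
- by move=> u _; rewrite lee_fin.
- exact/measurable_EFinP.
- by move=> u _; rewrite lee_fin.
- exact/measurable_EFinP.
have IB : (\int[mu]_u (s * small rho (t - u))%:E = (2 / (1 - al) * s `^ (p - 1))%:E)%E.
  under eq_integral do rewrite EFinM.
  rewrite ge0_integralZl_EFin//; last 3 first.
  - by move=> u _; rewrite lee_fin.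
  - exact/measurable_EFinP.
  - exact: ltW.
  rewrite integral_refl// integral_norm_small// -EFinM; congr EFin.
  rewrite /rho -powRrM.
  have -> : s `^ (p - 1) = s * s `^ (- p * (1 - al)).
    rewrite -{2}[s](@powRr1 _ s) ?(ltW s0)// -powRD; last by rewrite (gt_eqF s0) implybT.
    by congr (_ `^ _); rewrite /al /p; field; rewrite q0.
  by field; exact: al10.
rewrite IB.
have IA : (\int[mu]_u (s `^ (p - 1) * (rho * large rho (t - u) + g u `^ p))%:E <= (3 * s `^ (p - 1))%:E)%E.
  under eq_integral do rewrite EFinM EFinD.
  rewrite ge0_integralZl_EFin ?powR_ge0//; last 2 first.
  - by move=> u _; rewrite -EFinD lee_fin addr_ge0 ?powR_ge0// mulr_ge0// ltW.
  - by apply: emeasurable_funD; apply/measurable_EFinP => //; exact: measurable_funM.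
  rewrite mulrC EFinM lee_wpmul2l ?lee_fin ?powR_ge0//.
  under eq_integral do rewrite EFinM.
  rewrite ge0_integralD//; last 4 first.
  - by move=> u _; rewrite -EFinM lee_fin mulr_ge0// ltW.
  - by apply: measurable_funeM; exact/measurable_EFinP.
  - by move=> u _; rewrite lee_fin powR_ge0.
  - exact/measurable_EFinP.
  rewrite ge0_integralZl_EFin ?(ltW rho0)//; last 2 first.
  - by move=> u _; rewrite lee_fin.
  - exact/measurable_EFinP.
  rewrite integral_refl// integral_norm_large// -EFinM mulrCA mulfV ?gt_eqF// mulr1.
  apply: (@le_trans _ _ (2%:E + 1)%E); first by rewrite leeD2l.
  by rewrite -EFinD lee_fin; lra.
apply: (@le_trans _ _ ((3 * s `^ (p - 1))%:E + (2 / (1 - al) * s `^ (p - 1))%:E)%E).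
  by rewrite leeD2r.
rewrite -EFinD lee_fin -mulrDl le_eqVlt; apply/orP; left; apply/eqP.
by congr (_ * _); rewrite /K; field; exact: al10.
Qed.

(** For s^(p-1) = l/K the controlled part of [bound_lo] uses up l/2, so at these t the contribution
    of the values of g above s exceeds l/2. Markov's inequality and Tonelli's theorem bound the
    measure of such t. *)
Let level (g : R -> R) l : 0 < l -> measurable_fun setT g -> (forall u, 0 <= g u) ->
  (\int[mu]_u (g u `^ p)%:E <= 1)%E ->
  (mu [set t | l%:E < riesz g t] <=
    (4 / (1 - al) / l * (l / K) `^ (2 - q))%:E *
      \int[mu]_u (g u * ((l / K) `^ (q - 1) < g u)%R%:R)%:E)%E.
Proof.
move=> l0 mg g0 gp; set s := (l / K) `^ (q - 1).
have lK0 : 0 < l / K by rewrite divr_gt0.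
have s0 : 0 < s by rewrite powR_gt0.
set rho := s `^ (- p); have rho0 : 0 < rho by rewrite powR_gt0.
have sp : s `^ (p - 1) = l / K.
  rewrite /s -powRrM (_ : (q - 1) * (p - 1) = 1) ?powRr1 ?(ltW lK0)//.
  by rewrite /p; field.
have l20 : 0 < l / 2 by rewrite divr_gt0.
pose J t := (\int[mu]_u (small rho (t - u) * (g u * (s < g u)%R%:R))%:E)%E.
have mg1 : measurable_fun setT (fun u => g u * (s < g u)%R%:R).
  by apply: measurable_funM => //; exact: measurable_lt_nat.
have mF : measurable_fun setT (fun z : R * R => (small rho (z.1 - z.2) * (g z.2 * (s < g z.2)%R%:R))%:E).
  apply/measurable_EFinP; apply: measurable_funM.
    by apply: (measurableT_comp (measurable_small rho)); exact: measurable_funB.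
  exact: (measurableT_comp mg1 measurable_snd).
have mJ : measurable_fun setT J.
  exact (@measurable_integral_param _ _ _ _ _ mu (fun t u : R => (small rho (t - u) * (g u * (s < g u)%R%:R))%:E) mF).
have J0 t : (0 <= J t)%E by apply: integral_ge0 => u _; rewrite lee_fin mulr_ge0// mulr_ge0.
have mset (h : R -> \bar R) (b : R) : measurable_fun setT h -> measurable [set t | b%:E < h t]%E.
  move=> mh; have := mh measurableT `]b%:E, +oo[%classic (emeasurable_itv _).
  by rewrite setTI (_ : _ @^-1` _ = [set x | b%:E < h x]%E)//; apply/seteqP; split => x /=;
    rewrite in_itv/= andbT.
apply: (@le_trans _ _ (mu [set t | (l / 2)%:E < J t]%E)).
  apply: le_measure; rewrite ?inE.
  - by apply: mset; exact: measurable_riesz.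
  - exact: mset.
  - move=> t /= lt; rewrite ltNge; apply/negP => Jl.
    have := bound_lo t s0 mg g0 gp; rewrite -/rho -/(J t) sp => H.
    have : (riesz g t <= l%:E)%E.
      apply: (le_trans H); apply: (@le_trans _ _ ((K / 2 * (l / K))%:E + (l / 2)%:E)%E).
        by rewrite leeD2l.
      rewrite -EFinD lee_fin le_eqVlt; apply/orP; left; apply/eqP.
      by field; rewrite gt_eqF.
    by rewrite leNgt lt.
apply: (le_trans (markov_le mu l20 mJ J0)).
rewrite /J (@fubini_tonelli _ _ _ _ _ mu mu _ mF) => [|z]; last first.
  by rewrite lee_fin mulr_ge0// mulr_ge0.
have IS u : (\int[mu]_t (small rho (t - u) * (g u * (s < g u)%R%:R))%:E =
    (2 * (rho `^ (1 - al) / (1 - al)))%:E * (g u * (s < g u)%R%:R)%:E)%E.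
  under eq_integral do rewrite mulrC EFinM.
  rewrite ge0_integralZl_EFin//; last 3 first.
  - by move=> t _; rewrite lee_fin.
  - apply/measurable_EFinP; apply: (measurableT_comp (measurable_small rho)); exact: measurable_funB.
  - by rewrite mulr_ge0.
  rewrite muleC; congr (_ * _)%E; rewrite -integral_norm_small// -(integral_refl u (measurable_small rho) (small_ge0 rho)).
  by apply: eq_integral => t _; rewrite /small distrC.
under eq_integral do rewrite /= IS.
rewrite ge0_integralZl_EFin//; last 3 first.
- by move=> u _; rewrite lee_fin mulr_ge0.
- exact/measurable_EFinP.
- by rewrite mulr_ge0// divr_ge0 ?powR_ge0// ltW.
rewrite muleA -EFinM lee_wpmul2r//.
  by apply: integral_ge0 => u _; rewrite lee_fin mulr_ge0.
rewrite lee_fin le_eqVlt; apply/orP; left; apply/eqP.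
have -> : rho `^ (1 - al) = (l / K) `^ (2 - q).
  rewrite /rho /s -!powRrM; congr (_ `^ _).
  by rewrite /p /al; field; rewrite q0.
by field; rewrite al10 gt_eqF.
Qed.

(** The layer cake is combined with [level] and integrated in l first. The powers of l cancel, and
    (l/K)^(q-1) < g means l < K g^(p-1); hence a value g contributes a multiple of g g^(p-1) =
    g^p. *)
Theorem hls1 (g : R -> R) : measurable_fun setT g -> (forall u, 0 <= g u) ->
  (\int[mu]_u (g u `^ p)%:E <= 1)%E ->
  (\int[mu]_t (riesz g t `^ q) <= hls_cst%:E)%E.
Proof.
move=> mg g0 gp.
have mr := measurable_riesz mg.
have r0 t : (0 <= riesz g t)%E by apply: integral_ge0 => u _; rewrite lee_fin mulr_ge0 ?powR_ge0.
rewrite layer_cake//.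
pose c := q * (4 / (1 - al)) * K `^ (q - 2).
have c0 : 0 <= c by rewrite !mulr_ge0 ?invr_ge0 ?powR_ge0 ?(ltW al1_gt0) ?(ltW q_gt0).
pose F l u : R := c * (g u * ((0 < l)%R%:R * ((l / K) `^ (q - 1) < g u)%R%:R)).
have ms : measurable_fun setT (fun l : R => (l / K) `^ (q - 1)).
  by apply: (measurableT_comp (@measurable_powR R (q - 1))); exact: measurable_funM.
have mF : measurable_fun setT (fun z : R * R => (F z.1 z.2)%:E).
  apply/measurable_EFinP; apply: measurable_funM => //; apply: measurable_funM.
    exact: (measurableT_comp mg measurable_snd).
  apply: measurable_funM; first by apply: measurable_lt_nat => //; exact: measurable_fst.
  apply: measurable_lt_nat; first exact: (measurableT_comp ms measurable_fst).
  exact: (measurableT_comp mg measurable_snd).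
have F0 l u : 0 <= F l u by rewrite /F; apply: mulr_ge0 => //; apply: mulr_ge0 => //; rewrite mulr_ge0.
have mlev : measurable_fun setT (fun l : R => mu [set t | l%:E < riesz g t]%E).
  have -> : (fun l : R => mu [set t | l%:E < riesz g t]%E) =
      (fun l : R => \int[mu]_t ((l%:E < riesz g t)%E%:R)%:E)%E.
    apply/funext => l.
    have mA : measurable [set t | l%:E < riesz g t]%E.
      have := mr measurableT `]l%:E, +oo[%classic (emeasurable_itv _).
      by rewrite setTI (_ : _ @^-1` _ = [set x | l%:E < riesz g x]%E)//; apply/seteqP; split => x /=;
        rewrite in_itv/= andbT.
    rewrite -(setIT [set t | _]) -integral_indic//.
    apply: eq_integral => y _; rewrite indicE; congr (_%:R%:E).
    by rewrite (in_set_bool (fun t => (l%:E < riesz g t)%E)).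
  apply (@measurable_integral_param _ _ _ _ _ mu (fun (l t : R) => ((l%:E < riesz g t)%E%:R)%:E)).
  rewrite (_ : (fun z => _) = (fun z : R * R => if (z.1%:E < riesz g z.2)%E then 1 else 0)%E).
    apply: measurable_fun_ifT => //; apply: measurable_fun_lte.
      by apply/measurable_EFinP; exact: measurable_fst.
    exact: (measurableT_comp mr measurable_snd).
  by apply/funext => z; case: ifP.
apply: (@le_trans _ _ (\int[mu]_l \int[mu]_u (F l u)%:E)%E).
  apply: ge0_le_integral => //.
  - by move=> l _; rewrite mule_ge0// lee_fin pw_ge0// ltW.
  - apply: emeasurable_funM => //; apply/measurable_EFinP; exact: measurable_pw.
  - exact (@measurable_integral_param _ _ _ _ _ mu (fun (l u : R) => (F l u)%:E) mF).
  move=> l _; rewrite /F /pw; case: ifPn => [l0|_]; last first.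
    by rewrite mul0e; apply: integral_ge0 => x _; rewrite mul0r !mulr0.
  apply: (@le_trans _ _ ((q * l `^ (q - 1))%:E * ((4 / (1 - al) / l * (l / K) `^ (2 - q))%:E *
      \int[mu]_u (g u * ((l / K) `^ (q - 1) < g u)%R%:R)%:E))%E).
    by rewrite lee_wpmul2l ?level// lee_fin mulr_ge0 ?powR_ge0// ltW.
  under [leRHS]eq_integral do rewrite mul1r EFinM.
  rewrite [leRHS]ge0_integralZl_EFin//; last 2 first.
  - by move=> u _; rewrite lee_fin mulr_ge0.
  - apply/measurable_EFinP; apply: measurable_funM => //; exact: measurable_lt_nat.
  rewrite muleA -EFinM lee_wpmul2r//.
    by apply: integral_ge0 => u _; rewrite lee_fin mulr_ge0.
  rewrite lee_fin le_eqVlt; apply/orP; left; apply/eqP.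
  have -> : q - 1 = (q - 2) + 1 by ring.
  rewrite powRD; last by rewrite (gt_eqF l0) implybT.
  have -> : (l / K) `^ (2 - q) = (l `^ (q - 2))^-1 * K `^ (q - 2).
    rewrite powRM ?invr_ge0 ?(ltW l0) ?(ltW K_gt0)//; congr (_ * _).
      by rewrite -powRN; congr (_ `^ _); ring.
    rewrite -powR_inv1 ?(ltW K_gt0)// -powRrM; congr (_ `^ _); ring.
  rewrite powRr1 ?(ltW l0)// /c; field.
  by rewrite al10 !gt_eqF// powR_gt0.
rewrite (@fubini_tonelli _ _ _ _ _ mu mu _ mF) => [|z]; last by rewrite lee_fin.
apply: (@le_trans _ _ (\int[mu]_u ((c * K)%:E * (g u `^ p)%:E))%E).
  have mgp : measurable_fun setT (fun u => (g u `^ p)%:E).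
    by apply/measurable_EFinP; exact: (measurableT_comp (@measurable_powR R p)).
  apply: ge0_le_integral => //.
  - by move=> u _; apply: integral_ge0 => l _; rewrite lee_fin.
  - apply (@measurable_integral_param _ _ _ _ _ mu (fun u (l : R) => (F l u)%:E)).
    exact (@measurable_flip _ _ _ _ _ _ (fun (l : R) u => (F l u)%:E) mF).
  - exact: measurable_funeM.
  move=> u _ /=.
  have [gu0|gu0] := eqVneq (g u) 0.
    have -> : (\int[mu]_l (F l u)%:E = 0)%E.
      by apply: integral0_eq => l _; rewrite /F gu0 mul0r mulr0.
    by rewrite -EFinM lee_fin mulr_ge0 ?powR_ge0// mulr_ge0// ltW.
  have gu : 0 < g u by rewrite lt_def gu0 g0.
  have cg0 : 0 <= c * g u by apply: mulr_ge0.
  pose b := K * g u `^ (p - 1).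
  have b0 : 0 <= b by rewrite mulr_ge0 ?powR_ge0// ltW.
  apply: (@le_trans _ _ (\int[mu]_l ((c * g u)%:E * (pw 1 l * (l < b)%R%:R)%:E))%E).
    apply: ge0_le_integral => //.
    - by move=> l _; rewrite lee_fin.
    - exact: (measurable_curryl u mF).
    - apply: measurable_funeM; apply/measurable_EFinP; apply: measurable_funM; first exact: measurable_pw.
      exact: measurable_lt_nat.
    - move=> l _; rewrite -EFinM lee_fin /F mulrA; apply: ler_wpM2l => //.
      rewrite /pw; case: (ltP 0 l) => [l0|_]; last by rewrite !mul0r.
      rewrite !mul1r subrr powRr0 mul1r.
      case: (boolP ((l / K) `^ (q - 1) < g u)) => // H.
      suff -> : l < b by [].
      have lK0 : 0 <= l / K by rewrite divr_ge0 ?ltW.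
      have := @gt0_ltr_powR R (p - 1) _ _ _ _ _ H.
      rewrite !nnegrE powR_ge0 g0 => /(_ _ isT isT).
      rewrite -powRrM (_ : (q - 1) * (p - 1) = 1); last by rewrite /p; field.
      rewrite powRr1// ltr_pdivrMr// mulrC; apply.
      rewrite /p (_ : q / (q - 1) - 1 = (q - 1)^-1) ?invr_gt0//.
      by field.
  rewrite ge0_integralZl_EFin//; last 2 first.
  - by move=> l _; rewrite lee_fin mulr_ge0// pw_ge0.
  - by apply/measurable_EFinP; apply: measurable_funM; [exact: measurable_pw|exact: measurable_lt_nat].
  rewrite integral_pw// powRr1// -!EFinM lee_fin /b.
  have -> : g u `^ p = g u * g u `^ (p - 1) by rewrite mulr_powRB1// ltW.
  rewrite le_eqVlt; apply/orP; left; apply/eqP; ring.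
rewrite ge0_integralZl_EFin//; last 3 first.
- by move=> u _; rewrite lee_fin powR_ge0.
- by apply/measurable_EFinP; exact: (measurableT_comp (@measurable_powR R p)).
- by apply: mulr_ge0 => //; exact: ltW.
rewrite -[leRHS]mule1 lee_wpmul2l// lee_fin; apply: mulr_ge0 => //; exact: ltW.
Qed.

Lemma rieszZ (c : R) (g : R -> R) t : 0 <= c -> measurable_fun setT g -> (forall u, 0 <= g u) ->
  riesz (fun u => c * g u) t = (c%:E * riesz g t)%E.
Proof.
move=> c0 mg g0; rewrite /riesz -ge0_integralZl_EFin//.
- by apply: eq_integral => u _; rewrite -EFinM mulrCA.
- by move=> u _; rewrite lee_fin mulr_ge0 ?powR_ge0.
- apply/measurable_EFinP; apply: measurable_funM => //.
  by apply: (measurableT_comp (@measurable_powR R (- al))); apply: measurableT_comp => //; exact: measurable_funB.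
Qed.

Lemma riesz_ge0 g t : (forall u, 0 <= g u) -> (0 <= riesz g t)%E.
Proof. by move=> g0; apply: integral_ge0 => u _; rewrite lee_fin mulr_ge0 ?powR_ge0. Qed.

Let scale1 (g : R -> R) (N : R) : 0 < N -> measurable_fun setT g -> (forall u, 0 <= g u) ->
  (\int[mu]_u (g u `^ p)%:E <= N%:E)%E ->
  (\int[mu]_u ((N `^ (- p^-1) * g u) `^ p)%:E <= 1)%E.
Proof.
move=> N0 mg g0 gN.
under eq_integral do rewrite powRM ?powR_ge0// EFinM.
rewrite ge0_integralZl_EFin ?powR_ge0//; last 2 first.
- by move=> u _; rewrite lee_fin powR_ge0.
- by apply/measurable_EFinP; exact: (measurableT_comp (@measurable_powR R p)).
rewrite -powRrM mulNr mulVf ?gt_eqF// powR_inv1 ?(ltW N0)//.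
apply: (@le_trans _ _ ((N^-1)%:E * N%:E)%E).
  by rewrite lee_wpmul2l// lee_fin invr_ge0 ltW.
by rewrite -EFinM mulVf ?gt_eqF.
Qed.

Theorem hls (g : R -> R) (N : R) : 0 < N -> measurable_fun setT g -> (forall u, 0 <= g u) ->
  (\int[mu]_u (g u `^ p)%:E <= N%:E)%E ->
  (\int[mu]_t (riesz g t `^ q) <= (hls_cst * N `^ (q - 1))%:E)%E.
Proof.
move=> N0 mg g0 gN.
pose g1 u := N `^ (- p^-1) * g u.
have mg1 : measurable_fun setT g1 by exact: measurable_funM.
have g10 u : 0 <= g1 u by rewrite mulr_ge0 ?powR_ge0.
have := hls1 mg1 g10 (scale1 N0 mg g0 gN).
have gE : g = (fun u => N `^ p^-1 * g1 u).
  apply/funext => u; rewrite /g1 mulrA -powRD; last by rewrite (gt_eqF N0) implybT.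
  by rewrite subrr powRr0 mul1r.
have rE t : (riesz g t `^ q = (N `^ (q - 1))%:E * riesz g1 t `^ q)%E.
  rewrite gE rieszZ ?powR_ge0// poweRM ?lee_fin ?powR_ge0 ?riesz_ge0//.
  rewrite poweR_EFin -powRrM; congr ((_ `^ _)%:E * _)%E.
  by rewrite /p; field; rewrite q0 q10.
move=> H; under eq_integral do rewrite rE.
rewrite ge0_integralZl_EFin ?powR_ge0//; last 2 first.
- by move=> u _; rewrite poweR_ge0.
- apply: (@measurableT_comp _ _ _ _ _ _ (fun x : \bar R => x `^ q)%E) => //.
    exact: measurable_poweR.
  exact: measurable_riesz.
by rewrite mulrC EFinM lee_wpmul2l// lee_fin powR_ge0.
Qed.

Let young (x : R) (y : \bar R) : 0 <= x -> (0 <= y)%E -> (x%:E * y <= (x `^ p)%:E + y `^ q)%E.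
Proof.
move=> x0; case: y => [y| |//].
- rewrite lee_fin => y0; rewrite poweR_EFin -EFinM -EFinD lee_fin.
  have pq : p^-1 + q^-1 = 1 by rewrite /p; field; rewrite ?q0 ?q10.
  apply: le_trans (conjugate_powR x0 y0 p_gt0 q_gt0 pq) _.
  rewrite lerD// ler_piMr ?powR_ge0// invf_le1//.
    by rewrite ler_pdivlMr// mul1r gerBl ler01.
  by rewrite ltW// (lt_trans _ q2)// ltr1n.
- by move=> _; rewrite poweRyr// addey// leey.
Qed.

(** Once g is normalised so that its p-th power has integral at most 1, Young's inequality can
    replace Hoelder's, at the price of the constant 1 + [hls_cst]. *)
Theorem hls_bilinear (g : R -> R) (N : R) : 0 < N -> measurable_fun setT g -> (forall u, 0 <= g u) ->
  (\int[mu]_u (g u `^ p)%:E <= N%:E)%E ->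
  (\int[mu]_t ((g t)%:E * riesz g t) <= ((1 + hls_cst) * N `^ (2 / p))%:E)%E.
Proof.
move=> N0 mg g0 gN.
pose g1 u := N `^ (- p^-1) * g u.
have mg1 : measurable_fun setT g1 by exact: measurable_funM.
have g10 u : 0 <= g1 u by rewrite mulr_ge0 ?powR_ge0.
have g1N := scale1 N0 mg g0 gN.
have H := hls1 mg1 g10 g1N.
have gE u : g u = N `^ p^-1 * g1 u.
  rewrite /g1 mulrA -powRD; last by rewrite (gt_eqF N0) implybT.
  by rewrite subrr powRr0 mul1r.
have rE t : ((g t)%:E * riesz g t = (N `^ (2 / p))%:E * ((g1 t)%:E * riesz g1 t))%E.
  rewrite [in LHS](funext gE) rieszZ ?powR_ge0// EFinM muleACA -EFinM; congr (_%:E * _)%E.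
  by rewrite -powRD; [congr (_ `^ _); ring|rewrite (gt_eqF N0) implybT].
have mr := measurable_riesz mg1.
have mrq : measurable_fun setT (fun t => riesz g1 t `^ q)%E.
  by apply: (@measurableT_comp _ _ _ _ _ _ (fun x : \bar R => x `^ q)%E) => //; exact: measurable_poweR.
have mgp : measurable_fun setT (fun u => (g1 u `^ p)%:E).
  by apply/measurable_EFinP; exact: (measurableT_comp (@measurable_powR R p)).
under eq_integral do rewrite rE.
rewrite ge0_integralZl_EFin ?powR_ge0//; last 2 first.
- by move=> u _; rewrite mule_ge0 ?lee_fin ?riesz_ge0.
- by apply: emeasurable_funM => //; exact/measurable_EFinP.
rewrite [(1 + _) * _]mulrC EFinM lee_wpmul2l ?lee_fin ?powR_ge0//.
apply: (@le_trans _ _ (\int[mu]_t ((g1 t `^ p)%:E + riesz g1 t `^ q))%E).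
  apply: ge0_le_integral => //.
  - by move=> u _; rewrite mule_ge0 ?lee_fin ?riesz_ge0.
  - by apply: emeasurable_funM => //; exact/measurable_EFinP.
  - exact: emeasurable_funD.
  - by move=> u _; apply: young => //; exact: riesz_ge0.
rewrite ge0_integralD//; last 2 first.
- by move=> u _; rewrite lee_fin powR_ge0.
- by move=> u _; rewrite poweR_ge0.
by rewrite EFinD leeD.
Qed.

End hardy_littlewood_sobolev.

Section holder_real.
Context {R : realType} {d : measure_display} {T : measurableType d}.
Variable mu : {measure set T -> \bar R}.

Lemma Lnorm_le_powR (u : T -> R) (p A : R) : 0 < p -> 0 <= A -> (forall x, 0 <= u x) ->
  (\int[mu]_x (u x `^ p)%:E <= (A `^ p)%:E)%E -> ('N[mu]_p%:E[EFin \o u] <= A%:E)%E.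
Proof.
move=> p0 A0 u0 uA; rewrite unlock /=.
under eq_integral do rewrite ger0_norm//.
have -> : A%:E = ((A `^ p)%:E `^ p^-1)%E.
  by rewrite poweR_EFin -powRrM mulfV ?gt_eqF// powRr1.
apply: gt0_ler_poweR; rewrite ?invr_ge0 ?(ltW p0)// ?in_itv/= ?leey ?andbT ?lee_fin ?powR_ge0//.
by apply: integral_ge0 => x _; rewrite lee_fin powR_ge0.
Qed.

Lemma hoelder_le (u v : T -> R) (p p' A B : R) :
  measurable_fun setT u -> measurable_fun setT v ->
  (forall x, 0 <= u x) -> (forall x, 0 <= v x) ->
  0 < p -> 0 < p' -> p^-1 + p'^-1 = 1 -> 0 <= A -> 0 <= B ->
  (\int[mu]_x (u x `^ p)%:E <= (A `^ p)%:E)%E ->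
  (\int[mu]_x (v x `^ p')%:E <= (B `^ p')%:E)%E ->
  (\int[mu]_x (u x * v x)%:E <= (A * B)%:E)%E.
Proof.
move=> mu_ mv u0 v0 p0 p'0 pp A0 B0 uA vB.
have := hoelder mu mu_ mv p0 p'0 pp; rewrite Lnorm1.
under eq_integral do rewrite /= ger0_norm ?mulr_ge0//.
move=> H; apply: (le_trans H); rewrite EFinM.
by apply: lee_pmul; rewrite ?Lnorm_ge0// Lnorm_le_powR.
Qed.

End holder_real.

Lemma cintegral0 {R : realType} d (T : measurableType d) (mu : {measure set T -> \bar R}) (f : T -> R[i]) :
  (forall x, f x = 0) -> cintegral mu f = 0.
Proof.
move=> f0; rewrite (_ : f = fun=> 0); last exact/funext.
by apply: eq_ReIm; rewrite /= /Rintegral integral0.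
Qed.

Lemma cintegralR {R : realType} d (T : measurableType d) (mu : {measure set T -> \bar R}) (f : T -> R) :
  cintegral mu (fun x => (f x)%:C%C) = (\int[mu]_x f x)%:C%C.
Proof. by apply: eq_ReIm; rewrite /= /Rintegral ?integral0. Qed.

Section powR_facts.
Context {R : realType}.
Implicit Types x e lo hi : R.

(** Covers both signs of the exponent at once; it is applied to q/r - 1, which may have either
    sign. *)
Lemma powR_le_add lo hi x e : 0 < lo -> lo <= x -> x <= hi -> x `^ e <= lo `^ e + hi `^ e.
Proof.
move=> lo0 lx xh; have x0 : 0 < x := lt_le_trans lo0 lx.
have [e0|/ltW e0] := leP 0 e.
  rewrite (le_trans (y := hi `^ e))// ?lerDr ?powR_ge0//.
  by rewrite ge0_ler_powR// nnegrE ltW// (lt_le_trans x0).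
rewrite (le_trans (y := lo `^ e))// ?lerDl ?powR_ge0//.
rewrite -[e]opprK !(powRN _ (- e)) lef_pV2 ?posrE ?powR_gt0//.
by rewrite ge0_ler_powR ?oppr_ge0// nnegrE ltW.
Qed.

Lemma cvg_powR (u : nat -> R) (l : R) e : 0 < l -> u n @[n --> \oo] --> l ->
  u n `^ e @[n --> \oo] --> l `^ e.
Proof.
move=> l0 ul; apply: (cvg_comp u (fun x => x `^ e) ul).
have d := @derivable_powR R 1 e l.
suff H : {for l, continuous (fun x : R => x `^ e)} by exact H.
apply: differentiable_continuous.
by apply/derivable1_diffP; apply: d; rewrite in_itv/= l0.
Qed.

Lemma bool01 (b : bool) : 0 <= (b%:R : R) <= 1.
Proof. by case: b; rewrite ?lexx ler01. Qed.

End powR_facts.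

(** * The TT* argument *)

Section ttstar.
Context {R : realType} {d : measure_display} {T : measurableType d}.
Variable mu : {sigma_finite_measure set T -> \bar R}.
Variables (k : R -> T -> T -> R[i]) (kap : R -> R) (w : nat -> T -> R).
Variables (q r a b : R).
Hypotheses (r2 : 2 < r) (q2 : 2 < q) (a0 : 0 < a).
Hypothesis bE : b * (r - 2) / r = 2 / q.
Hypothesis mk : cmeasurable (fun z : R * (T * T) => k z.1 z.2.1 z.2.2).
Hypothesis mkap : measurable_fun setT kap.
Hypothesis kE : forall t x y, cmod (k t x y) <= kap t.
Hypotheses (mw : forall j, measurable_fun setT (w j)) (w0 : forall j y, 0 <= w j y).
Hypothesis w1 : forall j y, w j y <= 1.
Hypothesis iw : forall j, mu.-integrable setT (EFin \o w j).
Hypothesis wcvg : forall y, w j y @[j --> \oo] --> (1 : R).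

Definition kop t (f : T -> R[i]) x : R[i] := cintegral mu (fun y => k t x y * f y).
Definition kadj t (f : T -> R[i]) y : R[i] := cintegral mu (fun x => (k t x y)^*%C * f x).

Hypothesis kop2 : forall t f, cL12 mu f ->
  (\int[mu]_x (cmod (kop t f x) ^+ 2)%:E <= \int[mu]_x (cmod (f x) ^+ 2)%:E)%E.
Hypothesis kadj2 : forall t f, cL12 mu f ->
  (\int[mu]_x (cmod (kadj t f x) ^+ 2)%:E <= \int[mu]_x (cmod (f x) ^+ 2)%:E)%E.
(** The weight sits on the intermediate variable y, in which the product of two bounded kernels need
    not be integrable. The bound does not depend on j, which is what allows the weight to be removed
    at the end. *)
Hypothesis kTT : forall j t s x x', t != s ->
  cmod (cintegral mu (fun y => (w j y)%:C%C * (k t x y * (k s x' y)^*%C))) <= a * `|t - s| `^ (- b).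

Let kap0 t : T -> 0 <= kap t.
Proof. by move=> x; exact: le_trans (cmod_ge0 _) (kE t x x). Qed.

Let mkt t : cmeasurable (fun z : T * T => k t z.1 z.2).
Proof. exact (cmeasurable_comp mk (measurable_pair1 t)). Qed.

Let mkty t y : cmeasurable (fun x => k t x y).
Proof. exact (cmeasurable_comp (mkt t) (measurable_pair2 y)). Qed.

Let mktx t x : cmeasurable (fun y => k t x y).
Proof. exact (cmeasurable_comp (mkt t) (measurable_pair1 x)). Qed.

Let swapm : measurable_fun setT (fun z : T * T => (z.2, z.1)).
Proof. by apply/measurable_fun_pairP; split => /=; [exact: measurable_snd|exact: measurable_fst]. Qed.

Let L1 (f : T -> R[i]) := (\int[mu]_x cmod (f x))%R.

Let L1_ge0 f : 0 <= L1 f.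
Proof. by apply: Rintegral_ge0 => x _; exact: cmod_ge0. Qed.

Let ikop t x f : cL12 mu f -> cintegrable mu (fun y => k t x y * f y).
Proof.
case=> mf f1 _; apply: (@cintegrable_le _ _ _ mu _ (fun y => kap t * cmod (f y))).
- exact: cmeasurableM.
- by rewrite /comp; under eq_fun do rewrite EFinM; exact: integrableZl.
- by move=> y; rewrite cmodM ler_wpM2r ?cmod_ge0.
Qed.

Let ikadj t y f : cL12 mu f -> cintegrable mu (fun x => (k t x y)^*%C * f x).
Proof.
case=> mf f1 _; apply: (@cintegrable_le _ _ _ mu _ (fun y => kap t * cmod (f y))).
- by apply: cmeasurableM => //; exact: cmeasurable_conj.
- by rewrite /comp; under eq_fun do rewrite EFinM; exact: integrableZl.
- by move=> x; rewrite cmodM cmod_conj ler_wpM2r ?cmod_ge0.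
Qed.

Lemma cmeasurable_kop t f : cmeasurable f -> cmeasurable (kop t f).
Proof.
move=> mf; apply (@cmeasurable_cintegral _ _ _ _ _ mu (fun x y => k t x y * f y)).
by apply: cmeasurableM => //; exact: (cmeasurable_comp mf measurable_snd).
Qed.

Lemma cmeasurable_kadj t f : cmeasurable f -> cmeasurable (kadj t f).
Proof.
move=> mf; apply (@cmeasurable_cintegral _ _ _ _ _ mu (fun y x => (k t x y)^*%C * f x)).
apply: cmeasurableM; last exact: (cmeasurable_comp mf measurable_snd).
apply: cmeasurable_conj; exact (cmeasurable_comp (mkt t) swapm).
Qed.

Lemma cmod_kop t f x : cL12 mu f -> cmod (kop t f x) <= kap t * L1 f.
Proof.
move=> fL; have [mf f1 _] := fL; rewrite /L1 -RintegralZl//.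
apply: cmod_cintegral_bound.
- exact: cmeasurableM.
- by rewrite /comp; under eq_fun do rewrite EFinM; exact: integrableZl.
- by move=> y; rewrite cmodM ler_wpM2r ?cmod_ge0.
Qed.

Lemma cmod_kadj t f y : cL12 mu f -> cmod (kadj t f y) <= kap t * L1 f.
Proof.
move=> fL; have [mf f1 _] := fL; rewrite /L1 -RintegralZl//.
apply: cmod_cintegral_bound.
- by apply: cmeasurableM => //; exact: cmeasurable_conj.
- by rewrite /comp; under eq_fun do rewrite EFinM; exact: integrableZl.
- by move=> x; rewrite cmodM cmod_conj ler_wpM2r ?cmod_ge0.
Qed.

(** The image of f under the adjoint is only known to be bounded and square integrable; the weight
    brings it into L^1, so that [kop] can be applied to it. *)
Let wadj j s f y : R[i] := (w j y)%:C%C * kadj s f y.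

Let iwZ j (c : R) : mu.-integrable setT (EFin \o (fun y => c * w j y)).
Proof.
rewrite /comp; under eq_fun do rewrite EFinM.
exact (integrableZl measurableT c (iw j)).
Qed.

Let wadjL j s f : cL12 mu f -> cL12 mu (wadj j s f).
Proof.
move=> fL; have [mf f1 f2] := fL.
have mW : cmeasurable (wadj j s f).
  by apply: cmeasurableM; [exact: cmeasurableR|exact: cmeasurable_kadj].
have E y : cmod (wadj j s f y) = w j y * cmod (kadj s f y) by rewrite cmodM cmodR ger0_norm.
split => //.
- apply: (@le_integrable _ _ _ mu _ measurableT _ (EFin \o (fun y => (kap s * L1 f) * w j y)) _ _ (iwZ j _)).
  + by apply/measurable_EFinP; exact: measurable_cmod.
  + move=> y _; rewrite lee_fin E ger0_norm ?mulr_ge0 ?cmod_ge0//.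
    rewrite (le_trans _ (ler_norm _))// mulrC ler_wpM2r//; exact: cmod_kadj.
- apply: (@le_integrable _ _ _ mu _ measurableT _ (EFin \o (fun y => ((kap s * L1 f) ^+ 2) * w j y)) _ _ (iwZ j _)).
  + exact: measurable_cmod_sqr.
  + move=> y _; rewrite lee_fin E ger0_norm ?sqr_ge0// exprMn mulrC.
    rewrite (le_trans _ (ler_norm _))//; apply: ler_pM; rewrite ?sqr_ge0//.
      by rewrite ler_pXn2r// ?nnegrE ?cmod_ge0 ?mulr_ge0 ?(kap0 _ y)//; exact: cmod_kadj.
    by rewrite expr2 ler_piMr.
Qed.

Definition ttop j t s (f : T -> R[i]) x : R[i] := kop t (wadj j s f) x.

Let ttopD j t s f g y : cL12 mu f -> cL12 mu g ->
  ttop j t s (fun x => f x + g x) y = ttop j t s f y + ttop j t s g y.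
Proof.
move=> fL gL; rewrite /ttop /kop -cintegralD.
- apply: eq_cintegral => z; rewrite -mulrDr /wadj -mulrDr; congr (_ * (_ * _)).
  rewrite /kadj -cintegralD; [|exact: ikadj|exact: ikadj].
  by apply: eq_cintegral => x; rewrite mulrDr.
- by apply: ikop; exact: wadjL.
- by apply: ikop; exact: wadjL.
Qed.

Let ttopm j t s f : cL12 mu f -> cmeasurable (ttop j t s f).
Proof. by move=> fL; apply: cmeasurable_kop; case: (wadjL j s fL). Qed.

Let ttop2 j t s f : cL12 mu f ->
  (\int[mu]_y (cmod (ttop j t s f y) ^+ 2)%:E <= \int[mu]_x (cmod (f x) ^+ 2)%:E)%E.
Proof.
move=> fL; apply: (le_trans (kop2 t (wadjL j s fL))).
apply: le_trans (kadj2 s fL).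
have mA : cmeasurable (kadj s f) by apply: cmeasurable_kadj; case: fL.
apply: ge0_le_integral => //.
- by move=> y _; rewrite lee_fin sqr_ge0.
- by apply: measurable_cmod_sqr; case: (wadjL j s fL).
- exact: measurable_cmod_sqr.
- move=> y _; rewrite lee_fin ler_pXn2r// ?nnegrE ?cmod_ge0// cmodM cmodR ger0_norm//.
  by rewrite ler_piMl ?cmod_ge0.
Qed.

(** Exchanging the integrals exposes the kernel of the composite operator, which [kTT] bounds
    pointwise. *)
Let ttop1 j t s f y : t != s -> cL12 mu f ->
  ((cmod (ttop j t s f y))%:E <= (a * `|t - s| `^ (- b))%:E * \int[mu]_x (cmod (f x))%:E)%E.
Proof.
move=> ts fL; have [mf f1 _] := fL.
have mfs : cmeasurable (fun z : T * T => f z.2) by exact: (cmeasurable_comp mf measurable_snd).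
pose F (x' z : T) : R[i] := (w j z)%:C%C * (k t y z * (k s x' z)^*%C) * f x'.
have FE : ttop j t s f y = cintegral mu (fun x' => cintegral mu (F x')).
  rewrite (@cfubini _ _ _ _ _ mu mu (fun x' => cmod (f x')) (fun z => (kap t * kap s) * w j z) f1 (iwZ j _)) //.
  - apply: eq_cintegral => z; rewrite /wadj /kadj mulrA -cintegralZ; last exact: ikadj.
    by apply: eq_cintegral => x' /=; rewrite /F; ring.
  - by move=> x; exact: cmod_ge0.
  - by move=> x; rewrite !mulr_ge0// (kap0 _ x).
  - rewrite /F; apply: cmeasurableM; last exact: (cmeasurable_comp mf measurable_fst).
    apply: cmeasurableM; first by apply: cmeasurableR; exact: (measurableT_comp (mw j) measurable_snd).
    apply: cmeasurableM; first exact: (cmeasurable_comp (mktx t y) measurable_snd).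
    exact: cmeasurable_conj.
  - move=> x z; rewrite /F !cmodM cmod_conj cmodR ger0_norm// [leRHS]mulrC; apply: ler_wpM2r; first exact: cmod_ge0.
    rewrite [leRHS]mulrC; apply: ler_wpM2l => //; apply: ler_pM; rewrite ?cmod_ge0//.
have FZ x' : cintegral mu (F x') =
    cintegral mu (fun z => (w j z)%:C%C * (k t y z * (k s x' z)^*%C)) * f x'.
  rewrite mulrC -cintegralZ.
    by apply: eq_cintegral => z; rewrite /F mulrC.
  apply: (@cintegrable_le _ _ _ mu _ (fun z => (kap t * kap s) * w j z) _ (iwZ j _)) => //.
  - apply: cmeasurableM; first exact: cmeasurableR.
    apply: cmeasurableM => //; apply: cmeasurable_conj; exact: mktx.
  - move=> z; rewrite !cmodM cmod_conj cmodR ger0_norm// [leRHS]mulrC; apply: ler_wpM2l => //.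
    by apply: ler_pM; rewrite ?cmod_ge0//.
rewrite FE; under eq_cintegral do rewrite FZ.
have i1 := integrable_fin_num measurableT f1.
rewrite -(fineK i1) -EFinM lee_fin -/(L1 f) -RintegralZl//.
apply: cmod_cintegral_bound.
- have mfF : cmeasurable (fun z : T * T => F z.1 z.2).
    rewrite /F; apply: cmeasurableM; last exact: (cmeasurable_comp mf measurable_fst).
    apply: cmeasurableM; first by apply: cmeasurableR; exact: (measurableT_comp (mw j) measurable_snd).
    apply: cmeasurableM; first exact: (cmeasurable_comp (mktx t y) measurable_snd).
    exact: cmeasurable_conj.
  have := @cmeasurable_cintegral _ _ _ _ _ mu F mfF.
  by under eq_fun do rewrite FZ.
- by rewrite /comp; under eq_fun do rewrite EFinM; exact: integrableZl.
- by move=> x; rewrite cmodM ler_wpM2r ?cmod_ge0// kTT.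
Qed.

Lemma ttop_interpolation j t s f N : t != s -> 0 < N -> cL12 mu f ->
  (\int[mu]_x (cmod (f x) `^ (r / (r - 1)))%:E <= N%:E)%E ->
  (\int[mu]_y (cmod (ttop j t s f y) `^ r)%:E <=
    (interp_cst r * (a * `|t - s| `^ (- b)) `^ (r - 2) * N `^ (r - 1))%:E)%E.
Proof.
move=> ts N0; apply: interpolation => //.
- by rewrite mulr_gt0// powR_gt0// normr_gt0 subr_eq0.
- by move=> g h y; exact: ttopD.
- by move=> g; exact: ttopm.
- by move=> g y; exact: ttop1.
- by move=> g; exact: ttop2.
Qed.

(** The transpose, without conjugation: dual to [kop] for the bilinear pairing given by the integral
    of a product. *)
Definition kT t (f : T -> R[i]) y : R[i] := cintegral mu (fun x => k t x y * f x).

Lemma kT_conj t f y : cL12 mu f -> (kT t f y)^*%C = kadj t (fun x => (f x)^*%C) y.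
Proof.
move=> fL; rewrite /kT /kadj -cintegral_conj.
  by apply: eq_cintegral => x; rewrite conjcM.
have [mf f1 _] := fL.
apply: (@cintegrable_le _ _ _ mu _ (fun x => kap t * cmod (f x))).
- exact: cmeasurableM.
- by rewrite /comp; under eq_fun do rewrite EFinM; exact: integrableZl.
- by move=> x; rewrite cmodM ler_wpM2r ?cmod_ge0.
Qed.

(** The r-th root of the interpolation constant, with the power of the time lag taken out. *)
Definition tt_cst : R := (interp_cst r * a `^ (r - 2)) `^ r^-1.

Let r_gt0 : 0 < r. Proof. exact: lt_trans r2. Qed.
Let r1_gt0 : 0 < r - 1. Proof. by rewrite subr_gt0 (lt_trans _ r2)// ltr1n. Qed.
Let r0 : r != 0. Proof. by rewrite gt_eqF. Qed.
Let r10 : r - 1 != 0. Proof. by rewrite gt_eqF. Qed.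

(** The pairing is the integral of f against [ttop] of the conjugate of g, so Hoelder's inequality
    with r' and r and the interpolated bound apply; [bE] turns the exponent b (r-2)/r of the time
    lag into 2/q. *)
Lemma tt_pair j t s f g A B : t != s -> cL12 mu f -> cL12 mu g -> 0 < A -> 0 < B ->
  (\int[mu]_x (cmod (f x) `^ (r / (r - 1)))%:E <= (A `^ (r / (r - 1)))%:E)%E ->
  (\int[mu]_x (cmod (g x) `^ (r / (r - 1)))%:E <= (B `^ (r / (r - 1)))%:E)%E ->
  cmod (cintegral mu (fun y => (w j y)%:C%C * (kT t f y * (kT s g y)^*%C))) <=
    tt_cst * `|t - s| `^ (- (2 / q)) * (A * B).
Proof.
move=> ts fL gL A0 B0 fA gB.
have [mf f1 _] := fL; have [mg g1 _] := gL.
have gcL := cL12_conj gL.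
pose h := ttop j t s (fun x => (g x)^*%C).
have mh : cmeasurable h by exact: ttopm.
have iwk : cintegrable mu (wadj j s (fun x => (g x)^*%C)) by apply: cL12_cintegrable; exact: wadjL.
have -> : cintegral mu (fun y => (w j y)%:C%C * (kT t f y * (kT s g y)^*%C)) =
    cintegral mu (fun x => f x * h x).
  pose F (y x : T) := f x * (k t x y * wadj j s (fun x => (g x)^*%C) y).
  transitivity (cintegral mu (fun y => cintegral mu (F y))).
    apply: eq_cintegral => y; rewrite kT_conj// mulrCA mulrC -cintegralZ.
      by apply: eq_cintegral => x; rewrite /F /wadj; ring.
    apply: (@cintegrable_le _ _ _ mu _ (fun x => kap t * cmod (f x))).
    - exact: cmeasurableM.
    - by rewrite /comp; under eq_fun do rewrite EFinM; exact: integrableZl.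
    - by move=> x; rewrite cmodM ler_wpM2r ?cmod_ge0.
  have [mwa wa1 _] := wadjL j s gcL.
  rewrite (@cfubini _ _ _ _ _ mu mu (fun y => cmod (wadj j s (fun x => (g x)^*%C) y))
    (fun x => kap t * cmod (f x))) //.
  - apply: eq_cintegral => x; rewrite /h /ttop /kop -cintegralZ//.
    exact: ikop (wadjL j s gcL).
  - by rewrite /comp; under eq_fun do rewrite EFinM; exact: integrableZl.
  - by move=> y; exact: cmod_ge0.
  - by move=> x; rewrite mulr_ge0 ?cmod_ge0// (kap0 _ x).
  - apply: cmeasurableM; first exact: (cmeasurable_comp mf measurable_snd).
    apply: cmeasurableM; last exact: (cmeasurable_comp mwa measurable_fst).
    exact (cmeasurable_comp (mkt t) swapm).
  - move=> y x; rewrite /F (cmodM (f x)) (cmodM (k t x y)) mulrA [leLHS]mulrC; apply: ler_wpM2l; first exact: cmod_ge0.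
    by rewrite mulrC; apply: ler_wpM2r; rewrite ?cmod_ge0.
have H := @ttop_interpolation j t s _ (B `^ (r / (r - 1))) ts (powR_gt0 _ B0) gcL.
have {H} : (\int[mu]_y (cmod (h y) `^ r)%:E <=
    ((tt_cst * `|t - s| `^ (- (2 / q)) * B) `^ r)%:E)%E.
  have ts0 : 0 < `|t - s| by rewrite normr_gt0 subr_eq0.
  rewrite (_ : _ `^ r = interp_cst r * (a * `|t - s| `^ (- b)) `^ (r - 2) * (B `^ (r / (r - 1))) `^ (r - 1)).
    by apply: H; under eq_integral do rewrite cmod_conj.
  have ic0 : 0 <= interp_cst r * a `^ (r - 2).
    by apply: mulr_ge0; [exact: ltW (interp_cst_gt0 r2)|exact: powR_ge0].
  rewrite powRM ?mulr_ge0 ?powR_ge0 ?(ltW B0)// powRM ?powR_ge0//.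
  rewrite /tt_cst -!powRrM mulVf// powRr1//.
  rewrite powRM ?powR_ge0 ?(ltW a0)// -powRrM !mulrA; congr (_ * _ `^ _ * _ `^ _).
    by rewrite -bE; field.
  by field.
move=> hB.
rewrite -lee_fin; apply: (@le_trans _ _ (\int[mu]_x (cmod (f x) * cmod (h x))%:E)%E).
  apply: le_trans (cmod_cintegral_le _) _.
    have hb x : cmod (h x) <= kap t * L1 (wadj j s (fun x => (g x)^*%C)).
      by apply: cmod_kop; exact: wadjL.
    apply: (@cintegrable_le _ _ _ mu _ (fun x => (kap t * L1 (wadj j s (fun x => (g x)^*%C))) * cmod (f x))).
    - exact: cmeasurableM.
    - by rewrite /comp; under eq_fun do rewrite EFinM; exact: integrableZl.
    - by move=> x; rewrite cmodM mulrC; apply: ler_wpM2r; rewrite ?cmod_ge0.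
  by rewrite le_eqVlt; apply/orP; left; apply/eqP; apply: eq_integral => x _; rewrite cmodM.
rewrite [leRHS](_ : _ = (A * (tt_cst * `|t - s| `^ (- (2 / q)) * B))%:E); last by congr EFin; ring.
apply: (@hoelder_le _ _ _ mu _ _ (r / (r - 1)) r) => //.
- exact: measurable_cmod.
- exact: measurable_cmod.
- by move=> x; exact: cmod_ge0.
- by move=> x; exact: cmod_ge0.
- by rewrite divr_gt0.
- by field; rewrite r0 r10.
- exact: ltW.
- by rewrite !mulr_ge0 ?powR_ge0 ?(ltW B0).
Qed.

(** The squared norm of a time integral is a double time integral of pairings. These are bounded by
    the Riesz kernel, and [hls_bilinear] sums them. The majorant [c1 * tau t] justifies the
    exchanges of integrals and leaves no trace in the constant. *)
Lemma tt_square (A : R -> T -> R[i]) (g tau : R -> R) (K c1 N : R) :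
  cmeasurable (fun z : R * T => A z.1 z.2) ->
  measurable_fun setT g -> (forall t, 0 <= g t) ->
  lebesgue_measure.-integrable setT (EFin \o tau) -> (forall t, 0 <= tau t) ->
  0 <= c1 -> 0 <= K -> (forall t y, cmod (A t y) <= c1 * tau t) ->
  (forall j t s, t != s ->
    cmod (cintegral mu (fun y => (w j y)%:C%C * (A t y * (A s y)^*%C))) <=
      K * `|t - s| `^ (- (2 / q)) * (g t * g s)) ->
  0 < N -> (\int[lebesgue_measure]_t (g t `^ (q / (q - 1)))%:E <= N%:E)%E ->
  (\int[mu]_y (cmod (cintegral lebesgue_measure (fun t => A t y)) ^+ 2)%:E <=
    (K * ((1 + hls_cst q) * N `^ (2 / (q / (q - 1)))))%:E)%E.
Proof.
move=> mA mg g0 itau tau0 c10 K0 Ac AA N0 gN.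
have mA' : cmeasurable (fun z : T * R => A z.2 z.1).
  have m3 : measurable_fun setT (fun z : T * R => (z.2, z.1)).
    by apply/measurable_fun_pairP; split => /=; [exact: measurable_snd|exact: measurable_fst].
  exact (cmeasurable_comp mA m3).
have mAt t : cmeasurable (A t) by exact (cmeasurable_comp mA (measurable_pair1 t)).
have mAy y : cmeasurable (fun t => A t y) by exact (cmeasurable_comp mA (measurable_pair2 y)).
pose Phi y := cintegral lebesgue_measure (fun t => A t y).
have itc e : lebesgue_measure.-integrable setT (EFin \o (fun t : R => e * tau t)).
  by rewrite /comp; under eq_fun do rewrite EFinM; exact: integrableZl.
have mPhi : cmeasurable Phi.
  exact (@cmeasurable_cintegral _ _ _ _ _ lebesgue_measure (fun y t => A t y) mA').
have ile (h : R -> R[i]) e : cmeasurable h -> (forall t, cmod (h t) <= e * tau t) ->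
    cintegrable (@lebesgue_measure R) h.
  move=> mh he.
  apply: (@cintegrable_le _ _ _ (@lebesgue_measure R) h (fun t : R => e * tau t)) => //.
have iA y : cintegrable (@lebesgue_measure R) (fun t : R => A t y).
  exact: ile (mAy y) (fun t => Ac t y).
pose c2 := \int[lebesgue_measure]_t (c1 * tau t).
have c20 : 0 <= c2 by apply: Rintegral_ge0 => t _; rewrite mulr_ge0.
have Phic y : cmod (Phi y) <= c2.
  apply: (@cmod_cintegral_bound _ _ _ (@lebesgue_measure R) (fun t : R => A t y) (fun t : R => c1 * tau t)) => //.
  exact (mAy y).
apply: (@fatou_bound _ _ _ _ (fun j y => (w j y * cmod (Phi y) ^+ 2)%:E)).
- move=> j; apply/measurable_EFinP; apply: measurable_funM => //; apply: measurable_funX; exact: measurable_cmod.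
- by move=> j y; rewrite lee_fin mulr_ge0// sqr_ge0.
- move=> y; apply: cvg_EFin; first exact: nearW.
  rewrite /comp/= -[X in _ --> X]mul1r; apply: cvgMl; exact: wcvg.
move=> j.
pose J t := cintegral mu (fun y => (w j y)%:C%C * (A t y * (Phi y)^*%C)).
have iwP : mu.-integrable setT (EFin \o (fun y => w j y * cmod (Phi y) ^+ 2)).
  apply: (@le_integrable _ _ _ mu _ measurableT _ (EFin \o (fun x => (c2 ^+ 2) * w j x))) => //.
  + apply/measurable_EFinP; apply: measurable_funM => //; apply: measurable_funX; exact: measurable_cmod.
  + move=> y _; rewrite lee_fin.
    have H : w j y * cmod (Phi y) ^+ 2 <= c2 ^+ 2 * w j y.
      rewrite mulrC; apply: ler_wpM2r => //.
      by rewrite ler_pXn2r ?nnegrE ?cmod_ge0.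
    rewrite (ger0_norm (mulr_ge0 (w0 j y) (sqr_ge0 _))); exact: le_trans H (ler_norm _).
have SE : cintegral mu (fun y => (w j y)%:C%C * (Phi y * (Phi y)^*%C)) =
    (\int[mu]_y (w j y * cmod (Phi y) ^+ 2))%:C%C.
  by rewrite -cintegralR; apply: eq_cintegral => y; rewrite mulc_conj -rmorphM.
have SJ : cintegral mu (fun y => (w j y)%:C%C * (Phi y * (Phi y)^*%C)) = cintegral lebesgue_measure J.
  pose F (y : T) (t : R) := (w j y)%:C%C * (A t y * (Phi y)^*%C).
  transitivity (cintegral mu (fun y => cintegral lebesgue_measure (F y))).
    apply: eq_cintegral => y; rewrite [Phi y * _]mulrC mulrA -cintegralZ.
      by apply: eq_cintegral => t; rewrite /F; ring.
    exact: iA.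
  rewrite (@cfubini _ _ _ _ _ mu lebesgue_measure (fun y => c2 * w j y) (fun t => c1 * tau t) (iwZ j _) (itc c1)).
  - exact: erefl.
  - by move=> y; rewrite mulr_ge0.
  - by move=> t; rewrite mulr_ge0.
  - rewrite /F; apply: cmeasurableM; first by apply: cmeasurableR; exact: (measurableT_comp (mw j) measurable_fst).
    apply: cmeasurableM => //; apply: cmeasurable_conj; exact: (cmeasurable_comp mPhi measurable_fst).
  - move=> y t; rewrite /F !cmodM cmod_conj cmodR ger0_norm// [leRHS](_ : _ = w j y * ((c1 * tau t) * c2)); last by ring.
    by apply: ler_wpM2l => //; apply: ler_pM; rewrite ?cmod_ge0.
have Jb t : cmod (J t) <= (c1 * c2 * \int[mu]_y w j y) * tau t.
  apply: (@le_trans _ _ (\int[mu]_y ((c1 * tau t * c2) * w j y))).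
    apply: cmod_cintegral_bound => //.
    - apply: cmeasurableM; first exact: cmeasurableR.
      by apply: cmeasurableM => //; exact: cmeasurable_conj.
    - move=> y; rewrite !cmodM cmod_conj cmodR ger0_norm// [leRHS]mulrC; apply: ler_wpM2l => //.
      by apply: ler_pM; rewrite ?cmod_ge0.
  by rewrite RintegralZl//; rewrite le_eqVlt; apply/orP; left; apply/eqP; ring.
have mJ : cmeasurable J.
  apply (@cmeasurable_cintegral _ _ _ _ _ mu (fun (t : R) y => (w j y)%:C%C * (A t y * (Phi y)^*%C))).
  apply: cmeasurableM; first by apply: cmeasurableR; exact: (measurableT_comp (mw j) measurable_snd).
  apply: cmeasurableM => //; apply: cmeasurable_conj; exact: (cmeasurable_comp mPhi measurable_snd).
have JE t : J t = cintegral lebesgue_measure (fun s => cintegral mu (fun y => (w j y)%:C%C * (A t y * (A s y)^*%C))).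
  pose F (y : T) (s : R) := (w j y)%:C%C * (A t y * (A s y)^*%C).
  transitivity (cintegral mu (fun y => cintegral lebesgue_measure (F y))).
    apply: eq_cintegral => y; rewrite /Phi -cintegral_conj// mulrA -cintegralZ.
      by apply: eq_cintegral => s; rewrite /F mulrA.
    apply: (ile _ c1); first by apply: cmeasurable_conj.
    by move=> s; rewrite cmod_conj; exact: Ac.
  rewrite (@cfubini _ _ _ _ _ mu lebesgue_measure (fun y => (c1 * tau t) * w j y) (fun t => c1 * tau t) (iwZ j _) (itc c1)).
  - exact: erefl.
  - by move=> y; rewrite !mulr_ge0.
  - by move=> s; rewrite mulr_ge0.
  - rewrite /F; apply: cmeasurableM; first by apply: cmeasurableR; exact: (measurableT_comp (mw j) measurable_fst).
    apply: cmeasurableM; first exact: (cmeasurable_comp (mAt t) measurable_fst).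
    exact: cmeasurable_conj.
  - move=> y s; rewrite /F !cmodM cmod_conj cmodR ger0_norm// [leRHS](_ : _ = w j y * ((c1 * tau t) * (c1 * tau s))); last by ring.
    by apply: ler_wpM2l => //; apply: ler_pM; rewrite ?cmod_ge0.
have JR t : ((cmod (J t))%:E <= K%:E * ((g t)%:E * riesz q g t))%E.
  have mpair : cmeasurable (fun s => cintegral mu (fun y => (w j y)%:C%C * (A t y * (A s y)^*%C))).
    apply (@cmeasurable_cintegral _ _ _ _ _ mu (fun (s : R) y => (w j y)%:C%C * (A t y * (A s y)^*%C))).
    apply: cmeasurableM; first by apply: cmeasurableR; exact: (measurableT_comp (mw j) measurable_snd).
    apply: cmeasurableM; first exact: (cmeasurable_comp (mAt t) measurable_snd).
    exact: cmeasurable_conj.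
  have mts : measurable_fun setT (fun s : R => `|t - s| `^ (- (2 / q)) * g s).
    apply: measurable_funM => //; apply: (measurableT_comp (@measurable_powR R _)).
    by apply: measurableT_comp => //; exact: measurable_funB.
  rewrite JE; apply: le_trans (cmod_cintegral_le _) _.
    apply: (ile _ (c1 * tau t * (\int[mu]_y w j y) * c1)) => // s.
    apply: (@le_trans _ _ (\int[mu]_y ((c1 * tau t * (c1 * tau s)) * w j y))); last first.
      by rewrite RintegralZl//; rewrite le_eqVlt; apply/orP; left; apply/eqP; ring.
    apply: cmod_cintegral_bound => //.
    - apply: cmeasurableM; first exact: cmeasurableR.
      by apply: cmeasurableM => //; exact: cmeasurable_conj.
    - move=> y; rewrite !cmodM cmod_conj cmodR ger0_norm// [leRHS]mulrC; apply: ler_wpM2l => //.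
      by apply: ler_pM; rewrite ?cmod_ge0.
  apply: (@le_trans _ _ (\int[lebesgue_measure]_s ((K * g t) * (`|t - s| `^ (- (2 / q)) * g s))%:E)%E).
    apply: ae_ge0_le_integral => //.
    - by move=> s _; rewrite lee_fin cmod_ge0.
    - by apply/measurable_EFinP; exact: measurable_cmod.
    - by move=> s _; rewrite lee_fin !mulr_ge0 ?powR_ge0.
    - by apply/measurable_EFinP; exact: measurable_funM.
    (* The pairings are controlled off the diagonal; the single time s = t is negligible. *)
    - exists [set t]; split => //; first exact: lebesgue_measure_set1.
      move=> s /= H; apply: contrapT => /eqP st; apply: H => _.
      have ts : t != s by rewrite eq_sym.
      rewrite lee_fin [leRHS](_ : _ = K * `|t - s| `^ (- (2 / q)) * (g t * g s)); last by ring.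
      exact: AA.
  under eq_integral do rewrite EFinM.
  rewrite ge0_integralZl_EFin//.
  - by rewrite EFinM muleA.
  - by move=> s _; rewrite lee_fin mulr_ge0// powR_ge0.
  - exact/measurable_EFinP.
  - by rewrite mulr_ge0// powR_ge0.
have iwPf := integrable_fin_num measurableT iwP.
have S0 : 0 <= \int[mu]_y (w j y * cmod (Phi y) ^+ 2) by apply: Rintegral_ge0 => y _; rewrite mulr_ge0// sqr_ge0.
rewrite -(fineK iwPf) -[fine _](ger0_norm S0) -(cmodR (fine _)) -/(Rintegral _ _ _) -SE SJ.
apply: le_trans (cmod_cintegral_le _) _.
  exact: ile mJ Jb.
apply: (@le_trans _ _ (\int[lebesgue_measure]_t (K%:E * ((g t)%:E * riesz q g t)))%E).
  have mr : measurable_fun setT (fun t => (g t)%:E * riesz q g t)%E.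
    by apply: emeasurable_funM; [exact/measurable_EFinP|exact: measurable_riesz].
  apply: ge0_le_integral => //.
  - by move=> t _; rewrite lee_fin cmod_ge0.
  - by apply/measurable_EFinP; exact: measurable_cmod.
  - exact: measurable_funeM.
rewrite ge0_integralZl_EFin//; last 2 first.
- by move=> t _; rewrite mule_ge0// ?lee_fin// riesz_ge0.
- by apply: emeasurable_funM; [exact/measurable_EFinP|exact: measurable_riesz].
rewrite EFinM lee_wpmul2l ?lee_fin ?powR_ge0//.
exact: hls_bilinear.
Qed.

(** G has two majorants: the one for |G| puts every slice into [cL12], the one for [kap t] times |G|
    makes the images under [kT] integrable in time although the kernel may be unbounded in t. Times
    with g t = 0 are set apart because [tt_pair] takes positive norms. *)
Lemma tt_dual (G : R -> T -> R[i]) (g tau : R -> R) (chi : T -> R) (c N : R) :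
  cmeasurable (fun z : R * T => G z.1 z.2) ->
  measurable_fun setT g -> (forall t, 0 <= g t) ->
  lebesgue_measure.-integrable setT (EFin \o tau) -> (forall t, 0 <= tau t <= 1) ->
  mu.-integrable setT (EFin \o chi) -> (forall x, 0 <= chi x <= 1) -> 0 <= c ->
  (forall t x, cmod (G t x) <= c * tau t * chi x) ->
  (forall t x, kap t * cmod (G t x) <= c * tau t * chi x) ->
  (forall t, (\int[mu]_x (cmod (G t x) `^ (r / (r - 1)))%:E <= (g t `^ (r / (r - 1)))%:E)%E) ->
  (forall t, g t = 0 -> forall x, G t x = 0) -> 0 < N ->
  (\int[lebesgue_measure]_t (g t `^ (q / (q - 1)))%:E <= N%:E)%E ->
  (\int[mu]_y (cmod (cintegral lebesgue_measure (fun t => kT t (G t) y)) ^+ 2)%:E <=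
    (tt_cst * ((1 + hls_cst q) * N `^ (2 / (q / (q - 1)))))%:E)%E.
Proof.
move=> mG mg g0 itau tau01 ichi chi01 c0 Gc kGc Gg Gg0 N0 gN.
have tau0 t : 0 <= tau t by case/andP: (tau01 t).
have chi0 x : 0 <= chi x by case/andP: (chi01 x).
have mGt t : cmeasurable (G t) by exact (cmeasurable_comp mG (measurable_pair1 t)).
have GL t : cL12 mu (G t).
  split => //.
  - apply: (@le_integrable _ _ _ mu _ measurableT _ (EFin \o (fun x => (c * tau t) * chi x))) => //.
    + by apply/measurable_EFinP; exact: measurable_cmod.
    + move=> x _; rewrite lee_fin ger0_norm ?cmod_ge0//; exact: (le_trans (Gc t x) (ler_norm _)).
    + by rewrite /comp; under eq_fun do rewrite EFinM; exact: integrableZl.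
  - apply: (@le_integrable _ _ _ mu _ measurableT _ (EFin \o (fun x => ((c * tau t) ^+ 2) * chi x))) => //.
    + exact: measurable_cmod_sqr.
    + move=> x _; rewrite lee_fin ger0_norm ?sqr_ge0// (le_trans _ (ler_norm _))//.
      apply: (@le_trans _ _ ((c * tau t * chi x) ^+ 2)).
        by rewrite ler_pXn2r// nnegrE ?cmod_ge0// !mulr_ge0.
      rewrite exprMn ler_wpM2l ?sqr_ge0// expr2 ler_piMr//.
      by case/andP: (chi01 x).
    + by rewrite /comp; under eq_fun do rewrite EFinM; exact: integrableZl.
pose A t y := kT t (G t) y.
pose c1 := c * \int[mu]_x chi x.
have c10 : 0 <= c1 by rewrite mulr_ge0// Rintegral_ge0.
have Ac t y : cmod (A t y) <= c1 * tau t.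
  apply: (@le_trans _ _ (\int[mu]_x (c * tau t * chi x))).
    apply: cmod_cintegral_bound.
    - exact: cmeasurableM.
    - by rewrite /comp; under eq_fun do rewrite EFinM; exact: integrableZl.
    - move=> x; rewrite cmodM (le_trans _ (kGc t x))//.
      by apply: ler_wpM2r; rewrite ?cmod_ge0.
  by rewrite RintegralZl// /c1 mulrAC.
have mA : cmeasurable (fun z : R * T => A z.1 z.2).
  apply (@cmeasurable_cintegral _ _ _ _ _ mu (fun (z : R * T) x => k z.1 x z.2 * G z.1 x)).
  apply: cmeasurableM.
    have m1 : measurable_fun setT (fun z : R * T * T => (z.1.1, (z.2, z.1.2))).
      apply/measurable_fun_pairP; split => /=.
        exact: (measurableT_comp measurable_fst measurable_fst).
      apply/measurable_fun_pairP; split => /=; first exact: measurable_snd.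
      exact: (measurableT_comp measurable_snd measurable_fst).
    exact (cmeasurable_comp mk m1).
  have m2 : measurable_fun setT (fun z : R * T * T => (z.1.1, z.2)).
    apply/measurable_fun_pairP; split => /=; last exact: measurable_snd.
    exact: (measurableT_comp measurable_fst measurable_fst).
  exact (cmeasurable_comp mG m2).
apply: (@tt_square A g tau tt_cst c1 N) => //; first exact: powR_ge0.
move=> j t s ts.
have Z u v : (forall x, G u x = 0) \/ (forall x, G v x = 0) ->
    cmod (cintegral mu (fun y => (w j y)%:C%C * (A u y * (A v y)^*%C))) = 0.
  move=> uv; rewrite (_ : cintegral _ _ = 0) ?cmod0//.
  have A0 e y : (forall x, G e x = 0) -> A e y = 0.
    by move=> Ge; apply: cintegral0 => x; rewrite Ge mulr0.
  apply: cintegral0 => y.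
  by case: uv => H0; rewrite (A0 _ _ H0) ?conjc0 ?mul0r ?mulr0.
have R0 : 0 <= tt_cst * `|t - s| `^ (- (2 / q)) * (g t * g s) by rewrite !mulr_ge0 ?powR_ge0.
have [gt0|gt0] := eqVneq (g t) 0; first by rewrite Z//; left; exact: Gg0.
have [gs0|gs0] := eqVneq (g s) 0; first by rewrite Z//; right; exact: Gg0.
by apply: tt_pair => //; rewrite lt_def ?gt0 ?gs0 g0.
Qed.

Let q_gt0 : 0 < q. Proof. exact: lt_trans q2. Qed.
Let q1_gt0 : 0 < q - 1. Proof. by rewrite subr_gt0 (lt_trans _ q2)// ltr1n. Qed.
Let q0 : q != 0. Proof. by rewrite gt_eqF. Qed.
Let q10 : q - 1 != 0. Proof. by rewrite gt_eqF. Qed.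

Lemma cmeasurable_kop2 f : cmeasurable f -> cmeasurable (fun z : R * T => kop z.1 f z.2).
Proof.
move=> mf; apply (@cmeasurable_cintegral _ _ _ _ _ mu (fun (z : R * T) y => k z.1 z.2 y * f y)).
apply: cmeasurableM; last exact: (cmeasurable_comp mf measurable_snd).
have m1 : measurable_fun setT (fun z : R * T * T => (z.1.1, (z.1.2, z.2))).
  apply/measurable_fun_pairP; split => /=.
    exact: (measurableT_comp measurable_fst measurable_fst).
  apply/measurable_fun_pairP; split => /=; last exact: measurable_snd.
  exact: (measurableT_comp measurable_snd measurable_fst).
exact (cmeasurable_comp mk m1).
Qed.

Definition strichartz_cst : R := tt_cst * (1 + hls_cst q).

Definition local_power (f : T -> R[i]) (Bs : set T) t : R :=
  (\int[mu]_x (\1_Bs x * cmod (kop t f x) `^ r))%R.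
(** The lower bound n^-1 on the local power keeps its negative powers bounded and excludes the value
    0. *)
Definition local_times f Bs n t : R :=
  [&& `|t| <= n, kap t <= n & n^-1 <= local_power f Bs t]%:R.

Let mlp f (Bs : set T) : cmeasurable f -> measurable Bs ->
  measurable_fun setT (fun z : R * T => \1_Bs z.2 * cmod (kop z.1 f z.2) `^ r : R).
Proof.
move=> mf mBs; apply: measurable_funM.
  by apply: (measurableT_comp (measurable_indic mBs)); exact: measurable_snd.
by apply: (measurableT_comp (@measurable_powR R r)); apply: measurable_cmod; exact: cmeasurable_kop2.
Qed.

Lemma measurable_local_power f (Bs : set T) : cmeasurable f -> measurable Bs ->
  measurable_fun setT (local_power f Bs).
Proof.
move=> mf mBs.
exact (@measurable_Rintegral_param _ _ _ _ _ mu (fun t x => \1_Bs x * cmod (kop t f x) `^ r) (mlp mf mBs)).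
Qed.

Lemma measurable_local_times f (Bs : set T) n : cmeasurable f -> measurable Bs ->
  measurable_fun setT (local_times f Bs n).
Proof.
move=> mf mBs; have mm := measurable_local_power mf mBs.
rewrite (_ : local_times f Bs n = (fun t => (`|t| <= n)%R%:R * ((kap t <= n)%R%:R * (n^-1 <= local_power f Bs t)%R%:R))).
  apply: measurable_funM; first by apply: measurable_le_nat => //; exact: measurableT_comp.
  by apply: measurable_funM; apply: measurable_le_nat.
by apply/funext => t; rewrite /local_times -!natrM !mulnb.
Qed.

(* Duality with G = 1_E chi |m|^(q/r-1) |h|^(r-2) conj(h), h = kop f, m its localised r-th power integral,
   E a set of times on which everything is bounded. *)
Lemma strichartz_truncated (f : T -> R[i]) (M : R) (Bs : set T) (n : R) : cL12 mu f -> 0 < M ->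
  (\int[mu]_x (cmod (f x) ^+ 2)%:E <= M%:E)%E -> measurable Bs -> (mu Bs < +oo)%E -> 0 < n ->
  (\int[lebesgue_measure]_t (local_times f Bs n t * local_power f Bs t `^ (q / r))%:E <= ((strichartz_cst * M) `^ (q / 2))%:E)%E.
Proof.
move=> fL M0 fM mBs Bsy n0; set m := local_power f Bs; set e := local_times f Bs n.
have [mf f1 f2] := fL.
pose h t x := kop t f x.
have mh : cmeasurable (fun z : R * T => h z.1 z.2) by exact: cmeasurable_kop2.
have mht t : cmeasurable (h t) by exact (cmeasurable_comp mh (measurable_pair1 t)).
pose chi : T -> R := \1_Bs.
have mchi : measurable_fun setT chi by exact: measurable_indic.
have chi01 x : 0 <= chi x <= 1 by rewrite /chi indicE; exact: bool01.
have chi0 x : 0 <= chi x by case/andP: (chi01 x).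
have chi1 x : chi x <= 1 by case/andP: (chi01 x).
have ichi : mu.-integrable setT (EFin \o chi).
  apply/integrableP; split; first exact/measurable_EFinP.
  under eq_integral do rewrite /= ger0_norm//.
  by rewrite integral_indic// setIT.
have chichi x y : 0 <= y -> (chi x * y) `^ (r / (r - 1)) = chi x * y `^ (r / (r - 1)).
  move=> y0; rewrite /chi indicE; case: (_ \in _); rewrite ?mul1r// !mul0r powR0//.
  by rewrite mulf_neq0 ?invr_eq0.
have mhr : measurable_fun setT (fun z : R * T => chi z.2 * cmod (h z.1 z.2) `^ r) by exact: mlp.
have mm : measurable_fun setT m by exact: measurable_local_power.
have m0 t : 0 <= m t by apply: Rintegral_ge0 => x _; rewrite mulr_ge0 ?powR_ge0.
pose H := n * L1 f.
have H0 : 0 <= H by rewrite mulr_ge0// ltW.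
pose mx := H `^ r * \int[mu]_x chi x.
pose tau (t : R) : R := (`|t| <= n)%R%:R.
have tau01 t : 0 <= tau t <= 1 by exact: bool01.
have itau : lebesgue_measure.-integrable setT (EFin \o tau).
  have := @integrable_indic_itv R (- n) n true false.
  rewrite (_ : \1__ = tau)//; apply/funext => t.
  by rewrite /tau indicE ler_norml in_set_bool.
have me : measurable_fun setT e by exact: measurable_local_times.
have e01 t : 0 <= e t <= 1 by exact: bool01.
have e0 t : 0 <= e t by case/andP: (e01 t).
have hH t x : kap t <= n -> cmod (h t x) <= H.
  move=> kn; apply: (le_trans (cmod_kop t x fL)); apply: ler_wpM2r => //; exact: L1_ge0.
have imt t : kap t <= n -> mu.-integrable setT (EFin \o (fun x => chi x * cmod (h t x) `^ r)).
  move=> kn; apply: (@le_integrable _ _ _ mu _ measurableT _ (EFin \o (fun x => H `^ r * chi x))).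
  - by apply/measurable_EFinP; exact (measurableT_comp mhr (measurable_pair1 t)).
  - move=> x _; rewrite lee_fin (ger0_norm (mulr_ge0 (chi0 x) (powR_ge0 _ _))).
    rewrite (le_trans _ (ler_norm _))// mulrC; apply: ler_wpM2r => //.
    by rewrite ge0_ler_powR ?nnegrE ?cmod_ge0 ?hH ?(ltW r_gt0).
  - by rewrite /comp; under eq_fun do rewrite EFinM; exact: integrableZl.
have mmx t : kap t <= n -> m t <= mx.
  move=> kn; rewrite /mx -RintegralZl//; apply: le_Rintegral => //; first exact: imt.
    by rewrite /comp; under eq_fun do rewrite EFinM; exact: integrableZl.
  move=> x _; rewrite mulrC; apply: ler_wpM2r => //.
  by rewrite ge0_ler_powR ?nnegrE ?cmod_ge0 ?hH ?(ltW r_gt0).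
have eE t : e t != 0 -> [/\ `|t| <= n, kap t <= n & n^-1 <= m t].
  by rewrite /e /local_times -/m; case: (boolP [&& _, _ & _]) => [/and3P[]|]; rewrite ?eqxx.
pose s t := e t * m t `^ (q / r - 1).
have s0 t : 0 <= s t by rewrite mulr_ge0 ?powR_ge0.
have ms : measurable_fun setT s.
  by apply: measurable_funM => //; exact: (measurableT_comp (@measurable_powR R _) mm).
pose P := n^-1 `^ (q / r - 1) + mx `^ (q / r - 1).
have P0 : 0 <= P by rewrite addr_ge0 ?powR_ge0.
have sP t : s t <= P * tau t.
  have [et|et] := eqVneq (e t) 0.
    by rewrite /s et mul0r mulr_ge0//; case/andP: (tau01 t).
  have [tn kn nm] := eE t et; rewrite /s /tau tn mulr1.
  apply: (@le_trans _ _ (m t `^ (q / r - 1))).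
    by rewrite ler_piMl ?powR_ge0//; case/andP: (e01 t).
  by apply: powR_le_add; rewrite ?invr_gt0// mmx.
pose G t x : R[i] := (s t * (chi x * cmod (h t x) `^ (r - 2)))%:C%C * (h t x)^*%C.
have powr1 y : 0 <= y -> y `^ (r - 2) * y = y `^ (r - 1).
  move=> y0; have := @mulr_powRB1 _ y (r - 1) y0 r1_gt0.
  by rewrite mulrC (_ : r - 1 - 1 = r - 2)//; ring.
have powr2 y : 0 <= y -> y `^ (r - 1) * y = y `^ r.
  by move=> y0; rewrite mulrC mulr_powRB1.
have cG t x : cmod (G t x) = s t * (chi x * cmod (h t x) `^ (r - 1)).
  rewrite /G cmodM cmodR cmod_conj (ger0_norm (mulr_ge0 (s0 t) (mulr_ge0 (chi0 x) (powR_ge0 _ _)))).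
  by rewrite -!mulrA powr1 ?cmod_ge0.
have Gh t x : h t x * G t x = (s t * (chi x * cmod (h t x) `^ r))%:C%C.
  rewrite /G mulrCA mulc_conj -rmorphM; congr (_%:C%C).
  by rewrite -!mulrA -(powr2 _ (cmod_ge0 _)) -(powr1 _ (cmod_ge0 _)); ring.
have mG : cmeasurable (fun z : R * T => G z.1 z.2).
  apply: cmeasurableM; last exact: cmeasurable_conj.
  apply: cmeasurableR; apply: measurable_funM; first exact: (measurableT_comp ms measurable_fst).
  apply: measurable_funM; first exact: (measurableT_comp mchi measurable_snd).
  by apply: (measurableT_comp (@measurable_powR R _)); exact: measurable_cmod.
(* The factor 1 + n bounds 1 + [kap t] at the selected times, so that one constant serves both
   majorants of [tt_dual]. *)
pose c := (1 + n) * (P * H `^ (r - 1)).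
have PH0 : 0 <= P * H `^ (r - 1) by apply: mulr_ge0 => //; exact: powR_ge0.
have c0 : 0 <= c by apply: mulr_ge0 => //; rewrite addr_ge0// ltW.
have Gb t x : (1 + kap t) * cmod (G t x) <= c * tau t * chi x.
  rewrite cG; have [et|et] := eqVneq (e t) 0.
    rewrite /s et !mul0r mulr0; apply: mulr_ge0 => //; apply: mulr_ge0 => //; by case/andP: (tau01 t).
  have [tn kn nm] := eE t et; rewrite /tau tn mulr1 /c.
  have := sP t; rewrite /tau tn mulr1 => sP1.
  rewrite [leLHS](_ : _ = ((1 + kap t) * (s t * cmod (h t x) `^ (r - 1))) * chi x); last by ring.
  apply: ler_wpM2r => //; apply: ler_pM.
  - by rewrite addr_ge0// (kap0 t x).
  - by rewrite mulr_ge0 ?powR_ge0.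
  - by rewrite lerD2l.
  - apply: ler_pM => //; rewrite ?powR_ge0//.
    by rewrite ge0_ler_powR ?nnegrE ?cmod_ge0 ?hH ?(ltW r1_gt0).
have Gc t x : cmod (G t x) <= c * tau t * chi x.
  apply: le_trans (Gb t x); rewrite ler_peMl ?cmod_ge0// lerDl; exact: kap0 t x.
have kGc t x : kap t * cmod (G t x) <= c * tau t * chi x.
  by apply: le_trans (Gb t x); apply: ler_wpM2r; rewrite ?cmod_ge0// lerDr.
clearbody c.
(* The L^r' norm of the slice G t, since (q/r - 1) + (r-1)/r = (q-1)/r. Its q'-th power is e
   m^(q/r), so its time integral is again the quantity to be bounded. *)
pose g t := e t * m t `^ ((q - 1) / r).
have mg : measurable_fun setT g.
  by apply: measurable_funM => //; exact: (measurableT_comp (@measurable_powR R _) mm).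
have g0 t : 0 <= g t by rewrite mulr_ge0 ?powR_ge0.
have epow t (y z : R) : z != 0 -> 0 <= y -> (e t * y) `^ z = e t * y `^ z.
  move=> z0 y0; rewrite /e /local_times -/m; case: [&& _, _ & _]; rewrite ?mul1r// !mul0r powR0//.
have Gg t : (\int[mu]_x (cmod (G t x) `^ (r / (r - 1)))%:E <= (g t `^ (r / (r - 1)))%:E)%E.
  have rr0 : r / (r - 1) != 0 by rewrite mulf_neq0 ?invr_eq0.
  have GE x : cmod (G t x) `^ (r / (r - 1)) =
      e t * (m t `^ (q / r - 1)) `^ (r / (r - 1)) * (chi x * cmod (h t x) `^ r).
    rewrite cG /s -mulrA epow// ?mulr_ge0 ?powR_ge0//.
    rewrite powRM ?powR_ge0// ?mulr_ge0 ?powR_ge0// chichi ?powR_ge0//.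
    rewrite -!powRrM -!mulrA; congr (_ * (_ * (_ * _ `^ _))); by field.
  have [et|et] := eqVneq (e t) 0.
    rewrite integral0_eq ?lee_fin ?powR_ge0// => x _.
    by rewrite GE et !mul0r.
  have [tn kn nm] := eE t et.
  under eq_integral do rewrite GE EFinM.
  rewrite ge0_integralZl_EFin//; last 3 first.
  - by move=> x _; rewrite lee_fin mulr_ge0 ?powR_ge0.
  - exact: measurable_int (imt t kn).
  - by rewrite mulr_ge0 ?powR_ge0.
  have -> : (\int[mu]_x (chi x * cmod (h t x) `^ r)%:E = (m t)%:E)%E.
    by rewrite fineK//; exact: (integrable_fin_num measurableT (imt t kn)).
  rewrite -EFinM lee_fin /g epow ?powR_ge0// -mulrA; apply: ler_wpM2l => //.
  have mt0 : 0 < m t by rewrite (lt_le_trans _ nm)// invr_gt0.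
  rewrite -{2}[m t]powRr1// -!powRrM -powRD; last by rewrite (gt_eqF mt0) implybT.
  rewrite le_eqVlt; apply/orP; left; apply/eqP; congr (_ `^ _).
  by field; rewrite r0 r10.
have Gg0 t : g t = 0 -> forall x, G t x = 0.
  move/eqP; rewrite /g mulf_eq0 => /orP[/eqP et x|].
    by rewrite /G /s et !mul0r.
  rewrite powR_eq0 => /andP[/eqP mt0 _] x.
  have [et|et] := eqVneq (e t) 0; first by rewrite /G /s et !mul0r.
  have [_ _] := eE t et; rewrite mt0 leNgt invr_gt0 n0//.
have iI : lebesgue_measure.-integrable setT (EFin \o (fun t => e t * m t `^ (q / r))).
  apply: (@le_integrable _ _ _ (@lebesgue_measure R) _ measurableT _ (EFin \o (fun t => mx `^ (q / r) * tau t))) => //.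
  - apply/measurable_EFinP; apply: measurable_funM => //.
    exact: (measurableT_comp (@measurable_powR R _) mm).
  - move=> t _; rewrite lee_fin (ger0_norm (mulr_ge0 (e0 t) (powR_ge0 _ _))) (le_trans _ (ler_norm _))//.
    have [et|et] := eqVneq (e t) 0.
      by rewrite et mul0r mulr_ge0 ?powR_ge0//; case/andP: (tau01 t).
    have [tn kn nm] := eE t et; rewrite mulrC.
    apply: ler_pM; rewrite ?powR_ge0//; last by rewrite /tau tn; case/andP: (e01 t).
    by rewrite ge0_ler_powR ?nnegrE ?divr_ge0 ?mmx ?(ltW q_gt0) ?(ltW r_gt0)// mulr_ge0 ?powR_ge0// Rintegral_ge0.
  - by rewrite /comp; under eq_fun do rewrite EFinM; exact: integrableZl.
have fI := integrable_fin_num measurableT iI.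
pose I := \int[lebesgue_measure]_t (e t * m t `^ (q / r)).
have I0 : 0 <= I by apply: Rintegral_ge0 => t _; rewrite mulr_ge0 ?powR_ge0.
rewrite -(fineK fI) lee_fin -[leLHS]/I.
have [->|In0] := eqVneq I 0; first exact: powR_ge0.
have Igt0 : 0 < I by rewrite lt_def In0.
have gI : (\int[lebesgue_measure]_t (g t `^ (q / (q - 1)))%:E <= I%:E)%E.
  rewrite /I /Rintegral fineK// le_eqVlt; apply/orP; left; apply/eqP; apply: eq_integral => t _.
  rewrite /g epow ?powR_ge0// ?mulf_neq0 ?invr_eq0// -powRrM; congr (_ * _ `^ _)%:E.
  by field; rewrite q10 r0.
have dual := tt_dual mG mg g0 itau tau01 ichi chi01 c0 Gc kGc Gg Gg0 Igt0 gI.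
have tau0 t : 0 <= tau t by case/andP: (tau01 t).
pose A t y := kT t (G t) y.
pose c1 := c * \int[mu]_x chi x.
have c10 : 0 <= c1 by apply: mulr_ge0 => //; exact: Rintegral_ge0.
have mGt t : cmeasurable (G t) by exact (cmeasurable_comp mG (measurable_pair1 t)).
have ichiZ (v : R) : mu.-integrable setT (EFin \o (fun x => v * chi x)).
  by rewrite /comp; under eq_fun do rewrite EFinM; exact: integrableZl.
have kGb t x y : cmod (k t x y * G t x) <= c * tau t * chi x.
  by rewrite cmodM (le_trans _ (kGc t x))//; apply: ler_wpM2r; rewrite ?cmod_ge0.
have ikG t y : cintegrable mu (fun x => k t x y * G t x).
  by apply: (cintegrable_le _ (ichiZ (c * tau t))) => //; exact: cmeasurableM.
have Ac t y : cmod (A t y) <= c1 * tau t.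
  apply: (@le_trans _ _ (\int[mu]_x (c * tau t * chi x))).
    by apply: (cmod_cintegral_bound _ (ichiZ _)) => //; exact: cmeasurableM.
  by rewrite RintegralZl// /c1 mulrAC.
have mA : cmeasurable (fun z : R * T => A z.1 z.2).
  apply (@cmeasurable_cintegral _ _ _ _ _ mu (fun (z : R * T) x => k z.1 x z.2 * G z.1 x)).
  apply: cmeasurableM.
    have m1 : measurable_fun setT (fun z : R * T * T => (z.1.1, (z.2, z.1.2))).
      apply/measurable_fun_pairP; split => /=.
        exact: (measurableT_comp measurable_fst measurable_fst).
      apply/measurable_fun_pairP; split => /=; first exact: measurable_snd.
      exact: (measurableT_comp measurable_snd measurable_fst).
    exact (cmeasurable_comp mk m1).
  have m2 : measurable_fun setT (fun z : R * T * T => (z.1.1, z.2)).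
    apply/measurable_fun_pairP; split => /=; last exact: measurable_snd.
    exact: (measurableT_comp measurable_fst measurable_fst).
  exact (cmeasurable_comp mG m2).
have fA t : (e t * m t `^ (q / r))%:C%C = cintegral mu (fun y => f y * A t y).
  have step1 : (e t * m t `^ (q / r))%:C%C = cintegral mu (fun x => G t x * h t x).
    have [et|et] := eqVneq (e t) 0.
      by rewrite cintegral0 ?et ?mul0r// => x; rewrite /G /s et !mul0r.
    have [tn kn nm] := eE t et.
    have mt0 : 0 < m t by rewrite (lt_le_trans _ nm)// invr_gt0.
    under eq_cintegral do rewrite mulrC Gh.
    rewrite cintegralR RintegralZl//; last exact: imt.
    congr (_%:C%C); rewrite -/(local_power f Bs t) -/m /s -mulrA; congr (_ * _).
    by rewrite -{3}[m t]powRr1 ?(ltW mt0)// -powRD ?subrK// (gt_eqF mt0) implybT.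
  rewrite step1.
  transitivity (cintegral mu (fun x => cintegral mu (fun y => f y * (k t x y * G t x)))).
    apply: eq_cintegral => x; rewrite -cintegralZ; last exact: ikop.
    by apply: eq_cintegral => y; ring.
  rewrite (@cfubini _ _ _ _ _ mu mu _ (fun y => cmod (f y)) (ichiZ (c * tau t)) f1).
  - by apply: eq_cintegral => y; rewrite cintegralZ.
  - by move=> x; rewrite !mulr_ge0.
  - by move=> y; exact: cmod_ge0.
  - apply: cmeasurableM; first exact: (cmeasurable_comp mf measurable_snd).
    apply: cmeasurableM; first exact: mkt.
    exact: (cmeasurable_comp (mGt t) measurable_fst).
  - by move=> x y; rewrite cmodM mulrC; apply: ler_wpM2r; rewrite ?cmod_ge0.
pose Phi y := cintegral lebesgue_measure (fun t => A t y).
have IE : I%:C%C = cintegral mu (fun y => f y * Phi y).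
  rewrite /I -cintegralR.
  transitivity (cintegral lebesgue_measure (fun t => cintegral mu (fun y => f y * A t y))).
    by apply: eq_cintegral => t; exact: fA.
  have itc v : lebesgue_measure.-integrable setT (EFin \o (fun t : R => v * tau t)).
    by rewrite /comp; under eq_fun do rewrite EFinM; exact: integrableZl.
  rewrite (@cfubini _ _ _ _ _ lebesgue_measure mu (fun t : R => c1 * tau t) (fun y => cmod (f y)) (itc _) f1).
  - apply: eq_cintegral => y; rewrite cintegralZ//.
    apply: (@cintegrable_le _ _ _ (@lebesgue_measure R) _ (fun t : R => c1 * tau t)) => //.
    exact (cmeasurable_comp mA (measurable_pair2 y)).
  - by move=> t; rewrite mulr_ge0.
  - by move=> y; exact: cmod_ge0.
  - by apply: cmeasurableM => //; exact: (cmeasurable_comp mf measurable_snd).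
  - by move=> t y; rewrite cmodM mulrC; apply: ler_wpM2r; rewrite ?cmod_ge0.
have mPhi : cmeasurable Phi.
  have m3 : measurable_fun setT (fun z : T * R => (z.2, z.1)).
    by apply/measurable_fun_pairP; split => /=; [exact: measurable_snd|exact: measurable_fst].
  exact (@cmeasurable_cintegral _ _ _ _ _ lebesgue_measure (fun y t => A t y) (cmeasurable_comp mA m3)).
have C0 : 0 <= strichartz_cst.
  by apply: mulr_ge0; rewrite ?powR_ge0// addr_ge0// ltW// hls_cst_gt0.
pose p := q / (q - 1).
pose c2 := \int[lebesgue_measure]_t (c1 * tau t).
have itc v : lebesgue_measure.-integrable setT (EFin \o (fun t : R => v * tau t)).
  by rewrite /comp; under eq_fun do rewrite EFinM; exact: integrableZl.
have Phic y : cmod (Phi y) <= c2.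
  apply: (@cmod_cintegral_bound _ _ _ (@lebesgue_measure R) (fun t : R => A t y) (fun t : R => c1 * tau t)) => //.
  exact (cmeasurable_comp mA (measurable_pair2 y)).
have ifP : cintegrable mu (fun y => f y * Phi y).
  apply: (@cintegrable_le _ _ _ mu _ (fun y => c2 * cmod (f y))).
  - exact: cmeasurableM.
  - by rewrite /comp; under eq_fun do rewrite EFinM; exact: integrableZl.
  - by move=> y; rewrite cmodM mulrC; apply: ler_wpM2r; rewrite ?cmod_ge0.
(* I is the pairing of f with [Phi], and Cauchy-Schwarz bounds it by a multiple of I^(1/p). The
   truncation has made I finite, so this power can be divided out. *)
have IM : I <= M `^ 2^-1 * (strichartz_cst * I `^ (2 / p)) `^ 2^-1.
  rewrite -{1}(ger0_norm I0) -(cmodR I) IE -lee_fin.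
  apply: (le_trans (cmod_cintegral_le ifP)).
  have -> : (\int[mu]_x (cmod (f x * Phi x))%:E = \int[mu]_x (cmod (f x) * cmod (Phi x))%:E)%E.
    by apply: eq_integral => x _; rewrite cmodM.
  have p2 (g1 : T -> R[i]) : (\int[mu]_x (cmod (g1 x) `^ 2)%:E = \int[mu]_x (cmod (g1 x) ^+ 2)%:E)%E.
    by apply: eq_integral => x _; rewrite powR_mulrn ?cmod_ge0.
  apply: (@hoelder_le _ _ _ mu _ _ 2 2) => //.
  - exact: measurable_cmod.
  - exact: measurable_cmod.
  - by move=> x; exact: cmod_ge0.
  - by move=> x; exact: cmod_ge0.
  - by field.
  - exact: powR_ge0.
  - exact: powR_ge0.
  - by rewrite p2 -powRrM mulVf// powRr1 ?(ltW M0).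
  - rewrite p2 -powRrM mulVf// powRr1; last by apply: mulr_ge0 => //; exact: powR_ge0.
    by rewrite /strichartz_cst -mulrA; exact: dual.
have CM0 : 0 <= strichartz_cst * M by apply: mulr_ge0 => //; exact: ltW.
have II : I = I `^ q^-1 * I `^ p^-1.
  rewrite -powRD; last by rewrite (gt_eqF Igt0) implybT.
  rewrite (_ : _ + _ = 1) ?powRr1//.
  by rewrite /p; field; rewrite q0 q10.
have {}IM : I `^ q^-1 <= (strichartz_cst * M) `^ 2^-1.
  rewrite -(ler_pM2r (powR_gt0 p^-1 Igt0)) -II; apply: (le_trans IM).
  rewrite (powRM _ C0 (powR_ge0 _ _)) (powRM _ C0 (ltW M0)) -powRrM mulrA [M `^ _ * _]mulrC.
  by rewrite (_ : 2 / p * 2^-1 = p^-1)//; rewrite mulrAC mulfV ?mul1r.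
rewrite (_ : (strichartz_cst * M) `^ (q / 2) = ((strichartz_cst * M) `^ 2^-1) `^ q); last first.
  by rewrite [q / 2]mulrC powRrM.
have {1}-> : I = (I `^ q^-1) `^ q by rewrite -powRrM mulVf// powRr1.
by rewrite ge0_ler_powR ?nnegrE ?powR_ge0 ?(ltW q_gt0).
Qed.

(** The truncated bound is independent of the truncation. Along an exhaustion by sets of finite
    measure, with n = j + 1, the truncated integrands converge at every time, and Fatou's lemma
    concludes. *)
Theorem strichartz_homogeneous (f : T -> R[i]) (M : R) : cL12 mu f -> 0 < M ->
  (\int[mu]_x (cmod (f x) ^+ 2)%:E <= M%:E)%E ->
  (\int[lebesgue_measure]_t ((\int[mu]_x (cmod (kop t f x) `^ r)%:E) `^ (q / r)) <=
    ((strichartz_cst * M) `^ (q / 2))%:E)%E.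
Proof.
move=> fL M0 fM; have [mf f1 f2] := fL.
have [F [FT ndF mF]] := (sigma_finiteP setT mu).1 (sigma_finiteT mu).
pose N (j : nat) : R := j.+1%:R.
have mh t : cmeasurable (kop t f).
  exact (cmeasurable_comp (cmeasurable_kop2 mf) (measurable_pair1 t)).
have mhr t : measurable_fun setT (fun x => cmod (kop t f x) `^ r).
  by apply: (measurableT_comp (@measurable_powR R r)); exact: measurable_cmod.
apply: (@fatou_bound _ _ _ (@lebesgue_measure R) (fun j (t : R) => (local_times f (F j) (N j) t * local_power f (F j) t `^ (q / r))%:E)).
- move=> j; apply/measurable_EFinP; apply: measurable_funM.
    by apply: measurable_local_times => //; exact: (mF j).1.
  apply: (measurableT_comp (@measurable_powR R _)); apply: measurable_local_power => //; exact: (mF j).1.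
- move=> j t; rewrite lee_fin mulr_ge0 ?powR_ge0//.
- move=> t.
  (* At a fixed time the image of f is bounded and square integrable, and r > 2, so its r-th power
     is at most a constant times its square. *)
  have ih : mu.-integrable setT (EFin \o (fun x => cmod (kop t f x) `^ r)).
    have ih2 : mu.-integrable setT (EFin \o (fun x => cmod (kop t f x) ^+ 2)).
      apply/integrableP; split; first exact: measurable_cmod_sqr.
      apply: (@le_lt_trans _ _ M%:E); last exact: ltry.
      apply: le_trans fM; apply: le_trans (kop2 t fL).
      rewrite le_eqVlt; apply/orP; left; apply/eqP; apply: eq_integral => x _.
      by rewrite /= ger0_norm ?sqr_ge0.
    apply: (@le_integrable _ _ _ mu _ measurableT _ (EFin \o (fun x => (kap t * L1 f) `^ (r - 2) * cmod (kop t f x) ^+ 2))).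
    - exact/measurable_EFinP.
    - move=> x _; rewrite lee_fin (ger0_norm (powR_ge0 _ _)) (le_trans _ (ler_norm _))//.
      have [h0|h0] := eqVneq (cmod (kop t f x)) 0.
        by rewrite h0 powR0// mulr_ge0 ?powR_ge0// sqr_ge0.
      have -> : cmod (kop t f x) `^ r = cmod (kop t f x) `^ (r - 2) * cmod (kop t f x) ^+ 2.
        by rewrite -(powR_mulrn 2 (cmod_ge0 _)) -powRD ?subrK// h0 implybT.
      rewrite ler_wpM2r ?sqr_ge0//.
      have kL : 0 <= kap t * L1 f by rewrite mulr_ge0// (kap0 t x).
      by rewrite ge0_ler_powR ?nnegrE ?cmod_ge0 ?subr_ge0 ?(ltW r2)//; exact: cmod_kop.
    - by rewrite /comp; under eq_fun do rewrite EFinM; exact: integrableZl.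
  have hfin := integrable_fin_num measurableT ih.
  pose m := \int[mu]_x cmod (kop t f x) `^ r.
  rewrite -(fineK hfin) poweR_EFin -[fine _]/m.
  have m0 : 0 <= m by apply: Rintegral_ge0 => x _; exact: powR_ge0.
  have mF0 j : 0 <= local_power f (F j) t.
    by apply: Rintegral_ge0 => x _; rewrite mulr_ge0 ?powR_ge0// indicE.
  have iF j : mu.-integrable setT (EFin \o (fun x => \1_(F j) x * cmod (kop t f x) `^ r)).
    apply: (@le_integrable _ _ _ mu _ measurableT _ (EFin \o (fun x => cmod (kop t f x) `^ r))) => //.
      apply/measurable_EFinP; apply: measurable_funM => //; apply: measurable_indic; exact: (mF j).1.
    move=> x _; rewrite lee_fin (ger0_norm (powR_ge0 _ _)) ger0_norm ?mulr_ge0 ?powR_ge0 ?indicE//.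
    by rewrite ler_piMl ?powR_ge0//; case/andP: (@bool01 R (x \in F j)).
  have FM j : local_power f (F j) t <= m.
    apply: le_Rintegral => // x _; rewrite indicE ler_piMl ?powR_ge0//.
    by case/andP: (@bool01 R (x \in F j)).
  have cF : local_power f (F j) t @[j --> \oo] --> m.
    have cE : (\int[mu]_x (\1_(F j) x * cmod (kop t f x) `^ r)%:E)%E @[j --> \oo] -->
        (\int[mu]_x (cmod (kop t f x) `^ r)%:E)%E.
      have -> : (\int[mu]_x (cmod (kop t f x) `^ r)%:E =
          \int[mu]_x limn (fun j => (\1_(F j) x * cmod (kop t f x) `^ r)%:E))%E.
        apply: eq_integral => x _; apply/esym/cvg_lim => //.
        have [i _ Fi] : (\bigcup_i F i) x by rewrite -FT.
        apply: cvg_near_cst; exists i => // j /= ij.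
        by rewrite indicE mem_set ?mul1r//; move: Fi; exact/subsetPset/ndF.
      apply: cvg_monotone_convergence => //.
      - by move=> j; exact: measurable_int (iF j).
      - by move=> j x _; rewrite lee_fin mulr_ge0 ?powR_ge0// indicE.
      - move=> x _ i j ij; rewrite lee_fin ler_wpM2r ?powR_ge0// !indicE ler_nat.
        case: (boolP (x \in F i)) => // /set_mem Fi; rewrite (mem_set _)//.
        by move: Fi; exact/subsetPset/ndF.
    by move: cE; rewrite -(fineK hfin) => /fine_cvg.
  apply: cvg_EFin; first exact: nearW.
  rewrite /comp /=.
  (* If m = 0 the time is never selected, but the local powers vanish as well; otherwise the time is
     eventually selected. *)
  have [mz|mz] := eqVneq m 0.
    rewrite mz powR0; last by rewrite mulf_neq0 ?invr_eq0.
    apply: cvg_near_cst; apply: nearW => j.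
    have -> : local_power f (F j) t = 0 by apply/eqP; rewrite eq_le mF0 -mz FM.
    by rewrite powR0 ?mulr0// mulf_neq0 ?invr_eq0.
  have mgt0 : 0 < m by rewrite lt_def mz.
  have := cvg_powR (e := q / r) mgt0 cF; apply: cvg_trans; apply: near_eq_cvg.
  have l1 : \forall j \near \oo, m / 2 < local_power f (F j) t.
    apply: (cvgr_gt _ cF); rewrite ltr_pdivrMr// ltr_pMr// ltr1n//.
  have l2 (y : R) : \forall j \near \oo, y <= N j.
    have [i yi] : exists i : nat, y <= i%:R 
      by exists (Num.bound `|y|); exact: le_trans (ler_norm y) (ltW (archi_boundP (normr_ge0 y))).
    exists i => // j /= ij; rewrite (le_trans yi)// ler_nat; exact: leqW.
  near=> j.
  suff -> : local_times f (F j) (N j) t = 1 by rewrite mul1r.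
  rewrite /local_times (_ : [&& _, _ & _])//; apply/and3P; split.
  - by near: j; exact: l2.
  - by near: j; exact: l2.
  - have h1 : m / 2 < local_power f (F j) t by near: j; exact: l1.
    apply: le_trans (ltW h1).
    rewrite -[leRHS]invrK lef_pV2 ?posrE ?invr_gt0 ?divr_gt0//.
    by near: j; exact: l2.
- move=> j; apply: strichartz_truncated => //; [exact: (mF j).1|exact: (mF j).2].
Unshelve. all: by end_near. Qed.

End ttstar.

(** * The matrix exponential and the Gramian *)

Section matrix_limits.
Context {R : realType}.

Lemma cvg_mx m n (u : nat -> 'M[R]_(m, n)) (l : 'M[R]_(m, n)) :
  (forall i j, u k i j @[k --> \oo] --> l i j) -> u k @[k --> \oo] --> l.
Proof.
move=> ul A [P Pl PA]; suff: \forall k \near \oo, A (u k) by [].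
have : \forall k \near \oo, forall i j, P i j (u k i j).
  apply: filter_forall => i; apply: filter_forall => j.
  exact: ul (Pl i j).
by apply: filterS => k Pk; apply: PA.
Qed.

Lemma limn_mx m n (u : nat -> 'M[R]_(m, n)) (l : 'M[R]_(m, n)) :
  (forall i j, u k i j @[k --> \oo] --> l i j) -> limn u = l.
Proof. by move=> ul; apply: cvg_lim; [exact: norm_hausdorff|exact: cvg_mx]. Qed.

End matrix_limits.

Section triangle_sums.
Context {V : zmodType}.
Variable f : nat -> nat -> V.

Lemma sum_triangle N : \sum_(m < N) \sum_(j < m.+1) f j (m - j)%N =
  \sum_(j < N) \sum_(k < N - j) f j k.
Proof.
elim: N => [|N IHN]; first by rewrite !big_ord0.
rewrite big_ord_recr/= IHN [in RHS]big_ord_recr/= subSn// subnn big_ord1 [X in _ = X + _](_ : _ =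
    \sum_(j < N) \sum_(k < N - j) f j k + \sum_(j < N) f j (N - j)%N).
  by rewrite -addrA big_ord_recr/= subnn.
rewrite -big_split/=; apply: eq_bigr => j _.
by rewrite subSn ?(ltnW (ltn_ord j))// big_ord_recr.
Qed.

Lemma sum_square N : \sum_(j < N) \sum_(k < N) f j k =
  \sum_(j < N) \sum_(k < N - j) f j k + \sum_(j < N) \sum_(N - j <= k < N) f j k.
Proof.
rewrite -big_split/=; apply: eq_bigr => j _.
rewrite -(big_mkord xpredT (f j)) (@big_cat_nat _ _ _ (N - j)) ?leq_subr//=.
by rewrite big_mkord.
Qed.

End triangle_sums.

Section exponential_sums.
Context {R : realType} (n : nat).
Implicit Types (A B : 'M[R]_n) (s t : R).

Definition expsum (t : R) N : R := \sum_(k < N) t ^+ k / k`!%:R.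

Lemma cvg_expsum t : expsum t N @[N --> \oo] --> expR t.
Proof.
have := is_cvg_series_exp_coeff t; rewrite /expR => /cvg_ex[l cl].
rewrite (cvg_lim _ cl)//; move: cl; apply: cvg_trans.
rewrite (_ : (fun N => expsum t N) = series (exp_coeff t))//.
by apply/funext => N; rewrite /series/= big_mkord.
Qed.

Lemma expsum_le t N : 0 <= t -> expsum t N <= expR t.
Proof.
move=> t0; have c := @cvg_expsum t.
rewrite -(cvg_lim _ c)//; apply: nondecreasing_cvgn_le; last by apply/cvg_ex; exists (expR t).
apply/nondecreasing_seqP => m; rewrite /expsum big_ord_recr/= lerDl divr_ge0// exprn_ge0//.
Qed.

Lemma exprD_fact s t m : (s + t) ^+ m / m`!%:R =
  \sum_(j < m.+1) (s ^+ j / j`!%:R) * (t ^+ (m - j) / (m - j)`!%:R).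
Proof.
rewrite addrC exprDn mulr_suml; apply: eq_bigr => j _.
have jm : (j <= m)%N by rewrite -ltnS.
rewrite -(bin_fact jm) -mulr_natr !natrM.
by field; rewrite !pnatr_eq0 -!lt0n !fact_gt0 bin_gt0 jm.
Qed.

(** The indices of the N by N square that lie outside the triangle j + k < N. For scalars the tail
    tends to 0 because the exponential is multiplicative; taken at |s| b and |t| b it dominates the
    corresponding tail for matrices. *)
Definition expsum_tail (s t : R) N : R :=
  \sum_(j < N) \sum_(N - j <= k < N) (s ^+ j / j`!%:R) * (t ^+ k / k`!%:R).

Lemma expsumM s t N : expsum s N * expsum t N = expsum (s + t) N + expsum_tail s t N.
Proof.
rewrite /expsum_tail.
have -> : expsum s N * expsum t N =
    \sum_(j < N) \sum_(k < N) (s ^+ j / j`!%:R) * (t ^+ k / k`!%:R).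
  by rewrite /expsum mulr_suml; apply: eq_bigr => j _; rewrite mulr_sumr.
rewrite (sum_square (fun j k => (s ^+ j / j`!%:R) * (t ^+ k / k`!%:R))); congr (_ + _).
rewrite -(sum_triangle (fun j k => (s ^+ j / j`!%:R) * (t ^+ k / k`!%:R))).
by apply: eq_bigr => m _; rewrite exprD_fact.
Qed.

Lemma cvg_expsum_tail s t : expsum_tail s t N @[N --> \oo] --> 0.
Proof.
have -> : expsum_tail s t = (fun N => expsum s N * expsum t N - expsum (s + t) N).
  by apply/funext => N; rewrite expsumM addrC addKr.
rewrite -(subrr (expR (s + t))); apply: cvgB; last exact: cvg_expsum.
by rewrite expRD; apply: cvgM; exact: cvg_expsum.
Qed.

(** The factor n accounts for the sum over the intermediate index of a product, so that the k-th
    power of this number bounds the entries of A^k. *)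
Definition mxpow_bound A : R := n%:R * \sum_(i < n) \sum_(j < n) `|A i j|.

Lemma mxpow_bound_ge0 A : 0 <= mxpow_bound A.
Proof. by rewrite mulr_ge0//; do 2![apply: sumr_ge0 => ? _]. Qed.

Lemma mxpow_le A k i j : `|(A ^+ k) i j| <= mxpow_bound A ^+ k.
Proof.
elim: k i j => [|k IHk] i j.
  by rewrite !expr0 mxE; case: eqP; rewrite ?normr1 ?normr0.
rewrite exprS mxE (le_trans (ler_norm_sum _ _ _))// exprS.
have Al l : `|A i l| <= \sum_(i < n) \sum_(j < n) `|A i j|.
  rewrite (bigD1 i)//= (bigD1 l)//= -addrA lerDl addr_ge0//.
    by apply: sumr_ge0.
  by do 2![apply: sumr_ge0 => ? _].
apply: (@le_trans _ _ (\sum_(l < n) (\sum_(i < n) \sum_(j < n) `|A i j|) * mxpow_bound A ^+ k)).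
  by apply: ler_sum => l _; rewrite normrM ler_pM.
rewrite sumr_const card_ord -mulr_natl mulrA//.
Qed.

Definition mxexpsum A N : 'M[R]_n := \sum_(k < N) (k`!%:R)^-1 *: A ^+ k.

Lemma mxexprS A k : A ^+ k.+1 = A *m A ^+ k.
Proof. exact: exprS. Qed.

Lemma mxexprD A j k : A ^+ (j + k) = A ^+ j *m A ^+ k.
Proof. exact: exprD. Qed.

Lemma exprZ_mx s A k : (s *: A) ^+ k = s ^+ k *: A ^+ k.
Proof.
elim: k => [|k IHk]; first by rewrite !expr0 scale1r.
by rewrite !mxexprS IHk -scalemxAl -scalemxAr scalerA -exprS.
Qed.

Lemma mxexpsumZ s A N : mxexpsum (s *: A) N = \sum_(k < N) (s ^+ k / k`!%:R) *: A ^+ k.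
Proof. by apply: eq_bigr => k _; rewrite exprZ_mx scalerA mulrC. Qed.

Lemma is_cvg_mxexpsum A i j : cvgn (fun N => mxexpsum A N i j).
Proof.
have -> : (fun N => mxexpsum A N i j) = series (fun k => (k`!%:R)^-1 * (A ^+ k) i j).
  apply/funext => N; rewrite /mxexpsum summxE /series/= big_mkord.
  by apply: eq_bigr => k _; rewrite mxE.
apply: normed_cvg; apply: (@series_le_cvg _ _ (exp_coeff (mxpow_bound A))).
- by move=> k; exact: normr_ge0.
- by move=> k; rewrite exp_coeff_ge0 ?mxpow_bound_ge0.
- move=> k; rewrite /= normrM ger0_norm ?invr_ge0// /exp_coeff/= mulrC.
  by rewrite ler_wpM2r ?invr_ge0// mxpow_le.
- exact: is_cvg_series_exp_coeff.
Qed.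

Lemma expmxE A : expmx A = \matrix_(i, j) limn (fun N => mxexpsum A N i j).
Proof.
apply: limn_mx => i j; rewrite mxE; have := @is_cvg_mxexpsum A i j.
have -> : (fun k => series (fun k0 => (k0`!%:R)^-1 *: A ^+ k0) k i j) = (fun N => mxexpsum A N i j).
  by apply/funext => N; rewrite /series/= big_mkord.
exact.
Qed.

Lemma cvg_mxexpsum A i j : mxexpsum A N i j @[N --> \oo] --> expmx A i j.
Proof. by rewrite expmxE mxE; exact: is_cvg_mxexpsum. Qed.

Lemma expmx_uniq A (M : 'M[R]_n) : (forall i j, mxexpsum A N i j @[N --> \oo] --> M i j) -> expmx A = M.
Proof. by move=> H; apply/matrixP => i j; exact: cvg_unique (@cvg_mxexpsum A i j) (H i j). Qed.

Lemma expmx_tr A : (expmx A)^T = expmx A^T.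
Proof.
apply/esym/expmx_uniq => i j; rewrite mxE.
have trX k : (A^T) ^+ k = (A ^+ k)^T.
  elim: k => [|k IHk]; first by rewrite !expr0 trmx1.
  by rewrite exprSr [in RHS]mxexprS trmx_mul -IHk.
have -> : (fun N => mxexpsum A^T N i j) = (fun N => mxexpsum A N j i).
  apply/funext => N; rewrite /mxexpsum !summxE; apply: eq_bigr => k _.
  by rewrite !mxE trX mxE.
exact: cvg_mxexpsum.
Qed.

Lemma expmx0 : expmx (0 : 'M[R]_n) = 1%:M.
Proof.
apply: expmx_uniq => i j; apply: cvg_near_cst; exists 1%N => // -[//|N] _.
rewrite /mxexpsum big_ord_recl/= expr0 invr1 scale1r big1 ?addr0// => k _.
by rewrite exprS mul0r scaler0.
Qed.

(** A Cauchy product: the triangle of indices sums to the truncated series of (s + t) A, and the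
    remaining terms are dominated entrywise by [expsum_tail]. *)
Lemma expmxD s t A : expmx ((s + t) *: A) = expmx (s *: A) *m expmx (t *: A).
Proof.
set b := mxpow_bound A; have b0 : 0 <= b := mxpow_bound_ge0 A.
pose tail N : 'M[R]_n := \sum_(j < N) \sum_(N - j <= k < N) ((s ^+ j / j`!%:R) * (t ^+ k / k`!%:R)) *: A ^+ (j + k).
have E N : mxexpsum (s *: A) N *m mxexpsum (t *: A) N = mxexpsum ((s + t) *: A) N + tail N.
  pose f j k := ((s ^+ j / j`!%:R) * (t ^+ k / k`!%:R)) *: A ^+ (j + k).
  have -> : mxexpsum (s *: A) N *m mxexpsum (t *: A) N = \sum_(j < N) \sum_(k < N) f j k.
    rewrite !mxexpsumZ mulmx_suml; apply: eq_bigr => j _; rewrite mulmx_sumr.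
    by apply: eq_bigr => k _; rewrite -scalemxAl -scalemxAr scalerA /f mxexprD.
  rewrite sum_square -sum_triangle; congr (_ + _).
  rewrite mxexpsumZ; apply: eq_bigr => m _.
  rewrite exprD_fact scaler_suml; apply: eq_bigr => j _; rewrite /f subnKC// -ltnS//.
have tail0 i j : tail N i j @[N --> \oo] --> 0.
  apply/cvgr0Pnorm_le => e e0; have := @cvg_expsum_tail (`|s| * b) (`|t| * b).
  move=> /cvgr0Pnorm_le /(_ _ e0); apply: filterS => N; apply: le_trans.
  rewrite (le_trans _ (ler_norm _))// /tail summxE (le_trans (ler_norm_sum _ _ _))//.
  apply: ler_sum => l _; rewrite summxE (le_trans (ler_norm_sum _ _ _))//.
  apply: ler_sum => k _; rewrite mxE !normrM !normrX !normfV !normr_nat !(exprMn _ _ b).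
  rewrite [leRHS](_ : _ = `|s| ^+ l / l`!%:R * (`|t| ^+ k / k`!%:R) * b ^+ (l + k)).
    by rewrite ler_wpM2l ?mxpow_le// !mulr_ge0 ?invr_ge0 ?exprn_ge0.
  by rewrite exprD; ring.
apply: expmx_uniq => i j.
have -> : (fun N => mxexpsum ((s + t) *: A) N i j) = (fun N =>
    \sum_l mxexpsum (s *: A) N i l * mxexpsum (t *: A) N l j - tail N i j).
  by apply/funext => N; have := congr1 (fun M : 'M[R]_n => M i j) (E N); rewrite !mxE => ->; rewrite addrK.
rewrite mxE -[X in _ --> X]subr0; apply: cvgB => //.
apply: cvg_big => [|l _]; [exact: add_continuous|]; apply: cvgM; exact: cvg_mxexpsum.
Qed.

Lemma expmx_le t A i j : `|expmx (t *: A) i j| <= expR (`|t| * mxpow_bound A).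
Proof.
have := @cvg_mxexpsum (t *: A) i j => /cvg_norm c.
have H : \forall N \near \oo, `|mxexpsum (t *: A) N i j| <= expR (`|t| * mxpow_bound A).
  apply: nearW => N; rewrite mxexpsumZ summxE (le_trans (ler_norm_sum _ _ _))//.
  apply: le_trans (@expsum_le _ N _); last by rewrite mulr_ge0 ?mxpow_bound_ge0.
  apply: ler_sum => k _; rewrite mxE !normrM normrX normfV normr_nat exprMn mulrAC.
  by rewrite ler_wpM2r ?invr_ge0// ler_wpM2l ?mxpow_le// exprn_ge0.
by rewrite -(cvg_lim _ c)//; apply: limr_le => //; apply/cvg_ex; eexists; exact: c.
Qed.

Lemma measurable_expmx A i j : measurable_fun setT (fun t => expmx (t *: A) i j).
Proof.
apply: (@measurable_fun_cvg _ _ _ _ (fun N t => mxexpsum (t *: A) N i j)) => //.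
- move=> N; under eq_fun do rewrite mxexpsumZ summxE.
  apply: measurable_sum => k; under eq_fun do rewrite mxE.
  by apply: measurable_funM => //; apply: measurable_funM => //; exact: measurable_funX.
- by move=> t _; exact: cvg_mxexpsum.
Qed.

Lemma expmx_unit t A : expmx (t *: A) \in unitmx.
Proof.
have := expmxD t (- t) A; rewrite subrr scale0r expmx0 => /esym/mulmx1_unit[].
done.
Qed.

(** For |t| <= 1 every term of order at least 2 carries a factor t^2, and what is left is dominated
    by the exponential series at [mxpow_bound A]. *)
Lemma expmx_taylor A t i j : `|t| <= 1 ->
  `|expmx (t *: A) i j - ((i == j)%:R + t * A i j)| <= expR (mxpow_bound A) * t ^+ 2.
Proof.
move=> t1; set b := mxpow_bound A; have b0 : 0 <= b := mxpow_bound_ge0 A.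
have c : `|mxexpsum (t *: A) N i j - ((i == j)%:R + t * A i j)| @[N --> \oo] -->
    `|expmx (t *: A) i j - ((i == j)%:R + t * A i j)|.
  by apply: cvg_norm; apply: cvgB; [exact: cvg_mxexpsum|exact: cvg_cst].
have H : \forall N \near \oo, `|mxexpsum (t *: A) N i j - ((i == j)%:R + t * A i j)| <=
    expR b * t ^+ 2.
  exists 2%N => // -[|[|N]]// _.
  rewrite mxexpsumZ 2!big_ord_recl/= !mxE summxE expr0 !expr1 !divr1 mul1r addrA.
  have K (u v w : R) : u + v + w - (u + v) = w by ring.
  rewrite K (le_trans (ler_norm_sum _ _ _))//.
  apply: (@le_trans _ _ (expsum b N.+2 * t ^+ 2)); last first.
    by rewrite ler_wpM2r ?sqr_ge0// expsum_le.
  rewrite /expsum 2!big_ord_recl/= mulrDl mulrDl addrA ler_wpDl//.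
    by rewrite addr_ge0// mulr_ge0 ?sqr_ge0// divr_ge0// exprn_ge0.
  rewrite mulr_suml; apply: ler_sum => k _; rewrite mxE normrM (normrM (t ^+ _)) normrX normfV normr_nat.
  rewrite [leRHS]mulrAC [leLHS]mulrAC ler_wpM2r ?invr_ge0// mulrC.
  apply: ler_pM; rewrite ?exprn_ge0 ?mxpow_le//.
  rewrite /bump/= !add1n -[t ^+ 2]ger0_norm ?sqr_ge0// normrX.
  by rewrite (exprD _ 2 k) ler_piMr ?exprn_ge0// exprn_ile1.
by rewrite -(cvg_lim _ c)//; apply: limr_le => //; apply/cvg_ex; eexists; exact: c.
Qed.

End exponential_sums.

(** * First-order expansion of the determinant *)

Section det_expansion.
Context {R : realType}.

Lemma prod1D_le n (d : 'I_n -> R) (e : R) : 0 <= e <= 1 -> (forall i, `|d i| <= e) ->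
  `|\prod_i (1 + d i) - (1 + \sum_i d i)| <= 4 ^+ n * e ^+ 2.
Proof.
move=> /andP[e0 e1]; elim: n d => [|n IHn] d de.
  by rewrite !big_ord0 addr0 subrr normr0 mulr_ge0// sqr_ge0.
rewrite !big_ord_recl; set P := \prod_(i < n) _; set S := \sum_(i < n) _.
rewrite (_ : _ - _ = (1 + d ord0) * (P - (1 + S)) + d ord0 * S); last by ring.
rewrite (le_trans (ler_normD _ _))// !normrM.
have h1 : `|1 + d ord0| <= 2.
  rewrite (le_trans (ler_normD _ _))// normr1 (_ : 2 = 1 + 1)//.
  by rewrite lerD2l (le_trans (de _)).
have h2 : `|S| <= n%:R * e.
  rewrite (le_trans (ler_norm_sum _ _ _))// -[n in leRHS]card_ord mulr_natl -sumr_const.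
  by apply: ler_sum => i _; exact: de.
have h3 : n%:R <= (4 : R) ^+ n by rewrite -natrX ler_nat ltnW// ltn_expl.
apply: (@le_trans _ _ (2 * (4 ^+ n * e ^+ 2) + e * (n%:R * e))).
  by apply: lerD; apply: ler_pM => //; apply: IHn => i; exact: de.
have h4 : n%:R * e ^+ 2 <= 4 ^+ n * e ^+ 2 by rewrite ler_wpM2r// sqr_ge0.
have h5 : 0 <= (4 : R) ^+ n * e ^+ 2 by rewrite mulr_ge0 ?sqr_ge0// exprn_ge0.
rewrite [4 ^+ n.+1]exprS; move: h4 h5; set u := 4 ^+ n * e ^+ 2 => h4 h5.
rewrite [e * _]mulrCA -expr2 -mulrA -/u; move: h4 h5; lra.
Qed.

(** The identity permutation contributes 1 + tr D up to an error of order e^2. Any other permutation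
    moves some index and hence its image too, so its product has two off-diagonal factors of size e,
    the others being at most 2. *)
Lemma det1D_le n (D : 'M[R]_n) (e : R) : 0 <= e <= 1 -> (forall i j, `|D i j| <= e) ->
  \det (1%:M + D) <= 1 + \tr D + (4 ^+ n + #|{perm 'I_n}|%:R * 2 ^+ n) * e ^+ 2.
Proof.
move=> e01 De; have /andP[e0 e1] := e01.
rewrite /determinant (bigD1 1%g)//= odd_perm1 expr0 mul1r mulrDl addrA lerD//.
  have := @prod1D_le n (fun i => D i i) e e01 (fun i => De i i).
  rewrite ler_norml => /andP[_]; rewrite lerBlDl.
  rewrite [X in _ -> X <= _](eq_bigr (fun i => 1 + D i i)) => [H|i _]; last by rewrite perm1 !mxE eqxx.
  by rewrite (le_trans H)// addrC.
apply: (@le_trans _ _ (\sum_(s : {perm 'I_n} | s != 1%g) (2 ^+ n * e ^+ 2))); last first.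
  rewrite [leRHS](_ : _ = #|{perm 'I_n}|%:R * (2 ^+ n * e ^+ 2)); last by rewrite mulrA.
  rewrite sumr_const -[leLHS]mulr_natl ler_wpM2r ?mulr_ge0 ?sqr_ge0 ?exprn_ge0//.
  by rewrite ler_nat; apply: max_card.
apply: ler_sum => s s1; rewrite (le_trans (ler_norm _))// normrM normrX normrN1 expr1n mul1r.
have [i si] : exists i, s i != i.
  apply/existsP; apply: contraR s1 => /existsPn H; apply/eqP/permP => i.
  by rewrite perm1; apply/eqP; have := H i; rewrite negbK.
have m2 i' j' : `|(1%:M + D) i' j'| <= 2.
  rewrite !mxE (le_trans (ler_normD _ _))// (_ : 2 = 1 + 1)// lerD//; last exact: le_trans (De _ _) e1.
  by case: eqP; rewrite ?normr1 ?normr0.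
have mo i' j' : i' != j' -> `|(1%:M + D) i' j'| <= e.
  by move=> ij; rewrite !mxE (negbTE ij) add0r.
rewrite normr_prod (bigD1 i)//= (bigD1 (s i))/=; last by [].
rewrite mulrA [leRHS]mulrC; apply: ler_pM.
- by rewrite mulr_ge0.
- by apply: prodr_ge0.
- rewrite expr2; apply: ler_pM => //; apply: mo; first by rewrite eq_sym.
  by apply: contra si => /eqP/perm_inj <-.
- apply: (@le_trans _ _ (\prod_(i0 < n | (i0 != i) && (i0 != s i)) 2)).
    by apply: ler_prod => j _; rewrite normr_ge0 m2.
  rewrite prodr_const -[n in leRHS]card_ord ler_weXn2l// ?ler1n//; exact: max_card.
Qed.

End det_expansion.

Section det_exponential.
Context {R : realType} (n : nat).
Implicit Types (A : 'M[R]_n) (t : R).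

Let f A t := \det (expmx (t *: A)).

Let fD A s t : f A (s + t) = f A s * f A t.
Proof. by rewrite /f expmxD det_mulmx. Qed.

Let f0 A : f A 0 = 1.
Proof. by rewrite /f scale0r expmx0 det1. Qed.

Let f_neq0 A t : f A t != 0.
Proof. by rewrite -unitfE -[_ \is a _]/(_ \in unitmx) expmx_unit. Qed.

Let f_gt0 A t : 0 < f A t.
Proof.
have -> : t = t / 2 + t / 2 by field.
by rewrite fD -expr2 exprn_even_gt0// f_neq0.
Qed.

Let fX A t k : f A (k%:R * t) = f A t ^+ k.
Proof.
elim: k => [|k IHk]; first by rewrite mul0r f0.
by rewrite -addn1 natrD mulrDl mul1r fD IHk exprD expr1.
Qed.

(* As f A is multiplicative, f A t = f A (t / k) ^+ k, so that letting k grow in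
   this bound gives f A t <= expR (t * \tr A); its value at - t gives equality. *)
Let f_small A : exists2 K : R, 0 <= K & exists2 d : R, 0 < d & forall t, `|t| <= d ->
  f A t <= expR (t * \tr A + K * t ^+ 2).
Proof.
pose b := mxpow_bound A; pose c := b + expR b.
have b0 : 0 <= b := mxpow_bound_ge0 A.
have c1 : 1 <= c.
  by rewrite /c -[leLHS]add0r lerD// -expR0 ler_expR.
have c0 : 0 < c by rewrite (lt_le_trans _ c1).
pose P : R := 4 ^+ n + #|{perm 'I_n}|%:R * 2 ^+ n.
have P0 : 0 <= P by rewrite addr_ge0 ?mulr_ge0 ?exprn_ge0.
exists (n%:R * expR b + P * c ^+ 2).
  by rewrite addr_ge0// mulr_ge0 ?expR_ge0 ?sqr_ge0.
exists c^-1; first by rewrite invr_gt0.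
move=> t tc.
have t1 : `|t| <= 1 by rewrite (le_trans tc)// invf_le1.
pose D : 'M[R]_n := expmx (t *: A) - 1%:M.
have Dt i j : `|D i j - t * A i j| <= expR b * t ^+ 2.
  have := @expmx_taylor _ n A t i j t1; rewrite /D !mxE.
  by rewrite opprD addrA.
have t2 : t ^+ 2 <= `|t|.
  by rewrite -[t ^+ 2]ger0_norm ?sqr_ge0// normrX expr2 ler_piMl.
have De i j : `|D i j| <= `|t| * c.
  rewrite -[D i j](subrK (t * A i j)) (le_trans (ler_normD _ _))// mulrDr addrC lerD//.
    by rewrite normrM ler_wpM2l//; have := mxpow_le A 1 i j; rewrite !expr1.
  by rewrite (le_trans (Dt i j))// mulrC ler_wpM2r// expR_ge0.
have e01 : 0 <= `|t| * c <= 1.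
  by rewrite mulr_ge0//= ?(ltW c0)// -ler_pdivlMr// div1r.
have := det1D_le e01 De; rewrite (_ : 1%:M + D = expmx (t *: A)); last by rewrite /D addrC subrK.
move=> H; rewrite /f (le_trans H)// -/P.
have trD : \tr D <= t * \tr A + n%:R * (expR b * t ^+ 2).
  rewrite /mxtrace mulr_sumr -[n in n%:R]card_ord mulr_natl -sumr_const -big_split/=.
  apply: ler_sum => i _; rewrite -lerBlDl.
  exact: le_trans (ler_norm _) (Dt i i).
apply: le_trans (expR_ge1Dx _); rewrite -addrA lerD2l.
rewrite (_ : _ * t ^+ 2 = n%:R * (expR b * t ^+ 2) + P * (`|t| * c) ^+ 2); last first.
  by rewrite exprMn real_normK ?num_real//; ring.
by rewrite addrA lerD2r.
Qed.

Let f_le A t : f A t <= expR (t * \tr A).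
Proof.
have [K K0 [d d0 fd]] := f_small A.
rewrite -(lnK (f_gt0 A t : _ \in Num.pos)) ler_expR; apply/ler_addgt0Pr => e e0.
(* For N >= c the time t/N is in the range of [f_small] and the accumulated error K t^2 / N is at
   most e. *)
pose c := `|t| / d + K * t ^+ 2 / e.
have c0 : 0 <= c.
  apply: addr_ge0; first exact: divr_ge0 (normr_ge0 _) (ltW d0).
  exact: divr_ge0 (mulr_ge0 K0 (sqr_ge0 _)) (ltW e0).
pose N := (Num.bound c).+1.
have N0 : 0 < (N%:R : R) by rewrite ltr0n.
have cN : c <= N%:R.
  by rewrite (le_trans (ltW (archi_boundP c0)))// ler_nat.
have tN : `|t / N%:R| <= d.
  rewrite normrM normfV normr_nat ler_pdivrMr// mulrC -ler_pdivrMr// (le_trans _ cN)//.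
  by rewrite lerDl; exact: divr_ge0 (mulr_ge0 K0 (sqr_ge0 _)) (ltW e0).
have KN : K * t ^+ 2 / N%:R <= e.
  rewrite ler_pdivrMr// [e * _]mulrC -ler_pdivrMr// (le_trans _ cN)//.
  by rewrite lerDr; exact: divr_ge0 (normr_ge0 _) (ltW d0).
have E : f A t = f A (t / N%:R) ^+ N by rewrite -fX mulrC divfK ?gt_eqF.
have := fd _ tN; rewrite -(ler_pXn2r (n := N))// ?nnegrE ?expR_ge0 ?(ltW (f_gt0 _ _))//.
rewrite -E -expRM_natl -ler_ln ?posrE ?expR_gt0 ?f_gt0// expRK => H.
apply: (le_trans H); rewrite mulrDr.
rewrite (_ : N%:R * (t / N%:R * \tr A) = t * \tr A); last by field; rewrite gt_eqF.
rewrite (_ : N%:R * (K * (t / N%:R) ^+ 2) = K * t ^+ 2 / N%:R); last by field; rewrite gt_eqF.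
by rewrite lerD2l.
Qed.

Theorem det_expmx A t : \det (expmx (t *: A)) = expR (t * \tr A).
Proof.
rewrite -/(f A t); apply/eqP; rewrite eq_le f_le/=.
have : f A t * f A (- t) = 1 by rewrite -fD subrr f0.
move=> /(canRL (mulfK (f_neq0 A (- t)))) ->; rewrite mul1r.
rewrite -[leLHS]invrK -expRN lef_pV2 ?posrE ?expR_gt0 ?f_gt0//.
by rewrite -mulNr f_le.
Qed.

End det_exponential.

Lemma integrableMl_EFin {R : realType} d (T : measurableType d) (mu : {measure set T -> \bar R})
    (D : set T) (c : R) (f : T -> R) : measurable D ->
  mu.-integrable D (EFin \o f) -> mu.-integrable D (EFin \o (fun x => c * f x)).
Proof. by move=> mD fi; rewrite /comp; under eq_fun do rewrite EFinM; exact: integrableZl. Qed.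

Lemma Rintegral_sum {R : realType} d (T : measurableType d) (mu : {measure set T -> \bar R})
    (D : set T) (I : Type) (s : seq I) (F : I -> T -> R) : measurable D ->
  (forall i, mu.-integrable D (EFin \o F i)) ->
  \int[mu]_(x in D) (\sum_(i <- s) F i x) = \sum_(i <- s) \int[mu]_(x in D) F i x.
Proof.
move=> mD iF; elim: s => [|i s IHs].
  rewrite big_nil; under eq_Rintegral do rewrite big_nil.
  by rewrite /Rintegral integral0.
rewrite big_cons -IHs -RintegralD//; last first.
  rewrite (_ : _ \o _ = (fun x => \sum_(j <- s) (F j x)%:E)%E); last first.
    by apply/funext => x; rewrite /= sumEFin.
  by apply: integrable_sum => // j _; exact: iF.
by apply: eq_Rintegral => x _; rewrite big_cons.
Qed.

Lemma Rintegral_off_point {R : realType} (f g : R -> R) (a : R) :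
  measurable_fun setT f -> measurable_fun setT g -> (forall v, v != a -> f v = g v) ->
  \int[lebesgue_measure]_v f v = \int[lebesgue_measure]_v g v.
Proof.
move=> mf mg fg; rewrite /Rintegral; congr fine; apply: ae_eq_integral => //.
- exact/measurable_EFinP.
- exact/measurable_EFinP.
- exists [set a]; split => //; first exact: lebesgue_measure_set1.
  by move=> v /= H; apply: contrapT => /eqP va; apply: H => _; rewrite fg.
Qed.

Lemma Rintegral_mulmx {R : realType} d (T : measurableType d) (mu : {measure set T -> \bar R})
    m n p q (A : 'M[R]_(m, n)) (h : T -> 'M[R]_(n, p)) (C : 'M[R]_(p, q)) i j :
  (forall l k, mu.-integrable setT (EFin \o (fun v => h v l k))) ->
  \int[mu]_v (A *m h v *m C) i j = (A *m (\matrix_(l, k) \int[mu]_v h v l k) *m C) i j.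
Proof.
move=> ih.
have E v : (A *m h v *m C) i j = \sum_k \sum_l (A i l * C k j) * h v l k.
  rewrite mxE; apply: eq_bigr => k _; rewrite mxE mulr_suml.
  by apply: eq_bigr => l _; ring.
under eq_Rintegral do rewrite E.
have iZ k l : mu.-integrable setT (EFin \o (fun v => (A i l * C k j) * h v l k)).
  exact (integrableMl_EFin _ measurableT (ih l k)).
rewrite (Rintegral_sum _ measurableT) => [|k]; last first.
  rewrite (_ : _ \o _ = (fun v => \sum_l ((A i l * C k j) * h v l k)%:E)%E).
    by apply: integrable_sum => // l _; exact: iZ.
  by apply/funext => v; rewrite /= sumEFin.
rewrite mxE; apply: eq_bigr => k _; rewrite (Rintegral_sum _ measurableT)//.
rewrite mxE mulr_suml; apply: eq_bigr => l _.
by rewrite (RintegralZl _ measurableT)// mxE; ring.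
Qed.

(** * The Gramian and its additivity in time *)

Section gramian_facts.
Context {R : realType} (n : nat) (Q B : 'M[R]_n).
Notation mu := (@lebesgue_measure R).

Let K (u : R) : 'M[R]_n := expmx (u *: B) *m Q *m expmx (u *: B^T).

Let KE u i j : K u i j = \sum_k (\sum_l expmx (u *: B) i l * Q l k) * expmx (u *: B^T) k j.
Proof. by rewrite /K mxE; apply: eq_bigr => k _; rewrite mxE. Qed.

Let mK i j : measurable_fun setT (fun u => K u i j).
Proof.
under eq_fun do rewrite KE.
apply: measurable_sum => k; apply: measurable_funM; last exact: measurable_expmx.
by apply: measurable_sum => l; apply: measurable_funM => //; exact: measurable_expmx.
Qed.

Let Kbound i j (t : R) : exists M : R, forall u, 0 <= u <= t -> `|K u i j| <= M.
Proof.
pose e1 := expR (t * mxpow_bound B); pose e2 := expR (t * mxpow_bound B^T).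
exists (\sum_k (\sum_l e1 * `|Q l k|) * e2) => u /andP[u0 ut].
have h1 i' j' : `|expmx (u *: B) i' j'| <= e1.
  rewrite (le_trans (expmx_le _ _ _ _))// ler_expR ger0_norm// ler_wpM2r// mxpow_bound_ge0//.
have h2 i' j' : `|expmx (u *: B^T) i' j'| <= e2.
  rewrite (le_trans (expmx_le _ _ _ _))// ler_expR ger0_norm// ler_wpM2r// mxpow_bound_ge0//.
rewrite KE (le_trans (ler_norm_sum _ _ _))//; apply: ler_sum => k _.
rewrite normrM; apply: ler_pM => //.
rewrite (le_trans (ler_norm_sum _ _ _))//; apply: ler_sum => l _.
by rewrite normrM; apply: ler_wpM2r.
Qed.

(** With the interval written as a factor, all integrals run over the line; measurability in the
    endpoint and translation then follow from the general lemmas. *)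
Let bK (P : R -> bool) i j u : R := (P u)%:R * K u i j.

Let mbK (P : R -> bool) i j : measurable_fun setT (fun u => (P u)%:R : R) ->
  measurable_fun setT (bK P i j).
Proof. by move=> mP; exact: measurable_funM. Qed.

Let ibK (P : R -> bool) i j t : measurable_fun setT (fun u => (P u)%:R : R) ->
  (forall u, P u -> 0 <= u <= t) -> mu.-integrable setT (EFin \o bK P i j).
Proof.
move=> mP Pt; have [M KM] := Kbound i j t.
have M0 u : 0 <= u <= t -> 0 <= M by move=> /KM; exact: le_trans.
apply: (@le_integrable _ _ _ mu _ measurableT _ (EFin \o (fun u => M * \1_(`[0, t]%classic) u))) => //.
- by apply/measurable_EFinP; exact (mbK i j mP).
- move=> u _; rewrite lee_fin (le_trans _ (ler_norm _))// /bK normrM normr_nat indicE.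
  rewrite (in_set_bool (fun u => u \in `[0, t])) in_itv/=.
  have [Pu|nPu] := boolP (P u); last first.
    rewrite mul0r; case: (boolP (0 <= u <= t)) => [/M0 ?|_]; by rewrite ?mulr1 ?mulr0.
  by rewrite (Pt u Pu) mul1r mulr1 KM// Pt.
- rewrite /comp; under eq_fun do rewrite EFinM.
  by apply: integrableZl => //; exact: (@integrable_indic_itv R 0 t true false).
Qed.

Let itv_bool (a b : R) u : (u \in `[a, b]%classic) = (a <= u <= b).
Proof. by rewrite (in_set_bool (fun u => u \in `[a, b])) in_itv. Qed.

Lemma gramianE t i j : gramian Q B t i j = \int[mu]_u bK (fun u => 0 <= u <= t) i j u.
Proof.
rewrite mxE Rintegral_mkcond; apply: eq_Rintegral => u _.
by rewrite /patch itv_bool /bK; case: ifP => _; rewrite ?mul1r ?mul0r.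
Qed.

Lemma gramian_sym t : Q^T = Q -> (gramian Q B t)^T = gramian Q B t.
Proof.
move=> QT; apply/matrixP => i j; rewrite mxE !gramianE; apply: eq_Rintegral => u _.
congr (_ * _); have : (K u)^T = K u.
  by rewrite /K !trmx_mul QT !expmx_tr !linearZ/= trmxK mulmxA.
by move=> /matrixP/(_ i j); rewrite mxE.
Qed.

Let mb2 : measurable_fun setT (fun z : R * R => (0 <= z.2 <= z.1)%R%:R : R).
Proof.
rewrite (_ : (fun _ => _) = (fun z : R * R => (0 <= z.2)%R%:R * (z.2 <= z.1)%R%:R)).
  by apply: measurable_funM; apply: measurable_le_nat.
by apply/funext => z; rewrite -natrM mulnb.
Qed.

Let mb (a b : R) : measurable_fun setT (fun v : R => (a <= v <= b)%R%:R : R).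
Proof.
rewrite (_ : (fun _ => _) = (fun v : R => (a <= v)%R%:R * (v <= b)%R%:R)).
  by apply: measurable_funM; apply: measurable_le_nat.
by apply/funext => z; rewrite -natrM mulnb.
Qed.

Let mb' (a b : R) : measurable_fun setT (fun v : R => (a < v <= b)%R%:R : R).
Proof.
rewrite (_ : (fun _ => _) = (fun v : R => (a < v)%R%:R * (v <= b)%R%:R)).
  by apply: measurable_funM; [apply: measurable_lt_nat|apply: measurable_le_nat].
by apply/funext => z; rewrite -natrM mulnb.
Qed.

Lemma measurable_gramian i j : measurable_fun setT (fun t => gramian Q B t i j).
Proof.
under eq_fun do rewrite gramianE.
apply (@measurable_Rintegral_param _ _ _ _ _ mu (fun t u : R => bK (fun u => 0 <= u <= t) i j u)).
apply: measurable_funM; first exact: mb2.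
exact: (measurableT_comp (mK i j) measurable_snd).
Qed.

Let KD t u : K (t + u) = expmx (t *: B) *m K u *m (expmx (t *: B))^T.
Proof.
by rewrite /K expmx_tr linearZ/= expmxD [t + u]addrC expmxD !mulmxA.
Qed.

(** The part of the integral over ]t, t + u] is translated to start at 0, and e^((t+v)B) = e^(tB)
    e^(vB) conjugates its integrand by e^(tB). *)
Lemma gramianD t u : 0 <= t -> 0 <= u ->
  gramian Q B (t + u) = gramian Q B t + expmx (t *: B) *m gramian Q B u *m (expmx (t *: B))^T.
Proof.
move=> t0 u0; apply/matrixP => i j; rewrite [RHS]mxE !gramianE.
have ig (i' j' : 'I_n) : mu.-integrable setT (EFin \o bK (fun v => t < v <= t + u) i' j').
  apply: (ibK _ _ (t := t + u)) => // v /andP[tv ->]; rewrite andbT.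
  by rewrite (le_trans t0)// ltW.
have i0 (b : R) (i' j' : 'I_n) : mu.-integrable setT (EFin \o bK (fun v => 0 <= v <= b) i' j').
  exact: (ibK _ _ (t := b)).
transitivity (\int[mu]_v bK (fun v => 0 <= v <= t) i j v + \int[mu]_v bK (fun v => t < v <= t + u) i j v).
  rewrite -RintegralD//; apply: eq_Rintegral => v _; rewrite /bK -mulrDl -natrD; congr (_%:R * _).
  case: (leP v t) => vt; rewrite ?andbF ?andbT ?addn0//=.
    by rewrite (le_trans vt) ?lerDl// andbT.
  by rewrite (le_trans t0 (ltW vt)).
congr (_ + _).
have E := @Rintegral_transport _ _ _ mu _ _ (measurable_affine 1 t)
    (fun f mf f0 => @ge0_integral_affine R 1 t f (oner_neq0 R) mf f0) _ (ig i j).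
rewrite normr1 invr1 mul1r in E; rewrite -E.
(* The translated interval is ]0, u], while the Gramian integrates over [0, u]; the point 0 is
   negligible. *)
have -> : \int[mu]_v bK (fun v => t < v <= t + u) i j (1 * v + t) =
    \int[mu]_v ((0 <= v <= u)%R%:R * K (t + v) i j).
  apply: (@Rintegral_off_point _ _ _ 0).
  - apply: (measurableT_comp (mbK i j (mb' t (t + u)))); exact: measurable_affine.
  - apply: measurable_funM; first exact: mb.
    by apply: (measurableT_comp (mK i j)); exact: measurable_funD.
  - move=> v v0; rewrite /bK mul1r [v + t]addrC ltrDl lerD2l lt_neqAle.
    by rewrite eq_sym v0.
pose h v : 'M[R]_n := (0 <= v <= u)%R%:R *: K v.
have hE v l k : h v l k = bK (fun v => 0 <= v <= u) l k v by rewrite mxE.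
have -> : (fun v => (0 <= v <= u)%R%:R * K (t + v) i j) =
    (fun v => (expmx (t *: B) *m h v *m (expmx (t *: B))^T) i j).
  by apply/funext => v; rewrite KD /h -scalemxAr -scalemxAl [RHS]mxE.
rewrite Rintegral_mulmx => [|l k]; last first.
  by rewrite /comp; under eq_fun do rewrite hE; exact (i0 u l k).
suff -> : \matrix_(l, k) \int[mu]_v h v l k = gramian Q B u by [].
by apply/matrixP => l k; rewrite mxE gramianE; apply: eq_Rintegral => v _; rewrite hE.
Qed.

End gramian_facts.

(** * The kernel of the propagator *)

Section quadratic_phase.
Context {R : realType} (n : nat).
Implicit Types (S M : 'M[R]_n) (x y : 'cV[R]_n).
Notation leb := (lebesgue_cV R n).

Definition qphase S M x y : R := 4^-1 * cvdot (S *m (y - M *m x)) (y - M *m x).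

(** For symmetric S, the coefficient of the only term of [qphase] that couples x and y; the other
    two terms give unimodular factors in x or in y alone. *)
Definition cross S M : 'M[R]_n := (- 2^-1) *: (S *m M).

Lemma qphaseE S M x y : S^T = S ->
  qphase S M x y = 4^-1 * cvdot (S *m y) y + cvdot (cross S M *m x) y + 4^-1 * cvdot (S *m (M *m x)) (M *m x).
Proof.
move=> ST; rewrite /qphase mulmxBr !(cvdotBl, cvdotBr) /cross -scalemxAl cvdotZl -mulmxA.
have -> : cvdot (S *m y) (M *m x) = cvdot (S *m (M *m x)) y by rewrite cvdot_mulmxl ST cvdotC.
by field.
Qed.

Lemma det_cross S M : `|\det (cross S M)| = 2^-1 ^+ n * (`|\det S| * `|\det M|).
Proof.
rewrite /cross detZ det_mulmx normrM normrX normrN normrM.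
by have -> : `|2^-1 : R| = 2^-1 by rewrite ger0_norm.
Qed.

Lemma cross_unit S M : S \in unitmx -> M \in unitmx -> cross S M \in unitmx.
Proof.
move=> Su Mu; rewrite unitmxE unitfE -normr_eq0 det_cross.
have S0 : \det S != 0 by rewrite -unitfE -unitmxE.
have M0 : \det M != 0 by rewrite -unitfE -unitmxE.
by rewrite !mulf_neq0 ?expf_neq0 ?normr_eq0 ?invr_eq0.
Qed.

Lemma measurable_mulmxT d (T : measurableType d) m k (F : T -> 'M[R]_(m, k)) (v : T -> 'cV[R]_k) :
  (forall i j, measurable_fun setT (fun t => F t i j)) -> measurable_fun setT v ->
  measurable_fun setT (fun t => F t *m v t).
Proof.
move=> mF mv; apply: measurable_fun_coorP => i; under eq_fun do rewrite mxE.
apply: measurable_sum => j; apply: measurable_funM => //.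
exact: (measurableT_comp (measurable_coor j) mv).
Qed.

Lemma measurable_qphase d (T : measurableType d) (S M : T -> 'M[R]_n) (x y : T -> 'cV[R]_n) :
  (forall i j, measurable_fun setT (fun t => S t i j)) ->
  (forall i j, measurable_fun setT (fun t => M t i j)) ->
  measurable_fun setT x -> measurable_fun setT y ->
  measurable_fun setT (fun t => qphase (S t) (M t) (x t) (y t)).
Proof.
move=> mS mM mx my; apply: measurable_funM => //.
have mz : measurable_fun setT (fun t => y t - M t *m x t).
  by apply: measurable_cVB => //; exact: measurable_mulmxT.
by apply: measurable_cvdot => //; exact: measurable_mulmxT.
Qed.

Let mq' S M y : measurable_fun setT (fun x => qphase S M x y).
Proof. by apply: measurable_qphase. Qed.

Let fourier_cross (N : 'M[R]_n) (g : 'cV[R]_n -> R[i]) : N \in unitmx -> cL12 leb g ->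
  (\int[leb]_x (cmod (fourier g (N *m x)) ^+ 2)%:E <=
    ((2 * pi) ^+ n / `|\det N|)%:E * \int[leb]_y (cmod (g y) ^+ 2)%:E)%E.
Proof.
move=> Nu gL; rewrite (ge0_integral_mulmx (f := fun x => (cmod (fourier g x) ^+ 2)%:E) Nu).
- rewrite mulrC EFinM -muleA; apply: lee_wpmul2l; first by rewrite lee_fin invr_ge0.
  exact: plancherel_le.
- by apply: measurable_cmod_sqr; apply: cmeasurable_fourier; case: gL.
- by move=> x; rewrite lee_fin sqr_ge0.
Qed.

Let cst_cross S M : (2 * pi) ^+ n / `|\det (cross S M)| = (4 * pi) ^+ n / (`|\det S| * `|\det M|).
Proof.
rewrite det_cross invfM exprVn invrK mulrA -exprMn; congr (_ ^+ n / _); ring.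
Qed.

(** Up to a unimodular factor the operator multiplies f by a quadratic phase, takes the Fourier
    transform and evaluates it at [cross S M *m x]. Plancherel's inequality and the change of
    variables by that matrix give the constant. *)
Lemma qphase_L2 S M f : S^T = S -> S \in unitmx -> M \in unitmx -> cL12 leb f ->
  (\int[leb]_x (cmod (cintegral leb (fun y => expi (qphase S M x y) * f y)) ^+ 2)%:E <=
    ((4 * pi) ^+ n / (`|\det S| * `|\det M|))%:E * \int[leb]_y (cmod (f y) ^+ 2)%:E)%E.
Proof.
move=> ST Su Mu fL; have [mf _ _] := fL.
pose a y := 4^-1 * cvdot (S *m y) y.
have ma : measurable_fun setT a.
  by apply: measurable_funM => //; apply: measurable_cvdot => //; apply: measurable_mulmxT.
pose g y := expi (a y) * f y.
have gL : cL12 leb g by exact: cL12_phase.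
have E x : cmod (cintegral leb (fun y => expi (qphase S M x y) * f y)) = cmod (fourier g (cross S M *m x)).
  transitivity (cmod (expi (4^-1 * cvdot (S *m (M *m x)) (M *m x)) * fourier g (cross S M *m x))); last first.
    by rewrite cmodM cmod_expi mul1r.
  rewrite /fourier -cintegralZ; last first.
    apply: cL12_cintegrable; apply: cL12_phase => //; apply: measurable_cvdot => //.
  congr cmod; apply: eq_cintegral => y; rewrite qphaseE// !expiD /g; ring.
under eq_integral do rewrite E.
rewrite -cst_cross; apply: le_trans (fourier_cross (cross_unit Su Mu) gL) _.
rewrite le_eqVlt; apply/orP; left; apply/eqP; congr (_ * _)%E; apply: eq_integral => y _.
by rewrite cmodM cmod_expi mul1r.
Qed.

(** After conjugation this is the same argument with the roles of x and y exchanged, so that the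
    transpose of [cross S M] appears. *)
Lemma qphase_adj_L2 S M f : S^T = S -> S \in unitmx -> M \in unitmx -> cL12 leb f ->
  (\int[leb]_y (cmod (cintegral leb (fun x => (expi (qphase S M x y))^*%C * f x)) ^+ 2)%:E <=
    ((4 * pi) ^+ n / (`|\det S| * `|\det M|))%:E * \int[leb]_y (cmod (f y) ^+ 2)%:E)%E.
Proof.
move=> ST Su Mu fL; have [mf _ _] := fL.
pose a x := 4^-1 * cvdot (S *m (M *m x)) (M *m x).
have ma : measurable_fun setT a.
  by apply: measurable_funM => //; apply: measurable_cvdot => //; do ?apply: measurable_mulmxT.
pose g x := expi (a x) * (f x)^*%C.
have gL : cL12 leb g by apply: cL12_phase => //; exact: cL12_conj.
have E y : cmod (cintegral leb (fun x => (expi (qphase S M x y))^*%C * f x)) = cmod (fourier g ((cross S M)^T *m y)).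
  rewrite -cmod_conj -cintegral_conj; last first.
    apply: cL12_cintegrable; under eq_fun do rewrite -expiN.
    by apply: cL12_phase => //; exact: measurableT_comp.
  transitivity (cmod (expi (4^-1 * cvdot (S *m y) y) * fourier g ((cross S M)^T *m y))); last first.
    by rewrite cmodM cmod_expi mul1r.
  rewrite /fourier -cintegralZ; last first.
    by apply: cL12_cintegrable; apply: cL12_phase => //; apply: measurable_cvdot.
  congr cmod; apply: eq_cintegral => x; rewrite conjcM conjcK qphaseE// !expiD /g.
  have -> : cvdot ((cross S M)^T *m y) x = cvdot (cross S M *m x) y by rewrite cvdot_mulmxl trmxK cvdotC.
  ring.
under eq_integral do rewrite E.
have Nu : (cross S M)^T \in unitmx by rewrite unitmx_tr cross_unit.
rewrite -cst_cross -(det_tr (cross S M)); apply: le_trans (fourier_cross Nu gL) _.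
rewrite le_eqVlt; apply/orP; left; apply/eqP; congr (_ * _)%E; apply: eq_integral => y _.
by rewrite cmodM cmod_expi mul1r cmod_conj.
Qed.

(** In y the two phases subtract to the quadratic form of (S1 - S2)/4 plus a linear term. The points
    x1 and x2 only enter the linear term and a constant unimodular factor, neither of which affects
    the bound. *)
Lemma qphase_pair e S1 M1 S2 M2 x1 x2 : 0 < e -> S1^T = S1 -> S2^T = S2 -> S1 - S2 \in unitmx ->
  cmod (cintegral leb (fun y => (gaussn e y)%:C%C *
    (expi (qphase S1 M1 x1 y) * (expi (qphase S2 M2 x2 y))^*%C))) ^+ 2 <=
  (4 * pi) ^+ n / `|\det (S1 - S2)|.
Proof.
move=> e0 S1T S2T Su.
pose P : 'M[R]_n := 4^-1 *: (S1 - S2).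
have PT : P^T = P by rewrite /P linearZ/= linearB/= S1T S2T.
have dP : \det P = 4^-1 ^+ n * \det (S1 - S2) by rewrite detZ.
have Pu : P \in unitmx.
  by rewrite unitmxE dP unitfE mulf_neq0 ?expf_neq0 ?invr_eq0// -unitfE -unitmxE.
pose b := cross S1 M1 *m x1 - cross S2 M2 *m x2.
pose c := 4^-1 * cvdot (S1 *m (M1 *m x1)) (M1 *m x1) - 4^-1 * cvdot (S2 *m (M2 *m x2)) (M2 *m x2).
have -> : (4 * pi) ^+ n / `|\det (S1 - S2)| = pi ^+ n / `|\det P|.
  by rewrite dP normrM invfM ger0_norm ?exprn_ge0// mulrA exprVn invrK [4 * pi]mulrC exprMn.
rewrite -[leRHS]mul1r -(expr1n _ 2) -(cmod_expi c).
apply: le_trans (ler_wpM2l (sqr_ge0 _) (oscillatory_gaussn_le b e0 PT Pu)).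
rewrite -exprMn -cmodM -cintegralZ.
  rewrite le_eqVlt; apply/orP; left; apply/eqP; congr (cmod _ ^+ 2).
  apply: eq_cintegral => y; rewrite [RHS]mulrCA -expiD -expiN -expiD; congr (_ * expi _).
  have -> : P *m y = 4^-1 *: (S1 *m y - S2 *m y) by rewrite /P -scalemxAl mulmxBl.
  rewrite !qphaseE// /b /c cvdotZl !cvdotBl; ring.
apply: (@cintegrable_le _ _ _ leb _ (gaussn e)).
- apply: cmeasurableM; first by apply: cmeasurableR; exact: measurable_gaussn.
  apply: cmeasurable_expi; apply: measurable_funD; last exact: measurable_cvdot.
  by apply: measurable_cvdot => //; apply: measurable_mulmxT.
- exact: integrable_gaussn.
- by move=> y; rewrite cmodM cmod_expi mulr1 cmodR ger0_norm// gaussn_ge0.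
Qed.

End quadratic_phase.

Lemma invmxB {R : realType} n (S T : 'M[R]_n) : S \in unitmx -> T \in unitmx ->
  invmx S - invmx T = invmx S *m (T - S) *m invmx T.
Proof.
by move=> Su Tu; rewrite mulmxBr mulmxBl mulVmx// mul1mx -mulmxA mulmxV// mulmx1.
Qed.

Lemma det_invmxB {R : realType} n (S T : 'M[R]_n) : S \in unitmx -> T \in unitmx ->
  `|\det (invmx S - invmx T)| = `|\det (S - T)| / (`|\det S| * `|\det T|).
Proof.
move=> Su Tu; rewrite invmxB// !det_mulmx !det_inv !normrM !normfV.
have -> : T - S = - 1 *: (S - T) by rewrite scaleN1r opprB.
rewrite detZ normrM normrX normrN1 expr1n mul1r invfM; ring.
Qed.

Lemma powR_Nhalf_sqr {R : realType} (x : R) m : 0 <= x -> (x `^ (- (m%:R / 2))) ^+ 2 = x ^- m.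
Proof.
move=> x0; rewrite -powR_mulrn ?powR_ge0// -powRrM (_ : _ * 2%:R = - m%:R); last by field.
by rewrite powRN powR_mulrn.
Qed.

Lemma powR_Nhalf_sqr1 {R : realType} (x : R) : 0 <= x -> (x `^ (- 2^-1)) ^+ 2 = x^-1.
Proof. by move=> x0; have := powR_Nhalf_sqr 1 x0; rewrite mul1r expr1. Qed.

(** * The normalised kernel and its dispersive bounds *)

Section kernel.
Context {R : realType} (n : nat) (Q B : 'M[R]_n) (D : nat) (gam : R).
Hypotheses (n0 : (0 < n)%N) (QT : Q^T = Q) (gam0 : 0 < gam).
Hypothesis hV : forall t, 0 < t -> gam * t ^+ D * expR (t * \tr B) <= volume Q B t.
Notation leb := (lebesgue_cV R n).
Notation E t := (expmx (t *: B)).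

(* The Gramian extended to negative times so that the cocycle identity cgramD holds for all times. *)
Definition cgram t : 'M[R]_n :=
  if 0 <= t then gramian Q B t else - (E t *m gramian Q B (- t) *m (E t)^T).

Let E0 : E 0 = 1%:M. Proof. by rewrite scale0r expmx0. Qed.

Let ED s t : E (s + t) = E s *m E t. Proof. exact: expmxD. Qed.

Let EN t : E (- t) *m E t = 1%:M. Proof. by rewrite -ED addNr E0. Qed.

(** One formula for both signs of t, with Gramians at nonnegative times only, at the price of an
    auxiliary shift c. It frees the cocycle identity from case distinctions. *)
Lemma cgram_shift c t : 0 <= c -> 0 <= t + c ->
  cgram t = E (- c) *m (gramian Q B (t + c) - gramian Q B c) *m (E (- c))^T.
Proof.
move=> c0 tc; rewrite /cgram; case: ifPn => [t0|].
  rewrite [t + c]addrC gramianD// addrC addKr !mulmxA EN mul1mx -mulmxA -trmx_mul EN trmx1 mulmx1//.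
rewrite -ltNge => t0.
have -> : gramian Q B c = gramian Q B (t + c) + E (t + c) *m gramian Q B (- t) *m (E (t + c))^T.
  by rewrite -gramianD ?oppr_ge0 ?(ltW t0)// addrC addrA addNr add0r.
rewrite opprD addrA subrr sub0r mulmxN mulNmx; congr (- _).
have H : E t = E (- c) *m E (t + c) by rewrite -ED addrC addrK.
by rewrite H trmx_mul !mulmxA.
Qed.

Lemma cgramD t u : cgram (t + u) = cgram t + E t *m cgram u *m (E t)^T.
Proof.
(* This shift makes t + c and t + u + c nonnegative. The matrix at u is expanded with the shift t +
   c, so that the Gramians at t + c cancel. *)
pose c := `|t| + `|u|; have c0 : 0 <= c by rewrite addr_ge0.
have hN (x : R) : 0 <= x + `|x| by rewrite -lerBlDl sub0r -normrN ler_norm.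
have tc : 0 <= t + c by rewrite /c addrA addr_ge0.
have tuc : 0 <= t + u + c by rewrite /c addrACA addr_ge0.
have uc : 0 <= u + (t + c) by rewrite addrCA addrA.
rewrite (cgram_shift c0 tuc) (cgram_shift c0 tc) (cgram_shift tc uc).
have H : E t *m E (- (t + c)) = E (- c) by rewrite -ED opprD addrA subrr add0r.
have C (X Y Z : 'M[R]_n) : X *m (Y *m Z *m Y^T) *m X^T = (X *m Y) *m Z *m (X *m Y)^T.
  by rewrite trmx_mul !mulmxA.
rewrite C H -mulmxDl -mulmxDr; congr (_ *m _ *m _).
by rewrite [u + (t + c)]addrA [u + t]addrC [RHS]addrC subrKA.
Qed.

Lemma cgram0 : cgram 0 = 0.
Proof.
have := cgramD 0 0; rewrite addr0 E0 trmx1 mulmx1 mul1mx => /(congr1 (fun M => M - cgram 0)).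
by rewrite subrr addrK => <-.
Qed.

Lemma cgram_sym t : (cgram t)^T = cgram t.
Proof.
rewrite /cgram; case: ifP => _; first exact: gramian_sym.
by rewrite linearN/= !trmx_mul trmxK gramian_sym// mulmxA.
Qed.

Lemma measurable_cgram i j : measurable_fun setT (fun t => cgram t i j).
Proof.
pose M t i j : R := \sum_k (\sum_l E t i l * gramian Q B (- t) l k) * E t j k.
have -> : (fun t => cgram t i j) = (fun t => if 0 <= t then gramian Q B t i j else - M t i j).
  apply/funext => t; rewrite /cgram; case: ifP => // _; rewrite !mxE; congr (- _).
  by apply: eq_bigr => k _; rewrite !mxE.
apply: measurable_fun_if => //.
- by apply: measurable_fun_ler.
- exact: measurable_funTS (measurable_gramian Q B i j).
- apply: measurable_funTS; apply: measurableT_comp => //; apply: measurable_sum => k.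
  apply: measurable_funM; last exact: measurable_expmx.
  apply: measurable_sum => l; apply: measurable_funM; first exact: measurable_expmx.
  by apply: (measurableT_comp (measurable_gramian Q B l k)); exact: oppr_measurable.
Qed.

Lemma det_cgram_pos t : 0 < t -> \det (cgram t) = volume Q B t.
Proof. by move=> t0; rewrite /cgram (ltW t0). Qed.

Lemma det_cgram_neg t : t < 0 -> `|\det (cgram t)| = expR (2 * (t * \tr B)) * `|volume Q B (- t)|.
Proof.
move=> t0; rewrite /cgram leNgt t0/= -scaleN1r detZ !det_mulmx det_tr det_expmx !normrM normrX normrN1 expr1n mul1r.
by rewrite ger0_norm ?expR_ge0// mulrAC -expRD mulr_natl.
Qed.

Lemma volume_gt0 t : 0 < t -> 0 < volume Q B t.
Proof. by move=> t0; apply: lt_le_trans (hV t0); rewrite !mulr_gt0 ?exprn_gt0 ?expR_gt0. Qed.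

(** At a negative time |det A_t| = e^(2t tr B) V(-t) and V(-t) >= gam |t|^D e^(-t tr B); the
    exponentials combine to e^(t tr B), the same form as for positive times. *)
Lemma det_cgram_ge t : t != 0 -> gam * `|t| ^+ D * expR (t * \tr B) <= `|\det (cgram t)|.
Proof.
case: (ltgtP t 0) => // [t0|t0] _.
  rewrite det_cgram_neg// (ltr0_norm t0) (gtr0_norm (volume_gt0 _)) ?oppr_gt0//.
  have := hV (t := - t); rewrite oppr_gt0 => /(_ t0) /(ler_wpM2l (expR_ge0 (2 * (t * \tr B)))).
  apply: le_trans; rewrite le_eqVlt; apply/orP; left; apply/eqP.
  rewrite mulrCA -expRD; congr (_ * expR _); ring.
by rewrite det_cgram_pos// !gtr0_norm ?volume_gt0// hV.
Qed.

Lemma det_cgram_gt0 t : t != 0 -> 0 < `|\det (cgram t)|.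
Proof.
move=> t0; apply: lt_le_trans (det_cgram_ge t0).
by rewrite !mulr_gt0 ?expR_gt0// exprn_gt0 ?normr_gt0.
Qed.

Lemma cgram_unit t : t != 0 -> cgram t \in unitmx.
Proof. by move=> t0; rewrite unitmxE unitfE -normr_gt0 det_cgram_gt0. Qed.

(** The cocycle identity reads A_s - A_t = e^(tB) A_(s-t) e^(tB^T), and det e^(tB) = e^(t tr B). *)
Lemma det_cgramB s t : s != t ->
  gam * `|s - t| ^+ D * expR ((s + t) * \tr B) <= `|\det (cgram s - cgram t)|.
Proof.
move=> st; have -> : cgram s - cgram t = E t *m cgram (s - t) *m (E t)^T.
  by rewrite -{1}(subrK t s) [s - t + t]addrC cgramD addrC addKr.
have /det_cgram_ge : s - t != 0 by rewrite subr_eq0.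
move=> /(ler_wpM2l (expR_ge0 (2 * (t * \tr B)))).
rewrite !det_mulmx det_tr det_expmx !normrM (ger0_norm (expR_ge0 _)).
rewrite [X in _ -> _ <= X](_ : _ = expR (2 * (t * \tr B)) * `|\det (cgram (s - t))|); last first.
  by rewrite mulrAC -expRD mulr_natl.
apply: le_trans; rewrite le_eqVlt; apply/orP; left; apply/eqP.
rewrite mulrCA -expRD; congr (_ * expR _); ring.
Qed.

(* Equal to invmx (cgram t) for t <> 0 (icgramE), but visibly measurable in t. *)
Definition icgram t : 'M[R]_n := (\det (cgram t))^-1 *: \adj (cgram t).

Lemma icgramE t : t != 0 -> icgram t = invmx (cgram t).
Proof. by move=> /cgram_unit tu; rewrite /invmx tu. Qed.

Lemma icgram_unit t : t != 0 -> icgram t \in unitmx.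
Proof. by move=> t0; rewrite icgramE// unitmx_inv cgram_unit. Qed.

Lemma icgram_sym t : (icgram t)^T = icgram t.
Proof. by rewrite /icgram linearZ/= trmx_adj cgram_sym. Qed.

Lemma det_icgram t : t != 0 -> \det (icgram t) = (\det (cgram t))^-1.
Proof. by move=> t0; rewrite icgramE// det_inv. Qed.

Lemma measurable_det d (T : measurableType d) m (F : T -> 'M[R]_m) :
  (forall i j, measurable_fun setT (fun t => F t i j)) -> measurable_fun setT (fun t => \det (F t)).
Proof.
move=> mF; apply: measurable_sum => s; apply: measurable_funM => //.
by apply: measurable_prod.
Qed.

Lemma measurable_icgram i j : measurable_fun setT (fun t => icgram t i j).
Proof.
under eq_fun do rewrite /icgram !mxE; apply: measurable_funM.
  by apply: measurable_funV; apply: measurable_det => *; exact: measurable_cgram.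
rewrite /cofactor; apply: measurable_funM => //; apply: measurable_det => k l.
by under eq_fun do rewrite !mxE; exact: measurable_cgram.
Qed.

Lemma det_icgramB s t : s != 0 -> t != 0 ->
  `|\det (icgram s - icgram t)| = `|\det (cgram s - cgram t)| / (`|\det (cgram s)| * `|\det (cgram t)|).
Proof.
move=> s0 t0; rewrite (icgramE s0) (icgramE t0).
exact: det_invmxB (cgram_unit s0) (cgram_unit t0).
Qed.

Definition amp t : R := (4 * pi) `^ (- (n%:R / 2)) * `|\det (cgram t)| `^ (- 2^-1) * expR (t * \tr B / 2).

Lemma amp_ge0 t : 0 <= amp t.
Proof. by rewrite !mulr_ge0 ?powR_ge0 ?expR_ge0. Qed.

(** The Gramian vanishes at time 0, and 0 raised to a nonzero real power is 0 by convention. The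
    kernel is therefore 0 at time 0, and the kernel estimates hold there trivially. *)
Lemma amp0 : amp 0 = 0.
Proof.
rewrite /amp cgram0 (_ : \det 0 = 0); last by case: (n) n0 => // m _; exact: det0.
by rewrite normr0 powR0 ?mulr0 ?mul0r// oppr_eq0 invr_eq0.
Qed.

Lemma measurable_amp : measurable_fun setT amp.
Proof.
apply: measurable_funM.
  apply: measurable_funM => //; apply: (measurableT_comp (@measurable_powR R _)).
  by apply: measurableT_comp => //; apply: measurable_det => i j; exact: measurable_cgram.
apply: (@measurableT_comp _ _ _ _ _ _ (@expR R)); first exact: measurable_expR.
by apply: measurable_funM => //; exact: measurable_funM.
Qed.

Let pi4_gt0 : 0 < 4 * pi :> R. Proof. by rewrite mulr_gt0// pi_gt0. Qed.

Lemma amp_sqr t : t != 0 ->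
  amp t ^+ 2 = ((4 * pi) ^+ n)^-1 * (`|\det (cgram t)|)^-1 * expR (t * \tr B).
Proof.
move=> t0; have d0 := det_cgram_gt0 t0.
have e2 : expR (t * \tr B / 2) ^+ 2 = expR (t * \tr B) by rewrite -expRM_natl; congr expR; field.
by rewrite /amp 2!(exprMn 2) (powR_Nhalf_sqr n (ltW pi4_gt0)) (powR_Nhalf_sqr1 (ltW d0)) e2.
Qed.

Definition disp_cst : R := (4 * pi) `^ (- (n%:R / 2)) * gam `^ (- 2^-1).

Lemma disp_cst_gt0 : 0 < disp_cst.
Proof. by rewrite mulr_gt0 ?powR_gt0. Qed.

Let disp_sqr (t : R) : 0 < t ->
  (disp_cst * t `^ (- (D%:R / 2))) ^+ 2 = ((4 * pi) ^+ n)^-1 * (gam * t ^+ D)^-1.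
Proof.
move=> t0; rewrite /disp_cst 2!(exprMn 2) (powR_Nhalf_sqr n (ltW pi4_gt0)) (powR_Nhalf_sqr D (ltW t0)).
by rewrite (powR_Nhalf_sqr1 (ltW gam0)) invfM mulrA.
Qed.

Lemma amp_le t : t != 0 -> amp t <= disp_cst * `|t| `^ (- (D%:R / 2)).
Proof.
move=> t0; have ta : 0 < `|t| by rewrite normr_gt0.
rewrite -(ler_pXn2r (n := 2))// ?nnegrE ?amp_ge0 ?mulr_ge0 ?powR_ge0//.
rewrite amp_sqr// disp_sqr// -mulrA ler_wpM2l ?invr_ge0 ?exprn_ge0 ?(ltW pi4_gt0)//.
have g0 : 0 < gam * `|t| ^+ D by rewrite mulr_gt0// exprn_gt0.
rewrite ler_pdivrMl ?det_cgram_gt0// ler_pdivlMr// mulrC; exact: det_cgram_ge.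
Qed.

(** The exponentials of [amp s] and [amp t] cancel the factor e^((s+t) tr B) of [det_cgramB], and
    the determinants at s and t cancel those of [det_icgramB]; only the lag s - t survives. *)
Lemma amp_pair s t : s != t -> s != 0 -> t != 0 ->
  (amp s * amp t) ^+ 2 * ((4 * pi) ^+ n / `|\det (icgram s - icgram t)|) <=
  (disp_cst * `|s - t| `^ (- (D%:R / 2))) ^+ 2.
Proof.
move=> st s0 t0; have st0 : 0 < `|s - t| by rewrite normr_gt0 subr_eq0.
have d0 := det_cgram_gt0 s0; have d1 := det_cgram_gt0 t0.
have g0 : 0 < gam * `|s - t| ^+ D by rewrite mulr_gt0// exprn_gt0.
have dB := det_cgramB st.
have d2 : 0 < `|\det (cgram s - cgram t)| by apply: lt_le_trans dB; rewrite mulr_gt0// expR_gt0.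
rewrite exprMn !amp_sqr// det_icgramB// disp_sqr//.
have p0 : 0 < (4 * pi : R) ^+ n by rewrite exprn_gt0.
rewrite [leLHS](_ : _ = ((4 * pi) ^+ n)^-1 * (expR ((s + t) * \tr B) / `|\det (cgram s - cgram t)|)).
  rewrite ler_wpM2l ?invr_ge0 ?(ltW p0)// ler_pdivrMr// [leRHS]mulrC ler_pdivlMr// mulrC//.
have K (p u v c1 c2 c3 : R) : p != 0 -> c1 != 0 -> c2 != 0 -> c3 != 0 ->
    p^-1 / c1 * u * (p^-1 / c2 * v) * (p / (c3 / (c1 * c2))) = p^-1 * (u * v / c3).
  by move=> *; field; do ?[apply/andP; split].
rewrite [(s + t) * _]mulrDl expRD.
exact (K _ _ _ _ _ _ (lt0r_neq0 p0) (lt0r_neq0 d0) (lt0r_neq0 d1) (lt0r_neq0 d2)).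
Qed.

Definition kern t x y : R[i] := (amp t)%:C%C * expi (qphase (icgram t) (E t) x y).

Lemma cmod_kern t x y : cmod (kern t x y) = amp t.
Proof. by rewrite cmodM cmod_expi mulr1 cmodR ger0_norm ?amp_ge0. Qed.

Lemma kern0 x y : kern 0 x y = 0.
Proof. by rewrite /kern amp0 mul0r. Qed.

Lemma cmeasurable_kern : cmeasurable (fun z : R * ('cV[R]_n * 'cV[R]_n) => kern z.1 z.2.1 z.2.2).
Proof.
apply: cmeasurableM.
  by apply: cmeasurableR; exact: (measurableT_comp measurable_amp measurable_fst).
apply: cmeasurable_expi; apply: measurable_qphase.
- by move=> i j; exact: (measurableT_comp (measurable_icgram i j) measurable_fst).
- by move=> i j; exact: (measurableT_comp (@measurable_expmx _ _ B i j) measurable_fst).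
- exact: (measurableT_comp measurable_fst measurable_snd).
- exact: (measurableT_comp measurable_snd measurable_snd).
Qed.

(** The amplitude is precisely what normalises the constant of [qphase_L2] to 1. *)
Let amp_norm t : t != 0 ->
  amp t ^+ 2 * ((4 * pi) ^+ n / (`|\det (icgram t)| * `|\det (E t)|)) = 1.
Proof.
move=> t0; have d0 := det_cgram_gt0 t0.
rewrite amp_sqr// det_icgram// det_expmx normfV (ger0_norm (expR_ge0 _)).
have p0 : 0 < (4 * pi : R) ^+ n by rewrite exprn_gt0.
by field; rewrite !gt_eqF// expR_gt0.
Qed.

Let kern_sqr t (g : 'cV[R]_n -> R[i]) (N : \bar R) : t != 0 -> cmeasurable g ->
  (\int[leb]_x (cmod (g x) ^+ 2)%:E <= ((4 * pi) ^+ n / (`|\det (icgram t)| * `|\det (E t)|))%:E * N)%E ->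
  (\int[leb]_x (cmod ((amp t)%:C%C * g x) ^+ 2)%:E <= N)%E.
Proof.
move=> t0 mg H.
under eq_integral do rewrite cmodM cmodR (ger0_norm (amp_ge0 t)) exprMn EFinM.
rewrite ge0_integralZl_EFin ?sqr_ge0//; last 2 first.
- by move=> x _; rewrite lee_fin sqr_ge0.
- exact: measurable_cmod_sqr.
apply: (@le_trans _ _ ((amp t ^+ 2)%:E * (((4 * pi) ^+ n / (`|\det (icgram t)| * `|\det (E t)|))%:E * N))%E).
  by rewrite lee_wpmul2l// lee_fin sqr_ge0.
by rewrite muleA -EFinM (amp_norm t0) mul1e.
Qed.

Let mphase t : cmeasurable (fun z : 'cV[R]_n * 'cV[R]_n => expi (qphase (icgram t) (E t) z.1 z.2)).
Proof. by apply: cmeasurable_expi; apply: measurable_qphase. Qed.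

Lemma kern_L2 t f : cL12 leb f ->
  (\int[leb]_x (cmod (kop leb kern t f x) ^+ 2)%:E <= \int[leb]_x (cmod (f x) ^+ 2)%:E)%E.
Proof.
move=> fL; have [mf _ _] := fL; have [->|t0] := eqVneq t 0.
  rewrite integral0_eq ?integral_ge0// => x _; first by rewrite lee_fin sqr_ge0.
  by rewrite /kop cintegral0 ?cmod0 ?expr0n// => y; rewrite kern0 mul0r.
have E1 x : kop leb kern t f x = (amp t)%:C%C * cintegral leb (fun y => expi (qphase (icgram t) (E t) x y) * f y).
  rewrite /kop -cintegralZ; first by apply: eq_cintegral => y; rewrite /kern mulrA.
  by apply: cL12_cintegrable; apply: cL12_phase => //; apply: measurable_qphase.
under eq_integral do rewrite E1.
apply: kern_sqr => //.
  apply (@cmeasurable_cintegral _ _ _ _ _ leb (fun x y => expi (qphase (icgram t) (E t) x y) * f y)).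
  by apply: cmeasurableM => //; exact: (cmeasurable_comp mf measurable_snd).
by apply: qphase_L2 => //; [exact: icgram_sym|exact: icgram_unit|exact: expmx_unit].
Qed.

Lemma kern_adj_L2 t f : cL12 leb f ->
  (\int[leb]_x (cmod (kadj leb kern t f x) ^+ 2)%:E <= \int[leb]_x (cmod (f x) ^+ 2)%:E)%E.
Proof.
move=> fL; have [mf _ _] := fL; have [->|t0] := eqVneq t 0.
  rewrite integral0_eq ?integral_ge0// => x _; first by rewrite lee_fin sqr_ge0.
  by rewrite /kadj cintegral0 ?cmod0 ?expr0n// => y; rewrite kern0 conjc0 mul0r.
have E1 y : kadj leb kern t f y = (amp t)%:C%C * cintegral leb (fun x => (expi (qphase (icgram t) (E t) x y))^*%C * f x).
  rewrite /kadj -cintegralZ; first by apply: eq_cintegral => x; rewrite /kern conjcM conjc_real mulrA.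
  apply: cL12_cintegrable; under eq_fun do rewrite -expiN.
  by apply: cL12_phase => //; apply: measurableT_comp => //; apply: measurable_qphase.
under eq_integral do rewrite E1.
apply: kern_sqr => //.
  apply (@cmeasurable_cintegral _ _ _ _ _ leb (fun y x => (expi (qphase (icgram t) (E t) x y))^*%C * f x)).
  apply: cmeasurableM; last exact: (cmeasurable_comp mf measurable_snd).
  apply: cmeasurable_conj; apply: cmeasurable_expi; apply: measurable_qphase => //.
by apply: qphase_adj_L2 => //; [exact: icgram_sym|exact: icgram_unit|exact: expmx_unit].
Qed.

(* The quadratic part of the phase in y is a difference of the inverses of two
   Gramians, whose determinant the cocycle identity reduces to the time t - s. *)
Lemma kern_TT (j : nat) t s x x' : t != s ->
  cmod (cintegral leb (fun y => (gaussn (j.+1%:R)^-1 y)%:C%C * (kern t x y * (kern s x' y)^*%C))) <=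
    disp_cst * `|t - s| `^ (- (D%:R / 2)).
Proof.
move=> ts.
have R0 : 0 <= disp_cst * `|t - s| `^ (- (D%:R / 2)).
  by rewrite mulr_ge0 ?powR_ge0// ltW// disp_cst_gt0.
have [t0|t0] := eqVneq t 0.
  by rewrite cintegral0 ?cmod0// => y; rewrite t0 kern0 mul0r mulr0.
have [s0|s0] := eqVneq s 0.
  by rewrite cintegral0 ?cmod0// => y; rewrite s0 kern0 conjc0 !mulr0.
pose e : R := (j.+1%:R)^-1; have e0 : 0 < e by rewrite invr_gt0.
pose P y := (gaussn e y)%:C%C * (expi (qphase (icgram t) (E t) x y) * (expi (qphase (icgram s) (E s) x' y))^*%C).
have -> : cintegral leb (fun y => (gaussn e y)%:C%C * (kern t x y * (kern s x' y)^*%C)) =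
    (amp t * amp s)%:C%C * cintegral leb P.
  rewrite -cintegralZ.
    have -> : (amp t * amp s)%:C%C = (amp t)%:C%C * (amp s)%:C%C by rewrite rmorphM.
    apply: eq_cintegral => y; rewrite /kern conjcM conjc_real /P.
    set u := expi _; set v := (expi _)^*%C; ring.
  apply: (@cintegrable_le _ _ _ leb _ (gaussn e)).
  - apply: cmeasurableM; first by apply: cmeasurableR; exact: measurable_gaussn.
    by apply: cmeasurableM; [|apply: cmeasurable_conj]; apply: cmeasurable_expi; apply: measurable_qphase.
  - exact: integrable_gaussn.
  - by move=> y; rewrite /P !cmodM cmod_conj !cmod_expi !mulr1 cmodR ger0_norm// gaussn_ge0.
have aa : 0 <= amp t * amp s by rewrite mulr_ge0 ?amp_ge0.
rewrite -(ler_pXn2r (n := 2))// ?nnegrE ?cmod_ge0//.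
rewrite cmodM cmodR (ger0_norm aa) exprMn.
apply: le_trans (amp_pair ts t0 s0); rewrite ler_wpM2l ?sqr_ge0//.
apply: qphase_pair; rewrite ?icgram_sym//.
rewrite unitmxE unitfE -normr_gt0 det_icgramB// divr_gt0//; last by rewrite mulr_gt0// det_cgram_gt0.
apply: lt_le_trans (det_cgramB ts); rewrite !mulr_gt0 ?expR_gt0// exprn_gt0// normr_gt0 subr_eq0//.
Qed.

End kernel.

Lemma cintegralB {R : realType} d (T : measurableType d) (mu : {measure set T -> \bar R}) (f g : T -> R[i]) :
  cintegrable mu f -> cintegrable mu g ->
  cintegral mu (fun x => f x - g x) = cintegral mu f - cintegral mu g.
Proof.
move=> fi gi; rewrite cintegralD//; last exact: cintegrableN.
congr (_ + _); rewrite -mulN1r -cintegralZ//.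
by apply: eq_cintegral => x; rewrite mulN1r.
Qed.

Lemma cmodV {R : realType} (x : R) : cmod (x%:C%C)^-1 = `|x|^-1.
Proof. by rewrite -fmorphV cmodR normfV. Qed.

Lemma invmx_uniq {R : realType} n (X A : 'M[R]_n) : X *m A = 1%:M -> invmx A = X.
Proof.
move=> XA; have [_ Au] := mulmx1_unit XA.
by rewrite -[RHS]mulmx1 -(mulmxV Au) mulmxA XA mul1mx.
Qed.

(** * Comparison of the propagator with the kernel *)

Section propagator_kernel.
Context {R : realType} (n : nat) (Q B : 'M[R]_n) (D : nat) (gam : R).
Hypotheses (n0 : (0 < n)%N) (QT : Q^T = Q) (gam0 : 0 < gam).
Hypothesis hV : forall t, 0 < t -> gam * t ^+ D * expR (t * \tr B) <= volume Q B t.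
Notation leb := (lebesgue_cV R n).
Notation E t := (expmx (t *: B)).
Notation K := (kern Q B).
Notation prop := (propagator0 Q B).
Notation tr := (\tr B).

Let vol0 t : 0 < t -> 0 < volume Q B t. Proof. exact: volume_gt0 gam0 hV t. Qed.

Let kop_amp t f x : cL12 leb f ->
  cmod (kop leb K t f x) = amp Q B t * cmod (cintegral leb (fun y => expi (qphase (icgram Q B t) (E t) x y) * f y)).
Proof.
move=> fL; rewrite -[amp Q B t]ger0_norm ?amp_ge0// -cmodR -cmodM -cintegralZ.
  by congr cmod; apply: eq_cintegral => y; rewrite /kern mulrA.
by apply: cL12_cintegrable; apply: cL12_phase => //; apply: measurable_qphase.
Qed.

Let ikop t f x : cL12 leb f -> cintegrable leb (fun y => K t x y * f y).
Proof.
case=> mf f1 _; apply: (@cintegrable_le _ _ _ leb _ (fun y => amp Q B t * cmod (f y))).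
- apply: cmeasurableM => //.
  have mt := cmeasurable_comp (cmeasurable_kern Q B) (measurable_pair1 t).
  exact (cmeasurable_comp mt (measurable_pair1 x)).
- exact (integrableMl_EFin _ measurableT f1).
- by move=> y; rewrite cmodM cmod_kern.
Qed.

Let powR_half (x : R) : 0 < x -> x `^ (- 2^-1) = (Num.sqrt x)^-1.
Proof. by move=> x0; rewrite powRN powR12_sqrt// ltW. Qed.

Let icgram_neg t : t < 0 ->
  icgram Q B t = - ((E (- t))^T *m invmx (gramian Q B (- t)) *m E (- t)).
Proof.
move=> t0; have tn : t != 0 by rewrite lt_eqF.
rewrite (icgramE gam0 hV tn); apply: invmx_uniq.
have Gu : gramian Q B (- t) \in unitmx.
  by rewrite unitmxE unitfE gt_eqF// -/(volume _ _ _) vol0// oppr_gt0.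
have EN : E (- t) *m E t = 1%:M by rewrite -expmxD addNr scale0r expmx0.
rewrite /cgram leNgt t0/= mulNmx mulmxN opprK.
rewrite -!mulmxA [E (- t) *m _]mulmxA EN mul1mx [invmx _ *m _]mulmxA mulVmx// mul1mx.
by rewrite -trmx_mul -expmxD subrr scale0r expmx0 trmx1.
Qed.

(** Only moduli are compared, so the constant phases of the propagator drop out. For t < 0 one has x
    - e^(|t|B) y = -e^(|t|B) (y - e^(tB) x), which turns the quadratic form into that of the inverse
    of the continued Gramian. *)
Lemma propagator0_kop t f x : t != 0 -> cL12 leb f ->
  expR (t * tr / 2) * cmod (prop t f x) = cmod (kop leb K t f x).
Proof.
move=> t0 fL; rewrite kop_amp// /propagator0 (negbTE t0); case: ltP => [tp|tn].
  have vt := vol0 tp.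
  rewrite !cmodM cmodV cmodR cmod_expi mulr1 !ger0_norm ?powR_ge0 ?sqrtr_ge0//.
  rewrite /amp (det_cgram_pos _ _ tp) (gtr0_norm vt) powR_half//.
  rewrite (_ : cintegral _ _ = cintegral leb (fun y => expi (qphase (icgram Q B t) (E t) x y) * f y)); first by ring.
  apply: eq_cintegral => y; rewrite (icgramE gam0 hV t0) /qphase /cgram (ltW tp).
  by [].
have {}tn : t < 0 by rewrite lt_neqAle t0.
have ta : `|t| = - t by rewrite ltr0_norm.
have vt : 0 < volume Q B (- t) by rewrite vol0// oppr_gt0.
rewrite !cmodM cmodV !cmodR cmod_expi mulr1 ta !ger0_norm ?powR_ge0 ?sqrtr_ge0 ?expR_ge0//.
rewrite /amp (det_cgram_neg _ _ tn) (gtr0_norm vt).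
rewrite (powRM (- 2^-1) (expR_ge0 _) (ltW vt)) (powR_half vt).
have -> : expR (2 * (t * tr)) `^ (- 2^-1) = expR (- t * tr).
  by rewrite powRN powR12_sqrt ?expR_ge0// mulr_natl mulr2n expRD -expr2 sqrtr_sqr ger0_norm ?expR_ge0// -expRN mulNr.
rewrite (_ : cintegral _ _ = cintegral leb (fun y => expi (qphase (icgram Q B t) (E t) x y) * f y)); first by ring.
apply: eq_cintegral => y; congr (expi _ * _); rewrite /qphase icgram_neg// mulNmx cvdotNl mulrN; congr (- (_ * _)).
have -> : x - E (- t) *m y = - (E (- t) *m (y - E t *m x)).
  by rewrite mulmxBr mulmxA -expmxD addNr scale0r expmx0 mul1mx opprB.
by rewrite mulmxN cvdotNl cvdotNr opprK -!mulmxA [RHS]cvdot_mulmxl trmxK.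
Qed.

Lemma propagator0B t f g x : cL12 leb f -> cL12 leb g ->
  prop t (fun y => f y - g y) x = prop t f x - prop t g x.
Proof.
move=> fL gL; rewrite /propagator0; case: ifP => // t0; case: ifP => tp; rewrite -mulrBr -cintegralB.
- by congr (_ * _); apply: eq_cintegral => y; rewrite mulrBr.
- apply: cL12_cintegrable; apply: cL12_phase => //; exact: (@measurable_qphase _ _ _ _ _ _ (cst x) id).
- apply: cL12_cintegrable; apply: cL12_phase => //; exact: (@measurable_qphase _ _ _ _ _ _ (cst x) id).
- by congr (_ * _); apply: eq_cintegral => y; rewrite mulrBr.
all: apply: cL12_cintegrable; apply: cL12_phase => //; apply: measurableT_comp => //.
all: exact: (@measurable_qphase _ _ _ _ (cst (invmx (gramian Q B `|t|))) (cst (E `|t|)) id (cst x)).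
Qed.

Lemma cmeasurable_propagator0 t f : cL12 leb f -> cmeasurable (prop t f).
Proof.
case=> mf _ _; unfold propagator0; destruct (t == 0) => //.
have m1 : measurable_fun setT (@fst 'cV[R]_n 'cV[R]_n) by exact: measurable_fst.
have m2 : measurable_fun setT (@snd 'cV[R]_n 'cV[R]_n) by exact: measurable_snd.
destruct (0 < t)%R; apply: cmeasurableM; try exact: cmeasurable_cst.
  apply (@cmeasurable_cintegral _ _ _ _ _ leb (fun x y => expi (qphase (invmx (gramian Q B t)) (E t) x y) * f y)).
  apply: cmeasurableM; last exact: (cmeasurable_comp mf m2).
  by apply: cmeasurable_expi; apply: measurable_qphase.
apply (@cmeasurable_cintegral _ _ _ _ _ leb (fun x y => expi (- qphase (invmx (gramian Q B `|t|)) (E `|t|) y x) * f y)).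
apply: cmeasurableM; last exact: (cmeasurable_comp mf m2).
by apply: cmeasurable_expi; apply: measurableT_comp => //; apply: measurable_qphase.
Qed.

Lemma kop_L12 t f : cL12 leb f -> cmeasurable (kop leb K t f).
Proof.
move=> [mf _ _]; apply: cmeasurable_kop => //; exact: cmeasurable_kern.
Qed.

Lemma propagator0_L2 t f : cL12 leb f ->
  (\int[leb]_x ((expR (t * tr / 2) * cmod (prop t f x)) ^+ 2)%:E <= \int[leb]_x (cmod (f x) ^+ 2)%:E)%E.
Proof.
move=> fL; have [->|t0] := eqVneq t 0.
  rewrite le_eqVlt; apply/orP; left; apply/eqP; apply: eq_integral => x _.
  by rewrite !mul0r expR0 mul1r /propagator0 eqxx.
under eq_integral do rewrite propagator0_kop//.
exact: (kern_L2 n0 QT gam0 hV t fL).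
Qed.

Lemma propagator0_Lr t (r : R) f N : 2 < r -> t != 0 -> cL12 leb f -> 0 < N ->
  (\int[leb]_x (cmod (f x) `^ (r / (r - 1)))%:E <= N%:E)%E ->
  (\int[leb]_x ((expR (t * tr / 2) * cmod (prop t f x)) `^ r)%:E <=
    (interp_cst r * (disp_cst n gam * `|t| `^ (- (D%:R / 2))) `^ (r - 2) * N `^ (r - 1))%:E)%E.
Proof.
move=> r2 t0 fL N0 fN; under eq_integral do rewrite propagator0_kop//.
have a0 : 0 < disp_cst n gam * `|t| `^ (- (D%:R / 2)).
  by apply: mulr_gt0; [exact: disp_cst_gt0|rewrite powR_gt0// normr_gt0].
apply: (interpolation (mu := leb) (nu := leb) (Op := kop leb K t) a0 r2) => //.
- move=> g h x gL hL; rewrite /kop -cintegralD; [|exact: ikop|exact: ikop].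
  by apply: eq_cintegral => y; rewrite mulrDr.
- by move=> g; exact: kop_L12.
- move=> g x gL; have [mg g1 _] := gL.
  have i1 := integrable_fin_num measurableT g1.
  rewrite -(fineK i1) -EFinM lee_fin.
  have H := @cmod_kop _ _ _ leb K (amp Q B) (cmeasurable_kern Q B) _ t g x gL.
  apply: le_trans (H _) _ => [s u v|]; first by rewrite cmod_kern.
  apply: ler_wpM2r; last exact: (amp_le gam0 hV t0).
  by apply: Rintegral_ge0 => y _; exact: cmod_ge0.
- by move=> g gL; exact: (kern_L2 n0 QT gam0 hV).
Qed.

Lemma kern_strichartz (q r : R) f M : 2 < r -> 2 < q ->
  2 / q = D%:R * (1 / 2 - 1 / r) -> cL12 leb f -> 0 < M ->
  (\int[leb]_x (cmod (f x) ^+ 2)%:E <= M%:E)%E ->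
  (\int[lebesgue_measure]_t (\int[leb]_x (cmod (kop leb K t f x) `^ r)%:E) `^ (q / r) <=
    ((strichartz_cst q r (disp_cst n gam) * M) `^ (q / 2))%:E)%E.
Proof.
move=> r2 q2 qE fL M0 fM.
have r0 : r != 0 by rewrite gt_eqF// (lt_trans _ r2).
have bE : D%:R / 2 * (r - 2) / r = 2 / q by rewrite qE; field.
pose w (j : nat) (y : 'cV[R]_n) : R := gaussn (j.+1%:R)^-1 y.
have j0 (j : nat) : 0 < (j.+1%:R : R)^-1 by rewrite invr_gt0.
have kE t x y : cmod (K t x y) <= amp Q B t by rewrite cmod_kern.
have mw j : measurable_fun setT (w j) by exact: measurable_gaussn.
have w0 j y : 0 <= w j y by exact: gaussn_ge0.
have w1 j y : w j y <= 1 by apply: gaussn_le1; exact: ltW.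
have iw j : leb.-integrable setT (EFin \o w j) by exact: integrable_gaussn.
have wc y : w j y @[j --> \oo] --> (1 : R) by exact: gaussn_cvg.
exact (@strichartz_homogeneous R _ _ leb K (amp Q B) w q r (disp_cst n gam) (D%:R / 2)
  r2 q2 (disp_cst_gt0 n gam0) bE (cmeasurable_kern Q B) (measurable_amp Q B) kE mw w0 w1 iw wc
  (kern_L2 n0 QT gam0 hV) (kern_adj_L2 n0 QT gam0 hV) (kern_TT n0 QT gam0 hV) f M fL M0 fM).
Qed.

End propagator_kernel.

(** * Schwartz functions *)

Section lattice_approximation.
Context {R : realType} (n : nat).

(** Rounding to the lattice of mesh 1/(k+1). Any function of the rounded point is constant on each
    of countably many boxes, hence measurable for the sigma-algebra generated by the coordinates. *)
Definition cV_floor (k : nat) (x : 'cV[R]_n) : 'cV[int]_n := \col_i Num.floor (k.+1%:R * x i ord0).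

Definition cV_grid (k : nat) (c : 'cV[int]_n) : 'cV[R]_n := \col_i ((c i ord0)%:~R / k.+1%:R).

Lemma measurable_cV_floor (k : nat) (F : 'cV[int]_n -> R) :
  measurable_fun setT (fun x => F (cV_floor k x)).
Proof.
move=> _ Y mY; rewrite setTI.
have -> : (fun x => F (cV_floor k x)) @^-1` Y =
    \bigcup_(c : {c : 'cV[int]_n | F c \in Y}) \bigcap_(i in [set: 'I_n])
      ((fun x : 'cV[R]_n => k.+1%:R * x i ord0) @^-1`
        `[(val c i ord0)%:~R, (val c i ord0 + 1)%:~R[%classic).
  apply/seteqP; split => x /=.
    move=> Yx; have cY : F (cV_floor k x) \in Y by exact: mem_set.
    exists (exist _ (cV_floor k x) cY) => //= i _ /=.
    by rewrite in_itv/= !mxE floor_itv.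
  move=> [[c cY] _] /= H; suff -> : cV_floor k x = c by exact: set_mem.
  apply/colP => i; rewrite mxE; have := H i I; rewrite /= in_itv/= => ?.
  exact: floor_def.
apply: countable_bigcupT_measurable; first exact: countableP.
move=> [c cY]; apply: fin_bigcap_measurable => [|i _]; first exact: finite_finset.
have mc : measurable_fun setT (fun x : 'cV[R]_n => k.+1%:R * x i ord0).
  by apply: measurable_funM => //; exact: measurable_coor.
by rewrite -[X in measurable X]setTI; apply: mc => //; exact: measurable_itv.
Qed.

Lemma lipschitz_measurable (f : 'cV[R]_n -> R) (M : R) : 0 <= M ->
  (forall x y, `|f x - f y| <= M * \sum_i `|x i ord0 - y i ord0|) -> measurable_fun setT f.
Proof.
move=> M0 fM.
apply: (@measurable_fun_cvg _ _ _ _ (fun k x => f (cV_grid k (cV_floor k x)))).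
  by move=> k; exact: (measurable_cV_floor k (fun c => f (cV_grid k c))).
move=> x _.
have bound k : `|f x - f (cV_grid k (cV_floor k x))| <= M * n%:R * (k.+1%:R)^-1.
  apply: le_trans (fM _ _) _; rewrite -mulrA; apply: ler_wpM2l => //.
  rewrite mulr_natl -[n in leRHS]card_ord -sumr_const; apply: ler_sum => i _.
  rewrite !mxE; have /andP[h1 h2] := floor_itv (k.+1%:R * x i ord0).
  have k0 : 0 < (k.+1%:R : R) by rewrite ltr0n.
  rewrite ger0_norm ?subr_ge0; last by rewrite ler_pdivrMr// [x i ord0 * _]mulrC.
  rewrite -(ler_pM2l k0) mulfV ?gt_eqF// mulrBr mulrCA mulfV ?gt_eqF// mulr1.
  by rewrite lerBlDl ltW// -intrD1.
apply/cvgrPdist_le => e e0.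
have c0 : (M * n%:R * (k.+1%:R)^-1) @[k --> \oo] --> (0 : R).
  by rewrite -(mulr0 (M * n%:R)); apply: cvgMr; exact: cvg_harmonic.
have /cvgr0Pnorm_le /(_ _ e0) := c0; apply: filterS => k; apply: le_trans.
by rewrite (le_trans (bound k))// ler_norm.
Qed.

End lattice_approximation.

Section product_weight.
Context {R : realType}.
Notation mu := (@lebesgue_measure R).

Let w1 (u : R) : R := (1 + `|u|) ^- 2.

Let mw1 : measurable_fun setT w1.
Proof. by apply: measurable_funV; apply: measurable_funX; apply: measurable_funD => //; exact: measurableT_comp. Qed.

Let w10 u : 0 <= w1 u. Proof. by rewrite invr_ge0 exprn_ge0// addr_ge0. Qed.

Let iw1 : (\int[mu]_u (w1 u)%:E < +oo)%E.
Proof.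
have m1 : measurable_fun setT (fun u : R => `|u| ^- 2 * (1 <= `|u|)%R%:R : R).
  apply: measurable_funM; last by apply: measurable_le_nat => //; exact: measurableT_comp.
  by apply: measurable_funV; apply: measurable_funX.
apply: (@le_lt_trans _ _ (\int[mu]_u ((\1_(`[-1, 1]%classic) u)%:E + (`|u| ^- 2 * (1 <= `|u|)%R%:R)%:E))%E).
  apply: ge0_le_integral => //.
  - by move=> u _; rewrite lee_fin.
  - exact/measurable_EFinP.
  - by apply: emeasurable_funD; [apply/measurable_EFinP; exact: measurable_indic|exact/measurable_EFinP].
  move=> u _; rewrite -EFinD lee_fin indicE (in_set_bool (fun u => u \in `[-1, 1])) in_itv/= -ler_norml.
  have u1 : 1 <= 1 + `|u| by rewrite lerDl.
  have [h|h] := lerP `|u| 1.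
    rewrite (le_trans (y := 1))//; last by rewrite lerDl mulr_ge0// invr_ge0 sqr_ge0.
    by rewrite invf_le1 ?exprn_gt0 ?(lt_le_trans _ u1)// exprn_ege1.
  rewrite add0r (ltW h) mulr1 lef_pV2 ?posrE ?exprn_gt0 ?(lt_trans _ h)// ?(lt_le_trans _ u1)//.
  by rewrite ler_pXn2r ?nnegrE ?addr_ge0// lerDr.
rewrite ge0_integralD//; last 2 first.
- by apply/measurable_EFinP; exact: measurable_indic.
- by first [move=> u _; rewrite lee_fin mulr_ge0// invr_ge0 sqr_ge0|apply/measurable_EFinP].
have f1 : (\int[mu]_x (\1_`[-1, 1] x)%:E)%E \is a fin_num.
  exact (@integrable_fin_num _ _ _ mu _ measurableT _ (@integrable_indic_itv R (-1) 1 true false)).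
by rewrite integral_norm_large// lte_add_pinfty ?ltry// -ge0_fin_numE// integral_ge0// => x _; rewrite lee_fin.
Qed.

Definition prod_weight n (x : 'cV[R]_n) : R := \prod_i w1 (x i ord0).

Lemma measurable_prod_weight n : measurable_fun setT (@prod_weight n).
Proof. by apply: measurable_prod => i _; exact: (measurableT_comp mw1 (measurable_coor i)). Qed.

Lemma prod_weight_ge0 n (x : 'cV[R]_n) : 0 <= prod_weight x.
Proof. by apply: prodr_ge0. Qed.

Lemma integrable_prod_weight n : (lebesgue_cV R n).-integrable setT (EFin \o @prod_weight n).
Proof.
apply/integrableP; split; first by apply/measurable_EFinP; exact: measurable_prod_weight.
under eq_integral do rewrite /= ger0_norm ?prod_weight_ge0//.
elim: n => [|n IHn].
  apply: (@le_lt_trans _ _ (\int[lebesgue_cV R 0]_x 1%E)%E).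
    apply: ge0_le_integral => //.
    - by move=> x _; rewrite lee_fin prod_weight_ge0.
    - by apply/measurable_EFinP; exact: measurable_prod_weight.
    - by move=> x _; rewrite lee_fin /prod_weight big_ord0.
  by rewrite integral_cst//= mul1e diracT ltry.
rewrite ge0_integral_cons_cV//; last 2 first.
- by apply/measurable_EFinP; exact: measurable_prod_weight.
- by move=> x; rewrite lee_fin prod_weight_ge0.
have E a v : (prod_weight (cons_cV (a, v)))%:E = ((w1 a)%:E * (prod_weight v)%:E)%E.
  rewrite -EFinM /prod_weight big_ord_recl cons_cV0; congr (_ * _)%:E.
  by apply: eq_bigr => i _; rewrite cons_cVS.
have f2 : (\int[lebesgue_cV R n]_v (prod_weight v)%:E)%E \is a fin_num.
  by rewrite ge0_fin_numE// integral_ge0// => x _; rewrite lee_fin prod_weight_ge0.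
have f1 : (\int[mu]_u (w1 u)%:E)%E \is a fin_num.
  by rewrite ge0_fin_numE ?iw1//; apply: integral_ge0 => x _; rewrite lee_fin.
apply: (@le_lt_trans _ _ (\int[mu]_a ((w1 a)%:E * \int[lebesgue_cV R n]_v (prod_weight v)%:E))%E).
  rewrite le_eqVlt; apply/orP; left; apply/eqP; apply: eq_integral => a _.
  under eq_integral do rewrite E.
  rewrite ge0_integralZl_EFin//.
  - by move=> v _; rewrite lee_fin prod_weight_ge0.
  - by apply/measurable_EFinP; exact: measurable_prod_weight.
rewrite ge0_integralZr//.
- by rewrite -(fineK f1) -(fineK f2) -EFinM ltry.
- exact/measurable_EFinP.
- by move=> x _; rewrite lee_fin.
- by apply: integral_ge0 => x _; rewrite lee_fin prod_weight_ge0.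
Qed.

Lemma coor_le_norm n (x : 'cV[R]_n) i : `|x i ord0| <= `|x|.
Proof.
have -> : `|x| = mx_norm x by [].
rewrite mx_normrE; exact: (@le_bigmax _ _ _ 0 (fun ij : 'I_n * 'I_1 => `|x ij.1 ij.2|) (i, ord0)).
Qed.

(** Each of the n factors of the weight costs two powers of 1 + |x|, as a coordinate is at most the
    norm of x; hence the exponent 2n. *)
Lemma prod_weight_decay n (f : 'cV[R]_n -> R) (M : R) :
  (forall x, (1 + `|x|) ^+ (2 * n) * `|f x| <= M) -> forall x, `|f x| <= M * prod_weight x.
Proof.
move=> fM x; have w0 i : 0 < w1 (x i ord0) by rewrite invr_gt0 exprn_gt0// ltr_wpDr.
have W0 : 0 < prod_weight x by apply: prodr_gt0.
rewrite -ler_pdivrMr// mulrC; apply: le_trans (fM x); apply: ler_wpM2r => //.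
rewrite /prod_weight -prodfV; apply: (@le_trans _ _ (\prod_(i < n) ((1 + `|x|) ^+ 2))).
  apply: ler_prod => i _; rewrite invr_ge0 ltW//= invrK ler_pXn2r ?nnegrE ?addr_ge0//.
  by rewrite lerD2l coor_le_norm.
by rewrite prodr_const card_ord exprM.
Qed.

End product_weight.

Section schwartz_facts.
Context {R : realType} (n : nat).
Implicit Types f : 'cV[R]_n -> R.

Let ei (i : 'I_n) : 'cV[R]_n := delta_mx i ord0.

Let line_derive f (x : 'cV[R]_n) i (h : R) : derivable f (h *: ei i + x) (ei i) ->
  is_derive h 1 (fun u : R => f (u *: ei i + x)) ('D_(ei i) f (h *: ei i + x)).
Proof.
have E : (fun k : R => k^-1 *: (((fun u : R => f (u *: ei i + x)) \o shift h) (k *: 1) - f (h *: ei i + x))) =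
    (fun k : R => k^-1 *: ((f \o shift (h *: ei i + x)) (k *: ei i) - f (h *: ei i + x))).
  apply/funext => k /=; congr (_ *: (f _ - _)).
  by rewrite addrA -scalerDl /GRing.scale/= mulr1.
move=> df; apply: DeriveDef.
  by rewrite /derivable E.
by rewrite /derive E.
Qed.

Let line_bound f i (M : R) : (forall x, derivable f x (ei i)) -> (forall x, `|'D_(ei i) f x| <= M) ->
  forall x (h : R), `|f (h *: ei i + x) - f x| <= M * `|h|.
Proof.
move=> df fM.
have pos x (h : R) : 0 <= h -> `|f (h *: ei i + x) - f x| <= M * `|h|.
  move=> h0; pose g (u : R) := f (u *: ei i + x).
  have dg (u : R) : is_derive u 1 g ('D_(ei i) f (u *: ei i + x)) by exact: line_derive.
  have cg : {within `[0, h], continuous g}.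
    by apply: derivable_within_continuous => u _; exact: (@ex_derive _ _ _ _ _ _ _ (dg u)).
  have [c _] := MVT_segment h0 (fun u _ => dg u) cg.
  rewrite {1 2}/g scale0r add0r subr0 => ->; rewrite normrM ler_wpM2r//.
move=> x h; have [h0|/ltW h0] := leP 0 h; first exact: pos.
have := pos (h *: ei i + x) (- h); rewrite oppr_ge0 => /(_ h0).
by rewrite addrA -scalerDl addNr scale0r add0r normrN distrC.
Qed.

(** The coordinates are exchanged one at a time; in [upd s] those listed in s have already been
    moved from x to y. *)
Let coord_lipschitz f (M : R) : 0 <= M -> (forall i x (h : R), `|f (h *: ei i + x) - f x| <= M * `|h|) ->
  forall x y, `|f x - f y| <= M * \sum_i `|x i ord0 - y i ord0|.
Proof.
move=> M0 fM x y.
pose upd (s : seq 'I_n) : 'cV[R]_n := \col_i (if i \in s then y i ord0 else x i ord0).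
have step (s : seq 'I_n) : uniq s -> `|f x - f (upd s)| <= M * \sum_(i <- s) `|x i ord0 - y i ord0|.
  elim: s => [_|i s IHs /= /andP[si us]].
    rewrite big_nil mulr0 (_ : upd [::] = x) ?subrr ?normr0//.
    by apply/colP => i; rewrite mxE in_nil.
  rewrite big_cons mulrDr [leRHS]addrC.
  have -> : upd (i :: s) = (y i ord0 - x i ord0) *: ei i + upd s.
    apply/colP => j; rewrite !mxE in_cons eqxx andbT.
    case: (eqVneq j i) => [->|ji] /=; last by rewrite mulr0 add0r.
    by rewrite (negbTE si) mulr1 subrK.
  apply: le_trans (ler_distD (f (upd s)) _ _) _; rewrite lerD ?IHs//.
  by rewrite distrC [X in M * X]distrC fM.
have := step (enum 'I_n) (enum_uniq _); rewrite big_enum.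
rewrite (_ : upd _ = y)//; apply/colP => i; rewrite mxE mem_enum//.
Qed.

Lemma schwartz_measurable f : schwartz f -> measurable_fun setT f.
Proof.
move=> fS; have [df _] := fS [::].
have /choice[M fM] : forall i, exists M : R, forall x, `|'D_(ei i) f x| <= M.
  move=> i; have [_ /(_ 0%N)[M H]] := fS [:: i].
  by exists M => x; have := H x; rewrite expr0 mul1r.
have M0 i : 0 <= M i by apply: le_trans (fM i 0).
apply: (@lipschitz_measurable _ _ f (\sum_i M i)); first by apply: sumr_ge0.
apply: coord_lipschitz; first by apply: sumr_ge0.
move=> i x h; apply: le_trans (line_bound (fun x => df x i) (fM i) x h) _.
by rewrite ler_wpM2r// (bigD1 i)//= lerDl sumr_ge0.
Qed.

Lemma cschwartz_cL12 (f : 'cV[R]_n -> R[i]) : cschwartz f -> cL12 (lebesgue_cV R n) f.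
Proof.
move=> [f1 f2].
have mf : cmeasurable f by split; exact: schwartz_measurable.
have [_ /(_ (2 * n)%N)[M1 H1]] := f1 [::]; have [_ /(_ (2 * n)%N)[M2 H2]] := f2 [::].
have b1 := prod_weight_decay H1; have b2 := prod_weight_decay H2.
have fb x : cmod (f x) <= (M1 + M2) * prod_weight x.
  rewrite mulrDl; apply: le_trans (lerD (b1 x) (b2 x)); rewrite /= cmodE.
  set u := complex.Re _; set v := complex.Im _.
  rewrite -[leRHS]ger0_norm ?addr_ge0// -sqrtr_sqr ler_wsqrtr// sqrrD !real_normK ?num_real//.
  by rewrite lerD2r lerDl mulrn_wge0// mulr_ge0.
have iW (c : R) : (lebesgue_cV R n).-integrable setT (EFin \o (fun x => c * prod_weight x)).
  exact (integrableMl_EFin _ measurableT (@integrable_prod_weight R n)).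
have W1 (x : 'cV[R]_n) : prod_weight x <= 1.
  rewrite [leRHS](_ : 1 = \prod_(i < n) (1:R)); last by rewrite big1_eq.
  apply: ler_prod => i _.
  rewrite invr_ge0 exprn_ge0 ?addr_ge0//= invf_le1 ?exprn_gt0 ?ltr_wpDr//.
  by rewrite exprn_ege1// lerDl.
split => //.
- apply: (@le_integrable _ _ _ (lebesgue_cV R n) _ measurableT _ (EFin \o (fun x => (M1 + M2) * prod_weight x)) _ _ (iW _)).
  + by apply/measurable_EFinP; exact: measurable_cmod.
  + move=> x _; rewrite lee_fin ger0_norm ?cmod_ge0//; exact: le_trans (fb x) (ler_norm _).
- apply: (@le_integrable _ _ _ (lebesgue_cV R n) _ measurableT _ (EFin \o (fun x => (M1 + M2) ^+ 2 * prod_weight x)) _ _ (iW _)).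
  + exact: measurable_cmod_sqr.
  + move=> x _; rewrite lee_fin ger0_norm ?sqr_ge0//; apply: le_trans (ler_norm _).
    apply: (@le_trans _ _ (((M1 + M2) * prod_weight x) ^+ 2)).
      by rewrite ler_pXn2r ?nnegrE ?cmod_ge0// (le_trans (cmod_ge0 _) (fb x)).
    by rewrite exprMn ler_wpM2l ?sqr_ge0// expr2 ler_piMl ?prod_weight_ge0.
Qed.

End schwartz_facts.

(** * Norms and their limits *)

Section ereal_power.
Context {R : realType}.
Implicit Types (a b x : \bar R) (p : R).
Local Open Scope ereal_scope.

Lemma le_poweR p x y : (0 <= p)%R -> 0 <= x -> x <= y -> x `^ p <= y `^ p.
Proof.
move=> p0 x0 xy; apply: gt0_ler_poweR => //.
  by rewrite in_itv/= x0 leey.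
by rewrite in_itv/= (le_trans x0 xy) leey.
Qed.

Lemma poweRK p x : p != 0%R -> 0 <= x -> (x `^ p) `^ p^-1 = x.
Proof. by move=> p0 x0; rewrite -poweRrM mulfV// poweRe1. Qed.

Lemma poweRVK p x : p != 0%R -> 0 <= x -> (x `^ p^-1) `^ p = x.
Proof. by move=> p0 x0; rewrite -poweRrM mulVf// poweRe1. Qed.

Lemma poweRD_le p a b : (0 < p)%R -> 0 <= a -> 0 <= b ->
  (a + b) `^ p <= (2 `^ p)%:E * (a `^ p + b `^ p).
Proof.
move=> p0; wlog ab : a b / a <= b.
  move=> H a0 b0; have [ab|/ltW ba] := leP a b; first exact: H.
  by rewrite addeC [X in _ * X]addeC; exact: H.
move=> a0 b0; have b20 : 0 <= 2%:E * b by rewrite mule_ge0// lee_fin.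
apply: (@le_trans _ _ ((2%:E * b) `^ p)).
  apply: le_poweR; rewrite ?adde_ge0//; first exact: ltW.
  by rewrite mule_natl mule2n leeD2r.
rewrite poweRM ?lee_fin// poweR_EFin lee_wpmul2l ?lee_fin ?powR_ge0//.
by rewrite leeDr// poweR_ge0.
Qed.

(** Monotonicity of powers suffices: the infimum of a tail, raised to p, is below every term of the
    tail raised to p. Inverting the claim to a bound on the lower limit itself avoids any appeal to
    continuity of the power on the extended line. *)
Lemma limn_einf_poweR p (u : (\bar R)^nat) : (0 < p)%R -> (forall k, 0 <= u k) ->
  (limn_einf u) `^ p <= limn_einf (fun k => u k `^ p).
Proof.
move=> p0 u0; have p0' : p != 0%R by rewrite gt_eqF.
pose y := limn_einf (fun k => u k `^ p).
have einf_le (w : (\bar R)^nat) k j : (k <= j)%N -> einfs w k <= w j.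
  by move=> kj; apply: ereal_inf_lbound; exists j.
have nd_einf (w : (\bar R)^nat) k : einfs w k <= limn_einf w.
  rewrite limn_einf_lim; apply: lime_ge; first exact: is_cvg_einfs.
  by exists k => // j /= kj; exact: nondecreasing_einfs.
have l0 (w : (\bar R)^nat) : (forall k, 0 <= w k) -> 0 <= limn_einf w.
  by move=> w0; apply: le_trans (nd_einf w 0%N); apply: le_ereal_inf_tmp => _ [k _ <-].
have y0 : 0 <= y by apply: l0 => k; exact: poweR_ge0.
suff H : limn_einf u <= y `^ p^-1.
  apply: le_trans (le_poweR (ltW p0) (l0 _ u0) H) _; by rewrite poweRVK.
rewrite limn_einf_lim; apply: lime_le; first exact: is_cvg_einfs.
near=> k; rewrite -[leLHS](poweRK p0'); last by apply: le_ereal_inf_tmp => _ [j _ <-].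
apply: le_poweR; rewrite ?invr_ge0 ?poweR_ge0//; first exact: ltW.
apply: le_trans (nd_einf _ k); apply: le_ereal_inf_tmp => _ [j kj <-].
apply: le_poweR; [exact: ltW| |exact: einf_le].
by apply: le_ereal_inf_tmp => _ [i _ <-].
Unshelve. all: by end_near. Qed.

Let lt_nbhs0 (e : R) : (0 < e)%R -> nbhs (0 : \bar R) [set y | y < e%:E].
Proof. by move=> e0; apply: open_nbhs_nbhs; split; [exact: open_ereal_lt_ereal|rewrite /= lte_fin]. Qed.

Lemma cvge0_le_add x a (u : (\bar R)^nat) : u @ \oo --> 0 ->
  (forall k, x <= a + u k) -> x <= a.
Proof.
move=> u0 xau; apply/lee_addgt0Pr => e e0.
have : \forall k \near \oo, u k <= e%:E.
  have H : \forall k \near \oo, u k < e%:E by exact (u0 _ (lt_nbhs0 e0)).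
  by apply: filterS H => k /ltW.
by move=> [k _ /(_ k (leqnn k)) uk]; apply: le_trans (xau k) _; rewrite leeD2l.
Qed.

Lemma fast_subsequence (u : (\bar R)^nat) (e : nat -> R) : u @ \oo --> 0 -> (forall k, 0 < e k)%R ->
  exists h : nat -> nat, forall k, u (h k) <= (e k)%:E.
Proof.
move=> u0 e0; have /choice[h hP] : forall k, exists j, u j <= (e k)%:E; last by exists h.
move=> k; have [j _ /(_ j (leqnn j))] : \forall j \near \oo, u j < (e k)%:E by exact (u0 _ (lt_nbhs0 (e0 k))).
by move=> /ltW; exists j.
Qed.

End ereal_power.

Section cLnorm_facts.
Context {R : realType} {d : measure_display} {T : measurableType d}.
Variable mu : {measure set T -> \bar R}.
Implicit Types (f g : T -> R[i]) (r : R).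

Lemma measurable_cmod_powR f r : cmeasurable f -> measurable_fun setT (fun x => cmod (f x) `^ r).
Proof. by move=> mf; apply: (@measurableT_comp _ _ _ _ _ _ (@powR R ^~ r)) => //; exact: measurable_cmod. Qed.

Lemma measurable_cmod_powRE f r : cmeasurable f -> measurable_fun setT (fun x => (cmod (f x) `^ r)%:E).
Proof. by move=> mf; apply/measurable_EFinP; exact: measurable_cmod_powR. Qed.

Lemma cLnormE r f : cLnorm mu r f = ((\int[mu]_x (cmod (f x) `^ r)%:E) `^ r^-1)%E.
Proof.
rewrite /cLnorm.
rewrite Lnorm.unlock.
under eq_integral do rewrite gee0_abs ?lee_fin ?cmod_ge0// poweR_EFin.
by [].
Qed.

Lemma cLnorm_ge0 r f : (0 <= cLnorm mu r f)%E. Proof. exact: Lnorm_ge0. Qed.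

Lemma cLnorm_poweR r f : 0 < r -> (cLnorm mu r f `^ r = \int[mu]_x (cmod (f x) `^ r)%:E)%E.
Proof.
move=> r0; rewrite cLnormE poweRVK ?gt_eqF//.
by apply: integral_ge0 => x _; rewrite lee_fin powR_ge0.
Qed.

Lemma ae_le_cLnorm r f g : 0 < r -> cmeasurable f -> cmeasurable g ->
  {ae mu, forall x, cmod (f x) <= cmod (g x)} -> (cLnorm mu r f <= cLnorm mu r g)%E.
Proof.
move=> r0 mf mg fg; rewrite !cLnormE; apply: le_poweR.
- by rewrite invr_ge0 ltW.
- by apply: integral_ge0 => x _; rewrite lee_fin powR_ge0.
apply: ae_ge0_le_integral => //.
- by move=> x _; rewrite lee_fin powR_ge0.
- exact: measurable_cmod_powRE.
- by move=> x _; rewrite lee_fin powR_ge0.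
- exact: measurable_cmod_powRE.
apply: filterS fg => x xfg _; rewrite lee_fin ge0_ler_powR// ?nnegrE ?cmod_ge0// ltW//.
Qed.

Lemma le_cLnorm r f g : 0 < r -> cmeasurable f -> cmeasurable g ->
  (forall x, cmod (f x) <= cmod (g x)) -> (cLnorm mu r f <= cLnorm mu r g)%E.
Proof. by move=> r0 mf mg fg; apply: ae_le_cLnorm => //; apply: aeW. Qed.

Lemma cLnormD r f g : 1 <= r -> cmeasurable f -> cmeasurable g ->
  (cLnorm mu r (fun x => (f x + g x)%R) <= cLnorm mu r f + cLnorm mu r g)%E.
Proof.
move=> r1 mf mg; have r0 : 0 < r by exact: lt_le_trans r1.
have mF := measurable_cmod mf; have mG := measurable_cmod mg.
apply: le_trans (minkowski_EFin mu mF mG r1).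
pose h x : R[i] := (cmod (f x) + cmod (g x))%:C%C.
have mh : cmeasurable h by apply: cmeasurableR; exact: measurable_funD.
apply: (@le_trans _ _ (cLnorm mu r h)).
  apply: le_cLnorm => //; first exact: cmeasurableD.
  by move=> x; rewrite cmodR ger0_norm ?addr_ge0 ?cmod_ge0 ?cmodD.
rewrite le_eqVlt; apply/orP; left; apply/eqP; apply: eq_Lnorm => x; rewrite /h; congr EFin.
by rewrite cmodR ger0_norm// addr_ge0 ?cmod_ge0.
Qed.

Lemma cLnormB r f g : cLnorm mu r (fun x => f x - g x) = cLnorm mu r (fun x => g x - f x).
Proof. by apply: eq_Lnorm => x; rewrite cmodB. Qed.

Lemma cLnorm_dist r f g : 1 <= r -> cmeasurable f -> cmeasurable g ->
  (cLnorm mu r f <= cLnorm mu r g + cLnorm mu r (fun x => (f x - g x)%R))%E.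
Proof.
move=> r1 mf mg; apply: le_trans (cLnormD r1 mg (cmeasurableB mf mg)).
rewrite le_eqVlt; apply/orP; left; apply/eqP; apply: eq_Lnorm => x.
by rewrite subrKC.
Qed.

Lemma cLnormZ r (c : R) f : 0 < r -> 0 <= c -> cmeasurable f ->
  cLnorm mu r (fun x => c%:C%C * f x) = (c%:E * cLnorm mu r f)%E.
Proof.
move=> r0 c0 mf; rewrite !cLnormE.
have -> : (\int[mu]_x (cmod (c%:C%C * f x) `^ r)%:E = (c `^ r)%:E * \int[mu]_x (cmod (f x) `^ r)%:E)%E.
  rewrite -ge0_integralZl_EFin ?powR_ge0//; last 2 first.
  - by move=> x _; rewrite lee_fin powR_ge0.
  - exact: measurable_cmod_powRE.
  by apply: eq_integral => x _; rewrite cmodM cmodR ger0_norm// powRM ?cmod_ge0.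
rewrite poweRM ?lee_fin ?powR_ge0//; last by apply: integral_ge0 => x _; rewrite lee_fin powR_ge0.
by rewrite -poweR_EFin poweRK ?gt_eqF// lee_fin.
Qed.

(** The series of squared moduli has a finite integral, hence is finite almost everywhere, and the
    terms of a convergent series tend to 0. *)
Lemma summable_sqr_cvg0 (h : nat -> T -> R[i]) : (forall k, cmeasurable (h k)) ->
  (forall k, \int[mu]_x (cmod (h k x) `^ 2)%:E <= (1 / (2 ^ (k + 1))%:R)%:E)%E ->
  {ae mu, forall x, cmod (h k x) @[k --> \oo] --> (0 : R)}.
Proof.
move=> mh hk; pose S x := (\sum_(0 <= k <oo) (cmod (h k x) `^ 2)%:E)%E.
have mS : measurable_fun setT S.
  apply: ge0_emeasurable_sum => [k x _ _|k _]; first by rewrite lee_fin powR_ge0.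
  exact: measurable_cmod_powRE.
have S0 x : (0 <= S x)%E by apply: nneseries_ge0 => k _ _; rewrite lee_fin powR_ge0.
have iS : mu.-integrable setT S.
  apply/integrableP; split => //.
  under eq_integral do rewrite gee0_abs//.
  rewrite integral_nneseries//; last 2 first.
  - by move=> k; exact: measurable_cmod_powRE.
  - by move=> k x _; rewrite lee_fin powR_ge0.
  apply: (@le_lt_trans _ _ (\sum_(0 <= k <oo) (1 / (2 ^ (k + 1))%:R)%:E)%E); last first.
    by have := @cvg_geometric_eseries_half R 1 0; move=> /cvg_lim -> //; rewrite ltry.
  apply: lee_nneseries => [k _ _|k _]; last exact: hk.
  by apply: integral_ge0 => x _; rewrite lee_fin powR_ge0.
apply: filterS (integrable_ae measurableT iS) => x /(_ I) Sx.
have Sy : (S x < +oo)%E by rewrite -ge0_fin_numE.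
have p0 k : (0 <= (cmod (h k x) `^ 2)%:E)%E by rewrite lee_fin powR_ge0.
have tail := nneseries_tail_cvg Sy (fun k _ => p0 k).
have t0 : (cmod (h k x) `^ 2)%:E @[k --> \oo] --> 0%E.
  apply: (@squeeze_cvge _ _ _ _ (fun=> 0%E) _ (fun N => \sum_(N <= k <oo) (cmod (h k x) `^ 2)%:E)%E) tail.
    apply: nearW => N; rewrite p0/= (nneseries_split N 1)//.
    rewrite addn1 big_nat1 leeDl// nneseries_ge0//.
  exact: cvg_cst.
have {}t0 : (cmod (h k x) `^ 2) @[k --> \oo] --> (0 : R) by exact: (fine_cvg t0).
rewrite (_ : (fun k => cmod (h k x)) = (fun k => Num.sqrt (cmod (h k x) `^ 2))).
  rewrite -sqrtr0; exact: (continuous_cvg _ (@sqrt_continuous R _) t0).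
by apply/funext => k; rewrite powR_mulrn ?cmod_ge0// sqrtr_sqr ger0_norm ?cmod_ge0.
Qed.

End cLnorm_facts.

(** Turns an estimate stated for finite positive bounds N into a norm inequality. For I = +oo the
    right side is infinite; for I = 0 the estimate is used with arbitrarily small N. *)
Lemma le_poweR_homogeneous {R : realType} (a b c : R) (X I : \bar R) :
  0 < a -> 0 < b -> 0 < c -> (0 <= X)%E -> (0 <= I)%E ->
  (forall N : R, 0 < N -> (I <= N%:E)%E -> (X <= (c * N `^ (b / a))%:E)%E) ->
  (X `^ b^-1 <= (c `^ b^-1)%:E * I `^ a^-1)%E.
Proof.
move=> a0 b0 c0 X0 I0 H; have a0' : a != 0 by rewrite gt_eqF.
have b0' : b != 0 by rewrite gt_eqF.
have cb : 0 < c `^ b^-1 by exact: powR_gt0.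
have [Iy|Ify] := eqVneq I +oo%E.
  by rewrite Iy poweRyr ?invr_neq0// gt0_muley ?leey// lte_fin.
have If : I \is a fin_num by rewrite ge0_fin_numE// ltey.
have [I00|In0] := eqVneq I 0%E.
  have -> : X = 0%E.
    apply/eqP; rewrite eq_le X0 andbT; apply/lee_addgt0Pr => e e0; rewrite add0e.
    apply: le_trans (H ((e / c) `^ (a / b)) _ _) _; first by rewrite powR_gt0// divr_gt0.
      by rewrite I00 lee_fin powR_ge0.
    rewrite lee_fin -powRrM mulrA divfK// mulfV// powRr1; last by rewrite divr_ge0 ?ltW.
    by rewrite mulrCA mulfV ?mulr1// gt_eqF.
  by rewrite poweR0r ?invr_neq0// mule_ge0 ?lee_fin ?powR_ge0 ?poweR_ge0.
have fI0 : 0 < fine I by rewrite fine_gt0// lt0e In0 I0/= ltey.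
have XI : (X <= (c * fine I `^ (b / a))%:E)%E by apply: H => //; rewrite fineK.
apply: (@le_trans _ _ ((c * fine I `^ (b / a))%:E `^ b^-1)%E).
  by apply: le_poweR => //; rewrite invr_ge0 ltW.
have E : (c * fine I `^ (b / a)) `^ b^-1 = c `^ b^-1 * fine I `^ a^-1.
  by rewrite powRM ?powR_ge0 ?(ltW c0)// -powRrM; congr (_ * _ `^ _); rewrite mulrAC mulfV// mul1r.
by rewrite poweR_EFin E EFinM -[X in (_ <= _ * X `^ _)%E](fineK If) poweR_EFin.
Qed.

Lemma cL12B {R : realType} {d} {T : measurableType d} (mu : {measure set T -> \bar R}) (f g : T -> R[i]) :
  cL12 mu f -> cL12 mu g -> cL12 mu (fun x => f x - g x).
Proof.
move=> [mf f1 f2] [mg g1 g2]; have mfg := cmeasurableB mf mg.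
have fgD x : cmod (f x - g x) <= cmod (f x) + cmod (g x) by rewrite (le_trans (cmodD _ _))// cmodN.
split=> //.
- apply: (@le_integrable _ _ _ mu _ measurableT _ (fun x => (cmod (f x))%:E + (cmod (g x))%:E)%E).
  + by apply/measurable_EFinP; exact: measurable_cmod.
  + move=> x _; rewrite lee_fin ger0_norm ?cmod_ge0//.
    by rewrite ger0_norm ?addr_ge0 ?cmod_ge0.
  + exact (integrableD measurableT f1 g1).
- apply: (@le_integrable _ _ _ mu _ measurableT _
    (fun x => 2%:E * ((cmod (f x) ^+ 2)%:E + (cmod (g x) ^+ 2)%:E))%E).
  + exact: measurable_cmod_sqr.
  + move=> x _; rewrite -EFinD -EFinM lee_fin ger0_norm ?sqr_ge0// ger0_norm; last first.
      by rewrite mulr_ge0// addr_ge0// sqr_ge0.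
    have h := fgD x; have h0 := cmod_ge0 (f x - g x).
    apply: (@le_trans _ _ ((cmod (f x) + cmod (g x)) ^+ 2)).
      by rewrite ler_pXn2r ?nnegrE// (le_trans h0 h).
    have := sqr_ge0 (cmod (f x) - cmod (g x)).
    by move: (cmod (f x)) (cmod (g x)) => u v; rewrite !expr2; nra.
  + apply: integrableZl => //; exact (integrableD measurableT f2 g2).
Qed.

(** * Passage from [cL12] to the closure of the graph *)

Section propagator_limits.
Context {R : realType} (n : nat) (Q B : 'M[R]_n).
Notation leb := (lebesgue_cV R n).
Implicit Types phi psi f : 'cV[R]_n -> R[i].

(** psi is a limit of images of Schwartz functions f_k, and by linearity the bound applies to f_k -
    f0, the approximation errors tending to 0. As f0 is arbitrary in [cL12], convergence of images
    can be tested on one sequence chosen independently of t. *)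
Lemma propagator_dist (a b t C : R) phi psi f0 : 1 <= a -> 1 <= b -> 0 <= C ->
  (forall f, cL12 leb f -> (cLnorm leb b (propagator0 Q B t f) <= C%:E * cLnorm leb a f)%E) ->
  cL12 leb f0 -> propagator Q B a b t phi psi ->
  (cLnorm leb b (fun x => (psi x - propagator0 Q B t f0 x)%R) <=
     C%:E * cLnorm leb a (fun x => (phi x - f0 x)%R))%E.
Proof.
move=> a1 b1 C0 bd cf0 [[mphi pfin] [mpsi _] [f [sf fphi fpsi]]].
have cf k := cschwartz_cL12 (sf k).
have mf k : cmeasurable (f k) by case: (cf k).
have mf0 : cmeasurable f0 by case: cf0.
have mp g : cL12 leb g -> cmeasurable (propagator0 Q B t g) by exact: cmeasurable_propagator0.
apply: (@cvge0_le_add _ _ _ (fun k => C%:E * cLnorm leb a (fun x => (f k x - phi x)%R) +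
    cLnorm leb b (fun x => (propagator0 Q B t (f k) x - psi x)%R))%E).
  have Cf : C%:E \is a fin_num by [].
  have h1 := cvgeZl Cf fphi.
  have h2 := @cvgeD _ _ _ _ _ _ _ _ _ h1 fpsi.
  by move: h2; rewrite mule0 adde0; apply.
move=> k; pose h x := f k x - f0 x.
have ch : cL12 leb h by exact: cL12B.
apply: le_trans (cLnorm_dist leb b1 (cmeasurableB mpsi (mp _ cf0)) (mp _ ch)) _.
rewrite addeA; apply: leeD.
  apply: le_trans (bd _ ch) _.
  rewrite -ge0_muleDr ?cLnorm_ge0// lee_wpmul2l ?lee_fin//.
  apply: le_trans (cLnorm_dist leb a1 (cmeasurableB (mf k) mf0) (cmeasurableB mphi mf0)) _.
  rewrite leeD2l// le_eqVlt; apply/orP; left; apply/eqP; apply: eq_Lnorm => x.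
  by rewrite opprB addrA subrK.
rewrite cLnormB le_eqVlt; apply/orP; left; apply/eqP; apply: eq_Lnorm => x.
by rewrite /h propagator0B// opprB addrA subrK.
Qed.

Lemma cL12_0 : cL12 leb (fun=> 0).
Proof.
split; first exact: cmeasurable_cst.
- by under eq_fun do rewrite cmod0; exact: integrable0.
- by under eq_fun do rewrite cmod0 expr0n/=; exact: integrable0.
Qed.

Lemma propagator_le (a b t C : R) phi psi : 1 <= a -> 1 <= b -> 0 <= C ->
  (forall f, cL12 leb f -> (cLnorm leb b (propagator0 Q B t f) <= C%:E * cLnorm leb a f)%E) ->
  propagator Q B a b t phi psi -> (cLnorm leb b psi <= C%:E * cLnorm leb a phi)%E.
Proof.
move=> a1 b1 C0 bd pp; have := propagator_dist a1 b1 C0 bd cL12_0 pp.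
have -> : cLnorm leb a (fun x => (phi x - 0)%R) = cLnorm leb a phi.
  by apply: eq_Lnorm => x; rewrite subr0.
apply: le_trans; rewrite le_eqVlt; apply/orP; left; apply/eqP; apply: eq_Lnorm => x.
have -> : propagator0 Q B t (fun=> 0) x = 0; last by rewrite subr0.
have H := propagator0B Q B t x cL12_0 cL12_0; rewrite [RHS]subrr in H.
have E : (fun _ : 'cV[R]_n => (0 : R[i]) - 0) = (fun=> 0) by apply/funext => y; rewrite subrr.
by rewrite E in H.
Qed.

End propagator_limits.

(** * Norms of Bochner integrals *)

Section bochner_norm.
Context {R : realType} {d : measure_display} {T : measurableType d}.
Variables (mu : {sigma_finite_measure set T -> \bar R}) (b : R).
Hypothesis b1 : 1 <= b.
Notation lam := (@lebesgue_measure R).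
Variables (A : nat -> set R) (c : nat -> T -> R[i]).
Hypotheses (mA : forall i, measurable (A i)) (mc : forall i, cmeasurable (c i)).

Let b0 : 0 < b. Proof. exact: lt_le_trans b1. Qed.

Let S (m : nat) (c0 : T -> R[i]) (s : R) (x : T) : R[i] :=
  c0 x + \sum_(i < m) (\1_(A i) s)%:C%C * c i x.

Let mS m c0 : cmeasurable c0 -> measurable_fun setT (fun s => cLnorm mu b (S m c0 s)).
Proof.
move=> mc0; have -> : (fun s => cLnorm mu b (S m c0 s)) =
    (fun s => (\int[mu]_x (cmod (S m c0 s x) `^ b)%:E) `^ b^-1)%E.
  by apply/funext => s; rewrite cLnormE.
apply: (measurableT_comp (measurable_poweR _)).
apply (@measurable_integral_param _ _ _ _ _ mu (fun (s : R) (x : T) => (cmod (S m c0 s x) `^ b)%:E)).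
apply: measurable_cmod_powRE; apply: cmeasurableD.
  exact: (cmeasurable_comp mc0 measurable_snd).
apply: cmeasurable_sum => i; apply: cmeasurableM.
  have mi : measurable_fun setT (\1_(A i) : R -> R) by exact: measurable_indic.
  by apply: cmeasurableR; exact: (measurableT_comp mi measurable_fst).
exact: (cmeasurable_comp (mc i) measurable_snd).
Qed.

Let cmeasurable_coeff m (a : R) (e : nat -> R) c0 : cmeasurable c0 ->
  cmeasurable (fun x => a%:C%C * c0 x + \sum_(i < m) (e i)%:C%C * c i x).
Proof.
move=> mc0; apply: cmeasurableD; first by apply: cmeasurableM => //; exact: cmeasurable_cst.
by apply: cmeasurable_sum => i; apply: cmeasurableM => //; exact: cmeasurable_cst.
Qed.

(* The induction splits D along A m, where the offset c0 becomes c0 + c m. *)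
Let simple_norm m : forall (D : set R) c0, measurable D -> (lam D < +oo)%E -> cmeasurable c0 ->
  (cLnorm mu b (fun x => ((fine (lam D))%:C%C * c0 x +
       \sum_(i < m) (fine (lam (A i `&` D)))%:C%C * c i x)%R)
    <= \int[lam]_(s in D) cLnorm mu b (S m c0 s))%E.
Proof.
elim: m => [|m IHm] D c0 mD Dy mc0.
  have -> : (fun s => cLnorm mu b (S 0 c0 s)) = cst (cLnorm mu b c0).
    by apply/funext => s; apply: eq_Lnorm => x; rewrite /S big_ord0 addr0.
  have fD : lam D \is a fin_num by rewrite ge0_fin_numE.
  rewrite integral_cst// -[X in (_ * X)%E](fineK fD) muleC -cLnormZ ?fine_ge0// le_eqVlt; apply/orP; left; apply/eqP; apply: eq_Lnorm => x.
  by rewrite big_ord0 addr0.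
pose D1 := A m `&` D; pose D2 := D `\` A m.
have mD1 : measurable D1 by exact: measurableI.
have mD2 : measurable D2 by exact: measurableD.
have D12 : D = D1 `|` D2 by rewrite /D1 /D2 setIC setUIDK.
have fin X : measurable X -> X `<=` D -> lam X \is a fin_num.
  move=> mX XD; rewrite ge0_fin_numE; last exact: measure_ge0.
  apply: le_lt_trans Dy; apply: le_measure => //; exact: mem_set.
have D1D : D1 `<=` D by move=> x [].
have D2D : D2 `<=` D by move=> x [].
have add X : measurable X ->
    fine (lam (X `&` D)) = fine (lam (X `&` D1)) + fine (lam (X `&` D2)).
  move=> mX; have f1 : lam (X `&` D1) \is a fin_num.
    by apply: fin; [exact: measurableI|move=> x [_ /D1D]].
  have f2 : lam (X `&` D2) \is a fin_num by apply: fin; [exact: measurableI|move=> x [_ /D2D]].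
  rewrite -fineD// {1}D12 setIUr measureU//; try exact: measurableI.
  by apply/seteqP; split => x // -[[_ [Ax _]] [_ [_ /(_ Ax)]]].
have addT := add setT measurableT; rewrite !setTI in addT.
have mcm : cmeasurable (fun x => c0 x + c m x) by exact: cmeasurableD.
have D1y : (lam D1 < +oo)%E by rewrite -ge0_fin_numE// fin.
have D2y : (lam D2 < +oo)%E by rewrite -ge0_fin_numE// fin.
have I1 := IHm D1 _ mD1 D1y mcm; have I2 := IHm D2 _ mD2 D2y mc0.
rewrite D12 (@ge0_integral_setU _ _ _ lam D1 D2)//; last 3 first.
- by apply: (measurable_funS measurableT) => //; exact: mS.
- by move=> s _; exact: cLnorm_ge0.
- by apply/disj_setPS => x [[Ax _] [_ /(_ Ax)]].
rewrite -D12.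
have E1 : (\int[lam]_(s in D1) cLnorm mu b (S m.+1 c0 s) =
    \int[lam]_(s in D1) cLnorm mu b (S m (fun x => (c0 x + c m x)%R) s))%E.
  apply: eq_integral => s /set_mem [As _]; apply: eq_Lnorm => x.
  rewrite /S big_ord_recr/= indicE mem_set// mul1r -addrA; congr (cmod _)%:E.
  by congr (_ + _); rewrite addrC.
have E2 : (\int[lam]_(s in D2) cLnorm mu b (S m.+1 c0 s) = \int[lam]_(s in D2) cLnorm mu b (S m c0 s))%E.
  apply: eq_integral => s /set_mem [_ As]; apply: eq_Lnorm => x.
  by rewrite /S big_ord_recr/= indicE memNset// mul0r addr0.
rewrite E1 E2; apply: le_trans (leeD I1 I2).
apply: le_trans (cLnormD mu b1 (cmeasurable_coeff m _ (fun i => fine (lam (A i `&` D1))) mcm)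
  (cmeasurable_coeff m _ (fun i => fine (lam (A i `&` D2))) mc0)).
rewrite le_eqVlt; apply/orP; left; apply/eqP; apply: eq_Lnorm => x; congr (cmod _)%:E.
rewrite big_ord_recr/= (add _ (mA m)).
have -> : A m `&` D1 = D1 by rewrite /D1 setIA setIid.
have -> : A m `&` D2 = set0 by rewrite /D2 setDE setICA setICr setI0.
rewrite measure0 /= addr0.
under eq_bigr do rewrite add// rmorphD mulrDl.
rewrite big_split/= addT rmorphD mulrDl mulrDr -!addrA; congr (_ + _).
have sw (u v y z : R[i]) : u + (v + (y + z)) = z + (v + (u + y)) by ring.
exact: sw.
Qed.

Lemma simple_function_norm_le m (D : set R) : measurable D -> (lam D < +oo)%E ->
  (cLnorm mu b (fun x => (\sum_(i < m) (fine (lam (A i `&` D)))%:C%C * c i x)%R)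
    <= \int[lam]_(s in D) cLnorm mu b (fun x => (\sum_(i < m) (\1_(A i) s)%:C%C * c i x)%R))%E.
Proof.
move=> mD Dy; have := simple_norm m mD Dy (cmeasurable_cst 0).
set l1 := cLnorm _ _ _; set l2 := integral _ _ _; set l3 := cLnorm _ _ _; set l4 := integral _ _ _.
have -> : l1 = l3 by apply: eq_Lnorm => x; rewrite mulr0 add0r.
have -> // : l2 = l4 by apply: eq_integral => s _; apply: eq_Lnorm => x; rewrite /S add0r.
Qed.

Lemma measurable_simple_norm m : measurable_fun setT
  (fun s => cLnorm mu b (fun x => (\sum_(i < m) (\1_(A i) s)%:C%C * c i x)%R)).
Proof.
have := mS m (cmeasurable_cst 0); congr (measurable_fun _ _); apply/funext => s.
by apply: eq_Lnorm => x; rewrite /S add0r.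
Qed.

End bochner_norm.

(** The triangle inequality for simple functions passes to the limit. What is integrated is a
    measurable majorant W and not the norm of [w s], whose measurability in s the definition of the
    integral does not provide. *)
Lemma bochner_integral_le {R : realType} (n : nat) (b : R) (D : set R) (w : R -> 'cV[R]_n -> R[i])
    (g : 'cV[R]_n -> R[i]) (W : R -> \bar R) : 1 <= b ->
  measurable D -> (lebesgue_measure D < +oo)%E ->
  measurable_fun setT W -> (forall s, 0 <= W s)%E ->
  {ae lebesgue_measure, forall s, D s -> cmeasurable (w s) /\ (cLnorm (lebesgue_cV R n) b (w s) <= W s)%E} ->
  bochner_integral b D w g ->
  (cLnorm (lebesgue_cV R n) b g <= \int[lebesgue_measure]_(s in D) W s)%E.
Proof.
move=> b1 mD Dy mW W0 wW [m [A [c [Ac mdist dist0 [mg _] Gk]]]].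
have mA k i : measurable (A k i) by case: (Ac k i).
have mc k i : cmeasurable (c k i) by case: (Ac k i) => _ [].
pose dist k s := cLnorm (lebesgue_cV R n) b
  (fun x => (w s x - \sum_(i < m k) (\1_(A k i) s)%:C%C * c k i x)%R).
pose G k := cLnorm (lebesgue_cV R n) b
  (fun x => (\sum_(i < m k) (fine (lebesgue_measure (A k i `&` D)))%:C%C * c k i x - g x)%R).
have {}mdist k : measurable_fun D (dist k) := mdist k.
have {}dist0 : (fun k => \int[lebesgue_measure]_(s in D) dist k s)%E @ \oo --> 0%E := dist0.
have {}Gk : G @ \oo --> 0%E := Gk.
apply: (@cvge0_le_add _ _ _ (fun k => (\int[lebesgue_measure]_(s in D) dist k s)%E + G k)%E).
  have h2 := @cvgeD _ _ _ _ _ _ _ _ _ dist0 Gk.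
  by move: h2; rewrite adde0; apply.
move=> k.
have mG : cmeasurable (fun x => \sum_(i < m k) (fine (lebesgue_measure (A k i `&` D)))%:C%C * c k i x).
  by apply: cmeasurable_sum => i; apply: cmeasurableM => //; exact: cmeasurable_cst.
apply: le_trans (cLnorm_dist (lebesgue_cV R n) b1 mg mG) _.
rewrite addeA cLnormB; apply: leeD2r.
apply: le_trans (simple_function_norm_le _ b1 (mA k) (mc k) (m k) mD Dy) _.
rewrite -ge0_integralD//; try by [move=> s _; exact: cLnorm_ge0|exact: mdist|apply: (measurable_funS measurableT)].
apply: ae_ge0_le_integral => //.
- by move=> s _; exact: cLnorm_ge0.
- by apply: (measurable_funS measurableT) => //; exact: measurable_simple_norm.
- by move=> s _; rewrite adde_ge0 ?cLnorm_ge0.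
- apply: emeasurable_funD; [apply: (measurable_funS measurableT)|exact: mdist]; by [].
have fae := ae_filter_ringOfSetsType (@lebesgue_measure R).
apply: filterS wW => s wW Ds; have [mw wWs] := wW Ds.
have mSk : cmeasurable (fun x => \sum_(i < m k) (\1_(A k i) s)%:C%C * c k i x).
  by apply: cmeasurable_sum => i; apply: cmeasurableM => //; exact: cmeasurable_cst.
apply: le_trans (cLnorm_dist (lebesgue_cV R n) b1 mSk mw) _.
by rewrite cLnormB; apply: leeD.
Qed.

Lemma powR_scale {R : realType} (a b x y z e : R) : 0 <= a -> 0 <= b ->
  (a * (b * x `^ y) `^ z) `^ e = (a * b `^ z) `^ e * x `^ (y * z * e).
Proof.
move=> a0 b0; rewrite (powRM _ b0 (powR_ge0 _ _)) mulrA (powRM _ _ (powR_ge0 _ _)) ?mulr_ge0 ?powR_ge0//.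
by rewrite -!powRrM mulrA.
Qed.

(** * The space-time estimates *)

Section strichartz_estimates.
Context {R : realType} (n : nat) (Q B : 'M[R]_n) (D : nat) (gam : R).
Hypotheses (n0 : (0 < n)%N) (QT : Q^T = Q) (gam0 : 0 < gam).
Hypothesis hV : forall t : R, 0 < t -> gam * t ^+ D * expR (t * \tr B) <= volume Q B t.
Variables (q r : R).
Hypotheses (r2 : 2 < r) (q2 : 2 < q) (qr : 2 / q = D%:R * (1 / 2 - 1 / r)).
Notation leb := (lebesgue_cV R n).
Notation lam := (@lebesgue_measure R).
Let K (t : R) : R := expR (t * \tr B / 2).

Let K0 t : 0 < K t. Proof. exact: expR_gt0. Qed.
Let r0 : 0 < r. Proof. exact: lt_trans r2. Qed.
Let q0 : 0 < q. Proof. exact: lt_trans q2. Qed.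
Let r1 : 0 < r - 1. Proof. by rewrite subr_gt0 (lt_trans _ r2)// ltr1n. Qed.
Let q1 : 0 < q - 1. Proof. by rewrite subr_gt0 (lt_trans _ q2)// ltr1n. Qed.
Let r'0 : 0 < r / (r - 1). Proof. exact: divr_gt0. Qed.
Let q'0 : 0 < q / (q - 1). Proof. exact: divr_gt0. Qed.

Definition dispersive_cst : R := (interp_cst r * disp_cst n gam `^ (r - 2)) `^ r^-1.

Lemma dispersive_cst_gt0 : 0 < dispersive_cst.
Proof. by rewrite powR_gt0// mulr_gt0 ?interp_cst_gt0 ?powR_gt0 ?disp_cst_gt0. Qed.

Lemma propagator0_cLnorm2 t f : cL12 leb f ->
  (cLnorm leb 2 (propagator0 Q B t f) <= ((K t)^-1)%:E * cLnorm leb 2 f)%E.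
Proof.
move=> cf; have mf : cmeasurable f by case: cf.
have mp := cmeasurable_propagator0 Q B t cf.
have := propagator0_L2 n0 QT gam0 hV t cf; rewrite -/(K t) => H.
have H2 : (cLnorm leb 2 (fun x => ((K t)%:C%C * propagator0 Q B t f x)%R) <= cLnorm leb 2 f)%E.
  rewrite !cLnormE; apply: le_poweR; first by rewrite invr_ge0.
    by apply: integral_ge0 => x _; rewrite lee_fin powR_ge0.
  apply: le_trans (le_trans H _); rewrite le_eqVlt; apply/orP; left; apply/eqP; apply: eq_integral => x _.
    by rewrite cmodM cmodR gtr0_norm// powR_mulrn ?mulr_ge0 ?cmod_ge0// ltW.
  by rewrite powR_mulrn ?cmod_ge0.
rewrite cLnormZ// in H2; last exact: ltW.
by rewrite lee_pdivlMl.
Qed.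

Lemma propagator0_dispersive t f : t != 0 -> cL12 leb f ->
  (cLnorm leb r (propagator0 Q B t f) <=
    ((K t)^-1 * (dispersive_cst * `|t| `^ (- (2 / q))))%:E * cLnorm leb (r / (r - 1)) f)%E.
Proof.
move=> t0 cf; have mf : cmeasurable f by case: cf.
have mp := cmeasurable_propagator0 Q B t cf.
have at0 : 0 < `|t| by rewrite normr_gt0.
pose c := interp_cst r * (disp_cst n gam * `|t| `^ (- (D%:R / 2))) `^ (r - 2).
have c0 : 0 < c.
  by apply: mulr_gt0; [exact: interp_cst_gt0|apply/powR_gt0/mulr_gt0; [exact: disp_cst_gt0|exact: powR_gt0]].
have E : c `^ r^-1 = dispersive_cst * `|t| `^ (- (2 / q)).
  have d0 := ltW (disp_cst_gt0 n gam0); have i0 := ltW (interp_cst_gt0 r2).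
  rewrite /c (powR_scale _ _ _ _ i0 d0) qr; congr (_ * _ `^ _).
  by field; rewrite gt_eqF.
have H2 : (cLnorm leb r (fun x => ((K t)%:C%C * propagator0 Q B t f x)%R) <=
    (c `^ r^-1)%:E * cLnorm leb (r / (r - 1)) f)%E.
  rewrite !cLnormE; apply: le_poweR_homogeneous => //.
  - by apply: integral_ge0 => x _; rewrite lee_fin powR_ge0.
  - by apply: integral_ge0 => x _; rewrite lee_fin powR_ge0.
  move=> N N0 fN; have -> : r / (r / (r - 1)) = r - 1 by field; rewrite !gt_eqF.
  apply: le_trans (propagator0_Lr n0 QT gam0 hV r2 t0 cf N0 fN).
  rewrite le_eqVlt; apply/orP; left; apply/eqP; apply: eq_integral => x _.
  by rewrite cmodM cmodR gtr0_norm.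
rewrite E cLnormZ// in H2; last exact: ltW.
by rewrite EFinM -muleA lee_pdivlMl.
Qed.

Lemma propagator_dispersive t phi psi : t != 0 -> propagator Q B (r / (r - 1)) r t phi psi ->
  (cLnorm leb r psi <=
    ((K t)^-1 * (dispersive_cst * `|t| `^ (- (2 / q))))%:E * cLnorm leb (r / (r - 1)) phi)%E.
Proof.
move=> t0; apply: propagator_le.
- by rewrite ler_pdivlMr// mul1r lerBlDr lerDl.
- by rewrite ltW// (lt_trans _ r2)// ltr1n.
- by rewrite mulr_ge0 ?invr_ge0 ?mulr_ge0 ?powR_ge0 ?ltW ?dispersive_cst_gt0.
- by move=> f cf; exact: propagator0_dispersive.
Qed.

(** Real-valued, as [riesz] requires. An infinite norm becomes 0 under [fine], which is harmless:
    where Duhamel's formula is used the norm of [F s] is finite, and in the final bound the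
    replacement can only decrease the left side. *)
Definition forcing_norm (F : R -> 'cV[R]_n -> R[i]) (s : R) : R :=
  K s * fine (cLnorm leb (r / (r - 1)) (F s)).

Lemma measurable_cLnorm_param (a : R) (F : R -> 'cV[R]_n -> R[i]) :
  cmeasurable (fun z : R * 'cV[R]_n => F z.1 z.2) ->
  measurable_fun setT (fun s => cLnorm leb a (F s)).
Proof.
move=> mF; rewrite (_ : (fun s => _) = (fun s : R => (\int[leb]_x (cmod (F s x) `^ a)%:E) `^ a^-1)%E); last first.
  by apply/funext => s; rewrite cLnormE.
apply: (measurableT_comp (measurable_poweR _)).
exact (@measurable_integral_param _ _ _ _ _ leb (fun (s : R) x => (cmod (F s x) `^ a)%:E)
  (measurable_cmod_powRE _ mF)).
Qed.

Let mK : measurable_fun setT K.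
Proof.
apply: (measurableT_comp (@measurable_expR R)); apply: measurable_funM => //.
by apply: measurable_funM.
Qed.

Lemma measurable_forcing_norm F : cmeasurable (fun z : R * 'cV[R]_n => F z.1 z.2) ->
  measurable_fun setT (forcing_norm F).
Proof.
move=> mF; apply: measurable_funM => //.
by apply: (measurableT_comp (@fine_measurable R setT measurableT)); exact: measurable_cLnorm_param.
Qed.

Lemma forcing_norm_ge0 F s : 0 <= forcing_norm F s.
Proof. by rewrite mulr_ge0 ?(ltW (K0 s))// fine_ge0// cLnorm_ge0. Qed.

(** Since K(t - s)^-1 = K(t)^-1 K(s), the dispersive bound makes the weighted norm of the integrand
    a convolution with |t|^(-2/q); enlarging the interval between 0 and t to the line gives the
    Riesz potential of the weighted forcing. *)
Lemma duhamel_le (F : R -> 'cV[R]_n -> R[i]) (t : R) (w : R -> 'cV[R]_n -> R[i]) g :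
  cmeasurable (fun z : R * 'cV[R]_n => F z.1 z.2) ->
  {ae lam, forall s : R, s \in `[Num.min 0 t, Num.max 0 t] ->
     propagator Q B (r / (r - 1)) r (t - s) (F s) (w s)} ->
  bochner_integral r `[Num.min 0 t, Num.max 0 t] w g ->
  ((K t)%:E * cLnorm leb r g <= dispersive_cst%:E * riesz q (forcing_norm F) t)%E.
Proof.
move=> mF wF gw; have mG := measurable_forcing_norm mF.
have mk : measurable_fun setT (fun s : R => `|t - s| `^ (- (2 / q)) * forcing_norm F s).
  apply: measurable_funM => //.
  apply: (@measurableT_comp _ _ _ _ _ _ (@powR R ^~ (- (2 / q)))) => //.
  by apply: measurableT_comp => //; exact: measurable_funB.
pose W (s : R) : \bar R := (((K t)^-1 * dispersive_cst)%:E * (`|t - s| `^ (- (2 / q)) * forcing_norm F s)%:E)%E.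
have k0 s : 0 <= `|t - s| `^ (- (2 / q)) * forcing_norm F s.
  by rewrite mulr_ge0 ?powR_ge0 ?forcing_norm_ge0.
have c0 : 0 <= (K t)^-1 * dispersive_cst by rewrite mulr_ge0 ?invr_ge0 ?ltW ?dispersive_cst_gt0.
have W0 s : (0 <= W s)%E by rewrite mule_ge0 ?lee_fin.
have mW : measurable_fun setT W by apply: emeasurable_funM => //; exact/measurable_EFinP.
have fae := ae_filter_ringOfSetsType (@lebesgue_measure R).
have ne : {ae lam, forall s : R, s != t}.
  exists [set t]; split; [exact: measurable_set1|exact: lebesgue_measure_set1|].
  by move=> s /= /negP; rewrite negbK => /eqP.
pose I : set R := `[Num.min 0 t, Num.max 0 t]%classic.
have H : (cLnorm leb r g <= \int[lam]_(s in I) W s)%E.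
  apply: bochner_integral_le gw => //; first by rewrite ltW// (lt_trans _ r2)// ltr1n.
    by rewrite lebesgue_measure_itv/=; case: ifP => _; rewrite ?ltry// -EFinB ltry.
  apply: filterS2 wF ne => s ws st sD; have pw := ws sD.
  have [Fr' [mw _] _] := pw; split => //.
  have ts : t - s != 0 by rewrite subr_eq0 eq_sym.
  apply: le_trans (propagator_dispersive ts pw) _.
  have -> : cLnorm leb (r / (r - 1)) (F s) = (fine (cLnorm leb (r / (r - 1)) (F s)))%:E.
    by rewrite fineK// ge0_fin_numE ?cLnorm_ge0//; case: Fr'.
  rewrite /W -!EFinM lee_fin /forcing_norm.
  have -> : (K (t - s))^-1 = (K t)^-1 * K s.
    by rewrite /K -!expRN -expRD; congr expR; ring.
  by rewrite le_eqVlt; apply/orP; left; apply/eqP; ring.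
have H' : (cLnorm leb r g <= \int[lam]_s W s)%E.
  apply: le_trans H _; apply: ge0_subset_integral => //; exact: measurable_itv.
have -> : (dispersive_cst%:E * riesz q (forcing_norm F) t = (K t)%:E * \int[lam]_s W s)%E.
  rewrite /W ge0_integralZl_EFin//; last 2 first.
  - by move=> s _; rewrite lee_fin.
  - exact/measurable_EFinP.
  by rewrite muleA -EFinM mulrA mulfV ?mul1r// gt_eqF.
by rewrite lee_wpmul2l// lee_fin ltW.
Qed.

Lemma riesz_forcing_le (F : R -> 'cV[R]_n -> R[i]) :
  cmeasurable (fun z : R * 'cV[R]_n => F z.1 z.2) ->
  ((\int[lam]_t riesz q (forcing_norm F) t `^ q) `^ q^-1 <=
    (hls_cst q `^ q^-1)%:E *
    (\int[lam]_t (forcing_norm F t `^ (q / (q - 1)))%:E) `^ (q / (q - 1))^-1)%E.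
Proof.
move=> mF; apply: le_poweR_homogeneous => //.
- exact: hls_cst_gt0.
- by apply: integral_ge0 => t _; exact: poweR_ge0.
- by apply: integral_ge0 => t _; rewrite lee_fin powR_ge0.
move=> N N0 FN; have -> : q / (q / (q - 1)) = q - 1 by field; rewrite !gt_eqF.
apply: hls => //; first exact: measurable_forcing_norm.
by move=> u; exact: forcing_norm_ge0.
Qed.

End strichartz_estimates.

Lemma cmod_dist {R : realType} (y z : R[i]) : `|cmod y - cmod z| <= cmod (y - z).
Proof.
have H (u v : R[i]) : cmod u - cmod v <= cmod (u - v).
  by rewrite lerBlDr; apply: le_trans (cmodD (u - v) v); rewrite subrK.
by rewrite ler_norml lerNl opprB [cmod (y - z)]cmodB {1}H cmodB H.
Qed.

Lemma measurable_limn_einf {R : realType} {d} {T : measurableType d} (f : (T -> \bar R)^nat) :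
  (forall k, measurable_fun setT (f k)) -> measurable_fun setT (fun x => limn_einf (f^~ x)).
Proof.
move=> mf; have -> : (fun x => limn_einf (f^~ x)) = (fun x => - limn_esup (fun k => - f k x))%E.
  apply/funext => x; rewrite -limn_einfN; congr limn_einf; apply/funext => k /=; exact/esym/oppeK.
apply: (measurableT_comp (@oppe_measurable R _)).
by apply: measurable_fun_limn_esup => k; exact: (measurableT_comp (@oppe_measurable R _)).
Qed.

Lemma limn_einf_ge0 {R : realType} (u : (\bar R)^nat) : (forall k, 0 <= u k)%E -> (0 <= limn_einf u)%E.
Proof.
move=> u0; rewrite limn_einf_lim; apply: lime_ge; first exact: is_cvg_einfs.
by apply: nearW => k; apply: le_ereal_inf_tmp => _ [j _ <-].
Qed.

(** * The homogeneous estimate for general data *)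

Section homogeneous_limit.
Context {R : realType} (n : nat) (Q B : 'M[R]_n) (D : nat) (gam : R).
Hypotheses (n0 : (0 < n)%N) (QT : Q^T = Q) (gam0 : 0 < gam).
Hypothesis hV : forall t : R, 0 < t -> gam * t ^+ D * expR (t * \tr B) <= volume Q B t.
Variables (q r : R).
Hypotheses (r2 : 2 < r) (q2 : 2 < q) (qr : 2 / q = D%:R * (1 / 2 - 1 / r)).
Notation leb := (lebesgue_cV R n).
Notation lam := (@lebesgue_measure R).
Let K (t : R) : R := expR (t * \tr B / 2).

Let K0 t : 0 < K t. Proof. exact: expR_gt0. Qed.
Let r0 : 0 < r. Proof. exact: lt_trans r2. Qed.
Let q0 : 0 < q. Proof. exact: lt_trans q2. Qed.

Definition homogeneous_cst : R := (strichartz_cst q r (disp_cst n gam) `^ (q / 2)) `^ q^-1.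

Variables (phi : 'cV[R]_n -> R[i]) (f : nat -> 'cV[R]_n -> R[i]) (e : R).
Hypotheses (e0 : 0 < e) (mphi : cmeasurable phi) (cf : forall k, cL12 leb (f k)).
(** The bound e controls the norms of all [f k]; the square root makes the squared errors summable,
    which gives almost everywhere convergence of the images at every time. *)
Hypothesis fphi : forall k,
  (cLnorm leb 2 (fun x => (f k x - phi x)%R) <= (Num.min e (Num.sqrt (1 / (2 ^ (k + 1))%:R)))%:E)%E.

Let U k t x := kop leb (kern Q B) t (f k) x.

Let mf k : cmeasurable (f k). Proof. by case: (cf k). Qed.

Let mU k : cmeasurable (fun z : R * 'cV[R]_n => U k z.1 z.2).
Proof. exact (cmeasurable_kop2 leb (cmeasurable_kern Q B) (mf k)). Qed.

Let a k (t : R) : \bar R := (\int[leb]_x (cmod (U k t x) `^ r)%:E)%E.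

Let ma k : measurable_fun setT (a k).
Proof.
exact (@measurable_integral_param _ _ _ _ _ leb (fun (t : R) x => (cmod (U k t x) `^ r)%:E)
  (measurable_cmod_powRE _ (mU k))).
Qed.

Let a0 k t : (0 <= a k t)%E.
Proof. by apply: integral_ge0 => x _; rewrite lee_fin powR_ge0. Qed.

(** A majorant of the weighted L^r norm of U(t) phi that is measurable in t by construction and
    depends on the sequence alone. The function U(t) phi itself is only given separately for each t,
    through the closure of the graph. *)
Definition homogeneous_bound (t : R) : \bar R := ((limn_einf (fun k => a k t `^ (q / r))) `^ q^-1)%E.

Let m_aqr k : measurable_fun setT (fun t => a k t `^ (q / r))%E.
Proof. exact: (measurableT_comp (measurable_poweR _) (ma k)). Qed.

Lemma measurable_homogeneous_bound : measurable_fun setT homogeneous_bound.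
Proof.
apply: (measurableT_comp (measurable_poweR _)).
by apply: (@measurable_limn_einf _ _ _ (fun k t => a k t `^ (q / r))%E).
Qed.

Lemma homogeneous_bound_ge0 t : (0 <= homogeneous_bound t)%E.
Proof. exact: poweR_ge0. Qed.

Lemma homogeneous_bound_le :
  ((\int[lam]_t (homogeneous_bound t `^ q)) `^ q^-1 <=
    homogeneous_cst%:E * (cLnorm leb 2 phi + e%:E))%E.
Proof.
have S0 : 0 < strichartz_cst q r (disp_cst n gam).
  apply: mulr_gt0; first by apply/powR_gt0/mulr_gt0; [exact: interp_cst_gt0|exact/powR_gt0/disp_cst_gt0].
  by rewrite ltr_pwDl// ltW// hls_cst_gt0.
have Z0 : (0 <= homogeneous_cst%:E * (cLnorm leb 2 phi + e%:E))%E.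
  by rewrite mule_ge0 ?lee_fin ?powR_ge0 ?adde_ge0 ?cLnorm_ge0 ?lee_fin ?ltW.
have X0 k : (0 <= \int[lam]_t (a k t `^ (q / r)))%E by apply: integral_ge0 => t _; exact: poweR_ge0.
have bd k : (\int[lam]_t (a k t `^ (q / r)) <= (homogeneous_cst%:E * (cLnorm leb 2 phi + e%:E)) `^ q)%E.
  rewrite -[leLHS](@poweRVK _ q) ?gt_eqF//; apply: le_poweR; [exact: ltW|exact: poweR_ge0|].
  apply: (@le_trans _ _ (homogeneous_cst%:E * cLnorm leb 2 (f k))%E).
    rewrite cLnormE; apply: le_poweR_homogeneous => //.
    - exact: powR_gt0.
    - by apply: integral_ge0 => x _; rewrite lee_fin powR_ge0.
    move=> M M0 fM; rewrite -powRM ?(ltW S0) ?(ltW M0)//.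
    apply: (kern_strichartz n0 QT gam0 hV r2 q2 qr (cf k) M0).
    apply: le_trans fM; rewrite le_eqVlt; apply/orP; left; apply/eqP; apply: eq_integral => x _.
    by rewrite powR_mulrn ?cmod_ge0.
  rewrite lee_wpmul2l ?lee_fin ?powR_ge0//.
  apply: le_trans (cLnorm_dist leb _ (mf k) mphi) _; first by rewrite ler1n.
  by rewrite leeD2l// (le_trans (fphi k))// lee_fin ge_min lexx.
rewrite -[leRHS](@poweRK _ q) ?gt_eqF//; apply: le_poweR; first by rewrite invr_ge0 ltW.
  by apply: integral_ge0 => t _; exact: poweR_ge0.
apply: (@le_trans _ _ (\int[lam]_t limn_einf (fun k => a k t `^ (q / r)))%E).
  rewrite le_eqVlt; apply/orP; left; apply/eqP; apply: eq_integral => t _.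
  by rewrite /homogeneous_bound poweRVK ?gt_eqF// limn_einf_ge0// => k; exact: poweR_ge0.
apply: le_trans (@fatou _ _ _ lam setT measurableT (fun k t => a k t `^ (q / r))%E _ _) _.
- by move=> k; exact: m_aqr.
- by move=> k t _; exact: poweR_ge0.
exact: limn_einf_le_bound.
Qed.

(** At a fixed time the images of [f k] approach v in L^2 with summable squared errors, hence almost
    everywhere; Fatou's lemma in x bounds the L^r norm of v by the lower limit. *)
Lemma propagator_homogeneous_bound t v : t != 0 -> propagator Q B 2 2 t phi v ->
  ((K t)%:E * cLnorm leb r v <= homogeneous_bound t)%E.
Proof.
move=> t0 pv; have mv : cmeasurable v by case: pv => _ [].
have mp k := cmeasurable_propagator0 Q B t (cf k).
have mKv : cmeasurable (fun x => (K t)%:C%C * v x) by apply: cmeasurableM => //; exact: cmeasurable_cst.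
pose h k x := (K t)%:C%C * (v x - propagator0 Q B t (f k) x).
have mh k : cmeasurable (h k).
  by apply: cmeasurableM; [exact: cmeasurable_cst|exact: cmeasurableB].
have hk k : (\int[leb]_x (cmod (h k x) `^ 2)%:E <= (1 / (2 ^ (k + 1))%:R)%:E)%E.
  rewrite -cLnorm_poweR// /h cLnormZ//; [|exact: ltW|exact: cmeasurableB].
  have H : ((K t)%:E * cLnorm leb 2 (fun x => (v x - propagator0 Q B t (f k) x)%R) <=
      (Num.sqrt (1 / (2 ^ (k + 1))%:R))%:E)%E.
    rewrite -lee_pdivlMl//.
    apply: le_trans (propagator_dist _ _ _ (fun g cg => propagator0_cLnorm2 n0 QT gam0 hV t cg) (cf k) pv) _.
    - by rewrite ler1n.
    - by rewrite ler1n.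
    - by rewrite invr_ge0 expR_ge0.
    rewrite lee_wpmul2l ?lee_fin ?invr_ge0 ?(ltW (K0 t))// cLnormB.
    by apply: le_trans (fphi k) _; rewrite lee_fin ge_min lexx orbT.
  apply: le_trans (le_poweR _ _ H) _ => //.
    by rewrite mule_ge0 ?cLnorm_ge0// lee_fin ltW.
  by rewrite poweR_EFin powR_mulrn ?sqrtr_ge0// sqr_sqrtr// divr_ge0.
have hcvg := summable_sqr_cvg0 mh hk.
have fat : (\int[leb]_x (cmod ((K t)%:C%C * v x) `^ r)%:E <= limn_einf (fun k => a k t))%E.
  apply: (@le_trans _ _ (\int[leb]_x limn_einf (fun k => (cmod (U k t x) `^ r)%:E))%E); last first.
    apply: (@fatou _ _ _ leb setT measurableT (fun k x => (cmod (U k t x) `^ r)%:E)).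
    - move=> k; apply: measurable_cmod_powRE; exact: (cmeasurable_comp (mU k) (measurable_pair1 t)).
    - by move=> k x _; rewrite lee_fin powR_ge0.
  apply: ae_ge0_le_integral => //.
  - by move=> x _; rewrite lee_fin powR_ge0.
  - exact: measurable_cmod_powRE.
  - by move=> x _; apply: limn_einf_ge0 => k; rewrite lee_fin powR_ge0.
  - apply: (@measurable_limn_einf _ _ _ (fun k x => (cmod (U k t x) `^ r)%:E)) => k.
    apply: measurable_cmod_powRE; exact: (cmeasurable_comp (mU k) (measurable_pair1 t)).
  apply: filterS hcvg => x hx _.
  have l0 : (0 <= limn_einf (fun k => (cmod (U k t x) `^ r)%:E))%E.
    by apply: limn_einf_ge0 => k; rewrite lee_fin powR_ge0.
  have [z0|znz] := eqVneq (cmod ((K t)%:C%C * v x)) 0; first by rewrite z0 powR0// gt_eqF.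
  have zp : 0 < cmod ((K t)%:C%C * v x) by rewrite lt0r znz cmod_ge0.
  have Uv : cmod (U k t x) @[k --> \oo] --> cmod ((K t)%:C%C * v x).
    apply/cvgrPdist_le => d d0.
    have /cvgr0Pnorm_le /(_ _ d0) := hx; apply: filterS => k; apply: le_trans.
    rewrite [leRHS]ger0_norm ?cmod_ge0// /U -(propagator0_kop gam0 hV)// -/(K t).
    have -> : K t * cmod (propagator0 Q B t (f k) x) = cmod ((K t)%:C%C * propagator0 Q B t (f k) x).
      by rewrite cmodM cmodR gtr0_norm.
    rewrite /h mulrBr; set y := _ * v x; set z := _ * propagator0 _ _ _ _ _.
    exact: cmod_dist.
  have Ur : (cmod (U k t x) `^ r)%:E @[k --> \oo] --> (cmod ((K t)%:C%C * v x) `^ r)%:E.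
    by apply/fine_cvgP; split; [exact: nearW|exact: cvg_powR].
  by rewrite (cvg_limn_einf_sup Ur).1.
rewrite -cLnormZ//; last exact: ltW.
rewrite cLnormE /homogeneous_bound.
have -> (X : \bar R) : (X `^ r^-1 = (X `^ (q / r)) `^ q^-1)%E.
  by rewrite -poweRrM mulrAC mulfV ?mul1r// gt_eqF.
apply: le_poweR; [by rewrite invr_ge0 ltW|exact: poweR_ge0|].
apply: le_trans (limn_einf_poweR (divr_gt0 q0 r0) (fun k => a0 k t)).
apply: le_poweR => //; first by rewrite ltW// divr_gt0.
by apply: integral_ge0 => x _; rewrite lee_fin powR_ge0.
Qed.

End homogeneous_limit.

(** From (a + b)^p <= 2^p (a^p + b^p), used once with p = q and once with p = 1/q, in place of
    Minkowski's inequality for functions with values in [0, +oo]. *)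
Definition quasi_triangle_cst {R : realType} (q : R) : R := (2 `^ q) `^ q^-1 * 2 `^ q^-1.

Lemma ae_le_triangle {R : realType} {d} {T : measurableType d} (mu : {measure set T -> \bar R})
    (q c : R) (E H Z : T -> \bar R) : 0 < q -> 0 <= c ->
  measurable_fun setT E -> measurable_fun setT H -> measurable_fun setT Z ->
  (forall t, 0 <= E t)%E -> (forall t, 0 <= H t)%E -> (forall t, 0 <= Z t)%E ->
  {ae mu, forall t, (E t <= H t + c%:E * Z t)%E} ->
  ((\int[mu]_t (E t `^ q)) `^ q^-1 <= (quasi_triangle_cst q)%:E *
    ((\int[mu]_t (H t `^ q)) `^ q^-1 + c%:E * (\int[mu]_t (Z t `^ q)) `^ q^-1))%E.
Proof.
move=> q0 c0 mE mH mZ E0 H0 Z0 EHZ.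
have Hq0 t : (0 <= H t `^ q)%E by exact: poweR_ge0.
have Zq0 t : (0 <= Z t `^ q)%E by exact: poweR_ge0.
have Eq0 t : (0 <= E t `^ q)%E by exact: poweR_ge0.
have cq0 : 0 <= c `^ q by exact: powR_ge0.
have tq0 : 0 <= 2 `^ q :> R by exact: powR_ge0.
have cZ0 t : (0 <= (c `^ q)%:E * Z t `^ q)%E by rewrite mule_ge0.
have I0 : (0 <= \int[mu]_t (H t `^ q))%E by apply: integral_ge0.
have IZ0 : (0 <= \int[mu]_t (Z t `^ q))%E by apply: integral_ge0.
have mHq : measurable_fun setT (fun t => H t `^ q)%E by exact: (measurableT_comp (measurable_poweR _)).
have mZq : measurable_fun setT (fun t => Z t `^ q)%E by exact: (measurableT_comp (measurable_poweR _)).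
have mEq : measurable_fun setT (fun t => E t `^ q)%E by exact: (measurableT_comp (measurable_poweR _)).
have mcZ : measurable_fun setT (fun t => (c `^ q)%:E * Z t `^ q)%E by exact: emeasurable_funM.
have mHZ : measurable_fun setT (fun t => H t `^ q + (c `^ q)%:E * Z t `^ q)%E by exact: emeasurable_funD.
have HZ0 t : (0 <= H t `^ q + (c `^ q)%:E * Z t `^ q)%E by rewrite adde_ge0.
have step1 : (\int[mu]_t (E t `^ q) <=
    (2 `^ q)%:E * (\int[mu]_t (H t `^ q) + (c `^ q)%:E * \int[mu]_t (Z t `^ q)))%E.
  rewrite -(ge0_integralZl_EFin mu measurableT (f1 := fun t => (Z t `^ q)%E))//.
  rewrite -ge0_integralD// -ge0_integralZl_EFin//.
  apply: ae_ge0_le_integral => //.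
  - by move=> t _; rewrite mule_ge0.
  - exact: emeasurable_funM.
  apply: filterS EHZ => t Et _; apply: (@le_trans _ _ ((H t + c%:E * Z t) `^ q)%E).
    by apply: le_poweR => //; exact: ltW.
  have dZ0 : (0 <= c%:E * Z t)%E by rewrite mule_ge0.
  by apply: le_trans (poweRD_le q0 (H0 t) dZ0) _; rewrite poweRM// poweR_EFin.
have qV0 : 0 < q^-1 by rewrite invr_gt0.
apply: le_trans (le_poweR (ltW qV0) _ step1) _; first exact: integral_ge0.
have dq0 : (0 <= (c `^ q)%:E * \int[mu]_t (Z t `^ q))%E by rewrite mule_ge0.
rewrite (poweRM _ (_ : 0 <= (2 `^ q)%:E)%E (adde_ge0 I0 dq0)) ?lee_fin// poweR_EFin.
rewrite /quasi_triangle_cst EFinM -muleA.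
rewrite lee_wpmul2l ?lee_fin ?powR_ge0//.
apply: le_trans (poweRD_le qV0 I0 dq0) _.
by rewrite poweRM// poweR_EFin -powRrM mulfV ?gt_eqF// powRr1.
Qed.

(** * The estimate for solutions *)

Section inhomogeneous_estimate.
Context {R : realType} (n : nat) (Q B : 'M[R]_n) (D : nat) (gam : R).
Hypotheses (n0 : (0 < n)%N) (QT : Q^T = Q) (gam0 : 0 < gam).
Hypothesis hV : forall t : R, 0 < t -> gam * t ^+ D * expR (t * \tr B) <= volume Q B t.
Variables (q r : R).
Hypotheses (r2 : 2 < r) (q2 : 2 < q) (qr : 2 / q = D%:R * (1 / 2 - 1 / r)).
Notation leb := (lebesgue_cV R n).
Notation lam := (@lebesgue_measure R).
Let K (t : R) : R := expR (t * \tr B / 2).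

Let K0 t : 0 < K t. Proof. exact: expR_gt0. Qed.
Let r0 : 0 < r. Proof. exact: lt_trans r2. Qed.
Let q0 : 0 < q. Proof. exact: lt_trans q2. Qed.
Let r1 : 1 <= r. Proof. by rewrite ltW// (lt_trans _ r2)// ltr1n. Qed.

Let mK : measurable_fun setT K.
Proof.
by apply: (measurableT_comp (@measurable_expR R)); apply: measurable_funM => //; apply: measurable_funM.
Qed.

Let hc : R := homogeneous_cst n gam q r.
Let dc : R := dispersive_cst n gam r.
Let ic : R := hls_cst q `^ q^-1.
Let c2 : R := quasi_triangle_cst q.

Definition solution_cst : R := c2 * (hc + dc * ic).

Let c20 : 0 < c2. Proof. by apply: mulr_gt0; exact: powR_gt0. Qed.

Let hc0 : 0 < hc.
Proof.
apply/powR_gt0/powR_gt0/mulr_gt0.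
  by apply/powR_gt0/mulr_gt0; [exact: interp_cst_gt0|exact/powR_gt0/disp_cst_gt0].
by rewrite ltr_pwDl// ltW// hls_cst_gt0.
Qed.

Let dc0 : 0 < dc. Proof. exact: dispersive_cst_gt0. Qed.
Let ic0 : 0 < ic. Proof. exact/powR_gt0/hls_cst_gt0. Qed.

Lemma solution_cst_gt0 : 0 < solution_cst.
Proof. by apply: mulr_gt0 => //; apply: addr_gt0 => //; exact: mulr_gt0. Qed.

Variables (phi : 'cV[R]_n -> R[i]) (F u : R -> 'cV[R]_n -> R[i]).
Hypotheses (mF : cmeasurable (fun z : R * 'cV[R]_n => F z.1 z.2))
  (hu : cauchy_solution Q B r (r / (r - 1)) phi F u).

Let lamT : (0 < lam setT)%E.
Proof. by have := @lebesgue_measure_itv R `]-oo, +oo[; rewrite set_itvNyy => ->; rewrite /= ?ltNyy/= ?ltry. Qed.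

(** The time axis has positive measure, so Duhamel's formula holds at some time; the definition of
    U(t) phi at that time supplies Schwartz functions converging to phi, which are then used at all
    times. *)
Let data : exists2 f : nat -> 'cV[R]_n -> R[i], (forall k, cL12 leb (f k)) &
  (fun k => cLnorm leb 2 (fun x => (f k x - phi x)%R)) @ \oo --> 0%E.
Proof.
have [_ _ sol] := hu.
have pf : ProperFilter (almost_everywhere lam).
  exact: ae_properfilter_algebraOfSetsType lamT.
have [t [v [w [g [[_ _ [f [sf fphi _]]] _ _ _]]]]] := filter_ex sol.
by exists f => // k; exact: cschwartz_cL12.
Qed.

Let mphi : cmeasurable phi.
Proof.
have [_ _ sol] := hu.
have pf : ProperFilter (almost_everywhere lam).
  exact: ae_properfilter_algebraOfSetsType lamT.
by have [t [v [w [g [[[mp _] _ _] _ _ _]]]]] := filter_ex sol.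
Qed.

Let mu_t t : cmeasurable (u t).
Proof. have [mu _ _] := hu; exact: (cmeasurable_comp mu (pair1_measurable t)). Qed.

Let E t : \bar R := ((K t)%:E * cLnorm leb r (u t))%E.

Let mE : measurable_fun setT E.
Proof.
have [mu _ _] := hu; apply: emeasurable_funM; first exact/measurable_EFinP.
exact: measurable_cLnorm_param.
Qed.

Let E0 t : (0 <= E t)%E.
Proof. by rewrite mule_ge0 ?cLnorm_ge0// lee_fin ltW. Qed.

Let G := forcing_norm B r F.
Let Z t := riesz q G t.

Let mG : measurable_fun setT G. Proof. exact: measurable_forcing_norm. Qed.
Let G0 t : 0 <= G t. Proof. exact: forcing_norm_ge0. Qed.
Let mZ : measurable_fun setT Z. Proof. exact: measurable_riesz. Qed.
Let Z0 t : (0 <= Z t)%E. Proof. exact: riesz_ge0. Qed.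

Let pointwise (H : R -> \bar R) :
  (forall t v, t != 0 -> propagator Q B 2 2 t phi v -> ((K t)%:E * cLnorm leb r v <= H t)%E) ->
  {ae lam, forall t, (E t <= H t + dc%:E * Z t)%E}.
Proof.
move=> Hb; have [_ _ sol] := hu.
have ne : {ae lam, forall t : R, t != 0}.
  exists [set 0]; split; [exact: measurable_set1|exact: lebesgue_measure_set1|].
  by move=> t /= /negP; rewrite negbK => /eqP.
have fae := ae_filter_ringOfSetsType (@lebesgue_measure R).
apply: filterS2 sol ne => t [v [w [g [pv pw bg ueq]]]] t0.
have mv : cmeasurable v by case: pv => _ [].
have mg : cmeasurable g by case: bg => ? [? [? [_ _ _ []]]].
have msg : cmeasurable (fun x => (Num.sg t)%:C%C * g x).
  by apply: cmeasurableM => //; exact: cmeasurable_cst.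
have ule : (cLnorm leb r (u t) <= cLnorm leb r v + cLnorm leb r g)%E.
  apply: (@le_trans _ _ (cLnorm leb r (fun x => (v x + (Num.sg t)%:C%C * g x)%R))).
    apply: ae_le_cLnorm => //; first exact: cmeasurableD.
    by apply: filterS ueq => x ->.
  apply: le_trans (cLnormD leb r1 mv msg) _; rewrite leeD2l//.
  by apply: le_cLnorm => // x; rewrite cmodM cmodR normr_sg t0 mul1r.
apply: (@le_trans _ _ ((K t)%:E * (cLnorm leb r v + cLnorm leb r g))%E).
  by rewrite lee_wpmul2l// lee_fin ltW.
rewrite ge0_muleDr ?cLnorm_ge0//; apply: leeD; first exact: Hb.
exact: (duhamel_le n0 QT gam0 hV r2 qr mF pw bg).
Qed.

Let J := ((\int[lam]_t (((K t)%:E * cLnorm leb (r / (r - 1)) (F t)) `^ (q / (q - 1)))) `^ (q / (q - 1))^-1)%E.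

Let Z_le : ((\int[lam]_t Z t `^ q) `^ q^-1 <= ic%:E * J)%E.
Proof.
apply: le_trans (riesz_forcing_le B r q2 mF) _.
rewrite lee_wpmul2l ?lee_fin ?(ltW ic0)//; apply: le_poweR.
- by rewrite invr_ge0 divr_ge0 ?(ltW q0)// subr_ge0 ltW// (lt_trans _ q2)// ltr1n.
- by apply: integral_ge0 => t _; rewrite lee_fin powR_ge0.
have q'0 : 0 <= q / (q - 1) by rewrite divr_ge0 ?(ltW q0)// subr_ge0 ltW// (lt_trans _ q2)// ltr1n.
apply: ge0_le_integral => //.
- by move=> t _; rewrite lee_fin powR_ge0.
- apply/measurable_EFinP; exact: (@measurableT_comp _ _ _ _ _ _ (@powR R ^~ _)).
- apply: (measurableT_comp (measurable_poweR _)); apply: emeasurable_funM; first exact/measurable_EFinP.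
  exact: measurable_cLnorm_param.
move=> t _; rewrite -poweR_EFin; apply: le_poweR; rewrite ?lee_fin ?G0//.
rewrite /G /forcing_norm EFinM lee_wpmul2l ?lee_fin ?(ltW (K0 t))//.
by have := cLnorm_ge0 leb (r / (r - 1)) (F t); case: cLnorm => //= y _; rewrite leey.
Qed.

(** The majorant of the homogeneous part involves the error of an approximating sequence. The
    sequence is chosen after d, within e = d / [solution_cst] of phi, so that this error costs at
    most d, which is arbitrary. *)
Lemma solution_estimate :
  ((\int[lam]_t E t `^ q) `^ q^-1 <= solution_cst%:E * (cLnorm leb 2 phi + J))%E.
Proof.
have J0 : (0 <= J)%E by exact: poweR_ge0.
apply/lee_addgt0Pr => d d0; have C0 := solution_cst_gt0.
pose e := d / solution_cst; have e0 : 0 < e by exact: divr_gt0.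
have [f0 cf0 f0phi] := data.
have s0 k : 0 < Num.min e (Num.sqrt (1 / (2 ^ (k + 1))%:R)).
  by rewrite lt_min e0 sqrtr_gt0 divr_gt0// ltr0n expn_gt0.
have [h hP] := fast_subsequence f0phi s0.
pose f k := f0 (h k); have cf k : cL12 leb (f k) by exact: cf0.
pose H := homogeneous_bound Q B q r f.
have mH : measurable_fun setT H by exact: measurable_homogeneous_bound.
have H0 t : (0 <= H t)%E by exact: homogeneous_bound_ge0.
have Hle : ((\int[lam]_t (H t `^ q)) `^ q^-1 <= hc%:E * (cLnorm leb 2 phi + e%:E))%E.
  exact: (homogeneous_bound_le n0 QT gam0 hV r2 q2 qr e0 mphi cf hP).
have pt : {ae lam, forall t, (E t <= H t + dc%:E * Z t)%E}.
  apply: pointwise => t v t0 pv.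
  exact: (propagator_homogeneous_bound n0 QT gam0 hV r2 q2 cf hP t0 pv).
apply: (le_trans (@ae_le_triangle _ _ _ lam _ _ _ _ _ q0 (ltW dc0) mE mH mZ E0 H0 Z0 pt)).
apply: (@le_trans _ _ (c2%:E * ((hc + dc * ic)%:E * (cLnorm leb 2 phi + e%:E + J)))%E).
  rewrite lee_wpmul2l ?lee_fin ?(ltW c20)//.
  have A0 : (0 <= cLnorm leb 2 phi + e%:E)%E by rewrite adde_ge0 ?cLnorm_ge0// lee_fin ltW.
  apply: (@le_trans _ _ (hc%:E * (cLnorm leb 2 phi + e%:E) + (dc * ic)%:E * J)%E).
    by apply: leeD => //; rewrite EFinM -muleA lee_wpmul2l// lee_fin ltW.
  rewrite [leRHS]ge0_muleDr//; apply: leeD; rewrite lee_wpmul2r// lee_fin.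
    by rewrite lerDl mulr_ge0 ?ltW.
  by rewrite lerDr ltW.
rewrite muleA -EFinM -/solution_cst addeAC ge0_muleDr; last 2 first.
- by rewrite adde_ge0 ?cLnorm_ge0.
- by rewrite lee_fin ltW.
by rewrite leeD2l// -EFinM lee_fin /e mulrCA mulfV ?mulr1// gt_eqF.
Qed.

End inhomogeneous_estimate.

Lemma homogeneous_dim_ge (nu : nat) (p : 'I_nu.+1 -> nat) : (\sum_i p i <= homogeneous_dim p)%N.
Proof. by apply: leq_sum => i _; rewrite -[leqLHS]mul1n leq_mul2r addn1 ltnS leq0n orbT. Qed.

(** Multiplied out, r < 2D/(D-2) says D (1/2 - 1/r) < 1, that is 2/q < 1. For D = 2 this reads 1 -
    2/r < 1, which holds for every r > 2. *)
Lemma time_exponent_gt2 {R : realType} (D : nat) (q r : R) : (2 <= D)%N -> 2 < r ->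
  ((2 < D)%N -> r < 2 * D%:R / (D%:R - 2)) -> 2 / q = D%:R * (1 / 2 - 1 / r) -> 2 < q.
Proof.
move=> D2 r2 rD qE; have r0 : 0 < r by exact: lt_trans r2.
have D0 : 0 < D%:R :> R by rewrite ltr0n (leq_trans _ D2).
have pos : 0 < 2 / q.
  rewrite qE mulr_gt0// !div1r subr_gt0 ltf_pV2// posrE//.
have q0 : 0 < q by rewrite -invr_gt0 -(pmulr_rgt0 _ (ltr0n R 2)).
suff : 2 / q < 1 by rewrite ltr_pdivrMr// mul1r.
rewrite qE mulrBr; move: D2; rewrite leq_eqVlt => /predU1P[<-|D2].
  by rewrite div1r mulfV ?pnatr_eq0// ltrBlDr ltrDl mulr_gt0// divr_gt0.
have := rD D2; have D2' : 0 < D%:R - 2 :> R by rewrite subr_gt0 ltr_nat.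
rewrite ltr_pdivlMr// => H.
have : r * (D%:R * (1 / 2) - D%:R * (1 / r)) < r * 1.
  have -> : r * (D%:R * (1 / 2) - D%:R * (1 / r)) = r * D%:R / 2 - D%:R by field; rewrite gt_eqF.
  move: H; rewrite mulrBr; move: (r * D%:R) (D%:R : R) => x y; lra.
by rewrite ltr_pM2l.
Qed.

Lemma hoelder_conjugateE {R : realType} (a b : R) : 1 < a -> 1 / a + 1 / b = 1 -> b = a / (a - 1).
Proof.
move=> a1 ab; have a0 : a != 0 by rewrite gt_eqF// (lt_trans _ a1).
have a10 : a - 1 != 0 by rewrite subr_eq0 gt_eqF.
have E : b^-1 = (a - 1) / a by rewrite mulrBl mulfV// addrC; move: ab; rewrite !div1r => /(canRL (addKr _)).
by rewrite -(invrK b) E invf_div.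
Qed.

(** Moves the exponential weight inside the power, the form in which the estimates are proved. *)
Lemma weighted_power_cLnorm {R : realType} {d} {T : measurableType d} (mu : {measure set T -> \bar R})
    (a b c t : R) (f : T -> R[i]) :
  ((expR (a * c / 2 * t))%:E * (\int[mu]_x (cmod (f x) `^ b)%:E) `^ (a / b) =
   ((expR (t * c / 2))%:E * cLnorm mu b f) `^ a)%E.
Proof.
have I0 : (0 <= \int[mu]_x (cmod (f x) `^ b)%:E)%E by apply: integral_ge0 => x _; rewrite lee_fin powR_ge0.
rewrite poweRM ?lee_fin ?expR_ge0 ?cLnorm_ge0// poweR_EFin -expRM cLnormE -poweRrM.
by congr (_%:E * _ `^ _)%E; [congr expR; ring|rewrite mulrC].
Qed.

Theorem theoremA (R : realType) (nu : nat) (p : 'I_nu.+1 -> nat)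
    (Q B : 'M[R]_(\sum_i p i)%N)
    (hQB : standing_assumptions Q B)
    (hV : exists2 gamma : R, 0 < gamma &
       forall t : R, 0 < t ->
         gamma * t ^+ homogeneous_dim p * expR (t * \tr B) <= volume Q B t)
    (r q r' q' : R)
    (hr : 2 < r)
    (hrD : (2 < homogeneous_dim p)%N ->
       r < 2 * (homogeneous_dim p)%:R / ((homogeneous_dim p)%:R - 2))
    (hq : 2 / q = (homogeneous_dim p)%:R * (1 / 2 - 1 / r))
    (hr' : 1 / r + 1 / r' = 1)
    (hq' : 1 / q + 1 / q' = 1) :
  exists2 C : R, 0 < C &
    forall (phi : 'cV[R]_(\sum_i p i)%N -> R[i])
           (F u : R -> 'cV[R]_(\sum_i p i)%N -> R[i]),
      cLp (lebesgue_cV R _) 2 phi ->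
      cmeasurable (fun z : R * 'cV[R]_(\sum_i p i)%N => F z.1 z.2) ->
      ('N[lebesgue_measure]_(q'%:E)
         [(fun t : R => (expR (\tr B / 2 * t))%:E
                       * cLnorm (lebesgue_cV R _) r' (F t))] < +oo)%E ->
      cauchy_solution Q B r r' phi F u ->
      ((\int[lebesgue_measure]_t
          ((expR (q * \tr B / 2 * t))%:E
           * (\int[lebesgue_cV R _]_x ((cmod (u t x)) `^ r)%:E) `^ (q / r)))
         `^ (1 / q)
       <= C%:E *
          (cLnorm (lebesgue_cV R _) 2 phi
           + (\int[lebesgue_measure]_t
                ((expR (q' * \tr B / 2 * t))%:E
                 * (\int[lebesgue_cV R _]_x ((cmod (F t x)) `^ r')%:E)
                     `^ (q' / r')))
               `^ (1 / q')))%E.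

Proof.
have [sum2 QT _ _ _] := hQB; have [gam gam0 hVg] := hV.
have n0 : (0 < \sum_i p i)%N by exact: leq_trans sum2.
(* Every block size is counted at least once in D, so D >= n >= 2. *)
have D2 : (2 <= homogeneous_dim p)%N by exact: leq_trans sum2 (homogeneous_dim_ge p).
have q2 : 2 < q by exact: (time_exponent_gt2 D2 hr hrD hq).
have r'E : r' = r / (r - 1) by apply: hoelder_conjugateE hr'; rewrite (lt_trans _ hr)// ltr1n.
have q'E : q' = q / (q - 1) by apply: hoelder_conjugateE hq'; rewrite (lt_trans _ q2)// ltr1n.
exists (solution_cst (\sum_i p i)%N gam q r).
  exact (solution_cst_gt0 _ gam0 hr q2).
move=> phi F u _ mF _ sol.
rewrite r'E in sol.
have est := solution_estimate n0 QT gam0 hVg hr q2 hq mF sol.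
rewrite r'E q'E !div1r.
have Eu (t : R) := weighted_power_cLnorm (lebesgue_cV R (\sum_i p i)%N) q r (\tr B) t (u t).
have EF (t : R) := weighted_power_cLnorm (lebesgue_cV R (\sum_i p i)%N) (q / (q - 1)) (r / (r - 1)) (\tr B) t (F t).
rewrite (funext Eu) (funext EF); exact: est.
Qed.
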